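(* Let $n \geq 2$. Assume that $\mu \colon \mathcal{P}^n_o \to \mathbb{R}^n$ is a measurable valuation which is $\mathrm{SL}(n)$-contravariant, i.e. $\mu(\phi P) = \phi^{-t}\,\mu(P)$ for all $P \in \mathcal{P}^n_o$ and all $\phi \in \mathrm{SL}(n)$. Then, for $n=2$, there exist $k_1,k_2\in\mathbb{R}$ such that $\mu(P) = k_1\, m(P^* ) + k_2\,\rho_{\frac{\pi}{2}}\, m(P)$ for all $P \in \mathcal{P}^2_o$; and, for $n \geq 3$, there exists $k \in \mathbb{R}$ such that $\mu(P) = k\, m(P^* )$ for all $P \in \mathcal{P}^n_o$.
   Context: $\mathcal{P}^n_o$ denotes the set of convex polytopes in $\mathbb{R}^n$ containing the origin in their interiors, with the Hausdorff metric topology; ''measurable'' refers to Borel $\sigma$-algebras. $\phi^{-t}$ is the inverse of the transpose of $\phi$. A map $\mu$ on a family $\mathcal{S}$ of sets is a valuation if $\mu(K \cup L) + \mu(K \cap L) = \mu(K) + \mu(L)$ whenever $K, L, K\cup L, K \cap L \in \mathcal{S}$. The moment vector is $m(P) = \int_P x\,dx$; $P^* = \{y : y^t x \le 1 \ \forall x \in P\}$ is the polar body; $\rho_{\frac{\pi}{2}}$ is the counter-clockwise rotation of $\mathbb{R}^2$ by $\frac{\pi}{2}$. *)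

(* Defs.v *)
From HB Require Import structures.
From mathcomp Require Import all_boot all_order all_algebra.
From mathcomp Require Import all_classical all_reals all_analysis.
Set Implicit Arguments. Unset Strict Implicit. Unset Printing Implicit Defensive.
Import Order.TTheory GRing.Theory Num.Theory.
Local Open Scope classical_set_scope.
Local Open Scope ring_scope.

Section Defs.
Variable R : realType.
Variable n : nat.
Notation vec := 'cV[R]_n.

Definition dotv (x y : vec) : R := \sum_i x i 0 * y i 0.
Definition enorm (x : vec) : R := Num.sqrt (dotv x x).

Definition conv_hull (s : seq vec) : set vec :=
  [set x | exists w : 'I_(size s) -> R,
     (forall i, 0 <= w i) /\ \sum_i w i = 1 /\
     x = \sum_i w i *: nth 0 s i].

Definition is_polytope (P : set vec) : Prop := exists s : seq vec, P = conv_hull s.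

Definition Pno (P : set vec) : Prop :=
  is_polytope P /\ exists2 e : R, 0 < e & forall x, enorm x < e -> P x.

Definition hausdorff_lt (P Q : set vec) (e : R) : Prop :=
  exists2 d : R, 0 <= d < e &
    (forall x, P x -> exists2 y, Q y & enorm (x - y) <= d) /\
    (forall y, Q y -> exists2 x, P x & enorm (x - y) <= d).

Definition hopen (U : set (set vec)) : Prop :=
  U `<=` Pno /\
  forall P, U P -> exists2 e : R, 0 < e &
    forall Q, Pno Q -> hausdorff_lt P Q e -> U Q.

Definition borel_Pno : set (set (set vec)) := <<s Pno, hopen >>.

Definition eopen (U : set vec) : Prop :=
  forall x, U x -> exists2 e : R, 0 < e & forall y, enorm (y - x) < e -> U y.
Definition borel_Rn : set (set vec) := <<s setT, eopen >>.

Definition measurable_on_Pno (mu : set vec -> vec) : Prop :=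
  forall B, borel_Rn B -> borel_Pno (Pno `&` [set P | B (mu P)]).

Definition valuation_on_Pno (mu : set vec -> vec) : Prop :=
  forall K L, Pno K -> Pno L -> Pno (K `|` L) -> Pno (K `&` L) ->
    mu (K `|` L) + mu (K `&` L) = mu K + mu L.

Definition SL_contravariant (mu : set vec -> vec) : Prop :=
  forall (phi : 'M[R]_n) P, \det phi = 1 -> Pno P ->
    mu ((fun x => phi *m x) @` P) = (invmx phi)^T *m mu P.

(* Lebesgue integral over R^n, written as an iterated integral of
   one-dimensional Lebesgue integrals (Fubini) *)
Definition setc (x : vec) (k : nat) (t : R) : vec :=
  \col_i (if val i == k then t else x i 0).
Fixpoint iint (k : nat) (f : vec -> R) (x : vec) : R :=
  match k with
  | 0 => f x
  | k'.+1 => Rintegral (@lebesgue_measure R) setT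
               (fun t => iint k' f (setc x k' t))
  end.
Definition integral_Rn (f : vec -> R) : R := iint n f 0.

Definition moment (P : set vec) : vec :=
  \col_j integral_Rn (fun x => x j 0 * \1_P x).

Definition polar (P : set vec) : set vec :=
  [set y | forall x, P x -> dotv y x <= 1].

End Defs.

Definition rot90 (R : realType) (v : 'cV[R]_2) : 'cV[R]_2 :=
  \col_i (if val i == 0%N then - v (inord 1) 0 else v (inord 0) 0).

(* Main.v *)
(* Cut a polytope by a hyperplane through the origin and cap each half with a
   point of the polytope lying on the other side: the valuation property gives
   the value on the polytope in terms of the two capped halves and of the
   bipyramid over their common section.  A bipyramid with fixed apexes is a
   valuation of its equator, so induction on the dimension, together with
   cutting along simplicial cones so fine that the polytope is a simplex in each
   of them, shows that a valuation is determined by its values on joins, the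
   hulls of points [c_l b_l] and [- s_k (sum of the b_l of colour k)] for a basis
   [b] with coloured indices.  Shears and the unimodular maps permuting the
   vertices of a block of equal colour then reduce contravariant valuations to
   crosspolytopes, where all colours are distinct.

   In the plane, the increment of [mu] under a displacement of one apex of a
   quadrilateral parallel to the opposite diagonal is additive, hence linear by
   measurability, and the coincidence of the two degenerate quadrilaterals
   carried by a triangle becomes a functional equation with a two-dimensional
   space of solutions.  For [n >= 3] the planar result applies in each coordinate
   plane, and a quarter turn in the plane of two other coordinates excludes the
   second solution.  Both [P -> m(P^* )] and [P -> rho m(P)] are contravariant
   valuations, and Fubini gives their values on crosspolytopes. *)
Require Import Defs.
From HB Require Import structures.
From mathcomp Require Import all_boot all_order all_algebra.
From mathcomp Require Import all_classical all_reals all_analysis.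
From mathcomp Require Import perm measurable_realfun.
From mathcomp Require Import ring lra.
Set Implicit Arguments. Unset Strict Implicit. Unset Printing Implicit Defensive.
Import Order.TTheory GRing.Theory Num.Theory.
Local Open Scope classical_set_scope.
Local Open Scope ring_scope.

(** * Convex hulls and hyperplane sections *)

(** Cutting through the origin leaves [Pno]; hence the caps, and hence a bipyramid as correction
    term of every cut. Removing that term is what the induction on the dimension is for, and it is
    used twice in each dimension: for opposite apexes, then for arbitrary ones. The obstacle is that
    a bipyramid restricts well to its equator only if the equator contains the point where the
    segment between the apexes crosses it. Once opposite apexes are settled, the value depends only
    on the directions of the apexes and becomes a cocycle in two directions, in which this proviso
    has disappeared. Uniqueness is always proved as vanishing, for [mu] minus suitable multiples of
    the known valuations. Blocks of equal colour vanish because several equal quantities sum to 0.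
    Measurability serves Cauchy's equation only, at two places: for the increments of the second
    component, and for the last unknown function of the functional equation. It is therefore
    weakened to polytopes with one moving vertex, a property that passes to coordinate planes. *)

Section Dot.
Variables (R : realType) (n : nat).
Implicit Types x y a : 'cV[R]_n.

Lemma dotvDr a x y : dotv a (x + y) = dotv a x + dotv a y.
Proof. by rewrite -big_split; apply: eq_bigr => i _; rewrite mxE mulrDr. Qed.
Lemma dotvZr a c x : dotv a (c *: x) = c * dotv a x.
Proof. by rewrite mulr_sumr; apply: eq_bigr => i _; rewrite mxE mulrCA. Qed.
Lemma dotvC x y : dotv x y = dotv y x.
Proof. by apply: eq_bigr => i _; rewrite mulrC. Qed.
Lemma dotvDl a x y : dotv (x + y) a = dotv x a + dotv y a.
Proof. by rewrite dotvC dotvDr !(dotvC a). Qed.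
Lemma dotvZl a c x : dotv (c *: x) a = c * dotv x a.
Proof. by rewrite dotvC dotvZr (dotvC a). Qed.
Lemma dotvNr a x : dotv a (- x) = - dotv a x.
Proof. by rewrite -scaleN1r dotvZr mulN1r. Qed.
Lemma dotvNl a x : dotv (- x) a = - dotv x a.
Proof. by rewrite dotvC dotvNr dotvC. Qed.
Lemma dotv0r a : dotv a 0 = 0.
Proof. by apply: big1 => i _; rewrite mxE mulr0. Qed.
Lemma dotv0l a : dotv 0 a = 0.
Proof. by rewrite dotvC dotv0r. Qed.
Lemma dotv_sumr a (I : Type) (r : seq I) (P : pred I) (F : I -> 'cV[R]_n) :
  dotv a (\sum_(i <- r | P i) F i) = \sum_(i <- r | P i) dotv a (F i).
Proof. by apply: (big_morph (dotv a)) => [x y|]; rewrite (dotvDr, dotv0r). Qed.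
Lemma dotv_delta (i : 'I_n) x : dotv (delta_mx i 0) x = x i 0.
Proof.
rewrite /dotv (bigD1 i) //= mxE !eqxx mul1r big1 ?addr0 // => j /negbTE h.
by rewrite mxE h mul0r.
Qed.
End Dot.

Lemma dotv_mulmx (R : realType) m n (A : 'M[R]_(m, n)) a x :
  dotv a (A *m x) = dotv (A^T *m a) x.
Proof.
rewrite /dotv; under eq_bigr do rewrite mxE mulr_sumr.
rewrite exchange_big /=; apply: eq_bigr => j _; rewrite mxE mulr_suml.
by apply: eq_bigr => i _; rewrite mxE mulrA [a i 0 * _]mulrC.
Qed.

Definition is_convex (R : realType) n (C : set 'cV[R]_n) :=
  forall x y (a b : R), C x -> C y -> 0 <= a -> 0 <= b -> a + b = 1 ->
    C (a *: x + b *: y).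

(** Written as an intersection of convex sets so that inclusions are proved by exhibiting a convex
    superset ([hull_min]) instead of handling weights; [conv_hullE] ties it to [conv_hull]. *)
Definition hull (R : realType) n (A : set 'cV[R]_n) : set 'cV[R]_n :=
  [set x | forall C, is_convex C -> A `<=` C -> C x].

Section Cv.
Variables (R : realType) (n : nat).
Implicit Types (x y z u v a g : 'cV[R]_n) (A B C : set 'cV[R]_n).

Lemma hull_convex A : is_convex (hull A).
Proof.
move=> x y a b Ax Ay a0 b0 ab C Cc AC.
exact: Cc (Ax _ Cc AC) (Ay _ Cc AC) a0 b0 ab.
Qed.

Lemma sub_cv A : A `<=` hull A.
Proof. by move=> x Ax C _; apply. Qed.

Lemma hull_min A C : is_convex C -> A `<=` C -> hull A `<=` C.
Proof. by move=> Cc AC x; apply. Qed.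

Lemma hull_mono A B : A `<=` B -> hull A `<=` hull B.
Proof. by move=> AB; apply: hull_min => [|x /AB]; [exact: hull_convex|exact: sub_cv]. Qed.

Lemma hull_id C : is_convex C -> hull C = C.
Proof. by move=> Cc; apply/seteqP; split; [exact: hull_min|exact: sub_cv]. Qed.

Lemma hull_eq A B : A `<=` hull B -> B `<=` hull A -> hull A = hull B.
Proof.
by move=> AB BA; apply/seteqP; split; apply: hull_min => //; exact: hull_convex.
Qed.

Lemma hull_hullU A B : hull (hull A `|` B) = hull (A `|` B).
Proof.
apply: hull_eq => x [|] h.
- by apply: hull_mono h => y; left.
- by apply: sub_cv; right.
- by apply: sub_cv; left; apply: sub_cv.
- by apply: sub_cv; right.
Qed.

Lemma convexsI A B : is_convex A -> is_convex B -> is_convex (A `&` B).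
Proof.
by move=> Ac Bc x y a b [Ax Bx] [Ay By] a0 b0 ab; split; [apply: Ac|apply: Bc].
Qed.

Lemma convex_wsum C x y (a b : R) : is_convex C -> C x -> C y ->
  0 <= a -> 0 <= b -> 0 < a + b -> C ((a + b)^-1 *: (a *: x + b *: y)).
Proof.
move=> Cc Cx Cy a0 b0 ab; rewrite scalerDr !scalerA; apply: Cc => //.
- by rewrite mulr_ge0 // invr_ge0 ltW.
- by rewrite mulr_ge0 // invr_ge0 ltW.
- by rewrite -mulrDr mulVf // gt_eqF.
Qed.

Lemma convex_scale C x (t : R) : is_convex C -> C 0 -> C x -> 0 <= t <= 1 -> C (t *: x).
Proof.
move=> Cc C0 Cx /andP[t0 t1].
rewrite -[t *: x]addr0 -(scaler0 _ (1 - t)); apply: Cc => //; first by rewrite subr_ge0.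
by rewrite addrC subrK.
Qed.

Lemma hull_U1 A u : is_convex A -> A !=set0 ->
  hull (A `|` [set u]) = [set x | exists a (t : R), [/\ A a, 0 <= t <= 1 &
    x = (1 - t) *: a + t *: u]].
Proof.
move=> Ac [a0 Aa0]; apply/seteqP; split; last first.
  move=> x [a [t [Aa /andP[t0 t1] ->]]]; apply: hull_convex.
  - by apply: sub_cv; left.
  - by apply: sub_cv; right.
  - by rewrite subr_ge0.
  - by [].
  - by rewrite subrK.
apply: hull_min; last first.
  move=> x [Ax|->].
    by exists x, 0; split=> //; rewrite ?lexx ?ler01 // subr0 scale1r scale0r addr0.
  by exists a0, 1; split=> //; rewrite ?lexx ?ler01 // subrr scale0r scale1r add0r.
move=> x y c d [a [t [Aa /andP[t0 t1] ->]]] [b [s [Ab /andP[s0 s1] ->]]] c0 d0 cd.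
have h0 : 0 <= c * (1 - t) by rewrite mulr_ge0 // subr_ge0.
have h1 : 0 <= d * (1 - s) by rewrite mulr_ge0 // subr_ge0.
have E : c * (1 - t) + d * (1 - s) = 1 - (c * t + d * s).
  by rewrite -[in RHS]cd; ring.
have [h|h] := eqVneq (c * (1 - t) + d * (1 - s)) 0.
  have e0 : c * (1 - t) = 0 by lra.
  have e1 : d * (1 - s) = 0 by lra.
  exists a0, 1; split=> //; first by rewrite lexx ler01.
  rewrite !scalerDr !scalerA e0 e1 subrr !scale0r !add0r -scalerDl scale1r.
  by rewrite (_ : c * t + d * s = 1) ?scale1r //; lra.
exists ((c * (1 - t) + d * (1 - s))^-1 *: ((c * (1 - t)) *: a + (d * (1 - s)) *: b)).
exists (c * t + d * s); split.
- by apply: convex_wsum => //; rewrite lt0r h addr_ge0.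
- by apply/andP; split; [rewrite addr_ge0 // mulr_ge0|lra].
- rewrite -E scalerA mulfV // scale1r !scalerDr !scalerA scalerDl.
  by rewrite addrACA.
Qed.

(* The point of the segment [k, z] on the hyperplane [g = 0]. *)
Definition cross g k z : 'cV[R]_n :=
  (dotv g k - dotv g z)^-1 *: ((- dotv g z) *: k + dotv g k *: z).

Lemma cross0 g k z : dotv g z < 0 < dotv g k -> dotv g (cross g k z) = 0.
Proof. by move=> _; rewrite dotvZr dotvDr !dotvZr mulNr [dotv g z * _]mulrC addNr mulr0. Qed.

Lemma cross_conv C g k z : is_convex C -> C k -> C z ->
  dotv g z < 0 < dotv g k -> C (cross g k z).
Proof.
move=> Cc Ck Cz /andP[z0 k0]; rewrite /cross [_ - _]addrC; apply: convex_wsum => //.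
- by rewrite oppr_ge0 ltW.
- exact: ltW.
- by rewrite addr_gt0 // oppr_gt0.
Qed.

Lemma cross_mixl C g k k' z (a b : R) : is_convex C ->
  C (cross g k z) -> C (cross g k' z) -> dotv g z < 0 -> 0 <= dotv g k ->
  0 <= dotv g k' -> 0 <= a -> 0 <= b -> a + b = 1 -> C (cross g (a *: k + b *: k') z).
Proof.
move=> Cc Ck Ck' z0 k0 k0' a0 b0 ab; rewrite /cross.
set p := dotv g k in k0 *; set q := dotv g k' in k0' *; set r := - dotv g z.
have r0 : 0 < r by rewrite oppr_gt0.
have pr : 0 < p + r by lra.
have qr : 0 < q + r by lra.
have E : dotv g (a *: k + b *: k') - dotv g z = a * (p + r) + b * (q + r).
  by rewrite dotvDr !dotvZr -/p -/q -/r !mulrDr addrACA -mulrDl ab mul1r.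
rewrite E.
have -> : r *: (a *: k + b *: k') + dotv g (a *: k + b *: k') *: z =
   (a * (p + r)) *: cross g k z + (b * (q + r)) *: cross g k' z.
  rewrite /cross -/p -/q -/r !scalerA.
  rewrite -[a * _ / _]mulrA divff ?gt_eqF // -[b * _ / _]mulrA divff ?gt_eqF //.
  rewrite dotvDr !dotvZr -/p -/q !mulr1.
  by apply/matrixP => i j; rewrite !mxE; ring.
apply: convex_wsum => //; try by rewrite mulr_ge0 // ltW.
have [a1|/negbTE ane] := eqVneq a 0.
  by rewrite a1 mul0r add0r; rewrite mulr_gt0 //; lra.
by apply: ltr_wpDr; [rewrite mulr_ge0 // ltW|rewrite mulr_gt0 // lt0r ane].
Qed.

Lemma cross_sym g k z : dotv g z < dotv g k -> cross (- g) z k = cross g k z.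
Proof.
move=> h; rewrite /cross !dotvNl; congr (_^-1 *: _); first by ring.
by rewrite opprK addrC.
Qed.

(** Says that cutting the hull of [A] along [g = 0] creates no new vertices; under it the hull
    commutes with the section and with both half-spaces ([hull_cut_eq], [hull_cut_ge],
    [hull_cut_le]). *)
Definition crossing_ok g A :=
  forall k z, A k -> A z -> dotv g z < 0 < dotv g k ->
    hull (A `&` [set x | dotv g x = 0]) (cross g k z).

Lemma convex_half g : is_convex [set x | 0 <= dotv g x].
Proof.
move=> x y a b /= hx hy a0 b0 _.
by rewrite dotvDr !dotvZr addr_ge0 // mulr_ge0.
Qed.

Lemma convex_half1 g c : is_convex [set x | dotv g x <= c].
Proof.
move=> x y a b /= hx hy a0 b0 ab; rewrite dotvDr !dotvZr.
rewrite -[c]mul1r -ab mulrDl lerD // ler_wpM2l //.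
Qed.

Lemma convex_zero g : is_convex [set x | dotv g x = 0].
Proof.
by move=> x y a b /= hx hy a0 b0 _; rewrite dotvDr !dotvZr hx hy !mulr0 addr0.
Qed.

(** Two hull inductions: for a generator [z] the admissible [x] form a convex set by [cross_mixl];
    then [x] is fixed and [y] varies, the sides being exchanged through [cross_sym]. *)
Lemma cross_cv g A x y : crossing_ok g A ->
  hull (A `&` [set x | 0 <= dotv g x]) x -> hull (A `&` [set x | dotv g x <= 0]) y ->
  dotv g y < 0 < dotv g x -> hull (A `&` [set x | dotv g x = 0]) (cross g x y).
Proof.
move=> crosses cx cy /andP[y0 x0].
have cN g' k z : dotv g' z < 0 -> dotv g' k = 0 -> cross g' k z = k.
  move=> z0 k0; rewrite /cross k0 scale0r addr0 sub0r scalerA mulVf ?scale1r //.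
  by rewrite oppr_eq0 lt_eqF.
have key z : A z -> dotv g z < 0 ->
    hull (A `&` [set x | dotv g x = 0]) (cross g x z).
  move=> Az z0.
  suff [] : [set k | 0 <= dotv g k /\ hull (A `&` [set x | dotv g x = 0]) (cross g k z)] x.
    by [].
  apply: cx.
    move=> k k' a b [k0 hk] [k0' hk'] a0 b0 ab; split.
      by apply: (@convex_half g).
    by apply: cross_mixl => //; exact: hull_convex.
  move=> k /= [Ak k0]; split=> //.
  have [e|ne] := eqVneq (dotv g k) 0.
    by rewrite cN //; apply: sub_cv.
  by apply: crosses => //; rewrite z0 lt0r ne.
suff [_] : [set k | dotv g k <= 0 /\ (dotv g k <= 0 ->
      hull (A `&` [set x | dotv g x = 0]) (cross (- g) k x))] y.
  by rewrite cross_sym ?(lt_trans y0) //; apply; apply: ltW.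
apply: cy.
  move=> k k' a b [k0 hk] [k0' hk'] a0 b0 ab; split.
    by apply: (@convex_half1 g 0).
  move=> _; apply: cross_mixl => //; rewrite ?dotvNl ?oppr_lt0 ?oppr_ge0 //.
  - exact: hull_convex.
  - exact: hk.
  - exact: hk'.
move=> k /= [Ak k0]; split=> // _.
have [e|ne] := eqVneq (dotv g k) 0.
  rewrite cN ?dotvNl ?e ?oppr0 ?oppr_lt0 //; exact: sub_cv.
have k1 : dotv g k < 0 by rewrite lt_neqAle ne.
rewrite cross_sym ?(lt_trans k1) //; exact: key.
Qed.

(** A face argument: [g] is nonnegative on the generators, so a mixture with [g = 0] puts weight
    only on points with [g = 0]. The hull induction carries the sign along with the conditional
    claim. *)
Lemma hull_cut0 g A : hull (A `&` [set x | 0 <= dotv g x]) `&` [set x | dotv g x = 0]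
  `<=` hull (A `&` [set x | dotv g x = 0]).
Proof.
move=> x [cx x0].
suff : [set x | 0 <= dotv g x /\ (dotv g x = 0 -> hull (A `&` [set x | dotv g x = 0]) x)] x.
  by case=> _; apply.
apply: cx; last by move=> y [Ay y0]; split=> // e; apply: sub_cv.
move=> k k' a b [k0 hk] [k0' hk'] a0 b0 ab; split; first by apply: (@convex_half g).
rewrite dotvDr !dotvZr => e.
have e1 : a * dotv g k = 0.
  by have := mulr_ge0 a0 k0; have := mulr_ge0 b0 k0'; lra.
have e2 : b * dotv g k' = 0 by lra.
have [a1|na] := eqVneq a 0.
  have -> : b = 1 by lra.
  rewrite a1 scale0r add0r scale1r; apply: hk'.
  by move/eqP: e2; rewrite mulf_eq0 => /orP[/eqP b1|/eqP//]; lra.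
have h1 : hull (A `&` [set x | dotv g x = 0]) k.
  by apply: hk; move/eqP: e1; rewrite mulf_eq0 (negbTE na) => /eqP.
have [b1|nb] := eqVneq b 0.
  by rewrite b1 scale0r addr0 (_ : a = 1) ?scale1r //; lra.
apply: hull_convex => //.
by apply: hk'; move/eqP: e2; rewrite mulf_eq0 (negbTE nb) => /eqP.
Qed.

Lemma hull_cutU g A : crossing_ok g A ->
  hull A `<=` hull (A `&` [set x | 0 <= dotv g x]) `|` hull (A `&` [set x | dotv g x <= 0]).
Proof.
move=> crosses; set P := hull (A `&` _); set N := hull (A `&` _).
have Z0P : hull (A `&` [set x | dotv g x = 0]) `<=` P.
  by apply: hull_mono => z [Az /= z0]; split=> //=; rewrite z0.
have Z0N : hull (A `&` [set x | dotv g x = 0]) `<=` N.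
  by apply: hull_mono => z [Az /= z0]; split=> //=; rewrite z0.
have Pge : P `<=` [set x | 0 <= dotv g x].
  by apply: hull_min; [exact: convex_half|move=> z []].
have Nle : N `<=` [set x | dotv g x <= 0].
  by apply: hull_min; [exact: convex_half1|move=> z []].
have N0 : N `&` [set x | dotv g x = 0] `<=` hull (A `&` [set x | dotv g x = 0]).
  move=> x [Nx /= x0].
  have : hull (A `&` [set x | dotv (- g) x = 0]) x.
    apply: hull_cut0; split; last by rewrite /= dotvNl x0 oppr0.
    by apply: hull_mono Nx => y [Ay /= hy]; split=> //=; rewrite dotvNl oppr_ge0.
  by apply: hull_mono => y [Ay /= hy]; split=> //=; move: hy; rewrite dotvNl; lra.
(* mixing a point of P with a point of N through their crossing point *)
have mix x y (a b : R) : P x -> N y -> 0 <= a -> 0 <= b -> a + b = 1 ->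
    (P `|` N) (a *: x + b *: y).
  move=> Px Ny a0 b0 ab; have := Pge _ Px; have := Nle _ Ny => /= y0 x0.
  have [ex|nx] := eqVneq (dotv g x) 0.
    right; apply: hull_convex => //; apply: Z0N; apply: hull_cut0; split=> //.
  have [ey|ny] := eqVneq (dotv g y) 0.
    left; apply: hull_convex => //; apply: Z0P; apply: N0; split=> //.
  have x1 : 0 < dotv g x by rewrite lt0r nx.
  have y1 : dotv g y < 0 by rewrite lt_neqAle ny.
  have cz : hull (A `&` [set x | dotv g x = 0]) (cross g x y).
    by apply: cross_cv => //; rewrite x1 y1.
  set p := dotv g x in x1 *; set q := dotv g y in y1 *.
  have pq : 0 < p - q by lra.
  have pq0 : p - q != 0 by rewrite gt_eqF.
  have [h|h] := leP 0 (a * p + b * q).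
    left.
    have -> : a *: x + b *: y = (a + q / p * b) *: x + (b * (p - q) / p) *: cross g x y.
      rewrite /cross -/p -/q; apply/matrixP => i j; rewrite !mxE.
      by field; rewrite pq0 gt_eqF.
    apply: hull_convex => //; first by apply: Z0P.
    - have -> : a + q / p * b = (a * p + b * q) / p by field; rewrite gt_eqF.
      by rewrite divr_ge0 // ltW.
    - by apply: divr_ge0; [apply: mulr_ge0 => //|]; exact: ltW.
    - by rewrite -ab; field; rewrite gt_eqF.
  right.
  have -> : a *: x + b *: y = (a * (p - q) / (- q)) *: cross g x y + (b + p / q * a) *: y.
    rewrite /cross -/p -/q; apply/matrixP => i j; rewrite !mxE.
    by field; rewrite pq0 lt_eqF.
  apply: hull_convex => //; first by apply: Z0N.
  - by apply: divr_ge0; [apply: mulr_ge0 => //; exact: ltW|lra].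
  - have -> : b + p / q * a = - (a * p + b * q) / (- q) by field; rewrite lt_eqF.
    by apply: divr_ge0; lra.
  - by rewrite -ab; field; rewrite lt_eqF.
apply: hull_min; last first.
  by move=> x Ax; have [h|h] := leP 0 (dotv g x); [left|right]; apply: sub_cv; split=> //=; exact: ltW.
move=> x y a b [hx|hx] [hy|hy] a0 b0 ab.
- by left; apply: hull_convex.
- exact: mix.
- by rewrite addrC; apply: mix => //; rewrite addrC.
- by right; apply: hull_convex.
Qed.

Lemma hull_cut_ge g A : crossing_ok g A ->
  hull A `&` [set x | 0 <= dotv g x] = hull (A `&` [set x | 0 <= dotv g x]).
Proof.
move=> crosses; apply/seteqP; split; last first.
  move=> x hx; split; first by apply: hull_mono hx => y [].
  by apply: (@hull_min _ [set x | 0 <= dotv g x]) hx; [exact: convex_half|move=> z []].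
move=> x [/(hull_cutU crosses)[//|Nx] /= x0].
have x0' : dotv g x <= 0.
  by apply: (@hull_min _ [set x | dotv g x <= 0]) Nx; [exact: convex_half1|move=> z []].
have e : dotv g x = 0 by apply/eqP; rewrite eq_le x0 x0'.
have : hull (A `&` [set x | dotv (- g) x = 0]) x.
  apply: hull_cut0; split; last by rewrite /= dotvNl e oppr0.
  by apply: hull_mono Nx => y [Ay /= hy]; split=> //=; rewrite dotvNl oppr_ge0.
apply: hull_mono => y [Ay /= hy]; split=> //=; move: hy; rewrite dotvNl; lra.
Qed.

Lemma crossing_okN g A : crossing_ok g A -> crossing_ok (- g) A.
Proof.
move=> crosses k z Ak Az; rewrite !dotvNl => h; rewrite -cross_sym ?opprK; last first.
  by rewrite !dotvNl; lra.
have -> : A `&` [set x | dotv (- g) x = 0] = A `&` [set x | dotv g x = 0].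
  by apply/seteqP; split=> x [Ax /= hx]; split=> //=; move: hx; rewrite dotvNl; lra.
by apply: crosses => //; lra.
Qed.

Lemma hull_cut_le g A : crossing_ok g A ->
  hull A `&` [set x | dotv g x <= 0] = hull (A `&` [set x | dotv g x <= 0]).
Proof.
move=> /crossing_okN /hull_cut_ge.
have -> : [set x | 0 <= dotv (- g) x] = [set x | dotv g x <= 0].
  by apply/seteqP; split=> x /=; rewrite dotvNl oppr_ge0.
by [].
Qed.

Lemma hull_cut_eq g A : crossing_ok g A ->
  hull A `&` [set x | dotv g x = 0] = hull (A `&` [set x | dotv g x = 0]).
Proof.
move=> crosses; apply/seteqP; split.
  move=> x [Ax /= x0]; apply: hull_cut0; split=> //; rewrite -hull_cut_ge //; split=> //=.
  by rewrite x0.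
move=> x hx; split; first by apply: hull_mono hx => y [].
by apply: (@hull_min _ [set x | dotv g x = 0]) hx; [exact: convex_zero|move=> z []].
Qed.

End Cv.

Definition poly_set (R : realType) n (A : set 'cV[R]_n) :=
  exists s : seq 'cV[R]_n, A = hull [set` s].

(** The directional form of the interior condition in [Pno]: equivalent to it for polytopes by
    [PnoE], free of norms, and preserved by linear isomorphisms. *)
Definition absorbing (R : realType) n (A : set 'cV[R]_n) :=
  forall x, exists2 t : R, 0 < t & A (t *: x).

Lemma ex_small (R : realType) (I : finType) (Pr : I -> R -> Prop) :
  (forall i, exists2 t : R, 0 < t & forall s, 0 < s <= t -> Pr i s) ->
  exists2 t : R, 0 < t & forall i s, 0 < s <= t -> Pr i s.
Proof.
move=> h.
suff [t t0 ht] : exists2 t : R, 0 < t &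
    forall i, i \in enum I -> forall s, 0 < s <= t -> Pr i s.
  by exists t => // i; apply: ht; rewrite mem_enum.
elim: (enum I) => [|i r [t t0 ht]]; first by exists 1.
have [t' t'0 ht'] := h i.
exists (Num.min t t'); first by rewrite lt_min t0.
move=> j; rewrite inE => /orP[/eqP ->|jr] s /andP[s0]; rewrite le_min => /andP[s1 s2].
  by apply: ht'; rewrite s0.
by apply: ht => //; rewrite s0.
Qed.

Section Poly.
Variables (R : realType) (n : nat).
Implicit Types (x y z u v g : 'cV[R]_n) (A B C X P Q : set 'cV[R]_n).

Lemma convex_sum C (I : Type) (r : seq I) (w : I -> R) (p : I -> 'cV[R]_n) :
  is_convex C -> (forall i, 0 <= w i) -> \sum_(i <- r) w i = 1 ->
  (forall i, w i != 0 -> C (p i)) -> C (\sum_(i <- r) w i *: p i).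
Proof.
move=> Cc w0 w1 Cp.
have key : 0 < \sum_(i <- r) w i ->
    C ((\sum_(i <- r) w i)^-1 *: (\sum_(i <- r) w i *: p i)).
  elim: r {w1} => [|i r IH]; first by rewrite big_nil ltxx.
  rewrite !big_cons => h.
  have s0 : 0 <= \sum_(j <- r) w j by apply: sumr_ge0.
  have [e|ne] := eqVneq (\sum_(j <- r) w j) 0.
    rewrite e addr0 in h *.
    have -> : \sum_(j <- r) w j *: p j = 0.
      have : all (fun j => w j == 0) r.
        elim: (r) e => [//|j r' IHr]; rewrite big_cons => e /=.
        have h2 : 0 <= \sum_(i <- r') w i by apply: sumr_ge0.
        have h1 := w0 j.
        rewrite IHr ?andbT; last by lra.
        by apply/eqP; lra.
      elim: (r) => [|j r' IHr] /=; first by rewrite big_nil.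
      by case/andP=> /eqP e1 /IHr e2; rewrite big_cons e2 e1 scale0r addr0.
    rewrite addr0 scalerA mulVf ?gt_eqF // scale1r; apply: Cp; by rewrite gt_eqF.
  have s1 : 0 < \sum_(j <- r) w j by rewrite lt0r ne.
  have := IH s1; set q := _ *: (\sum_(j <- r) _) => Cq.
  have -> : \sum_(j <- r) w j *: p j = (\sum_(j <- r) w j) *: q.
    by rewrite /q scalerA mulfV // scale1r.
  have [wi|wi] := eqVneq (w i) 0.
    by rewrite wi scale0r !add0r scalerA mulVf // scale1r.
  by apply: convex_wsum => //; apply: Cp.
by have := key; rewrite w1 invr1 scale1r; apply.
Qed.

Lemma conv_hullE (s : seq 'cV[R]_n) : conv_hull s = hull [set` s].
Proof.
apply/seteqP; split.
  move=> x [w [w0 [w1 ->]]]; apply: convex_sum => //; first exact: hull_convex.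
  by move=> i _; apply: sub_cv => /=; apply: mem_nth.
apply: hull_min.
  move=> x y a b [w [w0 [w1 ->]]] [w' [w0' [w1' ->]]] a0 b0 ab.
  exists (fun i => a * w i + b * w' i); split.
    by move=> i; rewrite addr_ge0 // mulr_ge0.
  split; first by rewrite big_split /= -!mulr_sumr w1 w1' !mulr1.
  rewrite !scaler_sumr -big_split /=; apply: eq_bigr => i _.
  by rewrite scalerDl !scalerA.
move=> x /= xs; have h : (index x s < size s)%N by rewrite index_mem.
exists (fun i => (i == Ordinal h)%:R); split; first by move=> i; rewrite ler0n.
split.
  by rewrite (bigD1 (Ordinal h)) //= eqxx big1 ?addr0 // => i /negbTE ->.
rewrite (bigD1 (Ordinal h)) //= eqxx scale1r nth_index // big1 ?addr0 //.
by move=> i /negbTE ->; rewrite scale0r.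
Qed.

Lemma is_polytopeE A : is_polytope A <-> poly_set A.
Proof. by split=> -[s ->]; exists s; rewrite conv_hullE. Qed.

Lemma poly_convex A : poly_set A -> is_convex A.
Proof. by case=> s ->; exact: hull_convex. Qed.

Lemma absorbing0 A : absorbing A -> A 0.
Proof. by move=> /(_ 0) [t _]; rewrite scaler0. Qed.

Lemma absorb_le A x : is_convex A -> absorbing A ->
  exists2 t : R, 0 < t & forall s, 0 <= s <= t -> A (s *: x).
Proof.
move=> Ac Aa; have [t t0 At] := Aa x; exists t => // s /andP[s0 st].
have -> : s *: x = (s / t) *: (t *: x) by rewrite scalerA divfK ?gt_eqF.
apply: convex_scale => //; first exact: absorbing0.
apply/andP; split; first by apply: divr_ge0 => //; exact: ltW.
by rewrite ler_pdivrMr // mul1r.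
Qed.

Lemma enormZ (c : R) x : enorm (c *: x) = `|c| * enorm x.
Proof.
rewrite /enorm dotvZr dotvZl mulrA -expr2 sqrtrM ?sqr_ge0 // sqrtr_sqr //.
Qed.

Lemma dotv_ge0 x : 0 <= dotv x x.
Proof. by apply: sumr_ge0 => i _; rewrite -expr2 sqr_ge0. Qed.

Lemma enorm_coord x (i : 'I_n) : `|x i 0| <= enorm x.
Proof.
rewrite -sqrtr_sqr ler_sqrt ?dotv_ge0 // /dotv (bigD1 i) //= -expr2 lerDl.
by apply: sumr_ge0 => j _; rewrite -expr2 sqr_ge0.
Qed.

Lemma sum_delta x : x = \sum_i x i 0 *: delta_mx i 0.
Proof.
apply/matrixP => i j; rewrite ord1 summxE (bigD1 i) //= !mxE !eqxx mulr1.
rewrite big1 ?addr0 // => k /negbTE h; by rewrite !mxE eq_sym h mulr0.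
Qed.

(** For the converse, finitely many thresholds give one [t] such that all multiples of axis vectors
    by factors of absolute value at most [t] lie in [A]; a vector with coordinates below [t / n] is
    the average of the [n] axis vectors with coordinates [n x_i]. *)
Lemma PnoE A : Pno A <-> poly_set A /\ absorbing A.
Proof.
split=> [[/is_polytopeE pA [e e0 he]]|[pA aA]].
  split=> // x; have h : 0 < 1 + enorm x.
    by rewrite ltr_wpDr // sqrtr_ge0.
  exists (e / 2 / (1 + enorm x)); first by rewrite !divr_gt0.
  apply: he; rewrite enormZ ger0_norm; last first.
    by apply: ltW; rewrite !divr_gt0.
  have N0 : 0 <= enorm x by exact: sqrtr_ge0.
  rewrite -(mulrA (e / 2)); apply: (@le_lt_trans _ _ (e / 2)); last by lra.
  apply: ler_piMr; first by apply: divr_ge0 => //; exact: ltW.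
  by rewrite mulrC ler_pdivrMr // mul1r lerDr.
split; first exact/is_polytopeE.
have cA := poly_convex pA.
have [n0|n0] := posnP n.
  exists 1 => // x _.
  have -> : x = 0; last exact: absorbing0.
  by apply/matrixP => i; have := ltn_ord i; rewrite {2}n0.
have [t t0 ht] : exists2 t : R, 0 < t & forall (i : 'I_n) s, 0 < s <= t ->
    A (s *: delta_mx i 0) /\ A ((- s) *: delta_mx i 0).
  apply: ex_small => i.
  have [t1 t10 h1] := @absorb_le A (delta_mx i 0) cA aA.
  have [t2 t20 h2] := @absorb_le A (- delta_mx i 0) cA aA.
  exists (Num.min t1 t2); first by rewrite lt_min t10.
  move=> s /andP[s0]; rewrite le_min => /andP[s1 s2]; split.
    by apply: h1; rewrite ltW.
  by rewrite scaleNr -scalerN; apply: h2; rewrite ltW.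
have nR : 0 < n%:R :> R by rewrite ltr0n.
exists (t / n%:R); first by rewrite divr_gt0.
move=> x xe; rewrite (sum_delta x).
have -> : \sum_i x i 0 *: delta_mx i 0 =
    \sum_(i < n) n%:R^-1 *: ((n%:R * x i 0) *: delta_mx i 0) :> 'cV[R]_n.
  by apply: eq_bigr => i _; rewrite scalerA mulrA mulVf ?gt_eqF // mul1r.
apply: convex_sum => //.
- by rewrite sumr_const card_ord -[LHS]mulr_natr mulVf // gt_eqF.
move=> i _.
have hx : `|n%:R * x i 0| <= t.
  rewrite normrM ger0_norm ?ler0n // mulrC -ler_pdivlMr //.
  exact: le_trans (enorm_coord x i) (ltW xe).
have [xi|xi|->] := ltgtP (n%:R * x i 0) 0.
- have [] := ht i (- (n%:R * x i 0)) _; last by rewrite opprK.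
  by rewrite oppr_gt0 xi /= -ltr0_norm.
- have [] // := ht i (n%:R * x i 0) _.
  by rewrite xi /=; apply: le_trans hx; exact: ler_norm.
- by rewrite scale0r; apply: absorbing0.
Qed.

Lemma Pno_convex A : Pno A -> is_convex A.
Proof. by move=> /PnoE[/poly_convex]. Qed.

Lemma Pno0 A : Pno A -> A 0.
Proof. by move=> /PnoE[_ /absorbing0]. Qed.

Lemma Pno_small A x : Pno A -> exists2 t : R, 0 < t & forall s, 0 <= s <= t -> A (s *: x).
Proof. by move=> PA; apply: absorb_le; [exact: Pno_convex|case/PnoE: PA]. Qed.

Lemma poly_cvU A B : poly_set A -> poly_set B -> poly_set (hull (A `|` B)).
Proof.
move=> [s ->] [t ->]; exists (s ++ t).
rewrite hull_hullU setUC hull_hullU; congr hull; apply/seteqP; split=> x /=.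
  by move=> [h|h]; rewrite mem_cat h ?orbT.
by rewrite mem_cat => /orP[h|h]; [right|left].
Qed.

Lemma poly_set1 u : poly_set [set u].
Proof.
exists [:: u]; apply/seteqP; split=> x.
  by move=> ->; apply: sub_cv => /=; rewrite inE.
apply: hull_min => [y z a b -> -> a0 b0 ab|y /=]; last by rewrite inE => /eqP.
by rewrite -scalerDl ab scale1r.
Qed.

Lemma poly_U2 A u v : poly_set A -> poly_set (hull (A `|` [set u; v])).
Proof.
move=> pA; rewrite -[hull _]/(hull _) setUA -hull_hullU.
by apply: poly_cvU (poly_set1 v); apply: poly_cvU (poly_set1 u).
Qed.

Lemma poly_U1 A u : poly_set A -> poly_set (hull (A `|` [set u])).
Proof. by move=> pA; apply: poly_cvU (poly_set1 u). Qed.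

(** The crossing points of all pairs of vertices on opposite sides are adjoined to the vertex list.
    They lie in the hull, and the enlarged list satisfies [crossing_ok], so the cut merely discards
    vertices. *)
Lemma poly_cut g A : poly_set A -> poly_set (A `&` [set x | 0 <= dotv g x]).
Proof.
move=> [s ->].
pose t := s ++ [seq cross g k z | k <- [seq k <- s | 0 < dotv g k], z <- [seq z <- s | dotv g z < 0]].
have E : hull [set` s] = hull [set` t].
  apply: hull_eq => x /= xs; first by apply: sub_cv => /=; rewrite mem_cat xs.
  move: xs; rewrite mem_cat => /orP[xs|/allpairsP[[k z] /= [kt zt ->]]].
    exact: sub_cv.
  move: kt zt; rewrite !mem_filter => /andP[k0 ks] /andP[z0 zs].
  by apply: cross_conv; [exact: hull_convex|exact: sub_cv|exact: sub_cv|rewrite k0 z0].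
have crosses : crossing_ok g [set` t].
  move=> k z kt zt kz; apply: sub_cv => /=; split; last exact: cross0.
  have T0 y : y \in t -> dotv g y != 0 -> y \in s.
    rewrite mem_cat => /orP[//|/allpairsP[[k' z'] /= [k1 z1 ->]]].
    move: k1 z1; rewrite !mem_filter => /andP[k0 _] /andP[z0 _].
    by rewrite cross0 ?z0 ?k0 // eqxx.
  have /andP[z0 k0] := kz.
  rewrite mem_cat; apply/orP; right; apply/allpairsP; exists (k, z); split=> //=.
    by rewrite mem_filter k0 T0 // gt_eqF.
  by rewrite mem_filter z0 T0 // lt_eqF.
rewrite E hull_cut_ge //; exists [seq x <- t | 0 <= dotv g x]; congr hull.
apply/seteqP; split=> x /=; rewrite mem_filter.
  by move=> [-> ->].
by move=> /andP[].
Qed.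

Lemma half_oppr g : [set x | 0 <= dotv (- g) x] = [set x | dotv g x <= 0].
Proof. by apply/seteqP; split=> x /=; rewrite dotvNl oppr_ge0. Qed.

Lemma zeroE g : [set x | dotv g x = 0] = [set x | 0 <= dotv g x] `&` [set x | dotv g x <= 0].
Proof.
apply/seteqP; split=> x /=; first by move=> ->.
by move=> [h1 h2]; apply/eqP; rewrite eq_le h1 h2.
Qed.

Lemma poly_cutN g A : poly_set A -> poly_set (A `&` [set x | dotv g x <= 0]).
Proof. by rewrite -half_oppr; apply: poly_cut. Qed.

Lemma poly_cut0 g A : poly_set A -> poly_set (A `&` [set x | dotv g x = 0]).
Proof. by rewrite zeroE setIA => pA; apply: poly_cutN; apply: poly_cut. Qed.

(** Every [x] is [a *: w] plus a vector of the hyperplane, where [w] is whichever of [u], [v] lies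
    on the side of [x], so that [a >= 0]; normalising the mixture gives a positive multiple of
    [x]. *)
Lemma absorb_gen g A u v : is_convex A ->
  (forall h, dotv g h = 0 -> exists2 t : R, 0 < t & A (t *: h)) ->
  A u -> A v -> dotv g u < 0 < dotv g v -> absorbing A.
Proof.
move=> cA hA Au Av /andP[u0 v0] x.
have key w : A w -> dotv g w != 0 -> 0 <= dotv g x / dotv g w ->
    exists2 t : R, 0 < t & A (t *: x).
  move=> Aw w0; set a := _ / _ => a0.
  have [] := hA (x - a *: w).
    by rewrite dotvDr dotvNr dotvZr divfK // subrr.
  move=> t t0 At; exists (t / (1 + a * t)).
    by rewrite divr_gt0 // ltr_wpDr // mulr_ge0 // ltW.
  have p : 0 < 1 + a * t by rewrite ltr_wpDr // mulr_ge0 // ltW.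
  have -> : (t / (1 + a * t)) *: x =
      (1 + a * t)^-1 *: (1 *: (t *: (x - a *: w)) + (a * t) *: w).
    rewrite scale1r scalerBr scalerA [t * a]mulrC subrK scalerA mulrC //.
  by apply: convex_wsum => //; rewrite mulr_ge0 // ltW.
have [h|h] := leP 0 (dotv g x).
  by apply: (key v) => //; rewrite ?gt_eqF // divr_ge0 // ltW.
by apply: (key u) => //; rewrite ?lt_eqF // ltW // ltr_ndivlMr // mul0r.
Qed.

Lemma cut_absorb A (H : set 'cV[R]_n) : absorbing A -> (forall t x, 0 < t -> H x -> H (t *: x)) ->
  forall h, H h -> exists2 t : R, 0 < t & (A `&` H) (t *: h).
Proof. by move=> aA hH h Hh; have [t t0 At] := aA h; exists t => //; split=> //; apply: hH. Qed.

End Poly.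

(** * Valuations and bipyramids *)

(** Values in any additive group: this covers vector values, their scalar components, and values
    regarded as functions of the equator in a lower dimension. *)
Definition valuation (R : realType) n (V : zmodType) (nu : set 'cV[R]_n -> V) :=
  forall K L, Pno K -> Pno L -> Pno (K `|` L) -> Pno (K `&` L) ->
    nu (K `|` L) + nu (K `&` L) = nu K + nu L.

Section Val.
Variables (R : realType) (n : nat).
Implicit Types (x y z u v g : 'cV[R]_n) (A B C X P Q : set 'cV[R]_n).

Lemma Pno_cut g X u v : Pno X -> X u -> X v -> dotv g u < 0 < dotv g v ->
  [/\ Pno (hull ((X `&` [set x | 0 <= dotv g x]) `|` [set u])),
      Pno (hull ((X `&` [set x | dotv g x <= 0]) `|` [set v])) &
      Pno (hull ((X `&` [set x | dotv g x = 0]) `|` [set u; v]))].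
Proof.
move=> /PnoE[pX aX] Xu Xv uv; have /andP[u0 v0] := uv.
have H h : dotv g h = 0 -> exists2 t : R, 0 < t & (X `&` [set x | dotv g x = 0]) (t *: h).
  by apply: cut_absorb => // t x t0 /= e; rewrite dotvZr e mulr0.
split; apply/PnoE; split.
- by apply: poly_U1; apply: poly_cut.
- apply: (@absorb_gen _ _ g _ u v) => //; first exact: hull_convex.
  + move=> h /H[t t0 [Xt /= e]]; exists t => //; apply: sub_cv; left; split=> //=.
    by rewrite e.
  + by apply: sub_cv; right.
  + by apply: sub_cv; left; split=> //=; apply: ltW.
- by apply: poly_U1; apply: poly_cutN.
- apply: (@absorb_gen _ _ g _ u v) => //; first exact: hull_convex.
  + move=> h /H[t t0 [Xt /= e]]; exists t => //; apply: sub_cv; left; split=> //=.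
    by rewrite e.
  + by apply: sub_cv; left; split=> //=; apply: ltW.
  + by apply: sub_cv; right.
- by apply: poly_U2; apply: poly_cut0.
- apply: (@absorb_gen _ _ g _ u v) => //; first exact: hull_convex.
  + by move=> h /H[t t0 Xt]; exists t => //; apply: sub_cv; left.
  + by apply: sub_cv; right; left.
  + by apply: sub_cv; right; right.
Qed.

Lemma crossing_okU g X (W : set 'cV[R]_n) : is_convex X ->
  (forall x, W x -> X x) ->
  (forall x, W x -> dotv g x < 0) ->
  crossing_ok g ((X `&` [set x | 0 <= dotv g x]) `|` W).
Proof.
move=> cX WX W0 k z Ak Az kz; have /andP[z0 k0] := kz.
case: Az => [[_ /=]|Wz]; first by rewrite leNgt z0.
case: Ak => [[Xk _]|/W0]; last by rewrite ltNge (ltW k0).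
apply: sub_cv; split; last exact: cross0.
left; split; last by rewrite /= cross0.
by apply: cross_conv => //; exact: WX.
Qed.

Lemma cap_le g X u : is_convex X -> X u -> dotv g u < 0 ->
  hull ((X `&` [set x | 0 <= dotv g x]) `|` [set u]) `&` [set x | dotv g x <= 0] =
  hull ((X `&` [set x | dotv g x = 0]) `|` [set u]).
Proof.
move=> cX Xu u0; rewrite hull_cut_le; last first.
  by apply: crossing_okU => // x -> //.
congr hull; apply/seteqP; split=> x /=.
  move=> [[[Xx x0]|->] x1]; [left|by right]; split=> //.
  by apply/eqP; rewrite eq_le x0 x1.
by move=> [[Xx x0]|->]; split; rewrite ?x0; [left|by []|right|apply: ltW].
Qed.

(** Since the caps belong to [X], the two capped halves have union [X]. Beyond the hyperplane a
    capped half is just the cone from its cap over the section ([cap_le]), which identifies the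
    intersection. *)
Lemma valuation_cut (V : zmodType) (nu : set 'cV[R]_n -> V) g X u v : valuation nu ->
  Pno X -> X u -> X v -> dotv g u < 0 < dotv g v ->
  nu X = nu (hull ((X `&` [set x | 0 <= dotv g x]) `|` [set u]))
       + nu (hull ((X `&` [set x | dotv g x <= 0]) `|` [set v]))
       - nu (hull ((X `&` [set x | dotv g x = 0]) `|` [set u; v])).
Proof.
move=> val PX Xu Xv uv; have /andP[u0 v0] := uv.
have cX := Pno_convex PX.
have [P1 P2 P3] := Pno_cut PX Xu Xv uv.
set K := hull _ in P1 *; set L := hull _ in P2 *; set M := hull _ in P3 *.
have KX : K `<=` X by apply: hull_min => // x [[]|->].
have LX : L `<=` X by apply: hull_min => // x [[]|->].
have EU : K `|` L = X.
  apply/seteqP; split=> [x [/KX|/LX]//|x Xx].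
  have [h|h] := leP 0 (dotv g x); [left|right]; apply: sub_cv; left; split=> //.
  exact: ltW.
have EI : K `&` L = M.
  apply/seteqP; split; last first.
    move=> x Mx; split; move: x Mx; apply: hull_min; try exact: hull_convex.
      move=> x [[Xx /= x0]|[->|->]]; apply: sub_cv; first by left; split; rewrite //= x0.
        by right.
      by left; split=> //=; apply: ltW.
    move=> x [[Xx /= x0]|[->|->]]; apply: sub_cv; first by left; split; rewrite //= x0.
      by left; split=> //=; apply: ltW.
    by right.
  move=> x [Kx Lx]; have [h|h] := leP (dotv g x) 0.
    have : (K `&` [set x | dotv g x <= 0]) x by [].
    rewrite cap_le //; apply: hull_mono => y [|->]; first by left.
    by right; left.
  have : (L `&` [set x | dotv (- g) x <= 0]) x by split; rewrite //= dotvNl oppr_le0 ltW.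
  rewrite /L -half_oppr cap_le //; last by rewrite dotvNl oppr_lt0.
  apply: hull_mono => y [[Xy /= y0]|->]; last by right; right.
  by left; split=> //=; move: y0; rewrite dotvNl; lra.
have := val K L P1 P2; rewrite EU EI => /(_ PX P3) <-.
by rewrite addrK.
Qed.

End Val.

(* [Q] plays the role of a polytope of [Pno] inside the hyperplane [g = 0]. *)
Definition equatorial (R : realType) n (g : 'cV[R]_n) (Q : set 'cV[R]_n) :=
  [/\ poly_set Q, Q `<=` [set x | dotv g x = 0] &
    forall h, dotv g h = 0 -> exists2 t : R, 0 < t & Q (t *: h)].

Definition bipyr (R : realType) n (Q : set 'cV[R]_n) (u v : 'cV[R]_n) :=
  hull (Q `|` [set u; v]).

Lemma bipyrC (R : realType) n (Q : set 'cV[R]_n) u v : bipyr Q u v = bipyr Q v u.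
Proof. by rewrite /bipyr [X in _ `|` X]setUC. Qed.

Section Br.
Variables (R : realType) (n : nat) (g : 'cV[R]_n).
Implicit Types (x y z u v w r : 'cV[R]_n) (A B C X P Q : set 'cV[R]_n).

Lemma baseQ_convex Q : equatorial g Q -> is_convex Q.
Proof. by case=> /poly_convex. Qed.

Lemma baseQ0 Q : equatorial g Q -> Q 0.
Proof. by case=> _ _ h; have [|t _] := h 0; rewrite ?dotv0r // scaler0. Qed.

Lemma baseQ_zero Q x : equatorial g Q -> Q x -> dotv g x = 0.
Proof. by case=> _ h _; exact: h. Qed.

Lemma baseQ_cut X : Pno X -> equatorial g (X `&` [set x | dotv g x = 0]).
Proof.
move=> /PnoE[pX aX]; split; first exact: poly_cut0.
  by move=> x [].
by apply: cut_absorb => // t x t0 /= e; rewrite dotvZr e mulr0.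
Qed.

Lemma bipyr_ok Q u v : equatorial g Q -> dotv g v < 0 < dotv g u -> Q (cross g u v) ->
  crossing_ok g (Q `|` [set u; v]).
Proof.
move=> bQ /andP[v0 u0] equator k z Ak Az /andP[z0 k0].
have ek : k = u.
  case: Ak => [/(baseQ_zero bQ) e|[//|e]]; first by rewrite e ltxx in k0.
  by rewrite e ltNge (ltW v0) in k0.
have ez : z = v.
  case: Az => [/(baseQ_zero bQ) e|[e|//]]; first by rewrite e ltxx in z0.
  by rewrite e ltNge (ltW u0) in z0.
rewrite ek ez; apply: sub_cv; split; first by left.
by rewrite /= cross0 // v0.
Qed.

Lemma bipyr_ge Q u v : equatorial g Q -> dotv g v < 0 < dotv g u -> Q (cross g u v) ->
  bipyr Q u v `&` [set x | 0 <= dotv g x] = hull (Q `|` [set u]).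
Proof.
move=> bQ uv equator; rewrite hull_cut_ge; last exact: bipyr_ok.
have /andP[v0 u0] := uv; congr hull; apply/seteqP; split=> x.
  by move=> [[Qx|[->|->]] /= h]; [left|right|rewrite leNgt v0 in h].
move=> [Qx|->]; split; [by left| |by right; left|exact: ltW].
by rewrite /= (baseQ_zero bQ Qx).
Qed.

Lemma bipyr_le Q u v : equatorial g Q -> dotv g v < 0 < dotv g u -> Q (cross g u v) ->
  bipyr Q u v `&` [set x | dotv g x <= 0] = hull (Q `|` [set v]).
Proof.
move=> bQ uv equator; rewrite hull_cut_le; last exact: bipyr_ok.
have /andP[v0 u0] := uv; congr hull; apply/seteqP; split=> x.
  by move=> [[Qx|[->|->]] /= h]; [left|rewrite leNgt u0 in h|right].
move=> [Qx|->]; split; [by left| |by right; right|exact: ltW].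
by rewrite /= (baseQ_zero bQ Qx).
Qed.

Lemma bipyr_eq Q u v : equatorial g Q -> dotv g v < 0 < dotv g u -> Q (cross g u v) ->
  bipyr Q u v `&` [set x | dotv g x = 0] = Q.
Proof.
move=> bQ uv equator; rewrite hull_cut_eq; last exact: bipyr_ok.
have /andP[v0 u0] := uv; rewrite -[RHS]hull_id; last exact: baseQ_convex.
congr hull; apply/seteqP; split=> x.
  by move=> [[Qx|[->|->]] /= h] //; move: u0 v0; rewrite h ltxx.
by move=> Qx; split; [left|exact: (baseQ_zero bQ Qx)].
Qed.

Lemma bipyr_Pno Q u v : equatorial g Q -> dotv g v < 0 < dotv g u -> Pno (bipyr Q u v).
Proof.
move=> [pQ _ aQ] uv; apply/PnoE; split; first exact: poly_U2.
apply: (@absorb_gen _ _ g _ v u) => //; first exact: hull_convex.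
- by move=> h /aQ[t t0 Qt]; exists t => //; apply: sub_cv; left.
- by apply: sub_cv; right; right.
- by apply: sub_cv; right; left.
Qed.

Lemma bipyr_cross Q u v : equatorial g Q -> dotv g v < 0 < dotv g u -> Q (cross g u v) ->
  forall u' v', bipyr Q u v u' -> bipyr Q u v v' -> dotv g v' < 0 < dotv g u' ->
  Q (cross g u' v').
Proof.
move=> bQ uv equator u' v' Xu Xv uv'; rewrite -(bipyr_eq bQ uv equator); split.
  by apply: cross_conv => //; exact: hull_convex.
exact: cross0.
Qed.

(** This is [valuation_cut] for the bipyramid itself, with [u'] and [v'] as caps: its halves are
    cones over [Q], so each capped half is a bipyramid again. *)
Lemma bipyr_split (V : zmodType) (nu : set 'cV[R]_n -> V) Q u v u' v' : valuation nu ->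
  equatorial g Q -> dotv g v < 0 < dotv g u -> Q (cross g u v) ->
  bipyr Q u v u' -> bipyr Q u v v' -> dotv g v' < 0 < dotv g u' ->
  nu (bipyr Q u v) = nu (bipyr Q u v') + nu (bipyr Q u' v) - nu (bipyr Q u' v').
Proof.
move=> val bQ uv equator Xu Xv uv'.
rewrite (valuation_cut val (bipyr_Pno bQ uv) Xv Xu uv').
rewrite bipyr_ge // bipyr_le // bipyr_eq //; rewrite !hull_hullU -!setUA.
by rewrite -/(bipyr Q u v') -/(bipyr Q v u') (bipyrC Q v) -/(bipyr Q v' u') (bipyrC Q v').
Qed.

Section Zero.
Variables (V : zmodType) (nu : set 'cV[R]_n -> V) (Q : set 'cV[R]_n).
Hypothesis val : valuation nu.
Hypothesis bQ : equatorial g Q.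
Hypothesis Z : forall u (t : R), 0 < dotv g u -> 0 < t -> nu (bipyr Q u (- (t *: u))) = 0.

(** Inserts the direction [w] between the apexes: in [bipyr_split] with the points [s *: w] and
    [- (s' *: w)], the subtracted term has opposite apexes and vanishes by [Z]. *)
Lemma bipyr_mid u v w : dotv g v < 0 < dotv g u -> Q (cross g u v) -> 0 < dotv g w ->
  exists2 t : R, 0 < t & forall s s', 0 < s <= t -> 0 < s' <= t ->
   [/\ Q (cross g u (- (s' *: w))), Q (cross g (s *: w) v) &
    nu (bipyr Q u v) = nu (bipyr Q u (- (s' *: w))) + nu (bipyr Q (s *: w) v)].
Proof.
move=> uv equator w0; have PX := bipyr_Pno bQ uv.
have [t1 t10 h1] := Pno_small w PX; have [t2 t20 h2] := Pno_small (- w) PX.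
exists (Num.min t1 t2); first by rewrite lt_min t10.
move=> s s' /andP[s0]; rewrite le_min => /andP[s1 s2].
move=> /andP[s0']; rewrite le_min => /andP[s1' s2'].
have X1 : bipyr Q u v (s *: w) by apply: h1; rewrite ltW.
have X2 : bipyr Q u v (- (s' *: w)) by rewrite -scalerN; apply: h2; rewrite ltW.
have e1 : 0 < dotv g (s *: w) by rewrite dotvZr mulr_gt0.
have e2 : dotv g (- (s' *: w)) < 0 by rewrite dotvNr oppr_lt0 dotvZr mulr_gt0.
have /andP[v0 u0] := uv.
split.
- by apply: (bipyr_cross bQ uv) => //; [apply: sub_cv; right; left|rewrite e2].
- by apply: (bipyr_cross bQ uv) => //; [apply: sub_cv; right; right|rewrite v0].
rewrite (bipyr_split (u' := s *: w) (v' := - (s' *: w)) val bQ uv) ?e1 ?e2 //.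
have -> : - (s' *: w) = - ((s' / s) *: (s *: w)) by rewrite scalerA divfK ?gt_eqF.
by rewrite [X in _ - X]Z ?subr0 ?divr_gt0.
Qed.

(** Inserting the direction [u] itself, and then [- v], shrinks the apexes one after the other, the
    second summand having opposite apexes each time. The last stage frees the scale of [u] for all
    small [s'] at once. *)
Lemma bipyr_scale_small u v : dotv g v < 0 < dotv g u -> Q (cross g u v) ->
  exists2 t : R, 0 < t & forall s s', 0 < s <= t -> 0 < s' <= t ->
    nu (bipyr Q u v) = nu (bipyr Q (s *: u) (s' *: v)).
Proof.
move=> uv equator; have /andP[v0 u0] := uv.
have [t t0 ht] := bipyr_mid uv equator u0.
have v0' : 0 < dotv g (- v) by rewrite dotvNr oppr_gt0.
have e1 s : 0 < s -> 0 < dotv g (s *: u) by move=> s0; rewrite dotvZr mulr_gt0.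
have [t' t0' ht'] : exists2 t' : R, 0 < t' & forall s', 0 < s' <= t' ->
    nu (bipyr Q u v) = nu (bipyr Q (t *: u) (s' *: v)).
  have tt : 0 < t <= t by rewrite t0 lexx.
  have [_ Q2 E] := ht t t tt tt.
  have uv' : dotv g v < 0 < dotv g (t *: u) by rewrite v0 e1.
  have [t' t0' h] := bipyr_mid uv' Q2 v0'; exists t' => // s' hs'.
  have [_ _ E'] := h _ _ hs' hs'.
  rewrite E [X in X + _]Z // add0r E' -scalerN opprK.
  have -> : bipyr Q (s' *: - v) v = bipyr Q (s' *: (- v)) (- (s'^-1 *: (s' *: (- v)))).
    by rewrite scalerA mulVf ?gt_eqF ?scale1r ?opprK //; case/andP: hs'.
  case/andP: hs' => s0 _; rewrite [X in _ + X]Z ?addr0 ?invr_gt0 //.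
  by rewrite dotvZr mulr_gt0.
have E2 s s' : 0 < s <= t -> 0 < s' <= t' -> Q (cross g (t *: u) (s' *: v)) ->
    nu (bipyr Q (t *: u) (s' *: v)) = nu (bipyr Q (s *: u) (s' *: v)).
  move=> /andP[s0 st] /andP[s0' st'] Qc'.
  have uv' : dotv g (s' *: v) < 0 < dotv g (t *: u).
    by rewrite e1 // dotvZr pmulr_rlt0 // v0.
  have [d d0 h] := bipyr_mid uv' Qc' (e1 1 ltr01).
  have X1 : bipyr Q (t *: u) (s' *: v) (s *: u).
    have -> : s *: u = (s / t) *: (t *: u) by rewrite scalerA divfK ?gt_eqF.
    apply: convex_scale; first exact: hull_convex.
    - by apply: sub_cv; left; exact: baseQ0.
    - by apply: sub_cv; right; left.
    - by rewrite ler_pdivrMr // mul1r st andbT; apply: divr_ge0; exact: ltW.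
  have [p p0 hp] := Pno_small (- u) (bipyr_Pno bQ uv').
  have X2 : bipyr Q (t *: u) (s' *: v) (- (p *: u)).
    by rewrite -scalerN; apply: hp; rewrite lexx ltW.
  rewrite (bipyr_split (u' := s *: u) (v' := - (p *: u)) val bQ uv') ?e1 //; last first.
    by rewrite dotvNr oppr_lt0 !e1.
  have k (c : R) : 0 < c -> nu (bipyr Q (c *: u) (- (p *: u))) = 0.
    move=> c0; have -> : p *: u = (p / c) *: (c *: u) by rewrite scalerA divfK ?gt_eqF.
    by rewrite Z ?e1 // divr_gt0.
  by rewrite !k // add0r subr0.
exists (Num.min t (Num.min 1 t')); first by rewrite !lt_min t0 ltr01.
move=> s s' /andP[s0]; rewrite !le_min => /and3P[s1 _ _].
move=> /andP[s0' ] /and3P[_ s2' s3'].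
rewrite (ht' s') ?s0' //; apply: E2; rewrite ?s0 ?s0' //.
have tt : 0 < t <= t by rewrite t0 lexx.
have [_ Q2 _] := ht t t tt tt.
have uv' : dotv g v < 0 < dotv g (t *: u) by rewrite v0 e1.
apply: (bipyr_cross bQ uv' Q2); first by apply: sub_cv; right; left.
  apply: convex_scale; first exact: hull_convex.
  - by apply: sub_cv; left; exact: baseQ0.
  - by apply: sub_cv; right; right.
  - by rewrite ltW.
by rewrite e1 // dotvZr pmulr_rlt0 // v0.
Qed.

(** Both bipyramids equal the one with apexes [s *: u] and [s *: v] for a small common [s]; only the
    directions of the apexes matter. *)
Lemma bipyr_scale u v (a b : R) : dotv g v < 0 < dotv g u -> Q (cross g u v) ->
  0 < a -> 0 < b -> Q (cross g (a *: u) (b *: v)) ->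
  nu (bipyr Q u v) = nu (bipyr Q (a *: u) (b *: v)).
Proof.
move=> uv equator a0 b0 Qc'; have /andP[v0 u0] := uv.
have [t t0 h] := bipyr_scale_small uv equator.
have uv' : dotv g (b *: v) < 0 < dotv g (a *: u).
  by rewrite !dotvZr pmulr_rlt0 // v0 mulr_gt0.
have [t' t0' h'] := bipyr_scale_small uv' Qc'.
pose s := Num.min (Num.min t (t' * a)) (Num.min t (t' * b)).
have s0 : 0 < s by rewrite !lt_min t0 !mulr_gt0.
have st : s <= t by rewrite ge_min ge_min lexx.
have sa : s <= t' * a by rewrite !ge_min lexx !orbT.
have sb : s <= t' * b by rewrite !ge_min lexx !orbT.
rewrite (h s s) ?s0 // (h' (s / a) (s / b)) ?divr_gt0 ?ler_pdivrMr //.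
by rewrite !scalerA !divfK ?gt_eqF.
Qed.

End Zero.

(* A scale at which the segment between [t r] and [- t r'] crosses [g = 0] inside
   [Q]; the resulting bipyramid has a value depending only on the directions. *)
Definition tau Q r : R := xget 1 [set t | 0 < t /\ Q ((t / 2) *: r)].

Lemma tauP Q r : equatorial g Q -> dotv g r = 0 -> 0 < tau Q r /\ Q ((tau Q r / 2) *: r).
Proof.
move=> [_ _ aQ] /aQ[t t0 Qt]; rewrite /tau; case: xgetP => [y _ //|/(_ (2 * t)) []].
split; first by rewrite mulr_gt0.
by rewrite mulrAC divff ?mul1r.
Qed.

(** Under the hypothesis [Z] it plays the role of a difference [F r - F r'] on the hyperplane
    [g = 1]: it vanishes on the diagonal and satisfies the cocycle rule, obtained by inserting the
    middle direction with [bipyr_mid]. *)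
Definition bipyr_diff (V : zmodType) (nu : set 'cV[R]_n -> V) Q r r' :=
  nu (bipyr Q (tau Q (r - r') *: r) (- (tau Q (r - r') *: r'))).

Lemma cross_dir r r' (a b : R) : dotv g r = 1 -> dotv g r' = 1 -> 0 < a -> 0 < b ->
  cross g (a *: r) (- (b *: r')) = (a * b / (a + b)) *: (r - r').
Proof.
move=> r1 r1' a0 b0; rewrite /cross dotvNr !dotvZr r1 r1' !mulr1 !opprK.
by apply/matrixP => i j; rewrite !mxE; field; rewrite gt_eqF ?addr_gt0.
Qed.

Section Cocycle.
Variables (V : zmodType) (nu : set 'cV[R]_n -> V) (Q : set 'cV[R]_n).
Hypothesis val : valuation nu.
Hypothesis bQ : equatorial g Q.
Hypothesis Z : forall u (t : R), 0 < dotv g u -> 0 < t -> nu (bipyr Q u (- (t *: u))) = 0.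

Lemma dir_side r r' (a b : R) : dotv g r = 1 -> dotv g r' = 1 -> 0 < a -> 0 < b ->
  dotv g (- (b *: r')) < 0 < dotv g (a *: r).
Proof. by move=> r1 r1' a0 b0; rewrite dotvNr !dotvZr r1 r1' !mulr1 a0 oppr_lt0 b0. Qed.

Lemma bipyr_diffE r r' (a b : R) : dotv g r = 1 -> dotv g r' = 1 -> 0 < a -> 0 < b ->
  Q ((a * b / (a + b)) *: (r - r')) -> nu (bipyr Q (a *: r) (- (b *: r'))) = bipyr_diff nu Q r r'.
Proof.
move=> r1 r1' a0 b0 equator; rewrite /bipyr_diff; set t := tau _ _.
have [t0 Qt] : 0 < t /\ Q ((t / 2) *: (r - r')).
  by apply: tauP => //; rewrite dotvDr dotvNr r1 r1' subrr.
have := @bipyr_scale V nu Q val bQ Z (a *: r) (- (b *: r')) (t / a) (t / b).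
rewrite !scalerN !scalerA !divfK ?gt_eqF // => -> //.
- exact: dir_side.
- by rewrite cross_dir.
- exact: divr_gt0.
- exact: divr_gt0.
- rewrite cross_dir // (_ : t * t / (t + t) = t / 2) //.
  by field; rewrite gt_eqF // addr_gt0.
Qed.

Lemma bipyr_diff0 r : dotv g r = 1 -> bipyr_diff nu Q r r = 0.
Proof.
move=> r1; rewrite /bipyr_diff; set t := tau _ _.
have [t0 _] : 0 < t /\ Q ((t / 2) *: (r - r)).
  by apply: tauP => //; rewrite subrr dotv0r.
have := Z (u := t *: r) _ ltr01; rewrite scale1r; apply.
by rewrite dotvZr r1 mulr1.
Qed.

Lemma bipyr_diff_cocycle r r' r'' : dotv g r = 1 -> dotv g r' = 1 -> dotv g r'' = 1 ->
  bipyr_diff nu Q r r'' = bipyr_diff nu Q r r' + bipyr_diff nu Q r' r''.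
Proof.
move=> r1 r1' r1''; rewrite {1}/bipyr_diff; set t := tau _ _.
have [t0 Qt] : 0 < t /\ Q ((t / 2) *: (r - r'')).
  by apply: tauP => //; rewrite dotvDr dotvNr r1 r1'' subrr.
have uv := dir_side r1 r1'' t0 t0.
have equator : Q (cross g (t *: r) (- (t *: r''))).
  rewrite cross_dir // (_ : t * t / (t + t) = t / 2) //.
  by field; rewrite gt_eqF // addr_gt0.
have w0 : 0 < dotv g r' by rewrite r1'.
have [d d0 h] := bipyr_mid val bQ Z uv equator w0.
have dd : 0 < d <= d by rewrite d0 lexx.
have [h1 h2 ->] := h d d dd dd.
rewrite cross_dir // in h1; rewrite cross_dir // in h2.
by rewrite !bipyr_diffE.
Qed.

Lemma bipyr_diff_anti r r' : dotv g r = 1 -> dotv g r' = 1 -> bipyr_diff nu Q r r' = - bipyr_diff nu Q r' r.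
Proof.
by move=> r1 r1'; apply/eqP; rewrite -addr_eq0 -bipyr_diff_cocycle // bipyr_diff0.
Qed.

Lemma bipyr_to_diff u v : dotv g v < 0 < dotv g u -> Q (cross g u v) ->
  nu (bipyr Q u v) = bipyr_diff nu Q ((dotv g u)^-1 *: u) ((dotv g v)^-1 *: v).
Proof.
move=> /andP[v0 u0] equator.
have E1 : dotv g u *: ((dotv g u)^-1 *: u) = u by rewrite scalerA mulfV ?scale1r ?gt_eqF.
have E2 : - ((- dotv g v) *: ((dotv g v)^-1 *: v)) = v.
  by rewrite scaleNr opprK scalerA mulfV ?scale1r ?lt_eqF.
have R1 : dotv g ((dotv g u)^-1 *: u) = 1 by rewrite dotvZr mulVf ?gt_eqF.
have R2 : dotv g ((dotv g v)^-1 *: v) = 1 by rewrite dotvZr mulVf ?lt_eqF.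
have v0' : 0 < - dotv g v by rewrite oppr_gt0.
by rewrite -(bipyr_diffE R1 R2 u0 v0') -?cross_dir // ?E1 ?E2.
Qed.

End Cocycle.

(** Each half is a join of the equator with an apex. A join with a point distributes over unions,
    and over intersections as well because the value of [g] determines the join parameter. *)
Lemma bipyrU (V : zmodType) (nu : set 'cV[R]_n -> V) Q1 Q2 u v : valuation nu ->
  equatorial g Q1 -> equatorial g Q2 -> equatorial g (Q1 `|` Q2) -> equatorial g (Q1 `&` Q2) ->
  dotv g v < 0 < dotv g u -> Q1 (cross g u v) -> Q2 (cross g u v) ->
  nu (bipyr (Q1 `|` Q2) u v) + nu (bipyr (Q1 `&` Q2) u v) = nu (bipyr Q1 u v) + nu (bipyr Q2 u v).
Proof.
move=> val b1 b2 bU bI uv Qc1 Qc2; have /andP[v0 u0] := uv.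
have S Q x : equatorial g Q -> Q (cross g u v) ->
    bipyr Q u v x <-> (0 <= dotv g x /\ hull (Q `|` [set u]) x) \/
                   (dotv g x <= 0 /\ hull (Q `|` [set v]) x).
  move=> bQ equator; rewrite -(bipyr_ge bQ uv equator) -(bipyr_le bQ uv equator); split.
    move=> Xx; have [h|h] := leP 0 (dotv g x); first by left.
    by right; split; first exact: ltW; split=> //=; exact: ltW.
  by move=> [[_ []]|[_ []]].
have J Q w : equatorial g Q -> hull (Q `|` [set w]) = [set x | exists a (t : R),
    [/\ Q a, 0 <= t <= 1 & x = (1 - t) *: a + t *: w]].
  by move=> bQ; apply: hull_U1; [exact: baseQ_convex|exists 0; exact: baseQ0].
have JU w : hull (Q1 `|` Q2 `|` [set w]) = hull (Q1 `|` [set w]) `|` hull (Q2 `|` [set w]).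
  rewrite !J //; apply/seteqP; split=> x /=.
    by move=> [a [t [[Qa|Qa] ht e]]]; [left|right]; exists a, t.
  by move=> [] [a [t [Qa ht e]]]; exists a, t; split=> //; [left|right].
have JI w : dotv g w != 0 ->
    hull (Q1 `&` Q2 `|` [set w]) = hull (Q1 `|` [set w]) `&` hull (Q2 `|` [set w]).
  move=> w0; rewrite !J //; apply/seteqP; split=> x /=.
    by move=> [a [t [[Qa Qa'] ht e]]]; split; exists a, t.
  move=> [[a [t [Qa ht e]]] [a' [t' [Qa' ht' e']]]].
  have z1 : dotv g a = 0 by case: b1 => _ h _; exact: h.
  have z2 : dotv g a' = 0 by case: b2 => _ h _; exact: h.
  have et : t = t'.
    have : dotv g ((1 - t) *: a + t *: w) = dotv g ((1 - t') *: a' + t' *: w) by rewrite -e -e'.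
    by rewrite !dotvDr !dotvZr z1 z2 !mulr0 !add0r => /(mulIf w0).
  have [t1|t1] := eqVneq t 1.
    exists 0, t; split=> //; last by rewrite e t1 subrr !scale0r.
    by split; [exact: baseQ0 b1|exact: baseQ0 b2].
  have ea : a = a'.
    have ne : 1 - t != 0 by rewrite subr_eq0 eq_sym.
    apply: (scalerI ne); apply: (addIr (t *: w)).
    by rewrite -e e' et.
  by exists a, t; split=> //; rewrite -ea in Qa'.
have EU : bipyr (Q1 `|` Q2) u v = bipyr Q1 u v `|` bipyr Q2 u v.
  apply/seteqP; split=> x.
    rewrite S //; last by left.
    by rewrite !JU /= !S // => -[[h [h1|h1]]|[h [h1|h1]]]; tauto.
  rewrite /= S // S // => h; rewrite S //; last by left.
  by rewrite !JU /=; tauto.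
have EI : bipyr (Q1 `&` Q2) u v = bipyr Q1 u v `&` bipyr Q2 u v.
  have w0 : dotv g u != 0 by rewrite gt_eqF.
  have w1 : dotv g v != 0 by rewrite lt_eqF.
  apply/seteqP; split=> x.
    by move=> Xx; split; move: x Xx; apply: hull_mono => y [[]|]; by [left|right].
  move=> [/= h1 h2].
  have P1 := bipyr_ge b1 uv Qc1; have P2 := bipyr_ge b2 uv Qc2.
  have N1 := bipyr_le b1 uv Qc1; have N2 := bipyr_le b2 uv Qc2.
  have [h|h] := leP 0 (dotv g x).
    have : (hull (Q1 `|` [set u]) `&` hull (Q2 `|` [set u])) x.
      by rewrite -P1 -P2; split; split.
    by rewrite -JI //; apply: hull_mono => y [|->]; [left|right; left].
  have : (hull (Q1 `|` [set v]) `&` hull (Q2 `|` [set v])) x.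
    by rewrite -N1 -N2; split; split=> //=; exact: ltW.
  by rewrite -JI //; apply: hull_mono => y [|->]; [left|right; right].
have := val (bipyr Q1 u v) (bipyr Q2 u v); rewrite -EU -EI; apply; exact: bipyr_Pno.
Qed.

Lemma bipyr_diffU (V : zmodType) (nu : set 'cV[R]_n -> V) Q1 Q2 r r' : valuation nu ->
  (forall Q, equatorial g Q -> forall u (t : R), 0 < dotv g u -> 0 < t ->
     nu (bipyr Q u (- (t *: u))) = 0) ->
  equatorial g Q1 -> equatorial g Q2 -> equatorial g (Q1 `|` Q2) -> equatorial g (Q1 `&` Q2) ->
  dotv g r = 1 -> dotv g r' = 1 ->
  bipyr_diff nu (Q1 `|` Q2) r r' + bipyr_diff nu (Q1 `&` Q2) r r' = bipyr_diff nu Q1 r r' + bipyr_diff nu Q2 r r'.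
Proof.
move=> val Z b1 b2 bU bI r1 r1'.
(* A scale that fits the intersection fits all four equators, so the four differences become
   bipyramids with the same apexes. *)
have [t0 [Qt1 Qt2]] : 0 < tau (Q1 `&` Q2) (r - r') /\
    (Q1 `&` Q2) ((tau (Q1 `&` Q2) (r - r') / 2) *: (r - r')).
  by apply: tauP => //; rewrite dotvDr dotvNr r1 r1' subrr.
move: t0 Qt1 Qt2; set t := tau _ _ => t0.
have e : t * t / (t + t) = t / 2 by field; rewrite gt_eqF // addr_gt0.
rewrite -e => Qt1 Qt2.
have D Q : equatorial g Q -> Q ((t * t / (t + t)) *: (r - r')) ->
    bipyr_diff nu Q r r' = nu (bipyr Q (t *: r) (- (t *: r'))).
  by move=> bQ Qt; rewrite bipyr_diffE //; exact: Z.
rewrite !D //; last by left.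
by apply: bipyrU => //; rewrite ?cross_dir //; exact: dir_side.
Qed.

End Br.

(** * Half-space representation *)

Definition halfspaces (R : realType) n (A : seq 'cV[R]_n) : set 'cV[R]_n :=
  [set x | forall a, a \in A -> dotv a x <= 1].

Section Hrep.
Variables (R : realType) (n : nat).
Implicit Types (x y z u v w d a : 'cV[R]_n) (A : seq 'cV[R]_n) (P Q : set 'cV[R]_n).

Lemma halfspaces_convex A : is_convex (halfspaces A).
Proof.
by move=> x y s t hx hy s0 t0 st a aA; apply: convex_half1 => //; [exact: hx|exact: hy].
Qed.

Lemma poly_bounded P a : poly_set P -> exists M : R, forall x, P x -> dotv a x <= M.
Proof.
move=> [s ->]; suff [M hM] : exists M : R, forall x, x \in s -> dotv a x <= M.
  exists M => x; apply: (@hull_min _ _ _ [set x | dotv a x <= M]) => //; exact: convex_half1.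
elim: s => [|y s [M hM]]; first by exists 0.
exists (Num.max M (dotv a y)) => x; rewrite inE le_max => /orP[/eqP ->|/hM ->//].
by rewrite lexx orbT.
Qed.

Lemma dotv_eq0 x : dotv x x <= 0 -> x = 0.
Proof.
move=> h; apply/matrixP => i j; rewrite ord1 mxE; apply/eqP.
rewrite -sqrf_eq0 eq_le sqr_ge0 andbT; apply: le_trans h.
rewrite /dotv (bigD1 i) //= -expr2 lerDl.
by apply: sumr_ge0 => k _; rewrite -expr2 sqr_ge0.
Qed.

(** A nonzero such [d] would span a ray inside the bounded set [P]. *)
Lemma hset_pointed P A d : poly_set P -> halfspaces A `<=` P ->
  (forall a, a \in A -> dotv a d <= 0) -> d = 0.
Proof.
move=> pP AP hd; have [M hM] := poly_bounded d pP.
have M0 : 0 <= M.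
  have := hM 0; rewrite dotv0r; apply; apply: AP => a _; rewrite dotv0r; exact: ler01.
apply: dotv_eq0; rewrite leNgt; apply/negP => d0.
have s0 : 0 <= (M + 1) / dotv d d by apply: divr_ge0; [lra|exact: ltW].
have := hM (((M + 1) / dotv d d) *: d); rewrite dotvZr divfK ?gt_eqF // => h.
suff : M + 1 <= M by lra.
apply: h; apply: AP => a aA; rewrite dotvZr; apply: le_trans ler01.
by apply: mulr_ge0_le0 => //; exact: hd.
Qed.

Lemma ex_max0 (L : seq R) : exists t : R, [/\ 0 <= t, (forall y : R, y \in L -> y <= t) &
  t = 0 \/ t \in L].
Proof.
elim: L => [|y L [t [t0 ht tL]]]; first by exists 0; split=> //; left.
have [h|h] := leP y t.
  exists t; split=> //; last by case: tL => [|tL]; [left|right; rewrite inE tL orbT].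
  by move=> z; rewrite inE => /orP[/eqP ->|/ht].
exists y; split; first exact: le_trans t0 (ltW h).
  move=> z; rewrite inE => /orP[/eqP ->//|/ht zt]; exact: le_trans zt (ltW h).
by right; rewrite inE eqxx.
Qed.

(* Fourier-Motzkin elimination of the join parameter *)
Lemma hset_join P A v : poly_set P -> halfspaces A `<=` P ->
  exists A', hull (halfspaces A `|` [set v]) = halfspaces A'.
Proof.
move=> pP AP.
pose G := [seq a <- A | dotv a v <= 1]; pose B := [seq a <- A | 1 < dotv a v].
pose comb a a' := (dotv a' v - dotv a v)^-1 *:
  ((dotv a' v - 1) *: a + (1 - dotv a v) *: a').
have combE a a' x : dotv (comb a a') x = (dotv a' v - dotv a v)^-1 *
    ((dotv a' v - 1) * dotv a x + (1 - dotv a v) * dotv a' x).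
  by rewrite dotvZl dotvDl !dotvZl.
exists (G ++ [seq comb a a' | a <- G, a' <- B]).
have h0 : halfspaces A 0 by move=> a _; rewrite dotv0r; exact: ler01.
apply/seteqP; split.
  apply: hull_min; first exact: halfspaces_convex.
  move=> x hx c; rewrite mem_cat => /orP[|/allpairsP[[a a'] /= [aG aB ->]]].
    rewrite mem_filter => /andP[av aA]; case: hx => [/(_ _ aA)//|-> //].
  move: aG aB; rewrite !mem_filter => /andP[av aA] /andP[av' aA'].
  have p : 0 < dotv a' v - dotv a v by lra.
  rewrite combE ler_pdivrMl // mulr1; case: hx => [hx|->]; last by lra.
  have := hx _ aA; have := hx _ aA' => h1 h2.
  have : (dotv a' v - 1) * dotv a x <= (dotv a' v - 1) * 1 by apply: ler_wpM2l; lra.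
  have : (1 - dotv a v) * dotv a' x <= (1 - dotv a v) * 1 by apply: ler_wpM2l; lra.
  lra.
move=> x hx.
have hG a : a \in A -> dotv a v <= 1 -> dotv a x <= 1.
  by move=> aA av; apply: hx; rewrite mem_cat mem_filter av aA.
have hB a a' : a \in A -> a' \in A -> dotv a v <= 1 -> 1 < dotv a' v ->
    (dotv a' v - 1) * dotv a x + (1 - dotv a v) * dotv a' x <= dotv a' v - dotv a v.
  move=> aA aA' av av'.
  have /hx : comb a a' \in G ++ [seq comb a a' | a <- G, a' <- B].
    rewrite mem_cat; apply/orP; right; apply/allpairsP; exists (a, a') => /=.
    by rewrite !mem_filter av av' aA aA'.
  by rewrite combE ler_pdivrMl ?mulr1 //; lra.
(* Parameter [t] is admissible when [dotv a x - 1 <= t * (dotv a v - 1)] for all [a]; the [a] in [B]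
   bound it from below. The least value allowed by these bounds and 0 is taken, and the combined
   inequalities [hB] show that it satisfies the conditions from [G]. *)
have [t [t0 ht tL]] := ex_max0 [seq (dotv a x - 1) / (dotv a v - 1) | a <- B].
have key a : a \in A -> dotv a x - 1 <= t * (dotv a v - 1).
  move=> aA; have [av|av] := leP (dotv a v) 1; last first.
    rewrite -ler_pdivrMr ?subr_gt0 //; apply: ht; apply/mapP; exists a => //.
    by rewrite mem_filter av.
  case: tL => [->|/mapP[a1]].
    by rewrite mul0r subr_le0; apply: hG.
  rewrite mem_filter => /andP[av1 a1A] ->.
  have p : 0 < dotv a1 v - 1 by lra.
  rewrite mulrAC ler_pdivlMr //.
  have := hB _ _ aA a1A av av1; lra.
rewrite hull_U1; last 2 first.
- exact: halfspaces_convex.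
- by exists 0.
have [t1|t1|t1] := ltgtP t 1.
- exists ((1 - t)^-1 *: (x - t *: v)), t; split.
  + move=> a aA; rewrite dotvZr dotvDr dotvNr dotvZr ler_pdivrMl ?subr_gt0 // mulr1.
    by have := key _ aA; lra.
  + by rewrite t0 ltW.
  + by rewrite scalerA mulfV ?scale1r ?subrK // gt_eqF // subr_gt0.
- exfalso; have p : 0 < t - 1 by lra.
  have y0 : x - t *: v = 0.
    apply: (hset_pointed pP AP) => a aA.
    rewrite dotvDr dotvNr dotvZr; have := key _ aA; lra.
  have : x = t *: v by apply/eqP; rewrite -subr_eq0 y0.
  move=> e.
  have v0 : v = 0.
    have : - v = 0; last by move/eqP; rewrite oppr_eq0 => /eqP.
    apply: (hset_pointed pP AP) => a aA.
    by rewrite dotvNr; have := key _ aA; rewrite e dotvZr; lra.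
  have x0 : x = 0 by rewrite e v0 scaler0.
  case: tL => [|/mapP[a1]]; first by lra.
  by rewrite mem_filter => /andP[]; rewrite v0 dotv0r; lra.
- exists 0, 1; split=> //; first by rewrite ler01 lexx.
  rewrite subrr scaler0 add0r scale1r; apply/eqP; rewrite -subr_eq0; apply/eqP.
  apply: (hset_pointed pP AP) => a aA; rewrite dotvDr dotvNr.
  by have := key _ aA; rewrite t1; lra.
Qed.

(** Starts from a cube contained in [P] and joins the vertices of [P] to it one at a time;
    [hset_join] maintains the description by half-spaces. *)
Lemma Hrep P : Pno P -> exists A, P = halfspaces A.
Proof.
move=> PP; have [pP _] := iffLR (PnoE P) PP.
have [A0 A0P] : exists A, halfspaces A `<=` P.
  (* The factor [n.+1] leaves room in every dimension, 0 included: a point of the cube has squared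
     norm at most [n * d ^+ 2], which is below [e ^+ 2]. *)
  case: PP => _ [e e0 he]; pose d := e / n.+1%:R.
  have d0 : 0 < d by rewrite divr_gt0 // ltr0n.
  exists ([seq d^-1 *: delta_mx i 0 | i <- enum 'I_n] ++
          [seq (- d^-1) *: delta_mx i 0 | i <- enum 'I_n]).
  move=> x hx; apply: he.
  have hd (i : 'I_n) : x i 0 ^+ 2 <= d ^+ 2.
    have h1 : x i 0 <= d.
      have : dotv (d^-1 *: delta_mx i 0) x <= 1.
        by apply: hx; rewrite mem_cat; apply/orP; left; apply/mapP; exists i; rewrite ?mem_enum.
      by rewrite dotvZl dotv_delta ler_pdivrMl // mulr1.
    have h2 : - x i 0 <= d.
      have : dotv ((- d^-1) *: delta_mx i 0) x <= 1.
        by apply: hx; rewrite mem_cat; apply/orP; right; apply/mapP; exists i; rewrite ?mem_enum.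
      by rewrite dotvZl dotv_delta mulNr -mulrN ler_pdivrMl // mulr1.
    rewrite -[x i 0 ^+ 2]real_normK ?num_real // lerXn2r ?nnegrE ?normr_ge0 //.
      exact: ltW.
    by rewrite ler_norml lerNl h1 h2.
  have : dotv x x <= n%:R * d ^+ 2.
    rewrite mulr_natl -[X in _ *+ X]card_ord -sumr_const; apply: ler_sum => i _.
    by rewrite -expr2.
  move=> h; rewrite /enorm -[e]ger0_norm ?ltW // -sqrtr_sqr ltr_sqrt ?exprn_gt0 //.
  apply: le_lt_trans h _; have -> : e = d * n.+1%:R by rewrite /d divfK // pnatr_eq0.
  rewrite [X in _ < X]exprMn [n%:R * _]mulrC ltr_pM2l ?exprn_gt0 // -natrX ltr_nat.
  by apply: leq_trans (ltnSn n) _; rewrite expnS expn1 leq_pmulr.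
case: (pP) => s Ps.
suff [A [AP sA]] : exists A, halfspaces A `<=` P /\ forall v, v \in s -> halfspaces A v.
  exists A; apply/seteqP; split=> //; rewrite Ps; apply: hull_min => //.
  exact: halfspaces_convex.
have sP v : v \in s -> P v by rewrite Ps => vs; apply: sub_cv.
elim: (s) sP => [|v r IH] sP; first by exists A0.
have [w wr|A [AP rA]] := IH; first by apply: sP; rewrite inE wr orbT.
have [A' EA'] := hset_join v pP AP; exists A'; rewrite -EA'; split.
  apply: hull_min; first exact: poly_convex.
  by move=> x [/AP//|->]; apply: sP; rewrite inE eqxx.
move=> w; rewrite inE => /orP[/eqP ->|/rA wA]; apply: sub_cv; [by right|by left].
Qed.

End Hrep.

(** * Joins determine valuations *)

Section Dual.
Variables (R : realType) (n : nat).
Implicit Types (x y z u v w g : 'cV[R]_n) (A C X P Q : set 'cV[R]_n) (b d : 'I_n -> 'cV[R]_n).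

Definition dualb b d := forall i j, dotv (d i) (b j) = (i == j)%:R.

Lemma dual_complete b d x : dualb b d -> x = \sum_i dotv (d i) x *: b i.
Proof.
move=> bd; pose D := \matrix_(i, j) d i j 0; pose B := \matrix_(i, j) b j i 0.
have DB : D *m B = 1%:M.
  apply/matrixP => i j; rewrite !mxE -(bd i j); apply: eq_bigr => k _.
  by rewrite !mxE.
rewrite -[x in LHS]mul1mx -(mulmx1C DB) -mulmxA; apply/matrixP => i j.
rewrite ord1 summxE mxE; apply: eq_bigr => k _; rewrite !mxE mulrC; congr (_ * _).
by apply: eq_bigr => l _; rewrite !mxE.
Qed.

Lemma convex_subsum C (w : 'I_n -> R) (p : 'I_n -> 'cV[R]_n) : is_convex C -> C 0 ->
  (forall i, 0 <= w i) -> \sum_i w i <= 1 -> (forall i, C (p i)) -> C (\sum_i w i *: p i).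
Proof.
move=> Cc C0 w0 w1 Cp; have S0 : 0 <= \sum_i w i by apply: sumr_ge0.
have [e|ne] := eqVneq (\sum_i w i) 0.
  rewrite big1 // => i _; have : w i <= 0.
    by rewrite -e (bigD1 i) //= lerDl; apply: sumr_ge0.
  move=> h; have -> : w i = 0 by apply/eqP; rewrite eq_le h w0.
  by rewrite scale0r.
have -> : \sum_i w i *: p i = (\sum_i w i) *: (\sum_i (w i / \sum_j w j) *: p i).
  by rewrite scaler_sumr; apply: eq_bigr => i _; rewrite scalerA mulrC divfK.
apply: convex_scale => //; last by rewrite S0.
apply: convex_sum => //; first by move=> i; apply: divr_ge0.
by rewrite -mulr_suml divff.
Qed.

Lemma absorb_basis b d A : dualb b d -> is_convex A -> A 0 ->
  (forall i, exists2 t : R, 0 < t & A (t *: b i)) ->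
  (forall i, exists2 t : R, 0 < t & A (- (t *: b i))) -> absorbing A.
Proof.
move=> bd cA A0 h1 h2 x.
have [t t0 ht] : exists2 t : R, 0 < t & forall (i : 'I_n) s, 0 < s <= t ->
    A (s *: b i) /\ A (- (s *: b i)).
  apply: ex_small => i; have [t1 t10 a1] := h1 i; have [t2 t20 a2] := h2 i.
  exists (Num.min t1 t2); first by rewrite lt_min t10.
  move=> s /andP[s0]; rewrite le_min => /andP[s1 s2]; split.
    have -> : s *: b i = (s / t1) *: (t1 *: b i) by rewrite scalerA divfK ?gt_eqF.
    apply: convex_scale => //; rewrite ler_pdivrMr // mul1r s1 andbT.
    by apply: divr_ge0; exact: ltW.
  have -> : - (s *: b i) = (s / t2) *: - (t2 *: b i).
    by rewrite scalerN scalerA divfK ?gt_eqF.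
  apply: convex_scale => //; rewrite ler_pdivrMr // mul1r s2 andbT.
  by apply: divr_ge0; exact: ltW.
pose M := 1 + \sum_i `|dotv (d i) x|.
have M0 : 0 < M by rewrite ltr_wpDr //; apply: sumr_ge0.
exists (t / M); first exact: divr_gt0.
have -> : (t / M) *: x = \sum_i (`|dotv (d i) x| / M) *:
    ((t * Num.sg (dotv (d i) x)) *: b i).
  rewrite {1}(dual_complete x bd) scaler_sumr; apply: eq_bigr => i _.
  rewrite !scalerA; congr (_ *: _); rewrite {1}[dotv (d i) x]numEsg.
  by rewrite mulrAC [RHS]mulrAC; congr (_ / _); ring.
apply: convex_subsum => //.
- by move=> i; apply: divr_ge0 => //; exact: ltW.
- by rewrite -mulr_suml ler_pdivrMr // mul1r lerDr ler01.
move=> i; have [|] := ht i t; first by rewrite t0 lexx.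
case: sgrP => _; rewrite ?mulr0 ?scale0r ?mulr1 ?mulrN1 ?scaleNr //.
Qed.

Lemma cross_ge0 g f k z : dotv g z < 0 < dotv g k -> 0 <= dotv f k -> 0 <= dotv f z ->
  0 <= dotv f (cross g k z).
Proof.
by move=> h fk fz; apply: (cross_conv (C := [set x | 0 <= dotv f x])) => //; exact: convex_half.
Qed.

(* [kap] colours the indices; each colour class spans a simplex around 0 and the
   set is the join of these simplices. *)
Definition joinset b (kap : 'I_n -> nat) (c : 'I_n -> R) (s : nat -> R) : set 'cV[R]_n :=
  hull ([set 0] `|` [set x | exists i, x = c i *: b i] `|`
      [set x | exists i, x = - (s (kap i) *: \sum_(l | kap l == kap i) b l)]).

Definition vanish_joins (V : zmodType) (nu : set 'cV[R]_n -> V) :=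
  forall b d kap c s, dualb b d -> (forall i, 0 < c i) -> (forall k, 0 < s k) ->
    nu (joinset b kap c s) = 0.

(* The part of [P] in the cone [d_i >= 0 (i in J)], capped by points [- e_i b_i]. *)
Definition capped_cone P b d (J : pred 'I_n) (e : 'I_n -> R) : set 'cV[R]_n :=
  hull ((P `&` [set x | forall i, J i -> 0 <= dotv (d i) x]) `|`
      [set x | exists2 i, J i & x = - (e i *: b i)]).

Lemma poly_cone P d (J : pred 'I_n) : poly_set P ->
  poly_set (P `&` [set x | forall i, J i -> 0 <= dotv (d i) x]).
Proof.
move=> pP.
suff h (r : seq 'I_n) : poly_set (P `&` [set x | forall i, i \in r -> 0 <= dotv (d i) x]).
  have := h (enum J); congr poly_set; congr (_ `&` _).
  by apply/seteqP; split=> x /= hx i; [move=> Ji; apply: hx|move=> Ji; apply: hx]; rewrite mem_enum in Ji *.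
elim: r => [|i r IH].
  by rewrite (_ : [set x | _] = setT) ?setIT //; apply/seteqP; split.
have := poly_cut (d i) IH; congr poly_set; rewrite -setIA; congr (_ `&` _).
apply/seteqP; split=> x /=.
  by move=> [h1 h2] j; rewrite inE => /orP[/eqP ->|/h1].
by move=> h; split; [move=> j jr|]; apply: h; rewrite inE ?jr ?orbT ?eqxx.
Qed.

Lemma poly_closings b (J : pred 'I_n) e : poly_set (hull [set x | exists2 i, J i & x = - (e i *: b i)]).
Proof.
exists [seq - (e i *: b i) | i <- enum J]; congr hull; apply/seteqP; split=> x /=.
  by move=> [i Ji ->]; apply/mapP; exists i; rewrite ?mem_enum.
by move=> /mapP[i]; rewrite mem_enum => Ji ->; exists i.
Qed.

Lemma capped_cone_convex P d (J : pred 'I_n) : is_convex P ->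
  is_convex (P `&` [set x | forall i, J i -> 0 <= dotv (d i) x]).
Proof.
move=> cP; apply: convexsI => // x y s t hx hy s0 t0 st i Ji.
by apply: convex_half => //; [exact: hx|exact: hy].
Qed.

Lemma poly_capped_cone P b d J e : poly_set P -> poly_set (capped_cone P b d J e).
Proof.
move=> pP; rewrite /capped_cone setUC -hull_hullU; apply: poly_cvU; first exact: poly_closings.
exact: poly_cone.
Qed.

Lemma Pno_dir P x : Pno P -> exists2 t : R, 0 < t & P (t *: x).
Proof. by move=> /PnoE[_]; apply. Qed.

Lemma Pno_capped_cone P b d (J : pred 'I_n) e : Pno P -> dualb b d -> (forall i, J i -> 0 < e i) ->
  Pno (capped_cone P b d J e).
Proof.
move=> PP bd e0; apply/PnoE; split; first by apply: poly_capped_cone; case/PnoE: PP.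
apply: (absorb_basis bd); first exact: hull_convex.
- by apply: sub_cv; left; split; [exact: Pno0|move=> i _; rewrite /= dotv0r].
- move=> i; have [t t0 Pt] := Pno_dir (b i) PP; exists t => //.
  apply: sub_cv; left; split=> // j Jj; rewrite dotvZr bd mulr_ge0 ?ler0n //.
  exact: ltW.
move=> i; have [Ji|Ji] := boolP (J i).
  by exists (e i); [exact: e0|apply: sub_cv; right; exists i].
have [t t0 Pt] := Pno_dir (- b i) PP; exists t => //; rewrite -scalerN.
apply: sub_cv; left; split=> // j Jj; rewrite dotvZr dotvNr bd.
by case: eqP Jj => [->|_ _]; [rewrite (negbTE Ji)|rewrite oppr0 mulr0].
Qed.

Variables (V : zmodType) (nu : set 'cV[R]_n -> V).
Hypothesis val : valuation nu.
Hypothesis alld : forall g X u v, Pno X -> X u -> X v -> dotv g u < 0 < dotv g v ->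
  nu (hull ((X `&` [set x | dotv g x = 0]) `|` [set u; v])) = 0.

(** The caps are quantified because each cut brings in a new one; by [alld] the cuts cost no
    correction term. *)
Definition vanish_cone P b d (J : pred 'I_n) := forall e : 'I_n -> R,
  (forall l, J l -> 0 < e l /\ P (- (e l *: b l))) -> nu (capped_cone P b d J e) = 0.

Definition flipb (i : 'I_n) b l := if l == i then - b l else b l.

Lemma flip_dual b d i : dualb b d -> dualb (flipb i b) (flipb i d).
Proof.
move=> bd j l; rewrite /flipb; have [->|ji] := eqVneq j i; have [->|li] := eqVneq l i.
- by rewrite dotvNl dotvNr opprK bd eqxx.
- by rewrite dotvNl bd eq_sym (negbTE li) oppr0.
- by rewrite dotvNr bd (negbTE ji) oppr0.
- by rewrite bd.
Qed.

(** Cutting along [d i = 0] splits the cone of [J] into the cones with [b i] and with [- b i] added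
    ([flipb]); each is capped by a multiple of the opposite vector lying in [P]. *)
Lemma orth_step P b d (J : pred 'I_n) i : Pno P -> dualb b d -> ~~ J i ->
  vanish_cone P b d (fun l => J l || (l == i)) ->
  vanish_cone P (flipb i b) (flipb i d) (fun l => J l || (l == i)) -> vanish_cone P b d J.
Proof.
move=> PP bd Ji Z1 Z2 e he.
have cP := Pno_convex PP.
pose A := (P `&` [set x | forall i, J i -> 0 <= dotv (d i) x]) `|`
      [set x | exists2 i, J i & x = - (e i *: b i)].
have PX : Pno (capped_cone P b d J e) by apply: Pno_capped_cone => // l /he[].
have Jne l : J l -> l != i by move=> Jl; apply: contraNneq Ji => <-.
have [t t0 Pt] := Pno_dir (b i) PP; have [t' t'0 Pt'] := Pno_dir (- b i) PP.
rewrite scalerN in Pt'.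
have At : A (t *: b i).
  left; split=> // l Jl; rewrite dotvZr bd (negbTE (Jne _ Jl)) mulr0 //.
have At' : A (- (t' *: b i)).
  by left; split=> // l Jl; rewrite dotvNr dotvZr bd (negbTE (Jne _ Jl)) mulr0 oppr0.
have g1 : dotv (d i) (- (t' *: b i)) = - t' by rewrite dotvNr dotvZr bd eqxx mulr1.
have g2 : dotv (d i) (t *: b i) = t by rewrite dotvZr bd eqxx mulr1.
have gg : dotv (d i) (- (t' *: b i)) < 0 < dotv (d i) (t *: b i).
  by rewrite g1 g2 oppr_lt0 t0 t'0.
have clo x : (exists2 l, J l & x = - (e l *: b l)) -> dotv (d i) x = 0.
  move=> [l Jl ->]; rewrite dotvNr dotvZr bd eq_sym (negbTE (Jne _ Jl)).
  by rewrite mulr0 oppr0.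
have crosses : crossing_ok (d i) A.
  move=> k z Ak Az kz; have /andP[z0 k0] := kz.
  case: Ak => [Ak|/clo e1]; last by rewrite e1 ltxx in k0.
  case: Az => [Az|/clo e1]; last by rewrite e1 ltxx in z0.
  apply: sub_cv; split; last exact: cross0.
  by left; apply: cross_conv => //; exact: capped_cone_convex.
have Xu : capped_cone P b d J e (- (t' *: b i)) by exact: sub_cv.
have Xv : capped_cone P b d J e (t *: b i) by exact: sub_cv.
rewrite (valuation_cut val PX Xu Xv gg) (alld PX Xu Xv gg) subr0.
rewrite /capped_cone -/A hull_cut_ge // hull_cut_le // !hull_hullU.
pose e1 l := if l == i then t' else e l; pose e2 l := if l == i then t else e l.
have -> : A `&` [set x | 0 <= dotv (d i) x] `|` [set - (t' *: b i)] =
    (P `&` [set x | forall l, (J l || (l == i)) -> 0 <= dotv (d l) x]) `|`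
    [set x | exists2 l, (J l || (l == i)) & x = - (e1 l *: b l)].
  apply/seteqP; split=> x /=.
    move=> [[[[Px hx]|[l Jl ->]] x0]|->].
    - by left; split=> // l /orP[/hx|/eqP ->].
    - right; exists l; first by rewrite Jl.
      by rewrite /e1 (negbTE (Jne _ Jl)).
    - by right; exists i; rewrite /e1 eqxx ?orbT.
  move=> [[Px hx]|[l /orP[Jl|/eqP ->] ->]].
  - left; split; last by apply: hx; rewrite eqxx orbT.
    by left; split=> // l Jl; apply: hx; rewrite Jl.
  - left; rewrite /e1 (negbTE (Jne _ Jl)); split; first by right; exists l.
    by rewrite clo //; exists l.
  - by right; rewrite /e1 eqxx.
have -> : A `&` [set x | dotv (d i) x <= 0] `|` [set t *: b i] =
    (P `&` [set x | forall l, (J l || (l == i)) -> 0 <= dotv (flipb i d l) x]) `|`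
    [set x | exists2 l, (J l || (l == i)) & x = - (e2 l *: flipb i b l)].
  apply/seteqP; split=> x /=.
    move=> [[[[Px hx]|[l Jl ->]] x0]|->].
    - left; split=> // l; rewrite /flipb; have [->|li] := eqVneq l i.
        by rewrite dotvNl oppr_ge0.
      by rewrite orbF => /hx.
    - right; exists l; first by rewrite Jl.
      by rewrite /e2 /flipb (negbTE (Jne _ Jl)).
    - by right; exists i; rewrite /e2 /flipb eqxx ?orbT // scalerN opprK.
  move=> [[Px hx]|[l /orP[Jl|/eqP ->] ->]].
  - left; split; last first.
      have := hx i; rewrite eqxx orbT => /(_ isT).
      by rewrite /flipb eqxx dotvNl oppr_ge0.
    left; split=> // l Jl; have := hx l; rewrite Jl => /(_ isT).
    by rewrite /flipb (negbTE (Jne _ Jl)).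
  - left; rewrite /e2 /flipb (negbTE (Jne _ Jl)); split; first by right; exists l.
    by rewrite clo //; exists l.
  - by right; rewrite /e2 /flipb eqxx scalerN opprK.
rewrite -/(capped_cone P b d _ e1) -/(capped_cone P (flipb i b) (flipb i d) _ e2) Z1 ?Z2 ?addr0 //.
  move=> l; rewrite /e2 /flipb; case: eqP => [->|_]; last by rewrite orbF => /he.
  by move=> _; rewrite scalerN opprK.
move=> l; rewrite /e1; case: eqP => [->|_] //; by rewrite orbF => /he.
Qed.

Lemma orth_all P : Pno P -> (forall b d, dualb b d -> vanish_cone P b d predT) ->
  forall b d, dualb b d -> vanish_cone P b d pred0.
Proof.
move=> PP h b d bd.
suff H m (J : pred 'I_n) b' d' : dualb b' d' -> #|[pred l | ~~ J l]| = m -> vanish_cone P b' d' J.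
  exact: (H _ pred0 b d bd erefl).
elim: m J b' d' => [|m IH] J b' d' bd' cJ.
  move=> e he.
  have JT l : J l by move/card0_eq: cJ => /(_ l); rewrite inE => /negbT; rewrite negbK.
  have -> : capped_cone P b' d' J e = capped_cone P b' d' predT e.
    rewrite /capped_cone; congr (hull (_ `&` _ `|` _)); apply/seteqP; split=> x /=.
    - by move=> hx i _; apply: hx.
    - by move=> hx i _; apply: hx.
    - by move=> [i _ ->]; exists i.
    - by move=> [i _ ->]; exists i.
  by apply: h => // l _; apply: he.
have [i Ji] : exists i, ~~ J i.
  have /card_gt0P[i Ji] : (0 < #|[pred l | ~~ J l]|)%N by rewrite cJ.
  by exists i.
have c' : #|[pred l | ~~ (J l || (l == i))]| = m.
  apply/eqP; rewrite -eqSS -cJ (cardD1 i [pred l | ~~ J l]) inE Ji add1n eqSS.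
  by apply/eqP/eq_card => l; rewrite !inE negb_or andbC.
by apply: (orth_step PP bd' Ji); apply: IH => //; exact: flip_dual.
Qed.

(** Stellar subdivision: the generator [b j] is replaced by a point inside the edge spanned with
    [b i]; [edged] is the matching dual basis. *)
Definition edgeb i j (al be : R) b l := if l == j then al *: b i + be *: b j else b l.
Definition edged i j (al be : R) d l :=
  if l == j then be^-1 *: d j else if l == i then d i - (al / be) *: d j else d l.

Lemma edge_dual i j al be b d : i != j -> 0 < be -> dualb b d ->
  dualb (edgeb i j al be b) (edged i j al be d).
Proof.
move=> ij be0 bd k l; rewrite /edgeb /edged.
have be1 : be != 0 by rewrite gt_eqF.
have ji : (j == i) = false by rewrite eq_sym; exact: negbTE.
have [->|lj] := eqVneq l j.
  have [_|kj] := eqVneq k j.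
    by rewrite dotvZl dotvDr !dotvZr !bd eqxx ji mulr0 add0r mulr1 mulVf.
  have [_|ki] := eqVneq k i.
    rewrite dotvDl dotvNl dotvZl !dotvDr !dotvZr !bd !eqxx ji (negbTE ij).
    by rewrite !(mulr1, mulr0, addr0, add0r) divfK // subrr.
  by rewrite dotvDr !dotvZr !bd (negbTE ki) (negbTE kj) !mulr0 addr0.
have [->|kj] := eqVneq k j.
  by rewrite dotvZl bd eq_sym (negbTE lj) mulr0.
have [->|ki] := eqVneq k i.
  by rewrite dotvDl dotvNl dotvZl !bd [j == l]eq_sym (negbTE lj) mulr0 subr0.
by rewrite bd.
Qed.

Definition capped_half_cone i j (al be : R) P b d (e : 'I_n -> R) :=
  (P `&` [set x | forall l, 0 <= dotv (d l) x] `&`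
     [set x | 0 <= dotv (be *: d i - al *: d j) x]) `|`
  [set x | exists l, x = - (e l *: b l)].

(** The half still carries the cap on [- b j] instead of one on the new ray. Cutting along
    [d1 j = 0] repairs this: [z] is the only generator strictly below, so the lower part is a
    bipyramid over the section with apexes [z] and [t *: b1 j], which [alld] kills, and the upper
    part is the capped cone of the subdivided basis. *)
Lemma edge_half i j al be P b d e : Pno P -> dualb b d -> i != j -> 0 < al -> 0 < be ->
  (forall l, 0 < e l /\ P (- (e l *: b l))) ->
  vanish_cone P (edgeb i j al be b) (edged i j al be d) predT ->
  nu (hull (capped_half_cone i j al be P b d e)) = 0.
Proof.
move=> PP bd ij al0 be0 he Z; have cP := Pno_convex PP.
have bd1 := edge_dual al ij be0 bd.
set b1 := edgeb _ _ _ _ _ in Z bd1; set d1 := edged _ _ _ _ _ in Z bd1.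
set A := capped_half_cone i j al be P b d e.
have ji : (j == i) = false by rewrite eq_sym; exact: negbTE.
have w1 : b1 j = al *: b i + be *: b j by rewrite /b1 /edgeb eqxx.
have b1l l : l != j -> b1 l = b l by rewrite /b1 /edgeb => /negbTE ->.
have gj x : dotv (d1 j) x = be^-1 * dotv (d j) x by rewrite /d1 /edged eqxx dotvZl.
have d1i x : dotv (d1 i) x = be^-1 * dotv (be *: d i - al *: d j) x.
  rewrite /d1 /edged (negbTE ij) eqxx !(dotvDl, dotvNl, dotvZl) mulrBr mulrA mulVf ?gt_eqF //.
  by rewrite mul1r; congr (_ - _); rewrite mulrA [be^-1 * _]mulrC.
have d1l l : l != i -> l != j -> d1 l = d l.
  by rewrite /d1 /edged => /negbTE -> /negbTE ->.
have bi0 : 0 < be^-1 by rewrite invr_gt0.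
have C1E x : (forall l, 0 <= dotv (d1 l) x) <->
    (forall l, 0 <= dotv (d l) x) /\ 0 <= dotv (be *: d i - al *: d j) x.
  split=> [h|[h1 h2] l].
    have hj : 0 <= dotv (d j) x by have := h j; rewrite gj pmulr_rge0.
    have hg : 0 <= dotv (be *: d i - al *: d j) x by have := h i; rewrite d1i pmulr_rge0.
    split=> // l; have [->//|lj] := eqVneq l j; have [->|li] := eqVneq l i.
      move: hg; rewrite dotvDl dotvNl !dotvZl subr_ge0 => hg.
      by rewrite -(pmulr_rge0 _ be0); apply: le_trans hg; rewrite pmulr_rge0.
    by have := h l; rewrite d1l.
  have [->|lj] := eqVneq l j; first by rewrite gj pmulr_rge0.
  by have [->|li] := eqVneq l i; [rewrite d1i pmulr_rge0|rewrite d1l].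
have clo l : dotv (d1 j) (- (e l *: b l)) = - (e l * (be^-1 * (j == l)%:R)).
  by rewrite dotvNr dotvZr gj bd.
have clol l : l != j -> dotv (d1 j) (- (e l *: b l)) = 0.
  by rewrite clo eq_sym => /negbTE ->; rewrite !mulr0 oppr0.
have cloj : dotv (d1 j) (- (e j *: b j)) < 0.
  by rewrite clo eqxx mulr1 oppr_lt0 mulr_gt0 //; case: (he j).
have Age x : (forall l, 0 <= dotv (d l) x) -> 0 <= dotv (d1 j) x.
  by move=> h; rewrite gj pmulr_rge0.
pose z := - (e j *: b j).
have Az : A z by right; exists j.
have crosses : crossing_ok (d1 j) A.
  move=> k y Ak Ay ky; have /andP[y0 k0] := ky.
  have ey : y = z.
    case: Ay => [[[_ /Age]]|[l e1]]; first by rewrite leNgt y0.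
    by rewrite e1 /z; have [-> //|lj] := eqVneq l j; rewrite e1 clol // ltxx in y0.
  case: Ak => [[[Pk Ck] /= gk]|[l e1]]; last first.
    rewrite e1 in k0; have [lj|lj] := eqVneq l j.
      by rewrite lj ltNge (ltW cloj) in k0.
    by rewrite clol // ltxx in k0.
  have Py : P y by rewrite ey; case: (he j).
  apply: sub_cv; split; last exact: cross0.
  left; split; last first.
    apply: cross_ge0 => //; rewrite ey dotvNr dotvZr dotvDl dotvNl !dotvZl !bd (negbTE ij) eqxx.
    by rewrite mulr0 mulr1 sub0r mulrN opprK mulr_ge0 ?ltW //; case: (he j).
  split; first exact: cross_conv.
  move=> l; have [->|lj] := eqVneq l j.
    have /eqP := cross0 ky; rewrite gj mulf_eq0 gt_eqF //= => /eqP -> //.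
  apply: cross_ge0 => //; rewrite ey dotvNr dotvZr bd (negbTE lj) mulr0 oppr0 //.
have A0 : A 0.
  by left; split; [split; [exact: Pno0|move=> l; rewrite dotv0r]|rewrite /= dotv0r].
have [ei0 Pei] := he i; have [ej0 Pej] := he j.
(* Chosen so that [- (s *: b1 j)] lies on the segment between the caps [- (e i *: b i)] and
   [- (e j *: b j)]. *)
pose s := e i * e j / (al * e j + be * e i).
have D0 : 0 < al * e j + be * e i by rewrite addr_gt0 // mulr_gt0.
have s0 : 0 < s by rewrite divr_gt0 // mulr_gt0.
have sw : - (s *: b1 j) = (al * e j + be * e i)^-1 *:
    ((al * e j) *: - (e i *: b i) + (be * e i) *: - (e j *: b j)).
  rewrite w1; apply/matrixP => p q; rewrite !mxE /s; field; by rewrite gt_eqF.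
have Asw : hull A (- (s *: b1 j)).
  rewrite sw; apply: convex_wsum => //; first exact: hull_convex.
  - by apply: sub_cv; right; exists i.
  - by apply: sub_cv; right; exists j.
  - by rewrite mulr_ge0 // ltW.
  - by rewrite mulr_ge0 // ltW.
have dirA x : (forall l, 0 <= dotv (d1 l) x) -> exists2 t : R, 0 < t & A (t *: x).
  move=> /C1E[h1 h2]; have [t t0 Pt] := Pno_dir x PP; exists t => //.
  by left; split; [split=> // l|]; rewrite /= dotvZr pmulr_rge0.
have PT : Pno (hull A).
  apply/PnoE; split.
    rewrite /A /capped_half_cone setUC -hull_hullU; apply: poly_cvU.
      have := poly_closings b predT e; congr (poly_set (hull _)).
      by apply/seteqP; split=> x /= [l]; [move=> _ ->|move=> ->]; exists l.
    apply: poly_cut; have [pP _] := iffLR (PnoE P) PP.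
    have := @poly_cone P d predT pP; congr poly_set; congr (_ `&` _).
    by apply/seteqP; split=> x /= h l; [apply: h|move=> _; apply: h].
  apply: (absorb_basis bd1); first exact: hull_convex.
  - exact: sub_cv.
  - move=> l; have [|t t0 At] := @dirA (b1 l); last by exists t => //; exact: sub_cv.
    by move=> k; rewrite bd1 ler0n.
  - move=> l; have [->|lj] := eqVneq l j; first by exists s.
    exists (e l); first by case: (he l).
    by apply: sub_cv; right; exists l; rewrite b1l.
have [t t0 At] : exists2 t : R, 0 < t & A (t *: b1 j).
  by apply: dirA => k; rewrite bd1 ler0n.
have gu : dotv (d1 j) (- (s *: b1 j)) < 0 < dotv (d1 j) (t *: b1 j).
  by rewrite dotvNr !dotvZr bd1 eqxx !mulr1 oppr_lt0 s0.
have gu' : dotv (d1 j) z < 0 < dotv (d1 j) (t *: b1 j).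
  by rewrite cloj dotvZr bd1 eqxx mulr1.
have Xv : hull A (t *: b1 j) by exact: sub_cv.
rewrite (valuation_cut val PT Asw Xv gu) (alld PT Asw Xv gu) subr0.
have -> : hull (hull A `&` [set x | dotv (d1 j) x <= 0] `|` [set t *: b1 j]) =
    hull (hull A `&` [set x | dotv (d1 j) x = 0] `|` [set z; t *: b1 j]).
  rewrite hull_cut_le // hull_cut_eq // !hull_hullU; congr hull; apply/seteqP; split=> x /=.
    move=> [[[[[Px Cx] gx]|[l ->]] x0]|->]; last by right; right.
      left; split; first by left.
      by apply/eqP; rewrite eq_le x0 Age.
    have [->|lj] := eqVneq l j; first by right; left.
    by left; split; [right; exists l|exact: clol].
  move=> [[Ax x0]|[->|->]]; [left|left|by right]; split=> //; first by rewrite x0.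
  exact: ltW cloj.
rewrite (alld PT _ Xv gu') ?addr0; last exact: sub_cv.
rewrite hull_cut_ge // hull_hullU.
pose e1 l := if l == j then s else e l.
have -> : hull (A `&` [set x | 0 <= dotv (d1 j) x] `|` [set - (s *: b1 j)]) =
    capped_cone P b1 d1 predT e1.
  congr hull; apply/seteqP; split=> x /=.
    move=> [[[[[Px Cx] gx]|[l ->]] x0]|->].
    - by left; split=> // l _; exact: (iffRL (C1E x) (conj Cx gx) l).
    - have [lj|lj] := eqVneq l j; first by rewrite lj leNgt cloj in x0.
      by right; exists l => //; rewrite /e1 (negbTE lj) b1l.
    - by right; exists j => //; rewrite /e1 eqxx.
  move=> [[Px h]|[l _ ->]].
    have [h1 h2] := iffLR (C1E x) (fun l => h l isT).
    by left; split; [left|exact: Age].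
  rewrite /e1; have [->|lj] := eqVneq l j; first by right.
  by left; rewrite b1l //; split; [right; exists l|rewrite clol].
apply: Z => l _; rewrite /e1; have [->|lj] := eqVneq l j; last by rewrite b1l.
split=> //; rewrite sw; apply: convex_wsum => //; by rewrite mulr_ge0 // ltW.
Qed.

(** Only the crossing point of the two caps of [i] and [j] has to be adjoined. On [g = 0] the
    coordinates [d i] and [d j] are positively proportional, so a segment from a point of the cone
    to one of these caps crosses inside the cone. *)
Lemma edge_plus i j al be P b d e : Pno P -> dualb b d -> i != j -> 0 < al -> 0 < be ->
  (forall l, 0 < e l /\ P (- (e l *: b l))) ->
  hull ((capped_cone P b d predT e `&` [set x | 0 <= dotv (be *: d i - al *: d j) x]) `|`
      [set - (e i *: b i)]) = hull (capped_half_cone i j al be P b d e).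
Proof.
move=> PP bd ij al0 be0 he; have cP := Pno_convex PP.
set g := be *: d i - al *: d j.
have ji : (j == i) = false by rewrite eq_sym; exact: negbTE.
have gb l : dotv g (b l) = be * (i == l)%:R - al * (j == l)%:R.
  by rewrite dotvDl dotvNl !dotvZl !bd.
pose u := - (e i *: b i); pose v := - (e j *: b j).
have [ei0 Pei] := he i; have [ej0 Pej] := he j.
have gu : dotv g u < 0.
  by rewrite dotvNr dotvZr gb eqxx ji mulr0 subr0 mulr1 oppr_lt0 mulr_gt0.
have gv : 0 < dotv g v.
  by rewrite dotvNr dotvZr gb eqxx (negbTE ij) mulr0 sub0r mulr1 mulrN opprK mulr_gt0.
pose C := [set x | forall l : 'I_n, true -> 0 <= dotv (d l) x].
pose A := (P `&` C) `|` [set x | exists2 l : 'I_n, true & x = - (e l *: b l)].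
pose A' := A `|` [set cross g v u].
have uv : dotv g u < 0 < dotv g v by rewrite gu gv.
have cAu : hull A u by apply: sub_cv; right; exists i.
have cAv : hull A v by apply: sub_cv; right; exists j.
have EA : capped_cone P b d predT e = hull A'.
  apply: hull_eq => x; first by move=> Ax; apply: sub_cv; left.
  by move=> [Ax|->]; [exact: sub_cv|apply: cross_conv => //; exact: hull_convex].
have clo x : (exists2 l : 'I_n, true & x = - (e l *: b l)) ->
    [\/ x = u, x = v | dotv g x = 0].
  move=> [l _ ->]; have [->|li] := eqVneq l i; first by constructor 1.
  have [->|lj] := eqVneq l j; first by constructor 2.
  constructor 3; rewrite dotvNr dotvZr gb eq_sym (negbTE li) [j == l]eq_sym (negbTE lj).
  by rewrite !mulr0 subrr mulr0 oppr0.
have cC : is_convex (P `&` C) by exact: capped_cone_convex.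
have dl l k (c : R) : l != k -> dotv (d l) (- (c *: b k)) = 0.
  by move=> lk; rewrite dotvNr dotvZr bd (negbTE lk) mulr0 oppr0.
have crosses : crossing_ok g A'.
  move=> k y Ak Ay ky; have /andP[y0 k0] := ky.
  have cg0 := cross0 ky.
  have cgij : be * dotv (d i) (cross g k y) = al * dotv (d j) (cross g k y).
    by move/eqP: cg0; rewrite dotvDl dotvNl !dotvZl subr_eq0 => /eqP.
  have cuv0 := cross0 uv.
  have Ay' : (P `&` C) y \/ y = u.
    case: Ay => [[|/clo[]]|] e1; [by left|by right| | |].
    - by move: y0; rewrite e1 ltNge (ltW gv).
    - by rewrite e1 ltxx in y0.
    - by rewrite e1 cuv0 ltxx in y0.
  have Ak' : (P `&` C) k \/ k = v.
    case: Ak => [[|/clo[]]|] e1; [by left| |by right| |].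
    - by move: k0; rewrite e1 ltNge (ltW gu).
    - by rewrite e1 ltxx in k0.
    - by rewrite e1 cuv0 ltxx in k0.
  apply: sub_cv; split=> //.
  case: Ak' => [[Pk Ck]|ek]; case: Ay' => [[Py Cy]|ey].
  - by left; left; apply: cross_conv.
  - left; left; split; first by apply: cross_conv => //; rewrite ey.
    have hl l : l != i -> 0 <= dotv (d l) (cross g k y).
      by move=> li; apply: cross_ge0 => //; [exact: Ck|rewrite ey dl].
    move=> l _; have [->|/hl//] := eqVneq l i.
    by rewrite -(pmulr_rge0 _ be0) cgij pmulr_rge0 // hl // ji.
  - left; left; split; first by apply: cross_conv => //; rewrite ek.
    have hl l : l != j -> 0 <= dotv (d l) (cross g k y).
      by move=> lj; apply: cross_ge0 => //; [rewrite ek dl|exact: Cy].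
    move=> l _; have [->|/hl//] := eqVneq l j.
    by rewrite -(pmulr_rge0 _ al0) -cgij pmulr_rge0 // hl.
  - by right; rewrite ek ey.
rewrite EA hull_cut_ge // hull_hullU; apply: hull_eq => x.
  move=> [[[[[Px Cx]|[l _ ->]]|->] x0]|->].
  - by apply: sub_cv; left; split=> //; split=> // l; apply: Cx.
  - by apply: sub_cv; right; exists l.
  - apply: cross_conv => //; [exact: hull_convex| |].
      by apply: sub_cv; right; exists j.
    by apply: sub_cv; right; exists i.
  - by apply: sub_cv; right; exists i.
move=> [[[Px Cx] gx]|[l ->]]; apply: sub_cv.
  by left; split=> //; left; left; split=> // l _; apply: Cx.
have [/= -> |e1|e1] := clo (- (e l *: b l)) (ex_intro2 _ _ l isT erefl).
- by right.
- by left; split; [left; right; exists l|rewrite /= e1 ltW].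
- by left; split; [left; right; exists l|rewrite /= e1].
Qed.

Lemma edge_split i j al be P b d : Pno P -> dualb b d -> i != j -> 0 < al -> 0 < be ->
  vanish_cone P (edgeb i j al be b) (edged i j al be d) predT ->
  vanish_cone P (edgeb j i be al b) (edged j i be al d) predT -> vanish_cone P b d predT.
Proof.
move=> PP bd ij al0 be0 Z1 Z2 e he0.
have he l : 0 < e l /\ P (- (e l *: b l)) by apply: he0.
have PX : Pno (capped_cone P b d predT e) by apply: Pno_capped_cone => // l _; case: (he l).
set g := be *: d i - al *: d j.
have ji : (j == i) = false by rewrite eq_sym; exact: negbTE.
have gb l : dotv g (b l) = be * (i == l)%:R - al * (j == l)%:R.
  by rewrite dotvDl dotvNl !dotvZl !bd.
have [ei0 Pei] := he i; have [ej0 Pej] := he j.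
have uv : dotv g (- (e i *: b i)) < 0 < dotv g (- (e j *: b j)).
  rewrite !dotvNr !dotvZr !gb !eqxx ji (negbTE ij) !(mulr0, mulr1) subr0 sub0r.
  by rewrite mulrN opprK oppr_lt0 !mulr_gt0.
have Xu : capped_cone P b d predT e (- (e i *: b i)) by apply: sub_cv; right; exists i.
have Xv : capped_cone P b d predT e (- (e j *: b j)) by apply: sub_cv; right; exists j.
rewrite (valuation_cut val PX Xu Xv uv) (alld PX Xu Xv uv) subr0.
rewrite edge_plus // edge_half // add0r.
rewrite -half_oppr /g opprB edge_plus //; last by rewrite eq_sym.
by rewrite edge_half // eq_sym.
Qed.

Definition one_signed (f : 'cV[R]_n) b :=
  (forall l, 0 <= dotv f (b l)) \/ (forall l, dotv f (b l) <= 0).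

Lemma edge_good f i j al be b : 0 < al -> 0 < be -> one_signed f b -> one_signed f (edgeb i j al be b).
Proof.
move=> al0 be0 [h|h]; [left|right] => l; rewrite /edgeb; case: eqP => // _.
  by rewrite dotvDr !dotvZr addr_ge0 // pmulr_rge0.
by rewrite dotvDr !dotvZr -oppr_ge0 opprD -!mulrN addr_ge0 // pmulr_rge0 // oppr_ge0.
Qed.

(** A functional of mixed signs is positive at some [b i] and negative at some [b j]; the edge is
    subdivided at its zero. In both halves one nonzero value becomes 0, which is what the induction
    counts, and the functionals treated before stay one-signed ([edge_good]). *)
Lemma refine P (F : seq 'cV[R]_n) : Pno P ->
  (forall b d, dualb b d -> (forall f, f \in F -> one_signed f b) -> vanish_cone P b d predT) ->
  forall b d, dualb b d -> vanish_cone P b d predT.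
Proof.
move=> PP; elim: F => [|f F IH] h b d bd; first by apply: h.
apply: IH bd => {}b {}d bd gF.
have [m] := ubnP #|[pred l | dotv f (b l) != 0]|.
elim: m b d bd gF => // m IH b d bd gF cm.
have [gf|ngf] := pselect (one_signed f b).
  by apply: h => // f'; rewrite inE => /orP[/eqP ->|/gF].
have [i fi] : exists i, 0 < dotv f (b i).
  apply: contra_notP ngf => hn; right => l; rewrite leNgt; apply/negP => hl.
  by apply: hn; exists l.
have [j fj] : exists j, dotv f (b j) < 0.
  apply: contra_notP ngf => hn; left => l; rewrite leNgt; apply/negP => hl.
  by apply: hn; exists l.
have ij : i != j by apply/eqP => e; rewrite e ltNge (ltW fj) in fi.
have al0 : 0 < - dotv f (b j) by rewrite oppr_gt0.
have cnt k p q (al be : R) : dotv f (b q) != 0 -> dotv f (al *: b p + be *: b q) = 0 ->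
    (#|[pred l | dotv f (b l) != 0%R]| < k.+1)%N ->
    (#|[pred l | dotv f (edgeb p q al be b l) != 0%R]| < k)%N.
  move=> fq e; rewrite ltnS => hk; apply: leq_trans hk; apply: proper_card.
  apply/properP; split.
    by apply/fintype.subsetP => l; rewrite !inE /edgeb; have [_|] := eqVneq l q; rewrite // e eqxx.
  by exists q; rewrite !inE // /edgeb eqxx e eqxx.
apply: (edge_split PP bd ij al0 fi).
  apply: IH; first exact: edge_dual.
    by move=> f' /gF; exact: edge_good.
  apply: cnt cm; first by rewrite lt_eqF.
  by rewrite dotvDr !dotvZr mulrC mulrN addNr.
apply: IH; first by apply: edge_dual; rewrite // eq_sym.
  by move=> f' /gF; exact: edge_good.
apply: cnt cm; first by rewrite gt_eqF.
by rewrite dotvDr !dotvZr mulrC mulNr subrr.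
Qed.

(** When the differences of the defining functionals have constant sign on a cone, one functional
    dominates there, and it alone cuts the polytope out of the cone, leaving a simplex. *)
Lemma good_max (A : seq 'cV[R]_n) b :
  (forall a a', a \in A -> a' \in A -> one_signed (a - a') b) ->
  exists m, (m \in A \/ A = [::] /\ m = 0) /\
    forall a, a \in A -> forall l, dotv a (b l) <= dotv m (b l).
Proof.
elim: A => [|a A IH] h; first by exists 0; split; [right|].
have [|m [hm mA]] := IH; first by move=> x y xA yA; apply: h; rewrite inE ?xA ?yA orbT.
case: hm => [hm|[A0 _]]; last first.
  exists a; split; first by left; rewrite inE eqxx.
  by move=> c; rewrite A0 inE => /eqP ->.
have [ha|ha] : one_signed (a - m) b by apply: h; rewrite inE ?hm ?eqxx ?orbT.
  have ha' l : dotv m (b l) <= dotv a (b l).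
    by have := ha l; rewrite dotvDl dotvNl subr_ge0.
  exists a; split; first by left; rewrite inE eqxx.
  by move=> c; rewrite inE => /orP[/eqP ->//|/mA cm l]; exact: le_trans (cm l) (ha' l).
exists m; split; first by left; rewrite inE hm orbT.
move=> c; rewrite inE => /orP[/eqP -> l|/mA//].
by have := ha l; rewrite dotvDl dotvNl subr_le0.
Qed.

Lemma vanish_all P : vanish_joins nu -> Pno P -> nu P = 0.
Proof.
move=> van PP; have [A PA] := Hrep PP; have pP : poly_set P by case/PnoE: PP.
have bd0 : dualb (fun i : 'I_n => delta_mx i 0) (fun i => delta_mx i 0 : 'cV[R]_n).
  by move=> i j; rewrite dotv_delta mxE eqxx andbT.
have := @orth_all P PP _ _ _ bd0 (fun=> 1) _.
have -> : capped_cone P (fun i => delta_mx i 0) (fun i => delta_mx i 0) pred0 (fun=> 1) = P.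
  rewrite /capped_cone -[RHS]hull_id; last exact: poly_convex.
  by congr hull; apply/seteqP; split=> x /=; [move=> [[]//|[]//]|move=> Px; left; split].
apply=> //; apply: (@refine P [seq a - a' | a <- A, a' <- A]) => // b d bd gA e he0.
have he l : 0 < e l /\ P (- (e l *: b l)) by apply: he0.
have [|m [hm mA]] := @good_max A b.
  by move=> a a' aA a'A; apply: gA; apply/allpairsP; exists (a, a').
(* Otherwise [b l] would be a direction of recession of the bounded set [P]. *)
have c0 l : 0 < dotv m (b l).
  rewrite ltNge; apply/negP => ml.
  have b0 : b l = 0.
    by apply: (@hset_pointed _ _ P A) => // [|a aA]; [rewrite PA|exact: le_trans (mA _ aA l) ml].
  by have := bd l l; rewrite b0 dotv0r eqxx => /esym/eqP; rewrite oner_eq0.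
have PC x : (forall l, 0 <= dotv (d l) x) -> P x <-> dotv m x <= 1.
  move=> Cx; have ex a : dotv a x = \sum_l dotv (d l) x * dotv a (b l).
    by rewrite {1}(dual_complete x bd) dotv_sumr; apply: eq_bigr => l _; rewrite dotvZr.
  split.
    rewrite PA => Px; case: hm => [/Px//|[_ ->]]; by rewrite dotv0l.
  move=> mx; rewrite PA => a aA; apply: le_trans mx; rewrite !ex; apply: ler_sum => l _.
  by apply: ler_wpM2l => //; exact: mA.
(* One colour per index, so every block is a segment; the value 1 at numbers that are no index only
   keeps [s] positive. *)
pose s k := if insub k is Some i then e i else 1.
have s1 (i : 'I_n) : s i = e i by rewrite /s valK.
have -> : capped_cone P b d predT e = joinset b (@nat_of_ord n) (fun l => (dotv m (b l))^-1) s.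
  have sumb (i : 'I_n) : \sum_(l | nat_of_ord l == i) b l = b i by rewrite (big_pred1 i).
  apply: hull_eq => x.
    move=> [[Px Cx]|[l _ ->]]; last by apply: sub_cv; right; exists l; rewrite s1 sumb.
    have Cx' l : 0 <= dotv (d l) x by apply: Cx.
    rewrite (dual_complete x bd).
    have -> : \sum_l dotv (d l) x *: b l =
        \sum_l (dotv (d l) x * dotv m (b l)) *: ((dotv m (b l))^-1 *: b l).
      by apply: eq_bigr => l _; rewrite scalerA mulfK // gt_eqF.
    apply: convex_subsum; first exact: hull_convex.
    - by apply: sub_cv; left; left.
    - by move=> l; rewrite mulr_ge0 // ltW.
    - have /(PC _ Cx') := Px; rewrite {1}(dual_complete x bd) dotv_sumr.
      by under eq_bigr do rewrite dotvZr.
    - by move=> l; apply: sub_cv; left; right; exists l.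
  move=> [[->|[l ->]]|[l ->]]; apply: sub_cv.
  - by left; split; [exact: Pno0|move=> l _; rewrite dotv0r].
  - left; have C' k : 0 <= dotv (d k) ((dotv m (b l))^-1 *: b l).
      by rewrite dotvZr bd mulr_ge0 ?ler0n // invr_ge0 ltW.
    split; last by move=> k _; exact: C'.
    by apply/(PC _ C'); rewrite dotvZr mulVf // gt_eqF.
  - by right; exists l; rewrite // s1 sumb.
apply: (van _ d) => // [l|k]; first by rewrite invr_gt0.
by rewrite /s; case: insubP => // i _ _; case: (he i).
Qed.

End Dual.

Lemma det_rank1 (R : realType) n (u v : 'cV[R]_n) :
  \det (1%:M + u *m v^T) = 1 + dotv v u.
Proof.
pose L := block_mx 1%:M 0 v^T (1%:M : 'M[R]_1).
pose M := block_mx (1%:M + u *m v^T) u 0 (1%:M : 'M[R]_1).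
pose N := block_mx 1%:M 0 (- v^T) (1%:M : 'M[R]_1).
have E : L *m M *m N = block_mx 1%:M u 0 (1%:M + v^T *m u).
  rewrite /L /M /N !mulmx_block !(mul1mx, mul0mx, mulmx1, mulmx0, addr0, add0r).
  congr block_mx; first by rewrite mulmxN addrK.
    by rewrite mulmxDr mulmx1 mulmxN mulmxDl mul1mx mulmxA [X in _ - X]addrC subrr.
  by rewrite addrC.
have : \det (L *m M *m N) = \det (1%:M + v^T *m u).
  by rewrite E det_ublock det1 mul1r.
rewrite !det_mulmx /L /N !det_lblock /M det_ublock !det1 !(mul1r, mulr1) => ->.
rewrite det_mx11 !mxE /=; congr (_ + _).
by apply: eq_bigr => i _; rewrite mxE.
Qed.

Section Img.
Variables (R : realType).

Lemma hull_img m n (M : 'M[R]_(m, n)) (A : set 'cV[R]_n) :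
  hull (mulmx M @` A) = mulmx M @` hull A.
Proof.
apply/seteqP; split.
  apply: hull_min; last by move=> x [y Ay <-]; exists y => //; exact: sub_cv.
  move=> x y a b [x' Ax <-] [y' Ay <-] a0 b0 ab; exists (a *: x' + b *: y').
    exact: hull_convex.
  by rewrite mulmxDr -!scalemxAr.
move=> x [y Ay <-].
suff : hull A `<=` [set y | hull (mulmx M @` A) (M *m y)] by apply.
apply: hull_min; last by move=> z Az; apply: sub_cv; exists z.
move=> z z' a b /= hz hz' a0 b0 ab; rewrite mulmxDr -!scalemxAr.
exact: hull_convex.
Qed.

Lemma poly_img m n (M : 'M[R]_(m, n)) (A : set 'cV[R]_n) :
  poly_set A -> poly_set (mulmx M @` A).
Proof.
move=> [s ->]; exists [seq M *m x | x <- s]; rewrite -hull_img; congr hull.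
apply/seteqP; split=> x /=; first by move=> [y ys <-]; exact: map_f.
by move=> /mapP[y ys ->]; exists y.
Qed.

Variable n : nat.
Implicit Types (M : 'M[R]_n) (P X : set 'cV[R]_n).

Lemma Pno_img M P : M \in unitmx -> Pno P -> Pno (mulmx M @` P).
Proof.
move=> uM /PnoE[pP aP]; apply/PnoE; split; first exact: poly_img.
move=> x; have [t t0 Pt] := aP (invmx M *m x); exists t => //.
by exists (t *: (invmx M *m x)) => //; rewrite -scalemxAr mulKVmx.
Qed.

Lemma mulmx_inj M : M \in unitmx -> injective (mulmx M : 'cV[R]_n -> 'cV[R]_n).
Proof. by move=> uM; apply: can_inj (mulKmx uM). Qed.

Lemma image_setI_inj (T U : Type) (f : T -> U) (A B : set T) : injective f ->
  f @` (A `&` B) = f @` A `&` f @` B.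
Proof.
move=> fi; apply/seteqP; split=> x.
  by move=> [y [Ay By] <-]; split; exists y.
by move=> [[y Ay <-] [z Bz /fi e]]; exists y => //; split=> //; rewrite -e.
Qed.

Lemma valuation_img (V : zmodType) (nu : set 'cV[R]_n -> V) M : M \in unitmx ->
  valuation nu -> valuation (fun P => nu (mulmx M @` P)).
Proof.
move=> uM val K L PK PL PU PI; rewrite image_setU image_setI_inj; last exact: mulmx_inj.
apply: val; try exact: Pno_img.
  by rewrite -image_setU; exact: Pno_img.
by rewrite -image_setI_inj; [exact: Pno_img|exact: mulmx_inj].
Qed.

Lemma dual_img M (b d : 'I_n -> 'cV[R]_n) : M \in unitmx -> dualb b d ->
  dualb (fun i => M *m b i) (fun i => (invmx M)^T *m d i).
Proof. by move=> uM bd i j; rewrite -dotv_mulmx mulKmx. Qed.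

Lemma joinset_img M b kap c s :
  mulmx M @` joinset b kap c s = joinset (fun i => M *m b i) kap c s.
Proof.
rewrite /joinset -hull_img; congr hull; rewrite !image_setU; congr (_ `|` _ `|` _).
- by rewrite image_set1 mulmx0.
- apply/seteqP; split=> x; first by move=> [y [i ->] <-]; exists i; rewrite -scalemxAr.
  by move=> [i ->]; exists (c i *: b i); [exists i|rewrite -scalemxAr].
- apply/seteqP; split=> x.
    by move=> [y [i ->] <-]; exists i; rewrite mulmxN -scalemxAr mulmx_sumr.
  move=> [i ->]; exists (- (s (kap i) *: \sum_(l | kap l == kap i) b l)); first by exists i.
  by rewrite mulmxN -scalemxAr mulmx_sumr.
Qed.

Lemma vanish_joins_img (V : zmodType) (nu : set 'cV[R]_n -> V) M : M \in unitmx ->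
  vanish_joins nu -> vanish_joins (fun P => nu (mulmx M @` P)).
Proof.
move=> uM van b d kap c s bd c0 s0; rewrite joinset_img.
exact: (van _ _ kap c s (dual_img uM bd)).
Qed.

Lemma imgK M P : M \in unitmx -> mulmx M @` (mulmx (invmx M) @` P) = P.
Proof.
move=> uM; apply/seteqP; split=> x; first by move=> [y [z Pz <-] <-]; rewrite mulKVmx.
by move=> Px; exists (invmx M *m x); [exists x|rewrite mulKVmx].
Qed.

End Img.

Lemma ex_functional (R : realType) n (g : 'cV[R]_n.+1) : g != 0 ->
  exists2 A : 'M[R]_n.+1, A \in unitmx & forall x, dotv (delta_mx ord0 0) (A *m x) = dotv g x.
Proof.
move=> g0; have [i gi] : exists i, g i 0 != 0.
  apply: contra_neqP g0 => h; apply/matrixP => i j; rewrite ord1 mxE.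
  by apply: contra_notP h => /eqP; exists i.
(* The identity with row [i] replaced by [g], of determinant [g i 0]; the transposition then moves
   this row to the top. *)
pose A0 := 1%:M + delta_mx i 0 *m (g - delta_mx i 0)^T.
exists (tperm_mx ord0 i *m A0).
  rewrite unitmx_mul unitmx_perm unitmxE det_rank1 dotvDl dotvNl.
  by rewrite [dotv g _]dotvC !dotv_delta mxE !eqxx addrC subrK unitfE.
move=> x; rewrite dotv_delta -mulmxA -row_permE mxE tpermL.
rewrite /A0 mulmxDl mul1mx -mulmxA mxE.
have -> : (g - delta_mx i 0)^T *m x = (dotv g x - x i 0)%:M.
  apply/matrixP => p q; rewrite !ord1 !mxE eqxx mulr1n -[x i 0]dotv_delta -dotvNl -dotvDl.
  by apply: eq_bigr => k _; rewrite !mxE.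
by rewrite mul_mx_scalar !mxE !eqxx mulr1 addrC subrK.
Qed.

(** * Induction on the dimension: vanishing of bipyramids *)

Section Step.
Variables (R : realType) (k : nat).
Local Notation vec := 'cV[R]_(1 + k).
Let g0 : vec := delta_mx ord0 0.
Let Em : 'M[R]_(1 + k, k) := col_mx (0 : 'M[R]_(1, k)) 1%:M.
Let E (x : 'cV[R]_k) : vec := col_mx (0 : 'M[R]_(1, 1)) x.

Lemma EmE : mulmx Em = E :> ('cV[R]_k -> vec).
Proof. by apply/funext => x; rewrite /Em mul_col_mx mul0mx mul1mx. Qed.

Lemma E_inj : injective E.
Proof. by move=> x y /eq_col_mx[]. Qed.

Lemma dot_col (a b : 'M[R]_1) (x y : 'cV[R]_k) :
  dotv (col_mx a x : vec) (col_mx b y) = a 0 0 * b 0 0 + dotv x y.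
Proof.
rewrite /dotv big_split_ord /= big_ord1 !(col_mxEu _ _ (ord0 : 'I_1)); congr (_ + _).
by apply: eq_bigr => i _; rewrite !(col_mxEd).
Qed.

Lemma g0E : g0 = col_mx (1%:M : 'M[R]_1) (0 : 'cV[R]_k).
Proof.
apply/matrixP => i j; rewrite /g0 ord1 mxE eqxx andbT.
case: (@split_ordP 1 k i) => i' ->; rewrite ?col_mxEu ?col_mxEd !mxE ?ord1 ?eqxx //.
Qed.

Lemma E_g0 x : dotv g0 (E x) = 0.
Proof. by rewrite g0E dot_col [dotv 0 _]dotv0l !mxE mulr0 addr0. Qed.

Lemma E_surj y : dotv g0 y = 0 -> y = E (dsubmx (y : 'cV[R]_(1 + k))).
Proof.
move=> h; rewrite -[LHS](@vsubmxK _ 1 k) /E; congr col_mx.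
apply/matrixP => i j; move: h; rewrite -{1}[y](@vsubmxK _ 1 k) g0E dot_col dotv0l addr0.
by rewrite [1%:M _ _]mxE eqxx mul1r !ord1 => ->; rewrite mxE.
Qed.

Lemma equatorial_img Q : Pno Q -> equatorial g0 (E @` Q).
Proof.
move=> /PnoE[pQ aQ]; split; first by rewrite -EmE; exact: poly_img.
  by move=> x [y Qy <-]; exact: E_g0.
move=> h /E_surj ->; have [t t0 Qt] := aQ (dsubmx (h : 'cV[R]_(1 + k))); exists t => //.
by exists (t *: dsubmx (h : 'cV[R]_(1 + k))) => //; rewrite /E scale_col_mx scaler0.
Qed.

Lemma equatorial_imgP Q : equatorial g0 Q -> exists2 Q', Pno Q' & Q = E @` Q'.
Proof.
move=> bQ; have [pQ Q0 aQ] := bQ.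
pose D : 'M[R]_(k, 1 + k) := row_mx (0 : 'M[R]_(k, 1)) 1%:M.
have DE (x : vec) : D *m x = dsubmx (x : 'cV[R]_(1 + k)).
  by rewrite -[x in LHS](@vsubmxK _ 1 k) /D mul_row_col mul0mx mul1mx add0r.
exists (mulmx D @` Q).
  apply/PnoE; split; first exact: poly_img.
  move=> x; have [t t0 Qt] := aQ (E x) (E_g0 x); exists t => //.
  by exists (t *: E x) => //; rewrite DE /E scale_col_mx col_mxKd.
apply/seteqP; split=> x.
  by move=> Qx; exists (D *m x); [exists x|rewrite DE -E_surj //; exact: Q0].
by move=> [_ [y Qy <-] <-]; rewrite DE -E_surj //; exact: Q0.
Qed.

Hypothesis IH : forall (V : zmodType) (nu : set 'cV[R]_k -> V),
  valuation nu -> vanish_joins nu -> forall P, Pno P -> nu P = 0.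

Variables (V : zmodType) (nu : set vec -> V).
Hypothesis val : valuation nu.
Hypothesis van : vanish_joins nu.

Definition cons_basis (u : vec) (b : 'I_k -> 'cV[R]_k) (i : 'I_(1 + k)) : vec :=
  if unlift ord0 i is Some l then E (b l) else u.

Lemma cross_opp (g u : vec) t : 0 < dotv g u -> 0 < t -> cross g u (- (t *: u)) = 0.
Proof.
move=> u0 t0; rewrite /cross !dotvNr !dotvZr opprK scalerN scalerA mulrC subrr scaler0 //.
Qed.

Lemma E_sum (P : pred 'I_k) (b : 'I_k -> 'cV[R]_k) :
  \sum_(l | P l) E (b l) = E (\sum_(l | P l) b l).
Proof. by rewrite -EmE mulmx_sumr. Qed.

Lemma E_scale a x : E (a *: x) = a *: E x.
Proof. by rewrite /E scale_col_mx scaler0. Qed.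

Lemma E_opp x : E (- x) = - E x.
Proof. by rewrite -scaleN1r E_scale scaleN1r. Qed.

Lemma E0 : E 0 = 0.
Proof. by rewrite /E col_mx0. Qed.

(* adjoining a segment as a new block *)
Lemma join_segment b d kap c s u t : dualb b d -> (forall i, 0 < c i) ->
  (forall j, 0 < s j) -> 0 < dotv g0 u -> 0 < t ->
  nu (bipyr (E @` joinset b kap c s) u (- (t *: u))) = 0.
Proof.
move=> bd c0 s0 u0 t0.
(* A colour used by no index: the segment becomes a block of its own. Its basis vector is [t *: u],
   so the vertices [u] and [- (t *: u)] receive the coefficients [t^-1] and 1. *)
pose F := (\max_l kap l).+1.
have kF l : kap l != F by rewrite neq_ltn ltnS leq_bigmax.
pose kap' (i : 'I_(1 + k)) := if unlift ord0 i is Some l then kap l else F.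
pose c' (i : 'I_(1 + k)) := if unlift ord0 i is Some l then c l else t^-1.
pose s' j := if j == F then 1 else s j.
have [ua [ub uE]] : exists (ua : 'M[R]_1) (ub : 'cV[R]_k), u = col_mx ua ub.
  by exists (usubmx u), (dsubmx u); rewrite vsubmxK.
have u0' : 0 < ua 0 0.
  by move: u0; rewrite {1}uE g0E dot_col dotv0l addr0 !mxE mul1r.
pose d' (i : 'I_(1 + k)) : vec := if unlift ord0 i is Some l then
  col_mx (- (dotv (d l) ub / ua 0 0))%:M (d l) else col_mx ((t * ua 0 0)^-1)%:M 0.
have ne : t * ua 0 0 != 0 by rewrite gt_eqF // mulr_gt0.
have une : ua 0 0 != 0 by rewrite gt_eqF.
have bd' : dualb (cons_basis (t *: u) b) d'.
  move=> i j; rewrite /cons_basis /d' uE scale_col_mx.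
  case: (unliftP ord0 i) => [i'|] ->; case: (unliftP ord0 j) => [j'|] ->.
  - by rewrite dot_col !mxE mulr0 add0r bd (inj_eq lift_inj).
  - rewrite [_ == ord0]eq_sym (negbTE (neq_lift _ _)) dot_col !mxE eqxx mulr1n dotvZr.
    by rewrite mulr0n; field.
  - by rewrite dot_col !mxE mulr0 dotv0l addr0 (negbTE (neq_lift _ _)).
  - by rewrite dot_col !mxE eqxx mulr1n dotv0l addr0 mulVf.
have sumF : \sum_(l | kap' l == F) cons_basis (t *: u) b l = t *: u.
  rewrite (bigD1 ord0) /=; last by rewrite /kap' unlift_none.
  rewrite big1 ?addr0; first by rewrite /cons_basis unlift_none.
  move=> i; rewrite /kap'; case: (unliftP ord0 i) => [i'|] ->; last by rewrite eqxx andbF.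
  by rewrite (negbTE (kF i')).
have sumk i : \sum_(l | kap' l == kap i) cons_basis (t *: u) b l = E (\sum_(l | kap l == kap i) b l).
  rewrite big_mkcond big_ord_recl /= {1}/kap' unlift_none eq_sym (negbTE (kF i)) add0r.
  rewrite -E_sum [RHS]big_mkcond; apply: eq_bigr => l _.
  by rewrite /kap' /cons_basis liftK.
have klift l : kap' (lift ord0 l) = kap l by rewrite /kap' liftK.
have kord : kap' ord0 = F by rewrite /kap' unlift_none.
have -> : bipyr (E @` joinset b kap c s) u (- (t *: u)) = joinset (cons_basis (t *: u) b) kap' c' s'.
  rewrite /bipyr -EmE -hull_img hull_hullU EmE !image_setU image_set1 E0; congr hull.
  apply/seteqP; split=> x.
    move=> [[[->|[_ [i ->] <-]]|[_ [i ->] <-]]|[->|->]].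
    - by left; left.
    - by left; right; exists (lift ord0 i); rewrite /c' /cons_basis liftK E_scale.
    - right; exists (lift ord0 i); rewrite klift sumk /s' (negbTE (kF i)).
      by rewrite E_opp E_scale.
    - by left; right; exists ord0; rewrite /c' /cons_basis unlift_none scalerA mulVf ?gt_eqF ?scale1r.
    - by right; exists ord0; rewrite kord sumF /s' eqxx scale1r.
  move=> [[->|[i ->]]|[i ->]].
  - by left; left; left.
  - rewrite /c' /cons_basis; case: (unliftP ord0 i) => [i'|] _.
      by left; left; right; exists (c i' *: b i'); [exists i'|rewrite E_scale].
    by right; left; rewrite scalerA mulVf ?gt_eqF ?scale1r.
  - case: (unliftP ord0 i) => [i'|] ->; rewrite ?klift ?kord.
      left; right; exists (- (s (kap i') *: \sum_(l | kap l == kap i') b l)); first by exists i'.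
      by rewrite sumk /s' (negbTE (kF i')) E_opp E_scale.
    by right; right; rewrite sumF /s' eqxx scale1r.
apply: (van _ bd').
  by move=> i; rewrite /c'; case: (unlift ord0 i) => [i'|] //; rewrite invr_gt0.
by move=> j; rewrite /s'; case: eqP.
Qed.

(** Opposite apexes cross at 0, which every equator contains; so by [bipyrU] the value is a
    valuation of the equator. It vanishes on joins by [join_segment], and the induction hypothesis
    applies. *)
Lemma segment_zero Q u t : Pno Q -> 0 < dotv g0 u -> 0 < t ->
  nu (bipyr (E @` Q) u (- (t *: u))) = 0.
Proof.
move=> PQ u0 t0; pose nu' Q := nu (bipyr (E @` Q) u (- (t *: u))).
have uv : dotv g0 (- (t *: u)) < 0 < dotv g0 u.
  by rewrite u0 dotvNr dotvZr oppr_lt0 mulr_gt0.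
apply: (IH (nu := nu')) PQ; last first.
  by move=> b d kap c s bd c0 s0; apply: join_segment bd c0 s0 u0 t0.
move=> K L PK PL PU PI; rewrite /nu' image_setU image_setI_inj; last exact: E_inj.
have b0 Q' : Pno Q' -> (E @` Q') (cross g0 u (- (t *: u))).
  by move=> /equatorial_img; rewrite cross_opp //; exact: baseQ0.
apply: (bipyrU (g := g0)) => //; try exact: equatorial_img.
- by rewrite -image_setU; exact: equatorial_img.
- by rewrite -image_setI_inj; [exact: equatorial_img|exact: E_inj].
- exact: b0.
- exact: b0.
Qed.

Lemma Zseg Q : equatorial g0 Q -> forall u t, 0 < dotv g0 u -> 0 < t ->
  nu (bipyr Q u (- (t *: u))) = 0.
Proof. by move=> /equatorial_imgP[Q' PQ' ->] u t; exact: segment_zero. Qed.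

Lemma join_Pno b d kap c s : dualb b d -> (forall i, 0 < c i) -> (forall j, 0 < s j) ->
  Pno (joinset b kap c s : set 'cV[R]_k).
Proof.
move=> bd c0 s0; apply/PnoE; split.
  exists (0 :: [seq c i *: b i | i <- enum 'I_k] ++
   [seq - (s (kap i) *: \sum_(l | kap l == kap i) b l) | i <- enum 'I_k]).
  congr hull; apply/seteqP; split=> x /=.
    rewrite inE mem_cat => -[[->|[i ->]]|[i ->]]; first by rewrite eqxx.
      by apply/orP; right; apply/orP; left; apply/mapP; exists i; rewrite ?mem_enum.
    by apply/orP; right; apply/orP; right; apply/mapP; exists i; rewrite ?mem_enum.
  rewrite inE mem_cat => /or3P[/eqP ->|/mapP[i _ ->]|/mapP[i _ ->]].
  - by left; left.
  - by left; right; exists i.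
  - by right; exists i.
apply: (absorb_basis bd); first exact: hull_convex.
- by apply: sub_cv; left; left.
- by move=> i; exists (c i) => //; apply: sub_cv; left; right; exists i.
move=> i; pose K := [pred l | kap l == kap i].
have Ki : K i by rewrite /= eqxx.
(* -s b_i is a combination of the negative vertex and the other vertices of its block *)
pose D := 1 + \sum_(l | K l && (l != i)) s (kap i) / c l.
have D0 : 0 < D by rewrite ltr_wpDr //; apply: sumr_ge0 => l _; apply: ltW; rewrite divr_gt0.
exists (s (kap i) / D); first exact: divr_gt0.
pose w (o : option 'I_k) : R := if o is Some l then
   (if K l && (l != i) then s (kap i) / c l / D else 0) else D^-1.
pose p (o : option 'I_k) : 'cV[R]_k := if o is Some l then c l *: b l else
   - (s (kap i) *: \sum_(l | kap l == kap i) b l).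
have -> : - ((s (kap i) / D) *: b i) = \sum_(o <- None :: [seq Some l | l <- enum 'I_k]) w o *: p o.
  rewrite big_cons big_map big_enum /= (bigD1 i Ki) /=.
  set S := \sum_(l | _ && _) b l.
  rewrite [X in _ = _ + X](_ : _ = (s (kap i) / D) *: S).
    by rewrite scalerN scalerA [D^-1 * _]mulrC scalerDr opprD -addrA addNr addr0.
  rewrite scaler_sumr [RHS]big_mkcond; apply: eq_bigr => l _.
  case: ifP => _; last by rewrite scale0r.
  by rewrite scalerA; congr (_ *: _); field; rewrite !gt_eqF.
apply: convex_sum; first exact: hull_convex.
- case=> [l|] /=; last by rewrite invr_ge0 ltW.
  by case: ifP => // _; rewrite ltW // !divr_gt0.
- rewrite big_cons big_map big_enum /= -big_mkcond /= -mulr_suml -{1}[D^-1]mul1r -mulrDl.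
  by rewrite mulfV // gt_eqF.
case=> [l|] /= _; apply: sub_cv; first by left; right; exists l.
by right; exists i.
Qed.

(* splitting the vertex [c_l b_l] of a join *)
Lemma join_split b d kap c s l r (e : R) : dualb b d -> (forall i, 0 < c i) ->
  (forall j, 0 < s j) -> dotv g0 r = 1 -> 0 < e ->
  bipyr_diff nu (E @` joinset b kap c s) r (r - e *: E (b l)) = 0.
Proof.
move=> bd c0 s0 r1 e0; have PJ := join_Pno kap bd c0 s0.
have bJ := equatorial_img PJ; set r' := r - _.
have r1' : dotv g0 r' = 1 by rewrite dotvDr dotvNr dotvZr E_g0 mulr0 subr0.
(* Makes the segment from [a *: r] to [- (a *: r')] cross exactly at [c l *: E (b l)], which thereby
   ceases to be a vertex. *)
pose a := 2 * c l / e.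
have a0 : 0 < a by rewrite divr_gt0 // mulr_gt0.
have al : (a * a / (a + a)) *: (r - r') = c l *: E (b l).
  rewrite /r' subKr scalerA; congr (_ *: _); rewrite /a; field.
  by have := c0 l => cl; rewrite gt_eqF //= gt_eqF //; lra.
rewrite -(bipyr_diffE val bJ (Zseg bJ) r1 r1' a0 a0); last first.
  by rewrite al -E_scale; exists (c l *: b l) => //; apply: sub_cv; left; right; exists l.
have [ra [rb rE]] : exists (ra : 'M[R]_1) (rb : 'cV[R]_k), r = col_mx ra rb.
  by exists (usubmx r), (dsubmx r); rewrite vsubmxK.
have ra1 : ra 0 0 = 1.
  by move: r1; rewrite {1}rE g0E dot_col dotv0l addr0 !mxE mul1r.
(* The vectors [e^-1 *: r] and [- (e^-1 *: r')] sum to [E (b l)], so replacing it by these two keeps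
   all block sums: the bipyramid is a join whose block of [l] has one more index. *)
pose b' (i : 'I_(1 + k)) : vec := if unlift ord0 i is Some m then
   (if m == l then e^-1 *: r else E (b m)) else - (e^-1 *: r').
pose kap' (i : 'I_(1 + k)) := if unlift ord0 i is Some m then kap m else kap l.
pose c' (i : 'I_(1 + k)) := if unlift ord0 i is Some m then
   (if m == l then 2 * c l else c m) else 2 * c l.
pose dd m : vec := col_mx (- dotv (d m) rb)%:M (d m).
pose d' (i : 'I_(1 + k)) : vec := if unlift ord0 i is Some m then
  (if m == l then e *: g0 + dd l else dd m) else dd l.
have e1 : e != 0 by rewrite gt_eqF.
have ddr m : dotv (dd m) r = 0.
  by rewrite rE dot_col !mxE eqxx mulr1n ra1 mulr1 addNr.
have ddE m x : dotv (dd m) (E x) = dotv (d m) x.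
  by rewrite dot_col !mxE mulr0 add0r.
have ddr' m : dotv (dd m) r' = - (e * (m == l)%:R).
  by rewrite dotvDr dotvNr dotvZr ddr ddE bd add0r.
have bd' : dualb b' d'.
  move=> i j; rewrite /b' /d'.
  case: (unliftP ord0 i) => [i'|] ->; case: (unliftP ord0 j) => [j'|] ->.
  - rewrite (inj_eq lift_inj); have [->|il] := eqVneq i' l; have [jl|jl] := eqVneq j' l.
    + by rewrite dotvDl dotvZl !dotvZr ddr r1 mulr0 addr0 mulr1 mulfV // jl eqxx.
    + by rewrite dotvDl dotvZl E_g0 mulr0 add0r ddE bd eq_sym (negbTE jl).
    + by rewrite dotvZr ddr mulr0 jl (negbTE il).
    + by rewrite ddE bd.
  - rewrite [_ == ord0]eq_sym (negbTE (neq_lift _ _)).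
    have [_|il] := eqVneq i' l.
      rewrite dotvNr dotvZr dotvDl dotvZl r1' ddr' eqxx !mulr1 subrr mulr0 oppr0 //.
    by rewrite dotvNr dotvZr ddr' (negbTE il) !(mulr0, oppr0).
  - rewrite (negbTE (neq_lift _ _)); have [jl|jl] := eqVneq j' l.
      by rewrite dotvZr ddr mulr0.
    by rewrite ddE bd eq_sym (negbTE jl).
  - by rewrite eqxx dotvNr dotvZr ddr' eqxx mulr1 mulrN opprK mulVf.
have sumk i : \sum_(m | kap' m == kap i) b' m = E (\sum_(m | kap m == kap i) b m).
  rewrite big_mkcond big_ord_recl /= {1}/kap' {1}/b' unlift_none.
  rewrite -E_sum [RHS]big_mkcond (bigD1 l) //= [RHS](bigD1 l) //=.
  rewrite {1}/kap' {1}/b' liftK eqxx addrA; congr (_ + _).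
    case: eqP => _; last by rewrite addr0.
    by rewrite /r' scalerBr opprB subrK scalerA mulVf // scale1r.
  apply: eq_bigr => m /negbTE ml; by rewrite /kap' /b' liftK ml.
have klift m : kap' (lift ord0 m) = kap m by rewrite /kap' liftK.
have k0 : kap' ord0 = kap l by rewrite /kap' unlift_none.
have ea : 2 * c l * e^-1 = a by [].
have ar : a *: r = (2 * c l) *: (e^-1 *: r) by rewrite scalerA.
have ar' : - (a *: r') = (2 * c l) *: - (e^-1 *: r') by rewrite scalerN scalerA.
have -> : bipyr (E @` joinset b kap c s) (a *: r) (- (a *: r')) = joinset b' kap' c' s.
  rewrite /bipyr -EmE -hull_img hull_hullU EmE !image_setU image_set1 E0; apply: hull_eq => x.
    have Pr : joinset b' kap' c' s (a *: r).
      by apply: sub_cv; left; right; exists (lift ord0 l); rewrite /c' /b' liftK eqxx ar.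
    have Pr' : joinset b' kap' c' s (- (a *: r')).
      by apply: sub_cv; left; right; exists ord0; rewrite /c' /b' unlift_none ar'.
    move=> [[[->|[_ [i ->] <-]]|[_ [i ->] <-]]|[->|->]] //.
    - by apply: sub_cv; left; left.
    - have [->|il] := eqVneq i l.
        have -> : E (c l *: b l) = 2^-1 *: (a *: r) + 2^-1 *: (- (a *: r')).
          rewrite -scalerDr -scalerBr /r' subKr E_scale !scalerA; congr (_ *: _).
          by rewrite /a; field.
        by apply: hull_convex; rewrite ?invr_ge0 ?ler0n //; field.
      apply: sub_cv; left; right; exists (lift ord0 i).
      by rewrite /c' /b' liftK (negbTE il) E_scale.
    - apply: sub_cv; right; exists (lift ord0 i); rewrite klift sumk.
      by rewrite E_opp E_scale.
  have kk i : exists m, kap' i = kap m.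
    by rewrite /kap'; case: (unlift ord0 i) => [m|]; [exists m|exists l].
  move=> [[->|[i ->]]|[i ->]]; apply: sub_cv.
  - by left; left; left.
  - rewrite /c' /b'; case: (unlift ord0 i) => [m|]; last by right; right; rewrite ar'.
    have [_|ml] := eqVneq m l; first by right; left; rewrite ar.
    by left; left; right; exists (c m *: b m); [exists m|rewrite E_scale].
  - have [m em] := kk i; rewrite em sumk.
    left; right; exists (- (s (kap m) *: \sum_(m' | kap m' == kap m) b m')); first by exists m.
    by rewrite E_opp E_scale.
apply: (van _ bd') => // i; rewrite /c'; case: (unlift ord0 i) => [m|]; last by rewrite mulr_gt0.
by case: eqP => // _; rewrite mulr_gt0.
Qed.

(** The vector [r - r'] is a combination of the [E (b l)]. The way from [r] to [r'] is followed one
    basis direction at a time; each step vanishes by [join_split], up to orientation, and the steps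
    add up by the cocycle rule. *)
Lemma join_Dl b d kap c s r r' : dualb b d -> (forall i, 0 < c i) ->
  (forall j, 0 < s j) -> dotv g0 r = 1 -> dotv g0 r' = 1 ->
  bipyr_diff nu (E @` joinset b kap c s) r r' = 0.
Proof.
move=> bd c0 s0 r1 r1'; set Q := _ @` _.
have bJ : equatorial g0 Q by apply: equatorial_img; exact: join_Pno bd c0 s0.
have Z := Zseg bJ.
have s1 x (t : R) l : dotv g0 x = 1 -> dotv g0 (x - t *: E (b l)) = 1.
  by move=> x1; rewrite dotvDr dotvNr dotvZr E_g0 mulr0 subr0.
have step x (t : R) l : dotv g0 x = 1 -> bipyr_diff nu Q x (x - t *: E (b l)) = 0.
  move=> x1; have [t0|t0|->] := ltgtP t 0.
  - rewrite (bipyr_diff_anti val bJ Z) ?s1 //; set y := x - _.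
    have -> : x = y - (- t) *: E (b l) by rewrite /y scaleNr opprK subrK.
    by rewrite (join_split _ _ bd) ?oppr0 ?oppr_gt0 // /y s1.
  - by rewrite (join_split _ _ bd).
  - by rewrite scale0r subr0 (bipyr_diff0 bJ Z).
pose h := dsubmx ((r - r') : 'cV[R]_(1 + k)).
have hE : r' = r - \sum_(l <- enum 'I_k) dotv (d l) h *: E (b l).
  have -> : \sum_(l <- enum 'I_k) dotv (d l) h *: E (b l) = E h.
    rewrite {2}(dual_complete h bd) -EmE mulmx_sumr big_enum /=.
    by apply: eq_bigr => l _; rewrite -scalemxAr.
  rewrite /h -E_surj; last by rewrite dotvDr dotvNr r1 r1' subrr.
  by rewrite subKr.
rewrite hE; elim: (enum _) (r) r1 => [|l q IHq] x x1.
  by rewrite big_nil subr0 (bipyr_diff0 bJ Z).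
have e : forall y, \sum_(l <- q) dotv (d l) h *: E (b l) = y -> dotv g0 y = 0.
  move=> y <-; rewrite dotv_sumr big1 // => m _; by rewrite dotvZr E_g0 mulr0.
rewrite big_cons opprD addrA (bipyr_diff_cocycle val bJ Z (r' := x - dotv (d l) h *: E (b l))).
- by rewrite step // IHq ?s1 // addr0.
- by [].
- exact: s1.
- by rewrite dotvDr s1 // dotvNr (e _ erefl) subr0.
Qed.

(** Second use of the induction hypothesis: for fixed directions the value is a [bipyr_diff], which
    is a valuation of the equator by [bipyr_diffU] and is zero on joins by [join_Dl]. *)
Lemma bipyr_zero0 Q u v : equatorial g0 Q -> dotv g0 v < 0 < dotv g0 u -> Q (cross g0 u v) ->
  nu (bipyr Q u v) = 0.
Proof.
move=> bQ uv equator; rewrite (bipyr_to_diff val bQ (Zseg bQ) uv equator).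
have /andP[v0 u0] := uv.
set r := _ *: u; set r' := _ *: v.
have r1 : dotv g0 r = 1 by rewrite dotvZr mulVf // gt_eqF.
have r1' : dotv g0 r' = 1 by rewrite dotvZr mulVf // lt_eqF.
have [Q' PQ' ->] := equatorial_imgP bQ.
apply: (IH (nu := fun Q' => bipyr_diff nu (E @` Q') r r')) PQ'; last first.
  by move=> b d kap c s bd c0 s0; exact: join_Dl bd c0 s0 r1 r1'.
move=> K L PK PL PU PI; rewrite image_setU image_setI_inj; last exact: E_inj.
apply: (bipyr_diffU val _ _ _ _ _ r1 r1') => //; try exact: equatorial_img.
- by move=> Q0 bQ0; exact: Zseg.
- by rewrite -image_setU; exact: equatorial_img.
- by rewrite -image_setI_inj; [exact: equatorial_img|exact: E_inj].
Qed.

End Step.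

(** By [vanish_all] it remains to kill the correction terms of cuts; a linear isomorphism turns the
    cutting functional into the first coordinate, where [bipyr_zero0] applies. *)
Lemma joins_determine (R : realType) n (V : zmodType) (nu : set 'cV[R]_n -> V) :
  valuation nu -> vanish_joins nu -> forall P, Pno P -> nu P = 0.
Proof.
elim: n V nu => [|k IH] V nu val van P PP; apply: (vanish_all val) => // {P PP} g X u v PX Xu Xv.
  by rewrite /dotv !big_ord0 ltxx.
move=> uv; have /andP[u0 v0] := uv.
have g_ne : g != 0 by apply: contraTneq v0 => ->; rewrite dotv0l ltxx.
have [A uA Ag] := ex_functional g_ne.
have uA' : invmx A \in unitmx by rewrite unitmx_inv.
set Y := hull _.
have -> : Y = mulmx (invmx A) @` (mulmx A @` Y) by rewrite -{1}[A]invmxK imgK.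
rewrite -[LHS]/((fun P => nu (mulmx (invmx A) @` P)) (mulmx A @` Y)).
rewrite /Y -hull_img !image_setU !image_set1 -/(bipyr _ _ _) bipyrC.
apply: (bipyr_zero0 IH (nu := fun P : set (matrix R (1 + k) 1) => nu (mulmx (invmx A) @` P))).
- exact: valuation_img.
- exact: vanish_joins_img.
- have [pX X0 aX] := baseQ_cut g PX; split; first exact: poly_img.
    by move=> x [y [_ /= y0] <-]; rewrite Ag.
  move=> h h0; have [|t t0 Xt] := aX (invmx A *m h); first by rewrite -Ag mulKVmx.
  by exists t => //; exists (t *: (invmx A *m h)) => //; rewrite -scalemxAr mulKVmx.
- by rewrite !Ag u0 v0.
exists (cross g v u).
  by split; [apply: cross_conv => //; exact: Pno_convex|exact: cross0].
by rewrite /cross -scalemxAr mulmxDr -!scalemxAr !Ag.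
Qed.

(** * From joins to crosspolytopes *)

Lemma det_mx22 (R : comRingType) (M : 'M[R]_2) :
  \det M = M ord0 ord0 * M ord_max ord_max - M ord0 ord_max * M ord_max ord0.
Proof.
rewrite (expand_det_row _ ord0) !big_ord_recl big_ord0 addr0 /cofactor !det_mx11 !mxE /=.
rewrite /bump /= addn0 expr0 expr1 mul1r mulN1r mulrN.
by congr (_ * M _ _ - M _ _ * M _ _); apply: val_inj.
Qed.

Lemma det_sylvester (R : realType) n k (U : 'M[R]_(n, k)) (W : 'M[R]_(k, n)) :
  \det (1%:M + U *m W) = \det (1%:M + W *m U).
Proof.
pose L := block_mx 1%:M 0 W (1%:M : 'M[R]_k).
pose M := block_mx (1%:M + U *m W) U 0 (1%:M : 'M[R]_k).
pose N := block_mx 1%:M 0 (- W) (1%:M : 'M[R]_k).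
have E : L *m M *m N = block_mx 1%:M U 0 (1%:M + W *m U).
  rewrite /L /M /N !mulmx_block !(mul1mx, mul0mx, mulmx1, mulmx0, addr0, add0r).
  congr block_mx; first by rewrite mulmxN addrK.
    by rewrite mulmxDr mulmx1 mulmxN mulmxDl mul1mx mulmxA [X in _ - X]addrC subrr.
  by rewrite addrC.
have : \det (L *m M *m N) = \det (1%:M + W *m U).
  by rewrite E det_ublock det1 mul1r.
by rewrite !det_mulmx /L /N !det_lblock /M det_ublock !det1 !(mul1r, mulr1).
Qed.

Lemma det_rank2 (R : realType) n (u1 u2 v1 v2 : 'cV[R]_n) :
  \det (1%:M + u1 *m v1^T + u2 *m v2^T) =
  (1 + dotv v1 u1) * (1 + dotv v2 u2) - dotv v1 u2 * dotv v2 u1.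
Proof.
pose U : 'M[R]_(n, 2) := \matrix_(k, j) (if j == ord0 then u1 k 0 else u2 k 0).
pose W : 'M[R]_(2, n) := \matrix_(j, k) (if j == ord0 then v1 k 0 else v2 k 0).
have -> : 1%:M + u1 *m v1^T + u2 *m v2^T = 1%:M + U *m W.
  rewrite -addrA; congr (_ + _); apply/matrixP => i j.
  by rewrite mxE !mxE !big_ord_recl !big_ord0 !mxE /= !addr0.
rewrite det_sylvester det_mx22 ![(1%:M + _) _ _]mxE ![1%:M _ _]mxE /= !add0r.
congr ((_ + _) * (_ + _) - _ * _); rewrite mxE; apply: eq_bigr => k _; by rewrite !mxE.
Qed.

Definition upd (T : eqType) S (f : T -> S) a v := fun x => if x == a then v else f x.

Lemma upd_eq (T : eqType) S (f : T -> S) a v : upd f a v a = v.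
Proof. by rewrite /upd eqxx. Qed.
Lemma upd_ne (T : eqType) S (f : T -> S) a v x : x != a -> upd f a v x = f x.
Proof. by rewrite /upd => /negbTE ->. Qed.
Lemma upd_gt0 (R : realType) (T : eqType) (f : T -> R) a v : (forall x, 0 < f x) -> 0 < v ->
  forall x, 0 < upd f a v x.
Proof. by move=> f0 v0 x; rewrite /upd; case: eqP. Qed.

Section Contra.
Variables (R : realType) (n : nat).
Implicit Types (b d : 'I_n -> 'cV[R]_n) (c : 'I_n -> R) (s : nat -> R) (kap : 'I_n -> nat).

Definition bsum kap (k : nat) b := \sum_(l | kap l == k) b l.

Lemma join_in0 b kap c s : joinset b kap c s 0.
Proof. by apply: sub_cv; left; left. Qed.
Lemma join_inc b kap c s l : joinset b kap c s (c l *: b l).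
Proof. by apply: sub_cv; left; right; exists l. Qed.
Lemma join_ins b kap c s l : joinset b kap c s (- (s (kap l) *: bsum kap (kap l) b)).
Proof. by apply: sub_cv; right; exists l. Qed.

Arguments join_in0 : clear implicits.
Arguments join_inc : clear implicits.
Arguments join_ins : clear implicits.

Lemma join_min b kap c s C : is_convex C -> C 0 -> (forall l, C (c l *: b l)) ->
  (forall l, C (- (s (kap l) *: bsum kap (kap l) b))) -> joinset b kap c s `<=` C.
Proof. by move=> cC C0 Cc Cs; apply: hull_min => // x [[->|[l ->]]|[l ->]] //; exact: Cs. Qed.

Lemma join_eq b kap c s b' kap' c' s' :
  (forall l, joinset b' kap' c' s' (c l *: b l)) ->
  (forall l, joinset b' kap' c' s' (- (s (kap l) *: bsum kap (kap l) b))) ->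
  (forall l, joinset b kap c s (c' l *: b' l)) ->
  (forall l, joinset b kap c s (- (s' (kap' l) *: bsum kap' (kap' l) b'))) ->
  joinset b kap c s = joinset b' kap' c' s'.
Proof.
move=> h1 h2 h3 h4; apply/seteqP; split; apply: join_min => //;
  by [exact: hull_convex|exact: join_in0].
Qed.

Lemma bsum_upd kap k b j v : kap j = k -> bsum kap k (upd b j v) = bsum kap k b + (v - b j).
Proof.
move=> e; rewrite /bsum (bigD1 j) /=; last by rewrite e.
rewrite [in RHS](bigD1 j) /=; last by rewrite e.
rewrite upd_eq [X in _ + X = _](eq_bigr b); last by move=> l /andP[_ lj]; rewrite upd_ne.
by set S := \sum_(_ | _) _; rewrite (addrC v) (addrC (b j) S) -addrA [b j + _]addrC subrK.
Qed.

Lemma bsum_upd_ne kap k b j v : kap j != k -> bsum kap k (upd b j v) = bsum kap k b.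
Proof.
move=> e; apply: eq_bigr => l /eqP lk; rewrite upd_ne //.
by apply: contraNneq e => <-; rewrite lk.
Qed.

Lemma dot_bsum kap k b d i : dualb b d -> dotv (d i) (bsum kap k b) = (kap i == k)%:R.
Proof.
move=> bd; rewrite dotv_sumr; have [e|e] := eqVneq (kap i) k.
  rewrite (bigD1 i) /=; last by rewrite e.
  by rewrite bd eqxx big1 ?addr0 // => l /andP[_ li]; rewrite bd eq_sym (negbTE li).
rewrite big1 // => l /eqP lk; rewrite bd; case: (eqVneq i l) => // il.
by rewrite il lk eqxx in e.
Qed.

Lemma dot_zero b d v : dualb b d -> (forall l, dotv v (b l) = 0) -> v = 0.
Proof.
move=> bd h; apply: dotv_eq0; rewrite {2}(dual_complete v bd) dotv_sumr.
by rewrite big1 // => l _; rewrite dotvZr h mulr0.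
Qed.

Lemma joinset_Pno b d kap c s : dualb b d -> (forall i, 0 < c i) -> (forall j, 0 < s j) ->
  Pno (joinset b kap c s).
Proof. exact: join_Pno. Qed.

(** Measure of the induction on colourings; it is 0 exactly for the injective ones. *)
Definition nonsingle kap := #|[pred i : 'I_n | [exists j, (j != i) && (kap j == kap i)]]|.

Variable nu : set 'cV[R]_n -> 'cV[R]_n.
Hypothesis val : valuation nu.
Hypothesis contra : SL_contravariant nu.

Lemma contra_dot phi P y : \det phi = 1 -> Pno P ->
  dotv (nu (mulmx phi @` P)) (phi *m y) = dotv (nu P) y.
Proof.
move=> d1 PP; rewrite contra // -dotv_mulmx mulKmx //.
by rewrite unitmxE d1 unitr1.
Qed.

Lemma valuation_dot y : valuation (fun P => dotv (nu P) y).
Proof. by move=> K L PK PL PU PI; rewrite -!dotvDl val. Qed.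

Section Block.
Variables (kap : 'I_n -> nat).
Hypothesis IHk : forall kap', (nonsingle kap' < nonsingle kap)%N ->
  forall b d c s, dualb b d -> (forall i, 0 < c i) -> (forall j, 0 < s j) ->
    nu (joinset b kap' c s) = 0.

Section Pair.
Variables (b d : 'I_n -> 'cV[R]_n) (i j : 'I_n).
Hypothesis bd : dualb b d.
Hypothesis ij : i != j.
Hypothesis kij : kap i = kap j.
Let g := d i - d j.

Let ji : (j == i) = false.
Proof. by rewrite eq_sym; exact: negbTE. Qed.

Lemma g_b l : dotv g (b l) = (i == l)%:R - (j == l)%:R.
Proof. by rewrite dotvDl dotvNl !bd. Qed.

Lemma g_bi : dotv g (b i) = 1.
Proof. by rewrite g_b eqxx ji subr0. Qed.

Lemma g_bj : dotv g (b j) = -1.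
Proof. by rewrite g_b eqxx (negbTE ij) sub0r. Qed.

Lemma g_sum k : dotv g (bsum kap k b) = 0.
Proof. by rewrite dotvDl dotvNl !(dot_bsum _ _ _ bd) kij subrr. Qed.

(** Half the harmonic mean: the segment from [c i *: b i] to [c j *: b j] crosses the hyperplane
    [d i = d j] at [midc c *: (b i + b j)]. *)
Definition midc c := c i * c j / (c i + c j).

Lemma midc_gt0 c : (forall l, 0 < c l) -> 0 < midc c.
Proof. by move=> c0; rewrite divr_gt0 ?addr_gt0 ?mulr_gt0. Qed.

Definition equator_points c s m := [set 0] `|` [set x | exists l, [/\ l != i, l != j & x = c l *: b l]] `|`
  [set x | exists l, x = - (s (kap l) *: bsum kap (kap l) b)] `|` [set m *: (b i + b j)].

Lemma join_uv c : (forall l, 0 < c l) -> dotv g (c j *: b j) < 0 < dotv g (c i *: b i).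
Proof. by move=> c0; rewrite !dotvZr g_bi g_bj mulrN1 mulr1 oppr_lt0 !c0. Qed.

Lemma join_cross c : (forall l, 0 < c l) ->
  cross g (c i *: b i) (c j *: b j) = midc c *: (b i + b j).
Proof.
move=> c0; rewrite /cross !dotvZr g_bi g_bj /midc.
apply/matrixP => p q; rewrite !mxE; field.
by rewrite gt_eqF ?addr_gt0.
Qed.

Lemma join_cap c s : (forall l, 0 < c l) -> (forall k, 0 < s k) ->
  joinset b kap c s `&` [set x | dotv g x = 0] = hull (equator_points c s (midc c)).
Proof.
move=> c0 s0; pose A := ([set 0] `|` [set x | exists i, x = c i *: b i] `|`
      [set x | exists i, x = - (s (kap i) *: bsum kap (kap i) b)]) `|` [set midc c *: (b i + b j)].
have cr : joinset b kap c s (midc c *: (b i + b j)).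
  rewrite -join_cross //; apply: cross_conv; [exact: hull_convex|exact: join_inc|exact: join_inc|].
  exact: join_uv.
have -> : joinset b kap c s = hull A.
  apply: hull_eq => x; first by move=> h; apply: sub_cv; left.
  by move=> [h|->] //; exact: sub_cv.
have g1 : dotv g (b i + b j) = 0 by rewrite dotvDr g_bi g_bj subrr.
have gs l : dotv g (- (s (kap l) *: bsum kap (kap l) b)) = 0.
  by rewrite dotvNr dotvZr g_sum mulr0 oppr0.
have gl l : l != i -> l != j -> dotv g (c l *: b l) = 0.
  move=> li lj; rewrite dotvZr g_b eq_sym (negbTE li) [j == l]eq_sym (negbTE lj).
  by rewrite subr0 mulr0.
have Ap x : A x -> [\/ x = c i *: b i, x = c j *: b j | dotv g x = 0].
  move=> [[[->|[l ->]]|[l ->]]|->].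
  - by constructor 3; rewrite dotv0r.
  - have [->|li] := eqVneq l i; first by constructor 1.
    by have [->|lj] := eqVneq l j; [constructor 2|constructor 3; exact: gl].
  - by constructor 3.
  - by constructor 3; rewrite dotvZr g1 mulr0.
have /andP[v0 u0] := join_uv c0.
rewrite hull_cut_eq; last first.
  move=> k z Ak Az /andP[z0 k0]; apply: sub_cv.
  case: (Ap _ Ak) => e1; last by rewrite e1 ltxx in k0.
    case: (Ap _ Az) => e2; last by rewrite e2 ltxx in z0.
      by move: z0; rewrite e2 ltNge (ltW u0).
    rewrite e1 e2 join_cross //; split; first by right.
    by rewrite /= dotvZr g1 mulr0.
  by move: k0; rewrite e1 ltNge (ltW v0).
congr hull; apply/seteqP; split=> x.
  move=> [[[[->|[l ->]]|[l ->]]|->] /= x0]; first by left; left; left.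
  - left; left; right; exists l; split=> //.
      by apply: contraTneq u0 => <-; rewrite x0 ltxx.
    by apply: contraTneq v0 => <-; rewrite x0 ltxx.
  - by left; right; exists l.
  - by right.
move=> [[[->|[l [li lj ->]]]|[l ->]]|->]; split.
- by left; left; left.
- by rewrite /= dotv0r.
- by left; left; right; exists l.
- exact: gl.
- by left; right; exists l.
- exact: gs.
- by right.
- by rewrite /= dotvZr g1 mulr0.
Qed.

Definition equator c s := joinset b kap c s `&` [set x | dotv g x = 0].

Lemma equator_equatorial c s : (forall l, 0 < c l) -> (forall k, 0 < s k) -> equatorial g (equator c s).
Proof. by move=> c0 s0; apply: baseQ_cut; exact: joinset_Pno bd c0 s0. Qed.

Lemma equator_mid c s : (forall l, 0 < c l) -> (forall k, 0 < s k) ->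
  equator c s (midc c *: (b i + b j)).
Proof.
move=> c0 s0; rewrite /equator join_cap //; apply: sub_cv; by right.
Qed.

(** For two indices of one colour, all vertices other than theirs lie in the hyperplane [d i = d j],
    the negative vertex of their block included. *)
Lemma join_br c s : (forall l, 0 < c l) -> (forall k, 0 < s k) ->
  joinset b kap c s = bipyr (equator c s) (c i *: b i) (c j *: b j).
Proof.
move=> c0 s0; apply/seteqP; split; last first.
  apply: hull_min; first exact: hull_convex.
  by move=> x [[]//|[->|->]]; exact: join_inc.
apply: join_min; first exact: hull_convex.
- by apply: sub_cv; left; split; [exact: join_in0|rewrite /= dotv0r].
- move=> l; have [->|li] := eqVneq l i; first by apply: sub_cv; right; left.
  have [->|lj] := eqVneq l j; first by apply: sub_cv; right; right.
  apply: sub_cv; left; split; first exact: join_inc.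
  rewrite /= dotvZr g_b eq_sym (negbTE li) [j == l]eq_sym (negbTE lj).
  by rewrite subr0 mulr0.
- move=> l; apply: sub_cv; left; split; first exact: join_ins.
  by rewrite /= dotvNr dotvZr g_sum mulr0 oppr0.
Qed.

(* coning over [equator] with a segment frees the colour of [i] *)
Lemma equator_segment c s u t : (forall l, 0 < c l) -> (forall k, 0 < s k) ->
  0 < dotv g u -> 0 < t -> nu (bipyr (equator c s) u (- (t *: u))) = 0.
Proof.
move=> c0 s0 u0 t0; rewrite /equator join_cap // /bipyr hull_hullU.
pose F := (\max_l kap l).+1.
have kF l : kap l != F by rewrite neq_ltn ltnS leq_bigmax.
pose kap' := upd kap i F.
(* Once [i] has left the block, putting [b i + b j] in place of [b j] keeps the sum of the block and
   hence its negative vertex. *)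
pose b' := upd (upd b j (b i + b j)) i u.
pose d' := fun l => if l == i then (dotv g u)^-1 *: g else d l - (dotv (d l) u / dotv g u) *: g.
pose c' := upd (upd c j (midc c)) i 1.
pose s' := upd s F t.
have gu : dotv g u != 0 by rewrite gt_eqF.
have bd' : dualb b' d'.
  move=> p q; rewrite /d' /b'; have [->|qi] := eqVneq q i.
    rewrite upd_eq; have [_|pi] := eqVneq p i; first by rewrite dotvZl mulVf.
    by rewrite dotvDl dotvNl dotvZl divfK // subrr.
  rewrite upd_ne //; have [->|qj] := eqVneq q j.
    rewrite upd_eq; have [->|pi] := eqVneq p i.
      by rewrite (negbTE ij) dotvZl dotvDr g_bi g_bj subrr mulr0.
    rewrite dotvDl dotvNl dotvZl !dotvDr g_bi g_bj subrr mulr0 subr0 !bd (negbTE pi).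
    by rewrite add0r.
  have gq : dotv g (b q) = 0.
    by rewrite g_b eq_sym (negbTE qi) [j == q]eq_sym (negbTE qj) subrr.
  rewrite upd_ne //; have [->|pi] := eqVneq p i.
    by rewrite dotvZl gq mulr0 eq_sym (negbTE qi).
  by rewrite dotvDl dotvNl dotvZl gq mulr0 subr0 bd.
have k'i : kap' i = F by rewrite /kap' upd_eq.
have k'l l : l != i -> kap' l = kap l by move=> li; rewrite /kap' upd_ne.
have sumF : bsum kap' F b' = u.
  rewrite /bsum (bigD1 i) /=; last by rewrite k'i.
  rewrite /b' upd_eq big1 ?addr0 // => l /andP[lF li].
  by move: lF; rewrite k'l // (negbTE (kF l)).
have sumk l : bsum kap' (kap l) b' = bsum kap (kap l) b.
  rewrite /bsum big_mkcond (bigD1 i) //= k'i eq_sym (negbTE (kF l)) add0r.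
  rewrite [RHS]big_mkcond [RHS](bigD1 i) //= [LHS](bigD1 j) //=; last by rewrite ji.
  rewrite [X in _ = _ + X](bigD1 j) //=; last by rewrite ji.
  rewrite addrA; congr (_ + _).
    rewrite k'l; last by rewrite ji.
    rewrite /b' upd_ne; last by rewrite ji.
    by rewrite upd_eq kij; case: eqP => // _; rewrite addr0.
  apply: eq_bigr => m /andP[mi mj].
  by rewrite k'l // /b' upd_ne // upd_ne.
have b'i : b' i = u by rewrite /b' upd_eq.
have b'j : b' j = b i + b j by rewrite /b' upd_ne ?ji // upd_eq.
have b'l l : l != i -> l != j -> b' l = b l by move=> li lj; rewrite /b' upd_ne // upd_ne.
have c'i : c' i = 1 by rewrite /c' upd_eq.
have c'j : c' j = midc c by rewrite /c' upd_ne ?ji // upd_eq.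
have c'l l : l != i -> l != j -> c' l = c l by move=> li lj; rewrite /c' upd_ne // upd_ne.
have -> : hull (equator_points c s (midc c) `|` [set u; - (t *: u)]) = joinset b' kap' c' s'.
  have Ai : joinset b' kap' c' s' u.
    by have := join_inc b' kap' c' s' i; rewrite c'i b'i scale1r.
  have Aj : joinset b' kap' c' s' (midc c *: (b i + b j)).
    by have := join_inc b' kap' c' s' j; rewrite c'j b'j.
  have As l : s' (kap l) = s (kap l) by rewrite /s' upd_ne.
  apply/seteqP; split.
    apply: hull_min; first exact: hull_convex.
    move=> x [[[[->|[l [li lj ->]]]|[l ->]]|->]|[->|->]] //.
    - exact: join_in0.
    - by have := join_inc b' kap' c' s' l; rewrite c'l // b'l.
    - have [li|li] := eqVneq l i; last first.
        by have := join_ins b' kap' c' s' l; rewrite k'l // sumk As.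
      have := join_ins b' kap' c' s' j; rewrite k'l ?ji // sumk As li kij //.
    - by have := join_ins b' kap' c' s' i; rewrite k'i sumF /s' upd_eq.
  apply: join_min; first exact: hull_convex.
  - by apply: sub_cv; left; left; left; left.
  - move=> l; have [->|li] := eqVneq l i.
      by rewrite c'i b'i scale1r; apply: sub_cv; right; left.
    have [->|lj] := eqVneq l j; first by rewrite c'j b'j; apply: sub_cv; left; right.
    by rewrite c'l // b'l //; apply: sub_cv; left; left; left; right; exists l.
  - move=> l; have [->|li] := eqVneq l i.
      by rewrite k'i sumF /s' upd_eq; apply: sub_cv; right; right.
    by rewrite k'l // sumk As; apply: sub_cv; left; left; right; exists l.
apply: (IHk _ bd'); last 2 first.
- by apply: upd_gt0 => //; apply: upd_gt0 => //; exact: midc_gt0.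
- exact: upd_gt0.
apply: proper_card; apply/properP; split.
  apply/fintype.subsetP => l; rewrite !inE => /existsP[m /andP[ml]].
  have [->|li] := eqVneq l i; first by move=> _; apply/existsP; exists j; rewrite ji kij eqxx.
  rewrite (k'l _ li); have [mi|mi] := eqVneq m i.
    by rewrite mi k'i eq_sym (negbTE (kF l)).
  by rewrite (k'l _ mi) => e; apply/existsP; exists m; rewrite ml.
exists i; rewrite !inE; first by apply/existsP; exists j; rewrite ji kij eqxx.
apply/negP => /existsP[m /andP[mi]]; rewrite k'i k'l // (negbTE (kF m)) //.
Qed.

(** The section depends on [c i] and [c j] only through [midc], that is, through the sum of
    reciprocals; with the section unchanged, [bipyr_scale] allows the two apexes to be rescaled. *)
Lemma pair_move c s c' : (forall l, 0 < c l) -> (forall k, 0 < s k) ->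
  (forall l, 0 < c' l) -> (forall l, l != i -> l != j -> c' l = c l) ->
  (c' i)^-1 + (c' j)^-1 = (c i)^-1 + (c j)^-1 ->
  nu (joinset b kap c s) = nu (joinset b kap c' s).
Proof.
move=> c0 s0 c0' cc e.
have em : midc c' = midc c.
  have m1 (x : 'I_n -> R) : (forall l, 0 < x l) -> midc x = ((x i)^-1 + (x j)^-1)^-1.
    move=> x0; rewrite /midc; field; have := x0 i; have := x0 j => h1 h2.
    by rewrite !gt_eqF // addr_gt0.
  by rewrite !m1 // e.
have eQ : equator c' s = equator c s.
  rewrite /equator !join_cap // em; congr hull; rewrite /equator_points.
  congr (_ `|` _ `|` _ `|` _); apply/seteqP; split=> x [l [li lj ->]]; exists l; split=> //.
    by rewrite cc.
  by rewrite cc.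
rewrite !join_br // eQ.
have bQ := equator_equatorial c0 s0.
have ci : c' i *: b i = (c' i / c i) *: (c i *: b i) by rewrite scalerA divfK ?gt_eqF.
have cj : c' j *: b j = (c' j / c j) *: (c j *: b j) by rewrite scalerA divfK ?gt_eqF.
rewrite ci cj; apply: (bipyr_scale val bQ); rewrite -?ci -?cj.
- by move=> u t; exact: equator_segment.
- exact: join_uv.
- by rewrite join_cross //; exact: equator_mid.
- exact: divr_gt0.
- exact: divr_gt0.
- by rewrite join_cross // -eQ; exact: equator_mid.
Qed.

End Pair.
End Block.
End Contra.

Arguments join_in0 {R n} b kap c s.
Arguments join_inc {R n} b kap c s l.
Arguments join_ins {R n} b kap c s l.

Lemma upd_upd (T : eqType) S (f : T -> S) a v w : upd (upd f a v) a w = upd f a w.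
Proof. by apply/funext => x; rewrite /upd; case: eqP. Qed.

Lemma rank2_mul (R : realType) n (u1 u2 v1 v2 x : 'cV[R]_n) :
  (1%:M + u1 *m v1^T + u2 *m v2^T) *m x = x + dotv v1 x *: u1 + dotv v2 x *: u2.
Proof.
have D (u v : 'cV[R]_n) : u *m v^T *m x = dotv v x *: u.
  have -> : u *m v^T *m x = u *m (dotv v x)%:M.
    rewrite -mulmxA; congr (_ *m _); apply/matrixP => p q; rewrite !ord1 !mxE eqxx mulr1n.
    by apply: eq_bigr => k _; rewrite !mxE.
  by rewrite mul_mx_scalar.
by rewrite !mulmxDl mul1mx !D.
Qed.

Lemma rank1_mul (R : realType) n (u v x : 'cV[R]_n) :
  (1%:M + u *m v^T) *m x = x + dotv v x *: u.
Proof. by have := rank2_mul u 0 v 0 x; rewrite mul0mx addr0 dotv0l scale0r addr0. Qed.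

Section Blocks.
Variables (R : realType) (n : nat).
Implicit Types (b d : 'I_n -> 'cV[R]_n) (c : 'I_n -> R) (s : nat -> R) (y h : 'cV[R]_n).

(** The simplex of a block has its negative vertex as one more vertex; this change of basis lets it
    exchange roles with the vertex of [j]. *)
Definition swap_basis kap j b := upd b j (- bsum kap (kap j) b).
Definition swap_dual (kap : 'I_n -> nat) j d l : 'cV[R]_n :=
  if l == j then - d j else if kap l == kap j then d l - d j else d l.

Lemma rebase_dual kap j b d : dualb b d -> dualb (swap_basis kap j b) (swap_dual kap j d).
Proof.
move=> bd p q; rewrite /swap_basis /swap_dual; have [->|qj] := eqVneq q j.
  rewrite upd_eq dotvNr; have [_|pj] := eqVneq p j.
    by rewrite dotvNl opprK (dot_bsum _ _ _ bd) eqxx.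
  case: ifP => pk; rewrite ?dotvDl ?dotvNl !(dot_bsum _ _ _ bd) pk ?eqxx ?subrr oppr0 //.
rewrite upd_ne //; have [->|pj] := eqVneq p j.
  by rewrite dotvNl bd eq_sym (negbTE qj) oppr0.
by case: ifP => _; rewrite ?dotvDl ?dotvNl !bd // [j == q]eq_sym (negbTE qj) subr0.
Qed.

Lemma rebase_sum kap j b : bsum kap (kap j) (swap_basis kap j b) = - b j.
Proof. by rewrite /swap_basis bsum_upd // addrA subrr add0r. Qed.

Lemma rebase_join kap j b c s :
  joinset b kap c s = joinset (swap_basis kap j b) kap (upd c j (s (kap j))) (upd s (kap j) (c j)).
Proof.
have sn l : kap l != kap j -> bsum kap (kap l) (swap_basis kap j b) = bsum kap (kap l) b.
  by move=> lj; rewrite /swap_basis bsum_upd_ne // eq_sym.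
apply: join_eq => l.
- have [->|lj] := eqVneq l j.
    have := join_ins (swap_basis kap j b) kap (upd c j (s (kap j))) (upd s (kap j) (c j)) j.
    by rewrite rebase_sum upd_eq scalerN opprK.
  have := join_inc (swap_basis kap j b) kap (upd c j (s (kap j))) (upd s (kap j) (c j)) l.
  by rewrite /swap_basis !upd_ne.
- have [->|lj] := eqVneq (kap l) (kap j).
    have := join_inc (swap_basis kap j b) kap (upd c j (s (kap j))) (upd s (kap j) (c j)) j.
    by rewrite /swap_basis !upd_eq scalerN.
  have := join_ins (swap_basis kap j b) kap (upd c j (s (kap j))) (upd s (kap j) (c j)) l.
  by rewrite sn // upd_ne.
- have [->|lj] := eqVneq l j.
    by rewrite /swap_basis !upd_eq scalerN; exact: join_ins.
  by rewrite /swap_basis !upd_ne //; exact: join_inc.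
- have [->|lj] := eqVneq (kap l) (kap j).
    by rewrite rebase_sum upd_eq scalerN opprK; exact: join_inc.
  by rewrite sn // upd_ne //; exact: join_ins.
Qed.

Variable nu : set 'cV[R]_n -> 'cV[R]_n.
Hypothesis val : valuation nu.
Hypothesis contra : SL_contravariant nu.
Variables (kap : 'I_n -> nat).
Hypothesis IHk : forall kap', (nonsingle kap' < nonsingle kap)%N ->
  forall b d c s, dualb b d -> (forall i, 0 < c i) -> (forall j, 0 < s j) ->
    nu (joinset b kap' c s) = 0.

(** After the exchange by [swap_basis] the negative vertex is the vertex of index [j], and
    [pair_move] applies to it. *)
Lemma move_z b d i j c s (x y : R) : dualb b d -> i != j -> kap i = kap j ->
  (forall l, 0 < c l) -> (forall k, 0 < s k) -> 0 < x -> 0 < y ->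
  x^-1 + y^-1 = (c i)^-1 + (s (kap i))^-1 ->
  nu (joinset b kap c s) = nu (joinset b kap (upd c i x) (upd s (kap i) y)).
Proof.
move=> bd ij kij c0 s0 x0 y0 e.
rewrite (rebase_join kap j b c s) (rebase_join kap j b (upd c i x)).
rewrite kij upd_eq upd_upd (upd_ne c x (_ : j != i)); last by rewrite eq_sym.
apply: (pair_move val IHk (rebase_dual kap j bd) ij kij) => //.
- exact: upd_gt0.
- exact: upd_gt0.
- by apply: upd_gt0 => //; exact: upd_gt0.
- move=> l li lj; rewrite !upd_ne //.
- by rewrite !upd_eq !(upd_ne _ _ ij) upd_eq -kij.
Qed.

Section Pair.
Variables (b d : 'I_n -> 'cV[R]_n) (i j : 'I_n).
Hypothesis bd : dualb b d.
Hypothesis ij : i != j.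
Hypothesis kij : kap i = kap j.
Let g := d i - d j.
Let z := - bsum kap (kap i) b.

Let ji : j != i.
Proof. by rewrite eq_sym. Qed.

Definition cyc : 'M[R]_n := 1%:M + (b j - b i) *m (d i)^T + (z - b j) *m (d j)^T.

Lemma cyc_det : \det cyc = 1.
Proof.
rewrite det_rank2 !dotvDr !dotvNr !(dot_bsum _ _ _ bd) !bd !eqxx (negbTE ij) (negbTE ji) -kij eqxx.
by rewrite ?mulr0n ?mulr1n; ring.
Qed.

Lemma cyc_mul x : cyc *m x = x + dotv (d i) x *: (b j - b i) + dotv (d j) x *: (z - b j).
Proof. exact: rank2_mul. Qed.

Lemma cyc_i : cyc *m b i = b j.
Proof.
by rewrite cyc_mul !bd eqxx (negbTE ji) scale0r addr0 scale1r addrC subrK.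
Qed.

Lemma cyc_j : cyc *m b j = z.
Proof. by rewrite cyc_mul !bd eqxx (negbTE ij) scale0r addr0 scale1r addrC subrK. Qed.

Lemma cyc_l l : l != i -> l != j -> cyc *m b l = b l.
Proof.
move=> li lj; rewrite cyc_mul !bd eq_sym (negbTE li) [j == l]eq_sym (negbTE lj).
by rewrite !scale0r !addr0.
Qed.

Lemma cyc_sum : bsum kap (kap i) (fun l => cyc *m b l) = - b i.
Proof.
rewrite /bsum -mulmx_sumr cyc_mul -/(bsum kap (kap i) b) !(dot_bsum _ _ _ bd) -kij eqxx.
by rewrite !scale1r /z; set S := bsum _ _ _; apply/matrixP => p q; rewrite !mxE; ring.
Qed.

Lemma cyc_sum_ne k : kap i != k -> bsum kap k (fun l => cyc *m b l) = bsum kap k b.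
Proof.
move=> ne; rewrite /bsum -mulmx_sumr cyc_mul -/(bsum kap k b) !(dot_bsum _ _ _ bd) -kij.
by rewrite (negbTE ne) !scale0r !addr0.
Qed.

Lemma cyc_join c s : mulmx cyc @` joinset b kap c s =
  joinset b kap (upd (upd c i (s (kap i))) j (c i)) (upd s (kap i) (c j)).
Proof.
rewrite joinset_img; set c' := upd _ _ _; set s' := upd _ _ _.
have c'i : c' i = s (kap i) by rewrite /c' upd_ne // upd_eq.
have c'j : c' j = c i by rewrite /c' upd_eq.
have c'l l : l != i -> l != j -> c' l = c l by move=> li lj; rewrite /c' upd_ne // upd_ne.
have s'i : s' (kap i) = c j by rewrite /s' upd_eq.
apply: join_eq => l.
- have [->|li] := eqVneq l i; first by rewrite cyc_i -c'j; exact: join_inc.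
  have [->|lj] := eqVneq l j; last by rewrite cyc_l // -c'l //; exact: join_inc.
  by rewrite cyc_j /z scalerN -s'i; exact: join_ins.
- have [->|lk] := eqVneq (kap l) (kap i).
    by rewrite cyc_sum scalerN opprK -c'i; exact: join_inc.
  rewrite cyc_sum_ne ?[kap i == _]eq_sym // -(upd_ne s (c j) lk); exact: join_ins.
- have [->|li] := eqVneq l i.
    rewrite c'i -[b i]opprK -cyc_sum scalerN.
    exact: (join_ins (fun l => cyc *m b l) kap c s).
  have [->|lj] := eqVneq l j.
    by rewrite c'j -cyc_i; exact: (join_inc (fun l => cyc *m b l)).
  by rewrite c'l // -[b l]cyc_l //; exact: (join_inc (fun l => cyc *m b l)).
- have [->|lk] := eqVneq (kap l) (kap i).
    by rewrite s'i -scalerN -/z -cyc_j; exact: (join_inc (fun l => cyc *m b l)).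
  rewrite -cyc_sum_ne ?[kap i == _]eq_sym // /s' upd_ne //.
  exact: (join_ins (fun l => cyc *m b l)).
Qed.

(** The 3-cycle merely permutes the lengths of three vertices. Exchanging two lengths preserves the
    sum of their reciprocals, so [pair_move] and [move_z] undo the permutation. *)
Lemma cyc_nu c s : (forall l, 0 < c l) -> (forall k, 0 < s k) ->
  nu (mulmx cyc @` joinset b kap c s) = nu (joinset b kap c s).
Proof.
move=> c0 s0; rewrite cyc_join.
pose c1 := upd (upd c i (c j)) j (c i).
have c10 : forall l, 0 < c1 l by apply: upd_gt0 => //; exact: upd_gt0.
have -> : nu (joinset b kap c s) = nu (joinset b kap c1 s).
  apply: (pair_move val IHk bd ij kij) => //.
    by move=> l li lj; rewrite /c1 !upd_ne.
  by rewrite /c1 upd_eq (upd_ne _ _ ij) upd_eq addrC.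
have e1 : c1 i = c j by rewrite /c1 (upd_ne _ _ ij) upd_eq.
rewrite (@move_z _ _ i j c1 s (s (kap i)) (c j) bd ij kij) ?e1 //; last by rewrite addrC.
congr (nu (joinset _ _ _ _)); apply/funext => l; rewrite /c1.
have [->|li] := eqVneq l i; first by rewrite (upd_ne _ _ ij) !upd_eq.
have [e|lj] := eqVneq l j; first by rewrite e (upd_ne _ _ ji) !upd_eq.
by rewrite !upd_ne.
Qed.

Lemma cyc_dot c s x : (forall l, 0 < c l) -> (forall k, 0 < s k) ->
  dotv (nu (joinset b kap c s)) (cyc *m x) = dotv (nu (joinset b kap c s)) x.
Proof.
move=> c0 s0; rewrite -{1}cyc_nu // contra_dot //; first exact: cyc_det.
exact: joinset_Pno bd c0 s0.
Qed.

End Pair.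

(** By invariance under the 3-cycles the value pairs equally with all basis vectors of the block and
    with minus their sum; a block of [m] indices thus gives [m + 1] times the pairing equal to 0. *)
Lemma block_dot b d i j c s : dualb b d -> (forall l, 0 < c l) -> (forall k, 0 < s k) ->
  i != j -> kap i = kap j -> dotv (nu (joinset b kap c s)) (b i) = 0.
Proof.
move=> bd c0 s0 ij kij; set v := nu _.
have e l : l != i -> kap l = kap i -> dotv v (b l) = dotv v (b i).
  move=> li kl; have il : i != l by rewrite eq_sym.
  by rewrite -(cyc_i bd il) (cyc_dot bd il (esym kl)).
have ez : dotv v (- bsum kap (kap i) b) = dotv v (b i).
  rewrite -(cyc_j bd ij) (cyc_dot bd ij kij) // e //; by rewrite eq_sym.
have es : dotv v (bsum kap (kap i) b) = #|[pred l | kap l == kap i]|%:R * dotv v (b i).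
  rewrite /bsum dotv_sumr mulr_natl -sumr_const; apply: eq_bigr => l /eqP kl.
  by have [->//|li] := eqVneq l i; exact: e.
move: ez; rewrite dotvNr es => ez.
have : (#|[pred l | kap l == kap i]|%:R + 1) * dotv v (b i) = 0 by rewrite mulrDl mul1r -[X in _ + X]ez subrr.
move=> /eqP; rewrite mulf_eq0 => /orP[|/eqP //].
by rewrite natr1 pnatr_eq0.
Qed.

Section Scalar.
Variables (y : 'cV[R]_n) (i j : 'I_n).
Hypothesis ij : i != j.
Hypothesis kij : kap i = kap j.
Let lam P := dotv (nu P) y.

Let ji : j != i.
Proof. by rewrite eq_sym. Qed.

Lemma lam_inv phi P : \det phi = 1 -> Pno P -> phi *m y = y -> lam (mulmx phi @` P) = lam P.
Proof. by move=> d1 PP e; rewrite /lam -{1}e contra_dot. Qed.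

Lemma lam_val : valuation lam.
Proof. exact: valuation_dot. Qed.

Section Base.
Variables (b d : 'I_n -> 'cV[R]_n) (c : 'I_n -> R) (s : nat -> R).
Hypothesis bd : dualb b d.
Hypothesis c0 : forall l, 0 < c l.
Hypothesis s0 : forall k, 0 < s k.
Hypothesis dy : forall l, kap l = kap i -> dotv (d l) y = 0.
Let g := d i - d j.
Let Q := equator kap b d i j c s.
Let z := - bsum kap (kap i) b.
Let k := kap i.

Lemma lam_Z : forall u (t : R), 0 < dotv g u -> 0 < t -> lam (bipyr Q u (- (t *: u))) = 0.
Proof.
by move=> u t u0 t0; rewrite /lam (equator_segment IHk bd ij kij c0 s0 u0 t0) dotv0l.
Qed.

Let bQ : equatorial g Q.
Proof. exact: (equator_equatorial kap i j bd c0 s0). Qed.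

Let gi : dotv g (b i) = 1.
Proof. exact: (g_bi bd ij). Qed.

Let gj : dotv g (b j) = -1.
Proof. exact: (g_bj bd ij). Qed.

(** Increment of [lam] when one direction is displaced by [h] parallel to [g = 0]. Shears make it
    independent of the starting direction, hence additive ([delta_add]). *)
Definition delta h := bipyr_diff lam Q (b i) (b i - h).

Lemma delta_pair : delta (b i + b j) = lam (joinset b kap c s).
Proof.
have -> : delta (b i + b j) = bipyr_diff lam Q (b i) (- b j).
  by rewrite /delta opprD addrA subrr add0r.
rewrite -(bipyr_diffE lam_val bQ lam_Z (a := c i) (b := c j)) //.
- by rewrite scalerN opprK -(join_br bd kij c0 s0).
- by rewrite dotvNr gj opprK.
- by rewrite opprK; exact: (equator_mid bd ij kij c0 s0).
Qed.

(** The shear adding [g(x) h] to [x] fixes the equator pointwise and moves both directions by [h].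
    It fixes [y], whose coordinates in the block vanish, and therefore preserves [lam]. *)
Lemma shear_Dl h r r' : dotv g h = 0 -> dotv g r = 1 -> dotv g r' = 1 ->
  bipyr_diff lam Q (r + h) (r' + h) = bipyr_diff lam Q r r'.
Proof.
move=> h0 r1 r1'; rewrite /bipyr_diff.
have -> : r + h - (r' + h) = r - r' by rewrite opprD addrACA subrr addr0.
set t := tau _ _.
have [t0 Qt] : 0 < t /\ Q ((t / 2) *: (r - r')).
  by apply: (tauP bQ); rewrite dotvDr dotvNr r1 r1' subrr.
pose phi := 1%:M + h *m g^T.
have phiE x : phi *m x = x + dotv g x *: h by exact: rank1_mul.
rewrite -(@lam_inv phi (bipyr Q (t *: r) _)).
- congr lam; rewrite /bipyr -hull_img !image_setU !image_set1 !phiE.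
  rewrite dotvNr !dotvZr r1 r1' !mulr1 -!scalerDr scaleNr -opprD -scalerDr.
  congr (hull (_ `|` _)); apply/seteqP; split=> x.
    by move=> Qx; exists x => //; rewrite phiE (baseQ_zero bQ Qx) scale0r addr0.
  by move=> [x' Qx <-]; rewrite phiE (baseQ_zero bQ Qx) scale0r addr0.
- by rewrite det_rank1 h0 addr0.
- by apply: (bipyr_Pno bQ); apply: dir_side.
- rewrite phiE dotvDl dotvNl !dy ?subrr ?scale0r ?addr0 //.
Qed.

Lemma delta_add h h' : dotv g h = 0 -> dotv g h' = 0 -> delta (h + h') = delta h + delta h'.
Proof.
move=> h0 h0'.
have g1 x : dotv g x = 0 -> dotv g (b i - x) = 1 by move=> x0; rewrite dotvDr dotvNr gi x0 subr0.
rewrite /delta (bipyr_diff_cocycle lam_val bQ lam_Z (r' := b i - h)) ?g1 //; last first.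
  by rewrite dotvDr h0 h0' addr0.
congr (_ + _); rewrite -(@shear_Dl h (b i - h)) ?g1 //; last by rewrite dotvDr h0 h0' addr0.
by rewrite subrK opprD addrA addrAC subrK.
Qed.

Lemma delta0 : delta 0 = 0.
Proof. by rewrite /delta subr0 (bipyr_diff0 bQ lam_Z). Qed.

Let bs := edgeb i j 1 1 b.
Let ds := edged i j 1 1 d.

Lemma bsj : bs j = b i + b j.
Proof. by rewrite /bs /edgeb eqxx !scale1r. Qed.

Lemma bsl l : l != j -> bs l = b l.
Proof. by rewrite /bs /edgeb => /negbTE ->. Qed.

Lemma bs_dual : dualb bs ds.
Proof. exact: edge_dual. Qed.

Lemma bs_upd : bs = upd b j (b i + b j).
Proof.
by apply/funext => l; rewrite /upd; have [->|lj] := eqVneq l j; [exact: bsj|exact: bsl].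
Qed.

Lemma bs_sum : bsum kap k bs = bsum kap k b + b i.
Proof. by rewrite bs_upd bsum_upd ?addrK. Qed.

Lemma bs_sum_ne k' : k != k' -> bsum kap k' bs = bsum kap k' b.
Proof. by move=> ne; rewrite bs_upd bsum_upd_ne // -kij. Qed.

(** Sends [b i], [b j], [z] to [z - b i], [b i], [b i + b j]: the vertex directions of the block for
    [b] go to those of the block for [bs]. *)
Definition swp : 'M[R]_n := 1%:M + (z - (b i + b i)) *m (d i)^T + (b i - b j) *m (d j)^T.

Lemma swp_det : \det swp = 1.
Proof.
rewrite det_rank2 !dotvDr !dotvNr !(dot_bsum _ _ _ bd) !dotvDr !bd !eqxx (negbTE ij) (negbTE ji) -kij eqxx.
by rewrite ?mulr0n ?mulr1n; ring.
Qed.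

Lemma swp_mul x : swp *m x = x + dotv (d i) x *: (z - (b i + b i)) + dotv (d j) x *: (b i - b j).
Proof. exact: rank2_mul. Qed.

Lemma swp_i : swp *m b i = z - b i.
Proof.
by rewrite swp_mul !bd eqxx (negbTE ji) scale0r addr0 scale1r addrC opprD addrA subrK.
Qed.

Lemma swp_j : swp *m b j = b i.
Proof. by rewrite swp_mul !bd eqxx (negbTE ij) scale0r addr0 scale1r addrC subrK. Qed.

Lemma swp_l l : l != i -> l != j -> swp *m b l = b l.
Proof.
move=> li lj; rewrite swp_mul !bd eq_sym (negbTE li) [j == l]eq_sym (negbTE lj).
by rewrite !scale0r !addr0.
Qed.

Lemma swp_sum : bsum kap k (fun l => swp *m b l) = - (b i + b j).
Proof.
rewrite /bsum -mulmx_sumr swp_mul -/(bsum kap k b) !(dot_bsum _ _ _ bd) -kij eqxx.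
by rewrite !scale1r /z /k; set S := bsum _ _ _; apply/matrixP => p q; rewrite !mxE; ring.
Qed.

Lemma swp_sum_ne k' : k != k' -> bsum kap k' (fun l => swp *m b l) = bsum kap k' b.
Proof.
move=> ne; rewrite /bsum -mulmx_sumr swp_mul -/(bsum kap k' b) !(dot_bsum _ _ _ bd) -kij.
by rewrite -/k (negbTE ne) !scale0r !addr0.
Qed.

Lemma swp_join : mulmx swp @` joinset b kap c s =
  joinset bs kap (upd (upd c i (c j)) j (s k)) (upd s k (c i)).
Proof.
rewrite joinset_img; set c' := upd _ _ _; set s' := upd _ _ _.
have c'i : c' i = c j by rewrite /c' upd_ne // upd_eq.
have c'j : c' j = s k by rewrite /c' upd_eq.
have c'l l : l != i -> l != j -> c' l = c l by move=> li lj; rewrite /c' upd_ne // upd_ne.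
have s'i : s' k = c i by rewrite /s' upd_eq.
have zs : z - b i = - bsum kap k bs by rewrite bs_sum opprD.
apply: join_eq => l.
- have [->|li] := eqVneq l i.
    by rewrite swp_i zs scalerN -s'i; exact: join_ins.
  have [->|lj] := eqVneq l j; first by rewrite swp_j -c'i -bsl //; exact: join_inc.
  by rewrite swp_l // -c'l // -bsl //; exact: join_inc.
- have [->|lk] := eqVneq (kap l) (kap i).
    by rewrite -/k swp_sum scalerN opprK -c'j -bsj; exact: join_inc.
  rewrite swp_sum_ne ?[k == _]eq_sym // -(upd_ne s (c i) lk) -bs_sum_ne ?[k == _]eq_sym //.
  exact: join_ins.
- have [->|li] := eqVneq l i.
    by rewrite c'i bsl // -swp_j; exact: (join_inc (fun l => swp *m b l)).
  have [->|lj] := eqVneq l j.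
    rewrite c'j bsj -[b i + b j]opprK -swp_sum scalerN.
    exact: (join_ins (fun l => swp *m b l) kap c s i).
  by rewrite c'l // bsl // -[b l]swp_l //; exact: (join_inc (fun l => swp *m b l)).
- have [->|lk] := eqVneq (kap l) (kap i).
    by rewrite -/k s'i -scalerN -zs -swp_i; exact: (join_inc (fun l => swp *m b l)).
  rewrite bs_sum_ne ?[k == _]eq_sym // -swp_sum_ne ?[k == _]eq_sym // /s' upd_ne //.
  exact: (join_ins (fun l => swp *m b l)).
Qed.

(** The bipyramid defining the increment is a join for the basis [bs]. The map [swp] carries the
    original join to one for [bs] with other lengths, and two moves preserving sums of reciprocals
    reconcile the lengths. *)
Lemma delta_z : delta z = lam (joinset b kap c s).
Proof.
have sk : 0 < s k by [].
have sk2 : 0 < 2 * s k by rewrite mulr_gt0.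
have gz : dotv g z = 0 by rewrite dotvNr (g_sum bd kij) oppr0.
have Qz : Q (s k *: z).
  split; first by rewrite /z scalerN; exact: join_ins.
  by rewrite /= dotvZr gz mulr0.
have e2 : 2 * s k * (2 * s k) / (2 * s k + 2 * s k) = s k.
  by field; rewrite gt_eqF // addr_gt0.
(* With both scales equal to [2 * s k] the apexes cross exactly at the negative vertex
   [s k *: z]. *)
rewrite /delta -(bipyr_diffE lam_val bQ lam_Z (a := 2 * s k) (b := 2 * s k)) //; last 2 first.
- by rewrite dotvDr dotvNr gi gz subr0.
- by rewrite e2 subKr.
pose m := midc i j c.
have m0 : 0 < m by exact: midc_gt0.
pose cs := upd (upd c i (2 * s k)) j m; pose ss := upd s k (2 * s k).
have zs : z - b i = - bsum kap k bs by rewrite bs_sum opprD.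
have csi : cs i = 2 * s k by rewrite /cs upd_ne // upd_eq.
have csj : cs j = m by rewrite /cs upd_eq.
have csl l : l != i -> l != j -> cs l = c l by move=> li lj; rewrite /cs upd_ne // upd_ne.
have -> : bipyr Q ((2 * s k) *: b i) (- ((2 * s k) *: (b i - z))) = joinset bs kap cs ss.
  have Ju : joinset bs kap cs ss ((2 * s k) *: b i).
    by rewrite -csi -(bsl ij); exact: join_inc.
  have Jv : joinset bs kap cs ss (- ((2 * s k) *: (b i - z))).
    rewrite -scalerN opprB zs scalerN -[2 * s k](upd_eq s k); exact: (join_ins bs kap cs ss i).
  apply/seteqP; split.
    apply: hull_min; first exact: hull_convex.
    move=> x [Qx|[->|->]] //; move: x Qx.
    rewrite /Q /equator (join_cap bd ij kij c0 s0); apply: hull_min; first exact: hull_convex.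
    move=> x [[[->|[l [li lj ->]]]|[l ->]]|->].
    - exact: join_in0.
    - by rewrite -csl // -bsl //; exact: join_inc.
    - have [->|lk] := eqVneq (kap l) k.
        have -> : - (s k *: bsum kap k b) = 2^-1 *: ((2 * s k) *: b i) + 2^-1 *: (- ((2 * s k) *: (b i - z))).
          rewrite -scalerN -/z -scalerDr -scalerBr subKr scalerA; congr (_ *: _).
          by field.
        by apply: hull_convex; rewrite ?invr_ge0 ?ler0n //; field.
      rewrite -(upd_ne s (2 * s k) lk) -bs_sum_ne ?[k == _]eq_sym //; exact: join_ins.
    - by rewrite -bsj -/m -csj; exact: join_inc.
  apply: join_min; first exact: hull_convex.
  - by apply: sub_cv; left; exact: (baseQ0 bQ).
  - move=> l; have [->|li] := eqVneq l i.
      by rewrite csi (bsl ij); apply: sub_cv; right; left.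
    have [->|lj] := eqVneq l j.
      rewrite csj bsj; apply: sub_cv; left; exact: (equator_mid bd ij kij c0 s0).
    rewrite csl // bsl //; apply: sub_cv; left; split; first exact: join_inc.
    rewrite /= dotvZr (g_b _ _ bd) eq_sym (negbTE li) [j == l]eq_sym (negbTE lj).
    by rewrite subrr mulr0.
  - move=> l; have [->|lk] := eqVneq (kap l) k.
      rewrite /ss upd_eq -[- (_ *: bsum _ _ _)]scalerN -zs -[z - _]opprB scalerN.
      by apply: sub_cv; right; right.
    rewrite /ss upd_ne // bs_sum_ne ?[k == _]eq_sym //; apply: sub_cv; left; split.
      exact: join_ins.
    by rewrite /= dotvNr dotvZr (g_sum bd kij) mulr0 oppr0.
rewrite -[RHS](lam_inv (phi := swp)) ?swp_det //; last 2 first.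
- exact: (joinset_Pno kap bd c0 s0).
- by rewrite swp_mul !dy // !scale0r !addr0.
rewrite swp_join /lam; congr (dotv _ _).
have ci := c0 i; have cj := c0 j.
set c1 := upd (upd c i (c j)) j (s k); set s1 := upd s k (c i).
(* Intermediate length at [j]: it balances the reciprocals both in the move between [i] and [j] and
   in the next one, between [j] and the negative vertex. *)
pose w := ((c j)^-1 + (2 * s k)^-1)^-1.
have w0 : 0 < w by rewrite invr_gt0 addr_gt0 ?invr_gt0.
pose c2 := upd (upd c i (2 * s k)) j w.
have c10 : forall l, 0 < c1 l by apply: upd_gt0 => //; exact: upd_gt0.
have s10 : forall l, 0 < s1 l by exact: upd_gt0.
have c20 : forall l, 0 < c2 l by apply: upd_gt0 => //; exact: upd_gt0.
have c1i : c1 i = c j by rewrite /c1 upd_ne // upd_eq.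
have c1j : c1 j = s k by rewrite /c1 upd_eq.
have c2i : c2 i = 2 * s k by rewrite /c2 upd_ne // upd_eq.
have c2j : c2 j = w by rewrite /c2 upd_eq.
have s1k : s1 (kap j) = c i by rewrite -kij /s1 upd_eq.
have -> : nu (joinset bs kap c1 s1) = nu (joinset bs kap c2 s1).
  apply: (pair_move val IHk bs_dual ij kij) => //.
    by move=> l li lj; rewrite /c1 /c2 !upd_ne.
  by rewrite c1i c1j c2i c2j /w invrK; field; rewrite !gt_eqF.
rewrite (@move_z _ _ j i c2 s1 m (2 * s k) bs_dual ji (esym kij)) //; last first.
  rewrite c2j s1k /w /m /midc invrK; field.
  by rewrite !gt_eqF // addr_gt0.
congr (nu (joinset _ _ _ _)).
  by rewrite /cs /c2 upd_upd.
by rewrite /ss /s1 -kij upd_upd.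
Qed.

End Base.

(** The additive [delta] takes one and the same value [D] at [b i + b j], at minus the block sum,
    and at each further [b l] of the block. These vectors sum to 0, so a positive multiple of [D]
    vanishes. *)
Lemma scalar_zero b d c s : dualb b d -> (forall l, 0 < c l) -> (forall k, 0 < s k) ->
  (forall l, kap l = kap i -> dotv (d l) y = 0) -> lam (joinset b kap c s) = 0.
Proof.
move=> bd c0 s0 dy; set D := lam _.
(* Exchanging [b l] with minus the block sum by [swap_basis] reduces the claim to [delta_z]. *)
have dl l : l != i -> l != j -> kap l = kap i -> delta b d c s (b l) = D.
  move=> li lj kl.
  have rbd := rebase_dual kap l bd.
  have c0' := upd_gt0 l c0 (s0 (kap l)).
  have s0' := upd_gt0 (kap l) s0 (c0 l).
  have := @delta_z _ _ _ _ rbd c0' s0'.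
  rewrite -rebase_join -/D => <-.
    rewrite -kl rebase_sum opprK /delta /equator -rebase_join.
    rewrite /swap_basis upd_ne 1?eq_sym // /swap_dual (negbTE (_ : i != l)) 1?eq_sym //.
    rewrite (negbTE (_ : j != l)) 1?eq_sym // -kij kl eqxx.
    by rewrite opprB addrA subrK.
  move=> m km; rewrite /swap_dual; case: eqP => [_|_]; first by rewrite dotvNl dy // oppr0.
  by case: ifP => _; rewrite ?dotvDl ?dotvNl !dy // subrr.
have g1 : dotv (d i - d j) (b i + b j) = 0 by rewrite dotvDr (g_bi bd ij) (g_bj bd ij) subrr.
have gz : dotv (d i - d j) (- bsum kap (kap i) b) = 0 by rewrite dotvNr (g_sum bd kij) oppr0.
pose P l := [&& l != i, l != j & kap l == kap i].
have gl l : P l -> dotv (d i - d j) (b l) = 0.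
  case/and3P=> li lj _; rewrite (g_b _ _ bd) eq_sym (negbTE li) [j == l]eq_sym (negbTE lj).
  by rewrite subrr.
have S : \sum_(l | P l) b l + (b i + b j + - bsum kap (kap i) b) = 0.
  have -> : bsum kap (kap i) b = b i + (b j + \sum_(l | P l) b l).
    rewrite /bsum (bigD1 i) //= (bigD1 j) /=; last by rewrite kij eqxx eq_sym.
    congr (_ + (_ + _)); apply: eq_bigl => l; rewrite /P.
    by case: (l == i); case: (l == j); rewrite ?andbF ?andbT.
  by set T := \sum_(_ | _) _; apply/matrixP => p q; rewrite !mxE; ring.
have dS (r : seq 'I_n) : delta b d c s (\sum_(l <- r | P l) b l) = (count P r)%:R * D /\
    dotv (d i - d j) (\sum_(l <- r | P l) b l) = 0.
  elim: r => [|l r [IH1 IH2]]; first by rewrite big_nil delta0 // mul0r dotv0r.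
  rewrite big_cons /=; case: ifP => Pl; last by rewrite add0n.
  split; last by rewrite dotvDr gl // IH2 addr0.
  rewrite delta_add // ?gl // IH1 dl; first by rewrite natrD mulrDl mul1r.
  - by case/and3P: Pl.
  - by case/and3P: Pl.
  - by case/and3P: Pl => _ _ /eqP.
have [h1 h2] := dS (index_enum 'I_n).
have := delta0 bd c0 s0; rewrite -[X in delta _ _ _ _ X]S.
rewrite delta_add //; last by rewrite dotvDr g1 gz addr0.
rewrite h1 delta_add // delta_pair // delta_z // -/D.
move=> e; have : ((count P (index_enum 'I_n))%:R + 2) * D = 0 by rewrite -e; ring.
move=> /eqP; rewrite mulf_eq0 => /orP[|/eqP //].
by rewrite -natrD pnatr_eq0 addn2.
Qed.

End Scalar.

End Blocks.

(** Induction on [nonsingle]: if two indices share a colour, the value is tested against every basis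
    vector, by [block_dot] inside that colour class and by [scalar_zero] outside it. *)
Lemma crosspolytopes_determine (R : realType) n (nu : set 'cV[R]_n -> 'cV[R]_n) :
  valuation nu -> SL_contravariant nu ->
  (forall b d kap c s, dualb b d -> injective kap -> (forall i, 0 < c i) ->
     (forall k, 0 < s k) -> nu (joinset b kap c s) = 0) ->
  forall P, Pno P -> nu P = 0.
Proof.
move=> val contra H; apply: joins_determine => // b d kap.
have [m] := ubnP (nonsingle kap); elim: m b d kap => // m IH b d kap hm c s bd c0 s0.
have IHk kap' : (nonsingle kap' < nonsingle kap)%N -> forall b d c s, dualb b d ->
    (forall i, 0 < c i) -> (forall j, 0 < s j) -> nu (joinset b kap' c s) = 0.
  move=> hk b' d' c' s' bd' c0' s0'; apply: (IH b' d') => //.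
  by apply: leq_trans hk _; rewrite -ltnS.
have [inj|ninj] := pselect (injective kap); first exact: H bd inj c0 s0.
have [i [j [ij kij]]] : exists i j, i != j /\ kap i = kap j.
  apply: contra_notP ninj => h i j e; apply/eqP; apply/negPn/negP => ij.
  by apply: h; exists i, j.
apply: (dot_zero bd) => l.
have [e|ne] := eqVneq (kap l) (kap i).
  have [->|li] := eqVneq l i; first exact: (block_dot val contra IHk bd c0 s0 ij kij).
  exact: (block_dot val contra IHk bd c0 s0 li e).
apply: (scalar_zero val contra IHk ij kij bd c0 s0) => p kp; rewrite bd.
by case: eqP => // e; rewrite -kp e eqxx in ne.
Qed.

Import numFieldNormedType.Exports.

(** * Change of variables in iterated integrals *)

Section Line.
Variable R : realType.
Notation leb := (@lebesgue_measure R).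

Lemma affine_preimage (a b p q : R) : a != 0 ->
  leb ((fun x => a * x + b) @^-1` `]p, q]%classic) = (`|a|^-1 * Num.max (q - p) 0)%:E.
Proof.
move=> a0; have mE (i : interval R) : leb [set` i] = (if i.1 < i.2 then (i.2 : \bar R) - i.1 else 0)%E.
  exact: lebesgue_measure_itv.
have [ap|an|e] := ltgtP 0 a; last by rewrite e eqxx in a0.
  have -> : (fun x => a * x + b) @^-1` `]p, q]%classic = `](p - b) / a, (q - b) / a]%classic.
    apply/seteqP; split=> x /=; rewrite !in_itv /= ltr_pdivrMr // ler_pdivlMr //;
      by rewrite ltrBlDr lerBrDr mulrC.
  rewrite mE /= lte_fin gtr0_norm // ltr_pM2r ?invr_gt0 // ltrD2r -EFinB -mulrBl.
  rewrite opprB addrA subrK; case: ltP => pq.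
    by rewrite max_l ?subr_ge0 1?ltW // mulrC.
  by rewrite max_r ?mulr0 ?subr_le0.
have -> : (fun x => a * x + b) @^-1` `]p, q]%classic = `[(q - b) / a, (p - b) / a[%classic.
  apply/seteqP; split=> x /=; rewrite !in_itv /= ler_ndivrMr // ltr_ndivlMr //;
    by rewrite andbC ltrBlDr lerBrDr mulrC.
rewrite mE /= lte_fin ltr0_norm // ltr_nM2r ?invr_lt0 // ltrD2r -EFinB -mulrBl.
rewrite opprB addrA subrK; case: ltP => pq.
  by rewrite max_l ?subr_ge0 1?ltW // invrN mulNr -mulrN opprB mulrC.
by rewrite max_r ?mulr0 ?subr_le0.
Qed.

Lemma measurable_affine (a b : R) : measurable_fun setT (fun x : R => a * x + b).
Proof. by apply: measurable_funD => //; apply: measurable_funM. Qed.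

(** The rescaled pushforward agrees with Lebesgue measure on half-open intervals, and these
    determine it. *)
Lemma affine_measure (a b : R) A : a != 0 -> measurable A ->
  leb A = (`|a|%:E * leb ((fun x => (a * x + b)%R) @^-1` A))%E.
Proof.
move=> a0 mA; have na : 0 <= `|a| by [].
pose phi : measurableTypeR R -> measurableTypeR R := fun x => a * x + b.
have mphi : measurable_fun setT phi by exact: measurable_affine.
pose m := mscale (NngNum na) (pushforward leb phi).
transitivity (m mphi A); last by rewrite /m /mscale /pushforward.
apply: lebesgue_measure_unique => // _ [[p q]] _ <-.
transitivity (`|a|%:E * leb ((fun x => (a * x + b)%R) @^-1` `]p, q]%classic))%E; last by [].
rewrite affine_preimage //= lebesgue_measure_itv /= lte_fin.
rewrite -EFinM mulrA divff ?normr_eq0 // mul1r; case: ltP => pq.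
  by rewrite max_l ?subr_ge0 ?ltW.
by rewrite max_r ?subr_le0.
Qed.

Definition bounded_supp (g : R -> R) := measurable_fun setT g /\
  exists M r, forall t, `|g t| <= M /\ (r < `|t| -> g t = 0).

Lemma bounded_supp_box g : bounded_supp g -> exists M r, [/\ 0 <= M, 0 <= r &
  forall t, `|g t| <= M * \1_`[-r, r]%classic t].
Proof.
move=> [_ [M [r h]]]; exists M, `|r|; split=> [||t] //.
  by have [h1 _] := h 0; exact: le_trans h1.
have [h1 h2] := h t; rewrite indicE; case: (boolP (t \in _)) => [_|]; first by rewrite mulr1.
rewrite notin_setE /= in_itv /= -ler_norml => /negP; rewrite -ltNge => rt.
by rewrite h2 ?normr0 ?mulr0 //; apply: le_lt_trans rt; exact: ler_norm.
Qed.

Lemma integrable_box (r : R) : leb.-integrable setT (EFin \o \1_`[-r, r]%classic).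
Proof. exact: integrable_indic_itv. Qed.

Lemma bounded_supp_integrable g : bounded_supp g -> leb.-integrable setT (EFin \o g).
Proof.
move=> bg; have [mg _] := bg; have [M [r [M0 r0 h]]] := bounded_supp_box bg.
pose B : R -> R := \1_`[-r, r]%classic.
have iM : leb.-integrable setT (fun t => M%:E * (EFin \o B) t)%E.
  by apply: integrableZl => //; exact: integrable_box.
apply: (le_integrable measurableT _ _ iM).
- exact/measurable_EFinP.
- by move=> t _ /=; rewrite lee_fin; apply: le_trans (h t) _; exact: ler_norm.
Qed.

Lemma integral_box (r : R) : 0 <= r -> \int[leb]_x \1_`[-r, r]%classic x = 2 * r.
Proof.
move=> r0; rewrite /Rintegral integral_indic // setIT /= lebesgue_measure_itv /= lte_fin.
case: ltP => h; rewrite -?EFinD /=; first by rewrite opprK; ring.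
have -> : r = 0 by lra.
by rewrite mulr0.
Qed.

Lemma bounded_suppZ g (k : R) : bounded_supp g -> bounded_supp (fun t => k * g t).
Proof.
move=> [mg [M [r h]]]; split; first exact: measurable_funM.
exists (`|k| * M), r => t; have [h1 h2] := h t.
by rewrite normrM ler_wpM2l //; split=> // /h2 ->; rewrite mulr0.
Qed.

Lemma bounded_supp_indic (r : R) : bounded_supp \1_`[-r, r]%classic.
Proof.
split; first exact: measurable_indic.
exists 1, r => t; rewrite indicE; case: (boolP (t \in _)) => [|_].
  by rewrite inE /= in_itv /= -ler_norml normr1 => h; split=> //; rewrite ltNge h.
by rewrite normr0 ler01.
Qed.

Lemma bounded_supp_le g (M r : R) : 0 <= M -> bounded_supp g -> (forall t, `|g t| <= M * \1_`[-`|r|, `|r|]%classic t) ->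
  `|\int[leb]_x g x| <= M * (2 * `|r|).
Proof.
move=> M0 bg h; have ig := bounded_supp_integrable bg.
apply: le_trans (le_normr_Rintegral _ ig) _ => //.
rewrite -integral_box // -RintegralZl //; last exact: integrable_box.
apply: le_Rintegral => //.
- have := integrable_abse ig; by apply: eq_integrable => // x _.
- by apply: bounded_supp_integrable; apply: bounded_suppZ; exact: bounded_supp_indic.
Qed.

Lemma bounded_supp_affine g (a b : R) : a != 0 -> bounded_supp g -> bounded_supp (fun t => g (a * t + b)).
Proof.
move=> a0 [mg [M [r h]]]; split.
  by apply: (measurableT_comp mg); exact: measurable_affine.
exists M, ((r + `|b|) / `|a|) => t; have [h1 h2] := h (a * t + b); split=> // rt; apply: h2.
move: rt; rewrite ltr_pdivrMr ?normr_gt0 // -normrM mulrC => rt.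
have : `|a * t| <= `|a * t + b| + `|b| by rewrite -{1}(addrK b (a * t)) ler_normB.
lra.
Qed.

Lemma integral_affine g (a b : R) : a != 0 -> bounded_supp g ->
  \int[leb]_t g (a * t + b) = `|a|^-1 * \int[leb]_t g t.
Proof.
move=> a0 bg; have bga := bounded_supp_affine b a0 bg.
pose phi : measurableTypeR R -> measurableTypeR R := fun x => a * x + b.
have mphi : measurable_fun setT phi by exact: measurable_affine.
have na : 0 <= `|a|^-1 by rewrite invr_ge0.
have e1 : (\int[leb]_t (g (a * t + b))%:E = \int[pushforward leb phi]_t (g t)%:E)%E.
  rewrite (integral_pushforward mphi) //; last exact: bounded_supp_integrable bga.
  by apply/measurable_EFinP; case: bg.
rewrite /Rintegral e1.
have -> : (\int[pushforward leb phi]_t (g t)%:E = \int[mscale (NngNum na) leb]_t (g t)%:E)%E.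
  apply: eq_measure_integral => A mA _.
  transitivity (`|a|^-1%:E * leb A)%E; last by [].
  rewrite (affine_measure b a0 mA) muleA -EFinM mulVf ?normr_eq0 //.
  by rewrite mul1e.
have iP : leb.-integrable setT (EFin \o g) := bounded_supp_integrable bg.
rewrite [in LHS]integralE !ge0_integral_mscale //.
- rewrite -muleBr //; last first.
    exact: integrable_add_def.
  rewrite -(integralE leb setT (EFin \o g)) fineM //.
  exact: integrable_fin_num.
- by apply: measurable_funeneg; apply/measurable_EFinP; case: bg.
- by apply: measurable_funepos; apply/measurable_EFinP; case: bg.
Qed.

End Line.

Section Iterated.
Variables (R : realType) (n : nat).
Notation leb := (@lebesgue_measure R).
Notation vec := 'cV[R]_n.
Implicit Types (f g : vec -> R) (x y : vec) (S l : seq 'I_n) (i j : 'I_n).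

Lemma setcE x i t j : setc x i t j 0 = if j == i then t else x j 0.
Proof. by rewrite mxE. Qed.

Lemma setcC x i j s t : i != j -> setc (setc x i s) j t = setc (setc x j t) i s.
Proof.
move=> ij; apply/matrixP => k l; rewrite ord1 !setcE.
by case: eqP => // ->; rewrite eq_sym (negbTE ij).
Qed.

Definition line_integral i f x := \int[leb]_t f (setc x i t).

Fixpoint iter_integral l f := if l is i :: l' then iter_integral l' (line_integral i f) else f.

Lemma iintE f x : iint n f x = iter_integral (enum 'I_n) f x.
Proof.
suff H k : (k <= n)%N -> forall x, iint k f x = iter_integral (take k (enum 'I_n)) f x.
  by rewrite (H n) // take_oversize // size_enum_ord.
have IIr l i g y : iter_integral (rcons l i) g y = line_integral i (iter_integral l g) y by elim: l g => //= a l IH g.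
elim: k => [|k IH] kn y; first by rewrite take0.
have i0 : 'I_n by exact: Ordinal kn.
rewrite (take_nth i0) ?size_enum_ord // IIr /line_integral /=; apply: eq_Rintegral => t _.
by rewrite IH 1?ltnW // nth_enum_ord.
Qed.

(* measurability is asked along every measurable family of coordinates, which
   makes it stable under substitution without a sigma-algebra on vectors *)
Definition param_measurable f := forall d (T : measurableType d) (c : 'I_n -> T -> R),
  (forall i, measurable_fun setT (c i)) -> measurable_fun setT (fun t => f (\col_i c i t)).

(** [S] collects the coordinates already integrated: the function no longer depends on them and is
    bounded with bounded support in the others. The class is stable under each further integration
    ([nice_I1]), which keeps Fubini applicable. *)
Definition nice S f := [/\ param_measurable f,
  forall x y, (forall i, i \notin S -> x i 0 = y i 0) -> f x = f y &
  exists M r, forall x, `|f x| <= M /\ ((exists2 i, i \notin S & r < `|x i 0|) -> f x = 0)].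

Lemma setc_col d (T : measurableType d) (c : 'I_n -> T -> R) i t u :
  setc (\col_j c j t) i u = \col_j (if j == i then u else c j t).
Proof. by apply/matrixP => k l; rewrite ord1 setcE !mxE. Qed.

Lemma nice_sec S f i x : i \notin S -> nice S f -> bounded_supp (fun t => f (setc x i t)).
Proof.
move=> iS [mf _ [M [r h]]]; split.
  have -> : (fun t => f (setc x i t)) = (fun t => f (\col_j (if j == i then t else x j 0))).
    by apply/funext => t; congr f; apply/matrixP => k l; rewrite ord1 setcE mxE.
  by apply: mf => j; case: (j == i) => //; exact: measurable_id.
exists M, r => t; have [h1 h2] := h (setc x i t); split=> // rt; apply: h2.
by exists i => //; rewrite setcE eqxx.
Qed.

Lemma nice_I1 S f i : i \notin S -> nice S f -> nice (i :: S) (line_integral i f).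
Proof.
move=> iS nf; have [mf df [M [r h]]] := nf; split.
- move=> d T c mc; rewrite /line_integral.
  pose F (p : T * measurableTypeR R) : \bar R := (f (\col_j (if j == i then p.2 else c j p.1)))%:E.
  have mF : measurable_fun setT F.
    apply/measurable_EFinP; apply: (mf _ (T * measurableTypeR R)%type
      (fun j p => if j == i then p.2 else c j p.1)) => j.
    by case: (j == i); [exact: measurable_snd|exact: (measurableT_comp (mc j) measurable_fst)].
  have -> : (fun t => \int[leb]_u f (setc (\col_j c j t) i u)) =
      fine \o (fun t => \int[leb]_u F^\+ (t, u) - \int[leb]_u F^\- (t, u))%E.
    apply/funext => t; rewrite /Rintegral /=; congr fine.
    have -> : (fun u => (f (setc (\col_j c j t) i u))%:E) = F \o pair t.
      by apply/funext => u; rewrite /F /= setc_col.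
    rewrite integralE; congr (_ - _)%E; apply: eq_integral => u _.
      by rewrite funepos_comp.
    by rewrite funeneg_comp.
  apply: (measurableT_comp (fine_measurable measurableT)).
  apply: emeasurable_funB.
    by apply: (@measurable_fun_fubini_tonelli_F _ _ _ _ _ leb (F^\+)%E) => //; exact: measurable_funepos.
  by apply: (@measurable_fun_fubini_tonelli_F _ _ _ _ _ leb (F^\-)%E) => //; exact: measurable_funeneg.
- move=> x y xy; apply: eq_Rintegral => t _; apply: df => j jS; rewrite !setcE.
  by case: eqP => // /eqP ji; apply: xy; rewrite inE negb_or ji.
- exists (M * (2 * `|r|)), r => x; split.
    apply: bounded_supp_le; [|exact: nice_sec nf|move=> t].
      by have [h1 _] := h 0; exact: le_trans h1.
    have [h1 h2] := h (setc x i t); rewrite indicE; case: (boolP (t \in _)) => [_|].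
      by rewrite mulr1.
    rewrite notin_setE /= in_itv /= -ler_norml => /negP; rewrite -ltNge => rt.
    rewrite h2 ?normr0 ?mulr0 //; exists i => //; rewrite setcE eqxx.
    by apply: le_lt_trans rt; exact: ler_norm.
  move=> [j]; rewrite inE negb_or => /andP[ji jS] rj.
  rewrite /line_integral (@eq_Rintegral _ _ _ _ _ (cst 0)) ?Rintegral_cst ?mul0r // => t _.
  have [_ h2] := h (setc x i t); apply: h2.
  by exists j => //; rewrite setcE (negbTE ji).
Qed.

Lemma niceD S f g : nice S f -> nice S g -> nice S (fun x => f x + g x).
Proof.
move=> [mf df [M [r h]]] [mg dg [N [s k]]]; split.
- by move=> d T c mc; apply: measurable_funD; [exact: mf|exact: mg].
- by move=> x y xy; rewrite (df x y) // (dg x y).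
exists (M + N), (Num.max r s) => x; have [h1 h2] := h x; have [k1 k2] := k x; split.
  by apply: le_trans (ler_normD _ _) _; exact: lerD.
by move=> [i iS]; rewrite gt_max => /andP[ri si]; rewrite h2 ?k2 ?addr0 //; exists i.
Qed.

Lemma niceZ S f (a : R) : nice S f -> nice S (fun x => a * f x).
Proof.
move=> [mf df [M [r h]]]; split.
- by move=> d T c mc; apply: measurable_funM => //; exact: mf.
- by move=> x y xy; rewrite (df x y).
exists (`|a| * M), r => x; have [h1 h2] := h x; split.
  by rewrite normrM ler_wpM2l.
by move=> /h2 ->; rewrite mulr0.
Qed.

Lemma I1D S f g i : i \notin S -> nice S f -> nice S g ->
  line_integral i (fun x => f x + g x) = (fun x => line_integral i f x + line_integral i g x).
Proof.
move=> iS nf ng; apply/funext => x; rewrite /line_integral RintegralD //.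
  by apply: bounded_supp_integrable; exact: nice_sec nf.
by apply: bounded_supp_integrable; exact: nice_sec ng.
Qed.

Lemma I1Z S f i (a : R) : i \notin S -> nice S f ->
  line_integral i (fun x => a * f x) = (fun x => a * line_integral i f x).
Proof.
move=> iS nf; apply/funext => x; rewrite /line_integral RintegralZl //.
by apply: bounded_supp_integrable; exact: nice_sec nf.
Qed.

Definition free S l := uniq l && all (fun i => i \notin S) l.

Lemma freeS S i l : free S (i :: l) -> i \notin S /\ free (i :: S) l.
Proof.
rewrite /free /= => /andP[/andP[il ul] /andP[iS lS]]; split=> //; rewrite ul /=.
apply/allP => j jl; rewrite inE negb_or (allP lS) // andbT.
by apply: contraNneq il => <-.
Qed.

Lemma IID S l f g : free S l -> nice S f -> nice S g ->
  iter_integral l (fun x => f x + g x) = (fun x => iter_integral l f x + iter_integral l g x).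
Proof.
elim: l S f g => //= i l IH S f g /freeS[iS fl] nf ng; rewrite (I1D iS nf ng).
by apply: IH fl _ _; exact: nice_I1.
Qed.

Lemma IIZ S l f (a : R) : free S l -> nice S f ->
  iter_integral l (fun x => a * f x) = (fun x => a * iter_integral l f x).
Proof.
elim: l S f => //= i l IH S f /freeS[iS fl] nf; rewrite (I1Z a iS nf).
by apply: IH fl _; exact: nice_I1.
Qed.

Lemma integrable_box2 (r : R) :
  (leb \x leb)%E.-integrable setT (EFin \o \1_(`[-r, r]%classic `*` `[-r, r]%classic)).
Proof.
have mB : measurable (`[-r, r]%classic `*` `[-r, r]%classic : set (measurableTypeR R * measurableTypeR R)).
  exact: measurableX.
apply/integrableP; split; first by apply/measurable_EFinP; exact: measurable_indic.
under eq_integral do rewrite /= ger0_norm //.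
rewrite integral_indic // setIT.
rewrite [X in (X < _)%E](@product_measure1E _ _ _ _ _ leb leb) //=.
by rewrite !lebesgue_measure_itv /= lte_fin; case: ifP => _; rewrite ?mule0 -?EFinD -?EFinM ltry.
Qed.

Lemma I1C S f i j : i != j -> i \notin S -> j \notin S -> nice S f ->
  line_integral i (line_integral j f) = line_integral j (line_integral i f).
Proof.
move=> ij iS jS nf; apply/funext => x; rewrite /line_integral.
pose F (p : measurableTypeR R * measurableTypeR R) : \bar R := (f (setc (setc x i p.1) j p.2))%:E.
have [mf df [M [r h]]] := nf.
have M0 : 0 <= M by have [h1 _] := h 0; exact: le_trans h1.
have mF : measurable_fun setT F.
  apply/measurable_EFinP.
  have -> : (fun p : measurableTypeR R * measurableTypeR R => f (setc (setc x i p.1) j p.2)) =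
     (fun p => f (\col_k (if k == j then p.2 else if k == i then p.1 else x k 0))).
    by apply/funext => p; congr f; apply/matrixP => k l; rewrite ord1 !setcE !mxE.
  apply: (mf _ (measurableTypeR R * measurableTypeR R)%type
    (fun k p => if k == j then p.2 else if k == i then p.1 else x k 0)) => k.
  case: (k == j); first exact: measurable_snd.
  by case: (k == i) => //; exact: measurable_fst.
have iF : (leb \x leb)%E.-integrable setT F.
  pose B : measurableTypeR R * measurableTypeR R -> R := \1_(`[- `|r|, `|r|]%classic `*` `[- `|r|, `|r|]%classic).
  have iM : (leb \x leb)%E.-integrable setT (fun p => M%:E * (EFin \o B) p)%E.
    by apply: integrableZl => //; exact: integrable_box2.
  apply: (le_integrable measurableT mF _ iM) => -[s t] _ /=.
  rewrite lee_fin [leRHS]ger0_norm; last by rewrite mulr_ge0 // /B indicE.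
  have [h1 h2] := h (setc (setc x i s) j t); rewrite /B indicE; case: (boolP (_ \in _)) => [_|].
    by rewrite mulr1.
  rewrite notin_setE /= !in_itv /= -!ler_norml => st.
  rewrite h2 ?normr0 ?mulr0 //.
  have [sr|rs] := leP `|s| `|r|; last first.
    exists i => //; rewrite !setcE (negbTE ij) eqxx; apply: le_lt_trans rs; exact: ler_norm.
  have [tr|rt] := leP `|t| `|r|; first by case: st.
  exists j => //; rewrite !setcE eqxx; apply: le_lt_trans rt; exact: ler_norm.
have := Fubini iF; rewrite /Rintegral => E.
have E1 : (\int[leb]_s \int[leb]_t F (s, t) =
    \int[leb]_s (fine (\int[leb]_t (f (setc (setc x i s) j t))%:E))%:E)%E.
  apply: eq_integral => s _; rewrite /F fineK /=; first by apply: eq_integral.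
  have := bounded_supp_integrable (nice_sec (setc x i s) jS nf); exact: integrable_fin_num.
have E2 : (\int[leb]_t \int[leb]_s F (s, t) =
    \int[leb]_t (fine (\int[leb]_s (f (setc (setc x j t) i s))%:E))%:E)%E.
  apply: eq_integral => t _; rewrite /F fineK /=.
    by apply: eq_integral => s _; rewrite setcC.
  have := bounded_supp_integrable (nice_sec (setc x j t) iS nf); exact: integrable_fin_num.
by rewrite -E1 -E2 E.
Qed.

Lemma II_front S l1 l2 i f : free S (l1 ++ i :: l2) -> nice S f ->
  iter_integral (l1 ++ i :: l2) f = iter_integral (i :: l1 ++ l2) f.
Proof.
elim: l1 S f => //= a l1 IH S f fl nf; have [aS fl'] := freeS fl.
rewrite (IH _ _ fl' (nice_I1 aS nf)) /=.
move: fl; rewrite /free /= mem_cat inE all_cat /= => /andP[/andP[]].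
rewrite !negb_or => /and3P[_ ai _] _ /and3P[_ _ /andP[iS _]].
by rewrite (I1C _ iS aS nf) // eq_sym.
Qed.

Lemma II_perm S l l' f : perm_eq l l' -> free S l -> nice S f -> iter_integral l f = iter_integral l' f.
Proof.
elim: l S l' f => [|i l IH] S l' f; first by rewrite perm_sym => /perm_nilP ->.
move=> p fl nf; have il' : i \in l' by rewrite -(perm_mem p) inE eqxx.
have fl' : free S l'.
  by move: fl; rewrite /free (perm_uniq p) (eq_all_r (perm_mem p)).
case/splitPr: il' => p1 p2 in p fl' *; rewrite (II_front fl' nf) /=.
have [iS fl1] := freeS fl; apply: (IH (i :: S)) => //; last exact: nice_I1.
by rewrite -(perm_cons i); apply: perm_trans p _; exact: permEl (perm_catCA p1 [:: i] p2).
Qed.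

End Iterated.

Section ChangeOfVariable.
Variables (R : realType) (n : nat).
Notation leb := (@lebesgue_measure R).
Notation vec := 'cV[R]_n.
Implicit Types (f g : vec -> R) (x y : vec) (S l : seq 'I_n) (i j : 'I_n) (A : 'M[R]_n).

Lemma mulmx_setc A x i t j : (A *m setc x i t) j 0 = (A *m x) j 0 + A j i * (t - x i 0).
Proof.
have -> : setc x i t = x + (t - x i 0) *: delta_mx i 0.
  apply/matrixP => k l; rewrite !ord1 setcE !mxE eqxx andbT.
  by case: eqP => [->|_]; rewrite ?mulr1 ?mulr0 ?addr0 // addrC subrK.
rewrite mulmxDr -scalemxAr -colE !mxE; congr (_ + _); exact: mulrC.
Qed.

(** Triangularity relative to the order of integration: varying a coordinate changes, among the
    entries of [A *m x] not yet integrated, only its own. Each one-dimensional integral is then an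
    affine substitution ([II_tri]). *)
Definition tri l A := pairwise (fun i j => A j i == 0) l && all (fun i => A i i != 0) l.

Lemma II_tri S l f A (c : R) x : free S l -> (forall j, j \notin S -> j \in l) -> tri l A ->
  nice S f -> iter_integral l (fun x => c * f (A *m x)) x = c * \prod_(i <- l) `|A i i|^-1 * iter_integral l f (A *m x).
Proof.
elim: l S f c => [|i l IH] S f c fl cov; first by rewrite big_nil mulr1.
rewrite /tri /= => /andP[/andP[/allP ai tl] /andP[aii al]] nf.
have [iS fl'] := freeS fl.
have -> : line_integral i (fun x => c * f (A *m x)) = (fun x => (c * `|A i i|^-1) * line_integral i f (A *m x)).
  apply/funext => z; rewrite /line_integral.
  pose g t := c * f (setc (A *m z) i t).
  have bg : bounded_supp g by apply: bounded_suppZ; exact: nice_sec nf.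
  transitivity (\int[leb]_t g (A i i * t + ((A *m z) i 0 - A i i * z i 0))).
    apply: eq_Rintegral => t _; rewrite /g; congr (_ * _); case: nf => _ df _.
    apply: df => j jS; rewrite mulmx_setc setcE.
    have := cov j jS; rewrite inE => /orP[/eqP->|jl].
      by rewrite eqxx; ring.
    rewrite (eqP (ai j jl)) mul0r addr0; case: eqP => // ji.
    by move: aii; rewrite -{1}ji (eqP (ai j jl)) eqxx.
  rewrite integral_affine // /g RintegralZl //; first by rewrite mulrA [_ * c]mulrC.
  by apply: bounded_supp_integrable; exact: nice_sec nf.
rewrite (IH (i :: S)) //; first by rewrite big_cons !mulrA.
- move=> j; rewrite inE negb_or => /andP[ji jS].
  by have := cov j jS; rewrite inE (negbTE ji).
- by rewrite /tri tl al.
- exact: nice_I1.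
Qed.

Lemma II_const S l f x y : free S l -> (forall j, j \notin S -> j \in l) -> nice S f ->
  iter_integral l f x = iter_integral l f y.
Proof.
elim: l S f => [|i l IH] S f fl cov nf.
  by case: nf => _ df _; apply: df => j /cov.
have [iS fl'] := freeS fl; rewrite /=; apply: (IH (i :: S)) => //; last exact: nice_I1.
by move=> j; rewrite inE negb_or => /andP[ji /cov]; rewrite inE (negbTE ji).
Qed.

Lemma free_perm l : perm_eq l (enum 'I_n) -> free [::] l.
Proof.
by move=> p; rewrite /free (perm_uniq p) enum_uniq; apply/allP => i; rewrite in_nil.
Qed.

Lemma cov_perm l : perm_eq l (enum 'I_n) -> forall j, j \notin ([::] : seq 'I_n) -> j \in l.
Proof. by move=> p j _; rewrite (perm_mem p) mem_enum. Qed.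

Lemma integral_RnE l f x : nice [::] f -> perm_eq l (enum 'I_n) -> integral_Rn f = iter_integral l f x.
Proof.
move=> nf p; rewrite /integral_Rn iintE (II_perm (l' := l) _ (free_perm (perm_refl _)) nf).
  exact: II_const (free_perm p) (cov_perm p) nf.
by rewrite perm_sym.
Qed.

Lemma nice_comp f A : A \in unitmx -> nice [::] f -> nice [::] (fun x => f (A *m x)).
Proof.
move=> uA [mf df [M [r h]]]; split.
- move=> d T c mc.
  have -> : (fun t => f (A *m \col_i c i t)) = (fun t => f (\col_i \sum_k A i k * c k t)).
    apply/funext => t; congr f; apply/matrixP => i k; rewrite !mxE.
    by apply: eq_bigr => l _; rewrite !mxE.
  apply: (mf _ _ (fun i t => \sum_k A i k * c k t)) => i.
  by apply: measurable_sum => k; apply: measurable_funM.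
- by move=> x y xy; congr (f (_ *m _)); apply/matrixP => i j; rewrite ord1 xy.
pose N := \sum_i \sum_k `|invmx A i k| * `|r|.
exists M, N => x; have [h1 h2] := h (A *m x); split=> // -[i _ Ni]; apply: h2.
apply: contrapT => ne; have le k : `|(A *m x) k 0| <= `|r|.
  rewrite leNgt; apply/negP => rk; apply: ne; exists k => //.
  by apply: le_lt_trans rk; exact: ler_norm.
move: Ni; rewrite ltNge => /negP; apply.
have -> : x i 0 = \sum_k invmx A i k * (A *m x) k 0.
  by rewrite -[LHS](congr1 (fun z : vec => z i 0) (mulKmx uA x)) [LHS]mxE.
apply: le_trans (ler_norm_sum _ _ _) _; rewrite /N [leRHS](bigD1 i) //= -[leLHS]addr0.
apply: lerD; last by apply: sumr_ge0 => k _; apply: sumr_ge0 => l _; rewrite mulr_ge0.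
by apply: ler_sum => k _; rewrite normrM ler_wpM2l.
Qed.

Lemma integral_tri l f A : perm_eq l (enum 'I_n) -> tri l A -> A \in unitmx -> nice [::] f ->
  integral_Rn (fun x => f (A *m x)) = \prod_i `|A i i|^-1 * integral_Rn f.
Proof.
move=> p tl uA nf; rewrite (integral_RnE 0 (nice_comp uA nf) p) (integral_RnE (A *m 0) nf p).
have := II_tri 1 0 (free_perm p) (cov_perm p) tl nf.
under [X in iter_integral l X]eq_fun do rewrite mul1r.
by move=> ->; rewrite mul1r (perm_big _ p) /= big_enum.
Qed.

Lemma II_rowperm (s : 'S_n) l f x :
  iter_integral (map s l) (fun x => f (row_perm s x)) x = iter_integral l f (row_perm s x).
Proof.
elim: l f => //= i l IH f; rewrite -IH; congr (iter_integral _ _ x); apply/funext => z.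
apply: eq_Rintegral => t _; congr f; apply/matrixP => j k; rewrite ord1 setcE !mxE.
by rewrite (inj_eq val_inj) (inj_eq perm_inj).
Qed.

Lemma integral_rowperm (s : 'S_n) f : nice [::] f ->
  integral_Rn (fun x => f (perm_mx s *m x)) = integral_Rn f.
Proof.
move=> nf; have p : perm_eq (map s (enum 'I_n)) (enum 'I_n).
  apply: uniq_perm; [|exact: enum_uniq|].
    by rewrite (map_inj_uniq (@perm_inj _ s)) enum_uniq.
  by move=> i; rewrite mem_enum; apply/mapP; exists (s^-1%g i); rewrite ?mem_enum ?permKV.
rewrite (integral_RnE 0 (nice_comp (unitmx_perm _ s) nf) p).
under [X in iter_integral _ X]eq_fun do rewrite -row_permE.
by rewrite II_rowperm -integral_RnE.
Qed.

Lemma tri_upper A : (forall i j, (j < i)%N -> A i j = 0) -> (forall i, A i i != 0) ->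
  tri (enum 'I_n) A.
Proof.
move=> u d; rewrite /tri; apply/andP; split; last by apply/allP.
have : pairwise (fun i j : 'I_n => (i < j)%N) (enum 'I_n).
  by rewrite -(pairwise_map val ltn) val_enum_ord -sorted_pairwise ?iota_ltn_sorted //; exact: ltn_trans.
by apply: sub_pairwise => i j ij; rewrite u.
Qed.

Lemma tri_lower A : (forall i j, (i < j)%N -> A i j = 0) -> (forall i, A i i != 0) ->
  tri (rev (enum 'I_n)) A.
Proof.
move=> u d; rewrite /tri; apply/andP; split; last by apply/allP.
have : pairwise (fun i j : 'I_n => (j < i)%N) (rev (enum 'I_n)).
  rewrite -(pairwise_map val (fun a b => (b < a)%N)) map_rev val_enum_ord -sorted_pairwise.
    by rewrite rev_sorted iota_ltn_sorted.
  by move=> a b c ab bc; exact: ltn_trans bc ab.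
by apply: sub_pairwise => i j ij; rewrite u.
Qed.

End ChangeOfVariable.

(** LUP factorisation: a permutation reorders the integrals, the lower factor has unit diagonal, and
    the diagonal of the upper one has product of absolute value 1. The triangular factors call for
    opposite orders of integration. *)
Lemma integral_SL (R : realType) n (f : 'cV[R]_n.+1 -> R) (A : 'M[R]_n.+1) :
  \det A = 1 -> nice [::] f -> integral_Rn (fun x => f (A *m x)) = integral_Rn f.
Proof.
move=> dA nf; have := cormen_lup_correct A; have := cormen_lup_perm A.
have := cormen_lup_detL A; have := @cormen_lup_lower _ _ A; have := @cormen_lup_upper _ _ A.
case: (cormen_lup A) => [[P L] U] /= hU hL dL /is_perm_mxP[s eP] E.
have dU : `|\det U| = 1.
  have : \det (P * A) = \det (L * U) by rewrite E.
  rewrite !det_mulmx dL mul1r dA mulr1 eP det_perm => <-.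
  by rewrite normrX normrN1 expr1n.
have tU : \det U = \prod_i U i i.
  by rewrite -det_tr det_trig; [apply: eq_bigr => i _; rewrite mxE|apply/is_trig_mxP => i j ij; rewrite mxE hU].
have dUi i : U i i != 0.
  apply: contra_eq_neq dU => Ui; rewrite tU (bigD1 i) //= Ui mul0r normr0.
  by rewrite eq_sym oner_eq0.
have uU : U \in unitmx by rewrite unitmxE unitfE -normr_gt0 dU.
have uL : L \in unitmx by rewrite unitmxE dL unitr1.
have uP : (perm_mx s : 'M[R]_n.+1) \in unitmx by exact: unitmx_perm.
have -> : A = invmx (perm_mx s) *m L *m U.
  by rewrite -mulmxA -[L *m U]E eP mulKmx.
pose g x := f (perm_mx s^-1%g *m x).
have ng : nice [::] g by apply: nice_comp nf; exact: unitmx_perm.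
have -> : (fun x => f (invmx (perm_mx s) *m L *m U *m x)) = (fun x => g (L *m (U *m x))).
  by apply/funext => x; rewrite /g -!mulmxA perm_mxV.
have nL := nice_comp uL ng.
rewrite (@integral_tri _ _ (enum 'I_n.+1) (fun x => g (L *m x)) U) //; last exact: tri_upper.
rewrite (@integral_tri _ _ (rev (enum 'I_n.+1)) g L) //; last 2 first.
- by rewrite perm_rev.
- apply: tri_lower => i; first by move=> j ij; rewrite (hL _ _ (ltnW ij)) -val_eqE ltn_eqF.
  by rewrite (hL _ _ (leqnn i)) eqxx oner_eq0.
have -> : \prod_i `|L i i|^-1 = 1.
  by apply: big1 => i _; rewrite (hL _ _ (leqnn i)) eqxx normr1 invr1.
rewrite prodfV -normr_prod -tU dU invr1 !mul1r; exact: integral_rowperm.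
Qed.

(** * Moment vectors of polytopes *)

Section Moments.
Variables (R : realType) (n : nat).
Notation leb := (@lebesgue_measure R).
Notation vec := 'cV[R]_n.
Implicit Types (f g : vec -> R) (x y z : vec) (A : seq vec) (P Q K L : set vec) (i j : 'I_n).

Lemma integral_RnD f g : nice [::] f -> nice [::] g ->
  integral_Rn (fun x => f x + g x) = integral_Rn f + integral_Rn g.
Proof.
move=> nf ng; have p := perm_refl (enum 'I_n).
rewrite (integral_RnE 0 (niceD nf ng) p) (integral_RnE 0 nf p) (integral_RnE 0 ng p).
by rewrite (IID (free_perm p) nf ng).
Qed.

Lemma integral_RnZ f (a : R) : nice [::] f ->
  integral_Rn (fun x => a * f x) = a * integral_Rn f.
Proof.
move=> nf; have p := perm_refl (enum 'I_n).
rewrite (integral_RnE 0 (niceZ a nf) p) (integral_RnE 0 nf p).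
by rewrite (IIZ a (free_perm p) nf).
Qed.

Lemma nice0 : nice [::] (fun _ : vec => 0 : R).
Proof. by split=> //; exists 0, 0 => x; rewrite normr0. Qed.

Lemma nice_sum (I : Type) (r : seq I) (F : I -> vec -> R) : (forall k, nice [::] (F k)) ->
  nice [::] (fun x => \sum_(k <- r) F k x) /\
  integral_Rn (fun x => \sum_(k <- r) F k x) = \sum_(k <- r) integral_Rn (F k).
Proof.
move=> nF; elim: r => [|k r [IH1 IH2]].
  under [X in nice _ X]eq_fun do rewrite big_nil.
  under [X in integral_Rn X]eq_fun do rewrite big_nil.
  split; first exact: nice0.
  rewrite big_nil; have := integral_RnZ 0 nice0.
  by under [X in integral_Rn X]eq_fun do rewrite mul0r; rewrite mul0r.
under [X in nice _ X]eq_fun do rewrite big_cons.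
under [X in integral_Rn X]eq_fun do rewrite big_cons.
by split; [exact: niceD|rewrite integral_RnD // big_cons IH2].
Qed.

Lemma param_measurable_hset A : param_measurable (\1_(halfspaces A) : vec -> R).
Proof.
elim: A => [|a A IH] d T c mc.
  rewrite (_ : (fun _ => _) = cst 1) //; apply/funext => t.
  by rewrite indicE mem_set.
have -> : (fun t => \1_(halfspaces (a :: A)) (\col_i c i t)) =
    (fun t => (if \sum_i a i 0 * c i t <= 1 then 1 else 0) * \1_(halfspaces A) (\col_i c i t)) :> (T -> R).
  apply/funext => t; rewrite !indicE.
  have -> : \sum_i a i 0 * c i t = dotv a (\col_i c i t).
    by apply: eq_bigr => i _; rewrite mxE.
  case: ifP => h; last first.
    rewrite mul0r memNset // => /(_ a); rewrite inE eqxx => /(_ isT) h'.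
    by rewrite h' in h.
  rewrite mul1r; congr (nat_of_bool _)%:R; apply/idP/idP; rewrite !inE => H b.
    by move=> bA; apply: H; rewrite inE bA orbT.
  by rewrite inE => /orP[/eqP->//|]; exact: H.
apply: measurable_funM; last exact: IH.
apply: measurable_fun_ifT => //.
apply: measurable_fun_ler => //.
by apply: measurable_sum => k; apply: measurable_funM.
Qed.

(** Common description of polytopes and of their polars, from which the moment integrand is
    integrable for both; a vertex list of [P] directly gives this form for the polar
    ([polar_cv]). *)
Definition bounded_hset Q := exists A, Q = halfspaces A /\ exists r, forall x, Q x -> forall i, `|x i 0| <= r.

Lemma nice_moment Q j : bounded_hset Q -> nice [::] (fun x => x j 0 * \1_Q x).
Proof.
move=> [A [-> [r h]]]; split.
- move=> d T c mc; apply: measurable_funM; last exact: param_measurable_hset.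
  by rewrite (_ : (fun _ => _) = c j) //; apply/funext => t; rewrite mxE.
- by move=> x y xy; rewrite (_ : x = y) //; apply/matrixP => i k; rewrite ord1 xy.
exists `|r|, r => x; rewrite indicE; case: (boolP (x \in _)) => [|_].
  rewrite inE => /h hx; rewrite mulr1; split; first by apply: le_trans (hx j) _; exact: ler_norm.
  by move=> [i _]; rewrite ltNge hx.
by rewrite mulr0 normr0.
Qed.

Lemma bounded_coords Q : (forall i, exists M, forall x, Q x -> `|x i 0| <= M) ->
  exists r, forall x, Q x -> forall i, `|x i 0| <= r.
Proof.
move=> /choice[M hM]; exists (\sum_i `|M i|) => x Qx i.
apply: le_trans (hM i x Qx) _; rewrite (bigD1 i) //= -[leLHS]addr0.
by apply: lerD; [exact: ler_norm|apply: sumr_ge0].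
Qed.

Lemma Pno_bounded P : Pno P -> bounded_hset P.
Proof.
move=> PP; have [A eA] := Hrep PP; exists A; split=> //; apply: bounded_coords => i.
have [pP _] := iffLR (PnoE P) PP.
have [M hM] := poly_bounded (delta_mx i 0) pP.
have [N hN] := poly_bounded (- delta_mx i 0) pP.
exists (Num.max M N) => x Px; have := hM x Px; have := hN x Px.
rewrite dotvNl !dotv_delta => h1 h2.
by rewrite ler_norml le_max h2 lerNl le_max h1 orbT.
Qed.

Lemma polar_cv (s : seq vec) : polar (hull [set` s]) = halfspaces s.
Proof.
apply/seteqP; split=> y hy.
  by move=> a As; rewrite dotvC; apply: hy; exact: sub_cv.
move=> x; apply: (@hull_min _ _ _ [set x | dotv y x <= 1]); first exact: convex_half1.
by move=> a /= /hy; rewrite dotvC.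
Qed.

Lemma polar_bounded P : Pno P -> bounded_hset (polar P).
Proof.
move=> PP; have [[s es] _] := iffLR (PnoE P) PP; exists s; split; first by rewrite es polar_cv.
apply: bounded_coords => i.
have [t t0 ht] := Pno_small (delta_mx i 0) PP.
have [u u0 hu] := Pno_small (- delta_mx i 0) PP.
exists (Num.max t^-1 u^-1) => x Px.
have h1 : x i 0 <= t^-1.
  have := Px _ (ht t _); rewrite lexx ltW // => /(_ isT).
  by rewrite dotvZr dotvC dotv_delta mulrC -ler_pdivlMr // div1r.
have h2 : - x i 0 <= u^-1.
  have := Px _ (hu u _); rewrite lexx ltW // => /(_ isT).
  by rewrite dotvZr dotvNr dotvC dotv_delta mulrC -ler_pdivlMr // div1r.
by rewrite ler_norml le_max h1 lerNl le_max h2 orbT.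
Qed.

Lemma moment_UI K L : bounded_hset K -> bounded_hset L -> bounded_hset (K `|` L) ->
  bounded_hset (K `&` L) -> moment (K `|` L) + moment (K `&` L) = moment K + moment L.
Proof.
move=> bK bL bU bI; apply/matrixP => j k; rewrite !mxE.
rewrite -!integral_RnD; try exact: nice_moment.
congr integral_Rn; apply/funext => x; rewrite -!mulrDr; congr (_ * _).
rewrite !indicE in_setU in_setI; case: (x \in K); case: (x \in L); by rewrite /= ?addr0 ?add0r.
Qed.

Lemma polarU K L : polar (K `|` L) = polar K `&` polar L.
Proof.
apply/seteqP; split=> y; first by move=> h; split=> x Kx; apply: h; [left|right].
by move=> [h1 h2] x [/h1|/h2].
Qed.

(** By induction on the inequalities: a new one either holds at the exit point found so far, or is
    violated there, and then its point of equality is an earlier exit. *)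
Lemma hset_exit A p q : halfspaces A p -> ~ halfspaces A q -> exists2 t : R, 0 <= t < 1 &
  halfspaces A (p + t *: (q - p)) /\ forall s, t < s -> s <= 1 -> ~ halfspaces A (p + s *: (q - p)).
Proof.
move=> + nq; elim: A nq => [|a A IH] nq hp; first by case: nq.
have pA : halfspaces A p by move=> b bA; apply: hp; rewrite inE bA orbT.
have pa : dotv a p <= 1 by apply: hp; rewrite inE eqxx.
have sub z : ~ halfspaces A z -> ~ halfspaces (a :: A) z.
  by move=> h h'; apply: h => b bA; apply: h'; rewrite inE bA orbT.
have cons z : halfspaces A z -> dotv a z <= 1 -> halfspaces (a :: A) z.
  by move=> h h' b; rewrite inE => /orP[/eqP->|/h].
have lin t : dotv a (p + t *: (q - p)) = dotv a p + t * (dotv a q - dotv a p).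
  by rewrite dotvDr dotvZr dotvDr dotvNr.
have conv u t : 0 <= t <= u -> halfspaces A (p + u *: (q - p)) -> halfspaces A (p + t *: (q - p)).
  move=> /andP[t0 tu] hu; have [u0|u0] := eqVneq u 0.
    by have -> : t = 0; [apply/eqP; rewrite eq_le t0 andbT -u0|rewrite scale0r addr0].
  have up : 0 < u by rewrite lt_neqAle eq_sym u0 (le_trans t0).
  have -> : p + t *: (q - p) = (1 - t / u) *: p + (t / u) *: (p + u *: (q - p)).
    by apply/matrixP => k l; rewrite !mxE; field.
  apply: halfspaces_convex => //; rewrite ?divr_ge0 ?subr_ge0 ?ler_pdivrMr ?mul1r //; try exact: ltW.
  by rewrite subrK.
have cut u : 0 <= u <= 1 -> halfspaces A (p + u *: (q - p)) -> 1 < dotv a (p + u *: (q - p)) ->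
    exists2 t : R, 0 <= t < 1 & halfspaces (a :: A) (p + t *: (q - p)) /\
      forall s, t < s -> s <= 1 -> ~ halfspaces (a :: A) (p + s *: (q - p)).
  move=> /andP[u0 u1] hu; rewrite lin => au.
  have ud : 0 < u * (dotv a q - dotv a p) by lra.
  have dd : 0 < dotv a q - dotv a p by rewrite -(pmulr_rgt0 _ (_ : 0 < u)) // lt_neqAle u0 andbT; apply: contraTneq ud => <-; rewrite mul0r ltxx.
  pose t := (1 - dotv a p) / (dotv a q - dotv a p).
  have tu : t < u by rewrite ltr_pdivrMr //; lra.
  have t0 : 0 <= t by apply: divr_ge0; [lra|exact: ltW].
  exists t; first by rewrite t0 (lt_le_trans tu).
  split; first by apply: cons; [apply: conv hu; rewrite t0 ltW|rewrite lin /t mulfVK ?gt_eqF //; lra].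
  move=> s ts _ hs; have := hs a; rewrite inE eqxx lin => /(_ isT).
  have : t * (dotv a q - dotv a p) < s * (dotv a q - dotv a p) by rewrite ltr_pM2r.
  rewrite /t mulfVK ?gt_eqF //; lra.
have [quadrilateral|quadrilateral] := pselect (halfspaces A q).
  have e1 : p + 1 *: (q - p) = q by rewrite scale1r addrC subrK.
  apply: (cut 1); rewrite ?e1 ?ler01 ?lexx //.
  by rewrite ltNge; apply/negP => h; apply: nq; exact: cons.
have [t /andP[t0 t1] [ht hs]] := IH quadrilateral pA.
have [at1|at1] := leP (dotv a (p + t *: (q - p))) 1; last first.
  by apply: (cut t) => //; rewrite t0 ltW.
exists t; first by rewrite t0.
by split; [exact: cons|move=> s ts s1; apply: sub; exact: hs].
Qed.

(** If [y] is in neither polar, it exceeds 1 at some [p] in [K] and [q] in [L], hence on the whole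
    segment between them. Beyond the exit from [K] the segment is covered by [L], so the exit point
    lies in both sets, contradicting [hy]. *)
Lemma polarI K L : Pno K -> Pno L -> is_convex (K `|` L) -> polar (K `&` L) = polar K `|` polar L.
Proof.
move=> PK PL cU; apply/seteqP; split=> y; last first.
  by move=> [h|h] x [Kx Lx]; apply: h.
move=> hy; apply: contrapT => /not_orP[/existsNP[p /not_implyP[Kp /negP]]].
rewrite -ltNge => yp /existsNP[q /not_implyP[Lq /negP]]; rewrite -ltNge => yq.
have [AK eK] := Hrep PK; have [AL eL] := Hrep PL.
have lin v t : dotv v (p + t *: (q - p)) = dotv v p + t * (dotv v q - dotv v p).
  by rewrite dotvDr dotvZr dotvDr dotvNr.
have big t : 0 <= t <= 1 -> 1 < dotv y (p + t *: (q - p)).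
  move=> /andP[t0 t1]; rewrite lin.
  have : 0 <= t * (dotv y q - 1) by rewrite mulr_ge0 //; lra.
  have : 0 <= (1 - t) * (dotv y p - 1) by rewrite mulr_ge0; lra.
  have [->|t0'] := eqVneq t 0; first by move=> _ _; lra.
  have : 0 < t * (dotv y q - 1) by rewrite mulr_gt0 ?subr_gt0 // lt_neqAle eq_sym t0'.
  lra.
have nI z t : 0 <= t <= 1 -> z = p + t *: (q - p) -> ~ (K `&` L) z.
  by move=> t01 -> /hy; rewrite leNgt big.
have nKq : ~ K q.
  move=> Kq; apply: (nI q 1); rewrite ?ler01 ?lexx //; first by rewrite scale1r addrC subrK.
have [||t /andP[t0 t1] [ht hs]] := @hset_exit AK p q; rewrite -?eK // in nKq *.
rewrite -eK in ht.
have hsL s : t < s -> s <= 1 -> L (p + s *: (q - p)).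
  move=> ts s1; have s0 : 0 <= s by apply: ltW; exact: le_lt_trans ts.
  have : (K `|` L) (p + s *: (q - p)).
    have -> : p + s *: (q - p) = (1 - s) *: p + s *: q.
      by apply/matrixP => k l; rewrite !mxE; ring.
    by apply: cU; rewrite ?subr_ge0 ?subrK //; [left|right].
  by case=> // Ks; case: (hs s ts s1); rewrite -eK.
apply: (nI (p + t *: (q - p)) t) => //; first by rewrite t0 ltW.
split=> //; rewrite eL => a aA; rewrite leNgt; apply/negP => at1.
have aq : dotv a q <= 1 by move: Lq; rewrite eL; apply.
move: at1; rewrite lin => at1.
pose d := dotv a q - dotv a p.
have h1 : dotv a p + 1 * d <= 1 by rewrite /d; lra.
have dn : d < 0.
  have : 0 < (t - 1) * d by rewrite mulrBl; rewrite -/d in at1; lra.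
  by rewrite nmulr_rgt0 // subr_lt0.
(* If [a] exceeded 1 at the exit point, then, its slope [d] being negative, it would still do so
   after [e], half of the time needed to come down to 1; but those points lie in [L]. *)
pose e := (dotv a p + t * d - 1) / (- d) / 2.
have e0 : 0 < e by rewrite !divr_gt0 // ?oppr_gt0 // subr_gt0.
pose s := Num.min (t + e) 1.
have ts : t < s by rewrite lt_min t1 andbT ltrDl.
have s1 : s <= 1 by rewrite ge_min lexx orbT.
have := hsL s ts s1; rewrite eL => /(_ a aA); rewrite lin -/d leNgt => /negP; apply.
have se : s <= t + e by rewrite ge_min lexx.
have : (t + e) * d <= s * d by rewrite ler_wnM2r // ltW.
have -> : (t + e) * d = t * d - (dotv a p + t * d - 1) / 2 by rewrite /e; field; rewrite lt_eqF.
rewrite -/d in at1; lra.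
Qed.

Lemma polar_img (phi : 'M[R]_n) P : phi \in unitmx ->
  polar (mulmx phi @` P) = mulmx (invmx phi)^T @` polar P.
Proof.
move=> u; have ut : phi^T \in unitmx by rewrite unitmx_tr.
apply/seteqP; split=> y.
  move=> hy; exists (phi^T *m y); last by rewrite trmx_inv mulKmx.
  by move=> x Px; rewrite -dotv_mulmx; rewrite ?trmxK; apply: hy; exists x.
move=> [z hz <-] _ [x Px <-]; rewrite dotv_mulmx trmx_inv mulKVmx //; exact: hz.
Qed.

Lemma moment_valn : valuation (fun P : set vec => moment P).
Proof. by move=> K L PK PL PU PI; apply: moment_UI; exact: Pno_bounded. Qed.

Lemma moment_polar_valn : valuation (fun P : set vec => moment (polar P)).
Proof.
move=> K L PK PL PU PI; rewrite polarU polarI //; last exact: Pno_convex.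
rewrite addrC; apply: moment_UI; try exact: polar_bounded.
  by rewrite -polarI //; [exact: polar_bounded|exact: Pno_convex].
by rewrite -polarU; exact: polar_bounded.
Qed.

End Moments.

Lemma moment_img (R : realType) n (phi : 'M[R]_n.+1) Q : \det phi = 1 -> bounded_hset Q ->
  moment (mulmx phi @` Q) = phi *m moment Q.
Proof.
move=> d1 bQ; have u : phi \in unitmx by rewrite unitmxE d1 unitr1.
apply/matrixP => j k; rewrite ord1 !mxE.
pose g (x : 'cV[R]_n.+1) := \sum_l phi j l * (x l 0 * \1_Q x).
have [ng ig] := nice_sum (index_enum 'I_n.+1) (fun l => niceZ (phi j l) (nice_moment l bQ)).
transitivity (integral_Rn (fun x => g (invmx phi *m x))).
  congr integral_Rn; apply/funext => x; rewrite /g.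
  have -> : \1_(mulmx phi @` Q) x = \1_Q (invmx phi *m x) :> R.
    rewrite !indicE; congr (nat_of_bool _)%:R; apply/idP/idP; rewrite !inE.
      by move=> [y Qy <-]; rewrite mulKmx.
    by move=> h; exists (invmx phi *m x) => //; rewrite mulKVmx.
  under eq_bigr do rewrite mulrA.
  rewrite -mulr_suml; congr (_ * _).
  by rewrite -{1}[x](mulKVmx u) [LHS]mxE.
rewrite integral_SL //; last by rewrite det_inv d1 invr1.
by rewrite /g ig; apply: eq_bigr => l _; rewrite integral_RnZ ?mxE //; exact: nice_moment.
Qed.

Lemma moment_polar_contra (R : realType) n :
  SL_contravariant (fun P : set 'cV[R]_n.+1 => moment (polar P)).
Proof.
move=> phi P d1 PP; have u : phi \in unitmx by rewrite unitmxE d1 unitr1.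
rewrite polar_img // moment_img //; last exact: polar_bounded.
by rewrite det_tr det_inv d1 invr1.
Qed.

(** * Explicit moments of crosspolytopes and of their polars *)

Section OneDim.
Variable R : realType.
Notation leb := (@lebesgue_measure R).

Lemma Rintegral_deriv (p : {poly R}) (a b : R) : a <= b ->
  \int[leb]_(x in `[a, b]) (p^`()).[x] = p.[b] - p.[a].
Proof.
move=> ab; have [->|ne] := eqVneq a b; first by rewrite set_itv1 Rintegral_set1 subrr.
rewrite /Rintegral (@continuous_FTC2 _ _ (horner p)) //.
- by rewrite lt_neqAle ne.
- exact/continuous_subspaceT/continuous_horner.
- split; first by move=> x _; exact: derivable_horner.
    by apply: cvg_at_right_filter; exact: continuous_horner.
  by apply: cvg_at_left_filter; exact: continuous_horner.
- by move=> x _; rewrite -derivE.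
Qed.

Lemma Rintegral_poly2 (p q k0 k1 k2 : R) : p <= q ->
  \int[leb]_(t in `[p, q]) (k0 + k1 * t + k2 * t ^+ 2) =
  k0 * (q - p) + k1 * (q ^+ 2 - p ^+ 2) / 2 + k2 * (q ^+ 3 - p ^+ 3) / 3.
Proof.
move=> pq; pose P : {poly R} := k0 *: 'X + (k1 / 2) *: 'X^2 + (k2 / 3) *: 'X^3.
transitivity (P.[q] - P.[p]).
  rewrite -(Rintegral_deriv P pq); apply: eq_Rintegral => t _.
  rewrite /P !derivD !derivZ derivX !derivXn -[2.-1]/1%N -[3.-1]/2%N expr1 !hornerE.
  change (k0 + k1 * t + k2 * t * t = k0 + k1 / 2 * (t + t) + k2 / 3 * (t ^+ 2 + t ^+ 2 + t ^+ 2)).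
  by field.
by rewrite /P !(hornerD, hornerZ, hornerXn, hornerX); field.
Qed.

Lemma bounded_supp_cut (f : R -> R) (a b : R) : continuous f -> bounded_supp (fun t => f t * \1_`[a, b]%classic t).
Proof.
move=> cf; split.
  by apply: measurable_funM; [exact: continuous_measurable_fun|exact: measurable_indic].
have cK : compact (f @` `[a, b]).
  by apply: continuous_compact; [exact: continuous_subspaceT|exact: segment_compact].
have [M [_ hM]] := compact_bounded cK.
exists `|M + 1|, (Num.max `|a| `|b|) => t; rewrite indicE.
case: (boolP (t \in _)) => [|_]; last by rewrite mulr0 normr0.
rewrite inE /= => tab; rewrite mulr1; split.
  apply: le_trans (ler_norm _); apply: (hM (M + 1)); first by rewrite ltrDl.
  by exists t.
move: tab; rewrite in_itv /= => /andP[at_ tb]; rewrite ltNge; case/negP.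
rewrite ler_norml; apply/andP; split.
  apply: le_trans at_; rewrite lerNl le_max; apply/orP; left.
  by rewrite -normrN; exact: ler_norm.
by apply: le_trans tb _; rewrite le_max ler_norm orbT.
Qed.

Lemma integral_cut (a b k0 k1 k2 : R) : a <= b ->
  \int[leb]_t ((k0 + k1 * t + k2 * t ^+ 2) * \1_`[a, b]%classic t) =
  k0 * (b - a) + k1 * (b ^+ 2 - a ^+ 2) / 2 + k2 * (b ^+ 3 - a ^+ 3) / 3.
Proof.
move=> ab; rewrite -Rintegral_poly2 // [RHS]Rintegral_mkcond; apply: eq_Rintegral => t _.
by rewrite patchE indicE; case: (t \in _); rewrite ?mulr1 ?mulr0.
Qed.

Lemma continuous_poly2 (k0 k1 k2 : R) : continuous (fun t : R => k0 + k1 * t + k2 * t ^+ 2).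
Proof.
have -> : (fun t : R => k0 + k1 * t + k2 * t ^+ 2) =
    horner (k0%:P + k1 *: 'X + k2 *: 'X^2).
  by apply/funext => t; rewrite !hornerE.
exact: continuous_horner.
Qed.

End OneDim.

Section Box.
Variables (R : realType) (n : nat).
Notation leb := (@lebesgue_measure R).
Notation vec := 'cV[R]_n.

Lemma II_prod (g : 'I_n -> R -> R) (l S : seq 'I_n) (c : R) : (forall i, bounded_supp (g i)) ->
  free S l -> (forall j, j \notin S -> j \in l) ->
  iter_integral l (fun x : vec => c * \prod_(i | i \notin S) g i (x i 0)) =
  fun=> c * \prod_(i <- l) \int[leb]_t g i t.
Proof.
move=> bg; elim: l S c => [|i l IH] S c fl cov.
  apply/funext => x; rewrite /= big_nil big_pred0 // => j.
  by apply/negbTE/negP => /cov.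
have [iS fl'] := freeS fl; rewrite big_cons mulrA -(IH (i :: S)) //=; last first.
  by move=> j; rewrite inE negb_or => /andP[ji /cov]; rewrite inE (negbTE ji).
congr (iter_integral l _); apply/funext => x; rewrite /line_integral mulrAC -RintegralZl //; last exact: bounded_supp_integrable.
apply: eq_Rintegral => t _; rewrite (bigD1 i) //= setcE eqxx mulrA mulrAC; congr (_ * _ * _).
rewrite (eq_bigl (fun j => j \notin i :: S)); last first.
  by move=> j; rewrite inE negb_or andbC.
by apply: eq_bigr => j; rewrite inE negb_or => /andP[ji _]; rewrite setcE (negbTE ji).
Qed.

Definition cpoly (c : 'I_n -> R) (s : nat -> R) : set vec :=
  joinset (fun i => delta_mx i 0) (@nat_of_ord n) c s.

Lemma delta_dual : dualb (fun i => delta_mx i 0 : vec) (fun i => delta_mx i 0).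
Proof. by move=> i j; rewrite dotv_delta mxE eqxx andbT. Qed.

Lemma cpolyE (c : 'I_n -> R) (s : nat -> R) : cpoly c s = hull ([set 0] `|`
  [set x | exists i, x = c i *: delta_mx i 0] `|`
  [set x | exists i : 'I_n, x = - (s i *: delta_mx i 0)]).
Proof.
rewrite /cpoly /joinset; congr (hull (_ `|` _)); apply/seteqP.
by split=> x /= [i ->]; exists i; rewrite (big_pred1 i).
Qed.

Lemma cpoly_Pno c s : (forall i, 0 < c i) -> (forall k, 0 < s k) -> Pno (cpoly c s).
Proof. by move=> c0 s0; exact: (joinset_Pno _ delta_dual c0 s0). Qed.

Lemma polar_cpoly c s : (forall i, 0 < c i) -> (forall k, 0 < s k) ->
  polar (cpoly c s) = [set y : vec | forall i : 'I_n, - (s i)^-1 <= y i 0 <= (c i)^-1].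
Proof.
move=> c0 s0; rewrite cpolyE; apply/seteqP; split=> y hy.
  move=> i; have h1 := hy (c i *: delta_mx i 0); have h2 := hy (- (s i *: delta_mx i 0)).
  rewrite lerNl -div1r -(div1r (c i)) !ler_pdivlMr //.
  rewrite dotvC dotvZl dotv_delta in h1; rewrite dotvC dotvNl dotvZl dotv_delta in h2.
  apply/andP; split; last by rewrite mulrC; apply: h1; apply: sub_cv; left; right; exists i.
  by rewrite mulNr mulrC; apply: h2; apply: sub_cv; right; exists i.
move=> x; apply: (@hull_min _ _ _ [set x | dotv y x <= 1]); first exact: convex_half1.
move=> z /= [[->|[i ->]]|[i ->]]; first by rewrite dotv0r.
  rewrite dotvC dotvZl dotv_delta mulrC -ler_pdivlMr // div1r.
  by case/andP: (hy i).
rewrite dotvC dotvNl dotvZl dotv_delta mulrC -mulNr -ler_pdivlMr // div1r lerNl.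
by case/andP: (hy i).
Qed.

(** The polar is a box ([polar_cpoly]), so the integral is a product of one-dimensional ones. *)
Lemma moment_polar_cpoly c s j : (forall i, 0 < c i) -> (forall k, 0 < s k) ->
  moment (polar (cpoly c s)) j 0 =
  ((c j)^-2 - (s j)^-2) / 2 * \prod_(i | i != j) ((c i)^-1 + (s i)^-1).
Proof.
move=> c0 s0; have PP := cpoly_Pno c0 s0.
have p := perm_refl (enum 'I_n).
rewrite mxE (integral_RnE 0 (nice_moment j (polar_bounded PP)) p) polar_cpoly //.
pose g i t : R := (if i == j then t else 1) * \1_`[- (s i)^-1, (c i)^-1]%classic t.
have bg i : bounded_supp (g i).
  have -> : g i = fun t => (fun t => if i == j then t else 1) t * \1_`[- (s i)^-1, (c i)^-1]%classic t by [].
  apply: bounded_supp_cut; case: (i == j); last exact: cst_continuous.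
  by move=> x; exact: cvg_id.
have E := II_prod 1 bg (free_perm p) (cov_perm p).
transitivity (iter_integral (enum 'I_n) (fun x : vec => 1 * \prod_(i | i \notin [::]) g i (x i 0)) 0).
  congr (iter_integral _ _ _); apply/funext => x; rewrite mul1r /g big_split /=; congr (_ * _).
    by rewrite -big_mkcondr /= (eq_bigl (pred1 j)) ?big_pred1_eq // => i; rewrite in_nil.
  rewrite indicE; case: (boolP (x \in _)) => [|h].
    rewrite inE => hx; rewrite big1 // => i _; rewrite indicE mem_set //= in_itv /=; exact: hx.
  have [i hi] : exists i : 'I_n, ~~ (- (s i)^-1 <= x i 0 <= (c i)^-1).
    by apply: contrapT => ne; move/negP: h; apply; rewrite inE => i; apply: contrapT => /negP h; apply: ne; exists i.
  by rewrite (bigD1 i) //= indicE memNset ?mul0r //= in_itv /=; exact/negP.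
have ci i : 0 < (c i)^-1 by rewrite invr_gt0.
have si (i : 'I_n) : 0 < (s i)^-1 by rewrite invr_gt0.
have le (i : 'I_n) : - (s i)^-1 <= (c i)^-1 by have := ci i; have := si i; lra.
rewrite E mul1r big_enum (bigD1 j) //=; congr (_ * _).
  rewrite /g eqxx; have := integral_cut 0 1 0 (le j).
  under eq_Rintegral do rewrite add0r mul1r mul0r addr0.
  by move=> ->; rewrite sqrrN !exprVn; field; rewrite !gt_eqF.
apply: eq_bigr => i ij; rewrite /g (negbTE ij); have := integral_cut 1 0 0 (le i).
under eq_Rintegral do rewrite !mul0r !addr0.
by move=> ->; rewrite opprK !mul0r !addr0 mul1r.
Qed.

End Box.

Notation o0 := (ord0 : 'I_2).
Notation o1 := (ord_max : 'I_2).

Section Plane.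
Variable R : realType.
Notation leb := (@lebesgue_measure R).

Lemma ord2P (i : 'I_2) : i = o0 \/ i = o1.
Proof. by case: i => [[|[|//]] h]; [left|right]; apply: val_inj. Qed.

Lemma sum2 (V : nmodType) (F : 'I_2 -> V) : \sum_i F i = F o0 + F o1.
Proof. by rewrite big_ord_recl big_ord1; congr (_ + F _); exact: val_inj. Qed.

Lemma vec2P (x y : 'cV[R]_2) : x o0 0 = y o0 0 -> x o1 0 = y o1 0 -> x = y.
Proof. by move=> h0 h1; apply/matrixP => i j; rewrite ord1; case: (ord2P i) => ->. Qed.

Lemma rot90E (v : 'cV[R]_2) : rot90 v o0 0 = - v o1 0 /\ rot90 v o1 0 = v o0 0.
Proof.
by split; rewrite mxE /=; [congr (- v _ _)|congr (v _ _)]; apply: val_inj; rewrite /= inordK.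
Qed.

Lemma rot90_contra (phi : 'M[R]_2) v : \det phi = 1 ->
  rot90 (phi *m v) = (invmx phi)^T *m rot90 v.
Proof.
move=> d1; have u : phi^T \in unitmx by rewrite unitmx_tr unitmxE d1 unitr1.
apply: (can_inj (mulKmx u)); rewrite trmx_inv mulKVmx //.
have d : phi o0 o0 * phi o1 o1 - phi o0 o1 * phi o1 o0 = 1.
  by rewrite -d1 det_mx22; congr (phi _ _ * phi _ _ - phi _ _ * phi _ _); exact: val_inj.
have [e0 e1] := rot90E (phi *m v); have [f0 f1] := rot90E v.
apply: vec2P; rewrite [LHS]mxE sum2 e0 e1 ?f0 ?f1 !mxE !sum2.
  by rewrite -[- v o1 0]mulr1 -d; ring.
by rewrite -[v o0 0 in RHS]mulr1 -d; ring.
Qed.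

Lemma rot90D (v w : 'cV[R]_2) : rot90 (v + w) = rot90 v + rot90 w.
Proof.
have [a0 a1] := rot90E (v + w); have [b0 b1] := rot90E v; have [c0 c1] := rot90E w.
by apply: vec2P; rewrite [RHS]mxE ?a0 ?a1 ?b0 ?b1 ?c0 ?c1 mxE ?opprD.
Qed.

Lemma rot_moment_valn : valuation (fun P : set 'cV[R]_2 => rot90 (moment P)).
Proof.
move=> K L PK PL PU PI; apply: etrans (esym (rot90D _ _)) _.
exact: etrans (congr1 (@rot90 R) (moment_valn PK PL PU PI)) (rot90D _ _).
Qed.

Lemma rot_moment_contra : SL_contravariant (fun P : set 'cV[R]_2 => rot90 (moment P)).
Proof.
by move=> phi P d1 PP; rewrite moment_img ?rot90_contra //; exact: Pno_bounded.
Qed.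

Lemma convex_sub2 (C : set 'cV[R]_2) u v (a b : R) : is_convex C -> C 0 -> C u -> C v ->
  0 <= a -> 0 <= b -> a + b <= 1 -> C (a *: u + b *: v).
Proof.
move=> cC C0 Cu Cv a0 b0 ab; have [e|ne] := eqVneq a 1.
  by have -> : b = 0; [lra|rewrite scale0r addr0 e scale1r].
have a1 : 0 < 1 - a by rewrite subr_gt0 lt_neqAle ne; lra.
have -> : a *: u + b *: v = a *: u + (1 - a) *: ((b / (1 - a)) *: v + (1 - b / (1 - a)) *: 0).
  by rewrite scaler0 addr0 scalerA mulrC mulfVK ?gt_eqF.
have h1 : 0 <= b / (1 - a) by apply: divr_ge0 => //; exact: ltW.
have h2 : b / (1 - a) <= 1 by rewrite ler_pdivrMr //; lra.
apply: (cC) => //; [apply: (cC) => //; lra|exact: ltW|lra].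
Qed.

Section Value.
Variables (c : 'I_2 -> R) (s : nat -> R).
Hypothesis c0 : forall i, 0 < c i.
Hypothesis s0 : forall k, 0 < s k.
Let b1 := c o0. Let a1 := s 0%N. Let b2 := c o1. Let a2 := s 1%N.
Let b1_gt0 : 0 < b1. Proof. exact: c0. Qed.
Let b2_gt0 : 0 < b2. Proof. exact: c0. Qed.
Let a1_gt0 : 0 < a1. Proof. exact: s0. Qed.
Let a2_gt0 : 0 < a2. Proof. exact: s0. Qed.

Lemma cpoly2P x : cpoly c s x <->
  [/\ x o0 0 / b1 + x o1 0 / b2 <= 1, x o0 0 / b1 - x o1 0 / a2 <= 1,
      - x o0 0 / a1 + x o1 0 / b2 <= 1 & - x o0 0 / a1 - x o1 0 / a2 <= 1].
Proof.
rewrite cpolyE; split; last first.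
  have [C0 cC] : cpoly c s 0 /\ is_convex (cpoly c s) by split; [exact: join_in0|exact: hull_convex].
  rewrite -cpolyE => -[h1 h2 h3 h4].
  have U i : cpoly c s (c i *: delta_mx i 0) by exact: (join_inc _ _ c).
  have V (i : 'I_2) : cpoly c s (- (s i *: delta_mx i 0)).
    by rewrite cpolyE; apply: sub_cv; right; exists i.
  have key u v (p q : R) : cpoly c s u -> cpoly c s v -> 0 <= p -> 0 <= q -> p + q <= 1 ->
     x = p *: u + q *: v -> cpoly c s x by move=> Cu Cv p0 q0 pq ->; exact: convex_sub2.
  have dv (y z : R) : 0 <= y -> 0 < z -> 0 <= y / z by move=> y0 z0; apply: divr_ge0 => //; exact: ltW.
  have [x0|x0] := leP 0 (x o0 0); have [x1|x1] := leP 0 (x o1 0).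
  - apply: (key _ _ (x o0 0 / b1) (x o1 0 / b2) (U o0) (U o1)); [by apply: dv => //; lra|by apply: dv => //; lra|lra|].
    apply: vec2P; rewrite !mxE /= ?(mulr0, oppr0, addr0, add0r, mulr1) -?/a1 -?/b1 -?/a2 -?/b2; field; by rewrite gt_eqF.
  - apply: (key _ _ (x o0 0 / b1) (- x o1 0 / a2) (U o0) (V o1)); [by apply: dv => //; lra|by apply: dv => //; lra|lra|].
    apply: vec2P; rewrite !mxE /= ?(mulr0, oppr0, addr0, add0r, mulr1) -?/a1 -?/b1 -?/a2 -?/b2; field; by rewrite gt_eqF.
  - apply: (key _ _ (- x o0 0 / a1) (x o1 0 / b2) (V o0) (U o1)); [by apply: dv => //; lra|by apply: dv => //; lra|lra|].
    apply: vec2P; rewrite !mxE /= ?(mulr0, oppr0, addr0, add0r, mulr1) -?/a1 -?/b1 -?/a2 -?/b2; field; by rewrite gt_eqF.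
  - apply: (key _ _ (- x o0 0 / a1) (- x o1 0 / a2) (V o0) (V o1)); [by apply: dv => //; lra|by apply: dv => //; lra|lra|].
    apply: vec2P; rewrite !mxE /= ?(mulr0, oppr0, addr0, add0r, mulr1) -?/a1 -?/b1 -?/a2 -?/b2; field; by rewrite gt_eqF.
have half (p q : R) : is_convex [set z : 'cV[R]_2 | p * z o0 0 + q * z o1 0 <= 1].
  move=> y z a b /= hy hz a0 b0 ab; rewrite !mxE.
  have := ler_wpM2l a0 hy; have := ler_wpM2l b0 hz; lra.
have H (p q : R) : - a1^-1 <= p <= b1^-1 -> - a2^-1 <= q <= b2^-1 -> cpoly c s x ->
    p * x o0 0 + q * x o1 0 <= 1.
  move=> /andP[p1 p2] /andP[q1 q2]; rewrite cpolyE.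
  apply: (@hull_min _ _ _ [set z : 'cV[R]_2 | p * z o0 0 + q * z o1 0 <= 1]); first exact: half.
  have pc : p * b1 <= 1 by rewrite -ler_pdivlMr // div1r.
  have qc : q * b2 <= 1 by rewrite -ler_pdivlMr // div1r.
  have pa : - p * a1 <= 1 by rewrite -ler_pdivlMr // div1r lerNl.
  have qa : - q * a2 <= 1 by rewrite -ler_pdivlMr // div1r lerNl.
  move=> z /= [[->|[i ->]]|[i ->]]; first by rewrite !mxE !mulr0 addr0 ler01.
    by case: (ord2P i) => ->; rewrite !mxE /= ?mulr1 ?mulr0 ?addr0 ?add0r.
  by case: (ord2P i) => ->; rewrite !mxE /= ?mulr1 ?mulr0 ?oppr0 ?mulr0 ?addr0 ?add0r mulrN -mulNr.
rewrite -cpolyE => hx; have i1 : 0 < a1^-1 by rewrite invr_gt0.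
have i2 : 0 < a2^-1 by rewrite invr_gt0.
have i3 : 0 < b1^-1 by rewrite invr_gt0.
have i4 : 0 < b2^-1 by rewrite invr_gt0.
split; rewrite ?mulNr [x o0 0 / _]mulrC [x o1 0 / _]mulrC -?mulNr; apply: H => //; lra.
Qed.

(** Profile of the horizontal sections: at height [t] they have length [(a1 + b1) * w t]. At [t = 0]
    both indicators count, which is harmless because the moment integrand carries the factor [t]. *)
Let w (t : R) := (1 - t / b2) * \1_`[0, b2]%classic t + (1 + t / a2) * \1_`[- a2, 0]%classic t.

Lemma section2 x : line_integral o0 (fun x => x o1 0 * \1_(cpoly c s) x) x = x o1 0 * ((a1 + b1) * w (x o1 0)).
Proof.
set t := x o1 0; rewrite /line_integral.
have -> : (fun u => setc x o0 u o1 0 * \1_(cpoly c s) (setc x o0 u)) =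
    (fun u => t * \1_(cpoly c s) (setc x o0 u)) by apply/funext => u; rewrite setcE.
have Z : (forall u, ~ cpoly c s (setc x o0 u)) -> w t = 0 ->
    \int[leb]_u (t * \1_(cpoly c s) (setc x o0 u)) = t * ((a1 + b1) * w t).
  move=> h ->; rewrite !mulr0 (@eq_Rintegral _ _ _ _ _ (cst 0)) ?Rintegral_cst ?mul0r // => u _.
  by rewrite indicE memNset ?mulr0.
have Y (r : R) : 0 <= r -> w t = r ->
   (forall u, cpoly c s (setc x o0 u) <-> - (a1 * r) <= u <= b1 * r) ->
    \int[leb]_u (t * \1_(cpoly c s) (setc x o0 u)) = t * ((a1 + b1) * w t).
  move=> r0 wr h; rewrite wr.
  have le : - (a1 * r) <= b1 * r.
    have := mulr_ge0 (ltW a1_gt0) r0; have := mulr_ge0 (ltW b1_gt0) r0; lra.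
  have := integral_cut t 0 0 le.
  under eq_Rintegral do rewrite !mul0r !addr0.
  rewrite !mul0r !addr0 opprK -mulrDl [b1 + _]addrC => <-.
  apply: eq_Rintegral => u _; rewrite !indicE; congr (_ * (nat_of_bool _)%:R).
  by apply/idP/idP; rewrite !inE /= in_itv /= => /h.
have out (lo hi : R) : ~~ (lo <= t <= hi) -> \1_`[lo, hi]%classic t = 0 :> R.
  by move=> /negP h; rewrite indicE memNset //= in_itv.
have inn (lo hi : R) : lo <= t <= hi -> \1_`[lo, hi]%classic t = 1 :> R.
  by move=> h; rewrite indicE mem_set //= in_itv.
have [t0|[t0|t0]] : t = 0 \/ 0 < t \/ t < 0 by have [] := ltgtP t 0; auto.
- under eq_Rintegral do rewrite t0 mul0r.
  by rewrite t0 mul0r Rintegral_cst ?mul0r.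
- have w1 : \1_`[- a2, 0]%classic t = 0 :> R by rewrite out // [t <= 0]leNgt t0 andbF.
  have [tb|tb] := leP t b2; last first.
    apply: Z; last by rewrite /w w1 out ?mulr0 ?addr0 // [t <= b2]leNgt tb andbF.
    move=> u /cpoly2P; rewrite !setcE /= -/t => -[h1 _ h3 _].
    have : 1 < t / b2 by rewrite ltr_pdivlMr ?mul1r.
    have [u0|u0] := leP 0 u.
      have := divr_ge0 u0 (ltW b1_gt0); lra.
    have : 0 < - u / a1 by rewrite divr_gt0 // oppr_gt0.
    lra.
  have r0 : 0 <= 1 - t / b2 by rewrite subr_ge0 ler_pdivrMr ?mul1r.
  apply: (Y (1 - t / b2)) => //.
    by rewrite /w w1 mulr0 addr0 inn ?mulr1 // (ltW t0).
  move=> u; split.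
    move=> /cpoly2P; rewrite !setcE /= -/t => -[h1 _ h3 _].
    rewrite lerNl ![_ * (1 - _)]mulrC -!ler_pdivrMr //; apply/andP; split; lra.
  rewrite lerNl ![_ * (1 - _)]mulrC -!ler_pdivrMr // => /andP[h1 h2].
  have p : 0 < t / a2 by rewrite divr_gt0.
  have q : 0 < t / b2 by rewrite divr_gt0.
  apply/cpoly2P; rewrite !setcE /= -/t; split; lra.
- have w1 : \1_`[0, b2]%classic t = 0 :> R by rewrite out // [0 <= t]leNgt t0.
  have [tb|tb] := leP (- a2) t; last first.
    apply: Z; last by rewrite /w w1 out ?mulr0 ?addr0 // [- a2 <= t]leNgt tb.
    move=> u /cpoly2P; rewrite !setcE /= -/t => -[_ h1 _ h3].
    have : 1 < - t / a2 by rewrite ltr_pdivlMr ?mul1r //; lra.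
    have [u0|u0] := leP 0 u.
      have := divr_ge0 u0 (ltW b1_gt0); lra.
    have : 0 < - u / a1 by rewrite divr_gt0 // oppr_gt0.
    lra.
  have r0 : 0 <= 1 + t / a2.
    have : - t / a2 <= 1 by rewrite ler_pdivrMr ?mul1r //; lra.
    lra.
  apply: (Y (1 + t / a2)) => //.
    by rewrite /w w1 mulr0 add0r inn ?mulr1 // tb (ltW t0).
  have p : 0 < - t / a2 by rewrite divr_gt0 ?oppr_gt0.
  have q : 0 < - t / b2 by rewrite divr_gt0 ?oppr_gt0.
  move=> u; split.
    move=> /cpoly2P; rewrite !setcE /= -/t => -[_ h1 _ h3].
    rewrite lerNl ![_ * (1 + _)]mulrC -!ler_pdivrMr //; apply/andP; split; lra.
  rewrite lerNl ![_ * (1 + _)]mulrC -!ler_pdivrMr // => /andP[h1 h2].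
  apply/cpoly2P; rewrite !setcE /= -/t; split; lra.
Qed.

Lemma moment_cpoly2 : moment (cpoly c s) o1 0 = (b1 + a1) * (b2 ^+ 2 - a2 ^+ 2) / 6.
Proof.
have PP := cpoly_Pno c0 s0.
have p : perm_eq [:: o0; o1] (enum 'I_2).
  by apply: uniq_perm; rewrite ?enum_uniq // => i; rewrite mem_enum !inE; case: (ord2P i) => ->.
rewrite mxE (integral_RnE 0 (nice_moment o1 (Pno_bounded PP)) p) /=.
rewrite (_ : line_integral o0 _ = fun x => x o1 0 * ((a1 + b1) * w (x o1 0))); last by apply/funext => x; exact: section2.
rewrite /line_integral.
pose k := a1 + b1.
transitivity (\int[leb]_t ((0 + k * t + (- (k / b2)) * t ^+ 2) * \1_`[0, b2]%classic t +
   (0 + k * t + (k / a2) * t ^+ 2) * \1_`[- a2, 0]%classic t)).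
  by apply: eq_Rintegral => t _; rewrite setcE /= /w /k; ring.
rewrite RintegralD //; try (apply: bounded_supp_integrable; apply: bounded_supp_cut; exact: continuous_poly2).
rewrite !integral_cut ?ltW ?oppr_lt0 // /k; field.
by rewrite !gt_eqF.
Qed.

End Value.

End Plane.

Local Notation leb := (@lebesgue_measure _).

(** * Cauchy's equation and measurability *)

(** A Steinhaus argument bounds [f] near 0: if [f] is bounded by [N] on a set meeting its translate
    by [d], then [f d] is at most [2 N] in absolute value. By additivity the deviation from
    linearity is then at most a constant over [m], for every [m]. *)
Lemma cauchy_pos (R : realType) (f : R -> R) :
  (forall s t, 0 < s -> 0 < t -> f (s + t) = f s + f t) ->
  measurable_fun `[1 : R, 2]%classic f -> forall t, 0 < t -> f t = t * f 1.
Proof.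
move=> fD mf.
pose E (N : nat) : set (measurableTypeR R) := `[1, 2]%classic `&` f @^-1` `[- N%:R, N%:R]%classic.
have mE N : measurable (E N) by apply: mf => //; exact: measurable_itv.
have UE : \bigcup_N E N = `[1, 2]%classic.
  apply/seteqP; split=> t; first by move=> [N _ []].
  move=> ht; have /andP[_ h] := truncn_itv (normr_ge0 (f t)).
  by exists (Num.truncn `|f t|).+1 => //; split=> //=; rewrite in_itv /= -ler_norml ltW.
(* The set and its translate by [d <= 1 / 4] both lie in an interval of length 5/4, so measures
   above 3/4 force them to meet. *)
have [N hN] : exists N, ((3 / 4)%:E < leb (E N))%E.
  apply: contrapT => /forallNP h.
  have ndE : nondecreasing_seq E.
    move=> m k mk; apply/subsetPset => t [ht /=]; rewrite in_itv /= -ler_norml => hf.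
    by split=> //=; rewrite in_itv /= -ler_norml (le_trans hf) // ler_nat.
  have cE : leb \o E @ \oo --> leb (\bigcup_n E n).
    by apply: nondecreasing_cvg_mu => //; rewrite UE; exact: measurable_itv.
  have : (limn (leb \o E) <= (3 / 4)%:E)%E.
    apply: lime_le; first by apply/cvg_ex; exists (leb (\bigcup_n E n)).
    by near=> k; rewrite /= leNgt; apply/negP; exact: h.
  rewrite (cvg_lim _ cE) // UE lebesgue_measure_itv /= lte_fin ltr1n -EFinB lee_fin.
  by move=> hh; clear -hh; lra.
clear UE.
have small d : 0 < d -> d <= 1 / 4 -> `|f d| <= 2 * N%:R.
  move=> d0 d4.
  pose G : set (measurableTypeR R) := (fun x => 1 * x + d) @^-1` E N.
  have mG : measurable G.
    by have := measurable_affine (1 : R) d measurableT (mE N); rewrite setTI.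
  have eG : leb G = leb (E N).
    by rewrite (affine_measure d (oner_neq0 R) (mE N)) normr1 mul1e.
  have [x [Ex Gx]] : exists x, E N x /\ G x.
    apply: contrapT => ne.
    have dis : E N `&` G = set0.
      by apply/seteqP; split=> // x [Ex Gx]; apply: ne; exists x.
    have eU : leb (E N `|` G) = (leb (E N) + leb (E N))%E.
      by rewrite -{2}eG; exact: measureU.
    pose lo : R := 3 / 4.
    have : (leb (E N `|` G) <= leb `[lo, 2%R]%classic)%E.
      apply: le_measure; rewrite ?inE; [exact: measurableU|exact: measurable_itv|].
      move=> x [[]|[]]; rewrite /= !in_itv /= /lo; first by move=> /andP[h1 h2] _; clear -h1 h2; apply/andP; split; lra.
      by move=> /andP[h1 h2] _; clear -h1 h2 d0 d4; apply/andP; split; lra.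
    have lo2 : lo < 2 by rewrite /lo; clear; lra.
    rewrite eU lebesgue_measure_itv /= lte_fin lo2 /lo.
    move=> hle; have := lt_le_trans (lteD hN hN) hle; rewrite -EFinD -EFinB lte_fin => hh.
    clear -hh; lra.
  move: Ex Gx; rewrite /E /G /= !in_itv /= -!ler_norml mul1r => -[/andP[x1 _] h1] [_ h2].
  have x0 : 0 < x by clear -x1; lra.
  have {}h2 : `|f (x + d)| <= N%:R by move: h2; rewrite /= in_itv /= -ler_norml.
  have -> : f d = f (x + d) - f x by rewrite fD // addrAC subrr add0r.
  by apply: le_trans (ler_normB _ _) _; rewrite mulr_natl mulr2n; exact: lerD.
have fM k t : 0 < t -> f (k.+1%:R * t) = k.+1%:R * f t.
  move=> t0; elim: k => [|k IH]; first by rewrite !mul1r.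
  have e (z : R) : k.+2%:R * z = k.+1%:R * z + z by rewrite -natr1 mulrDl mul1r.
  by rewrite !e fD ?IH // mulr_gt0.
have bnd m t : 0 < t -> `|f t - t * f 1| <= (2 * N%:R + `|f 1|) / m.+1%:R.
  move=> t0; set M : R := m.+1%:R; have M0 : 0 < M by rewrite ltr0n.
  (* Here [M * r <= 1 / 4], so the bound near 0 applies to [f (M * r) = M * f r]. *)
  have rem r : 0 < r -> r <= (4 * M)^-1 -> `|f r - r * f 1| <= (2 * N%:R + `|f 1|) / M.
    move=> r0 rM; have h := small (M * r) (mulr_gt0 M0 r0).
    have Mr : M * r <= 1 / 4.
      by rewrite mulrC -ler_pdivlMr //; apply: le_trans rM _; rewrite le_eqVlt; apply/orP; left; apply/eqP; field; rewrite gt_eqF.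
    have {}h := h Mr; rewrite fM // normrM -/M (ger0_norm (ltW M0)) in h.
    rewrite ler_pdivlMr // mulrC; have r1 : M * (r * `|f 1|) <= `|f 1|.
      rewrite mulrA; apply: ler_piMl => //; lra.
    have : `|f r - r * f 1| <= `|f r| + r * `|f 1|.
      by apply: le_trans (ler_normB _ _) _; rewrite normrM (ger0_norm (ltW r0)).
    by move=> /(ler_wpM2l (ltW M0)); lra.
  have d0 : 0 < (4 * M)^-1 by rewrite invr_gt0 mulr_gt0.
  have fd : f (4 * M)^-1 = (4 * M)^-1 * f 1.
    have e : 4 * M = (4 * m.+1).-1.+1%:R by rewrite /M prednK // natrM.
    have := fM (4 * m.+1).-1 _ d0; rewrite -e mulfV ?gt_eqF ?mulr_gt0 // => ->.
    by rewrite mulrA mulVf ?mul1r // gt_eqF // mulr_gt0.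
  have M4 : 0 < 4 * M by rewrite mulr_gt0.
  have /andP[k1 k2] := truncn_itv (ltW (mulr_gt0 M4 t0)).
  (* [t] is a multiple of the step [(4 * M)^-1], on which [f] is exactly linear, plus a remainder
     treated by [rem]. Additivity holds for positive arguments only, hence the separate cases where
     one of the two parts is 0. *)
  set k := Num.truncn _ in k1 k2; pose r := t - k%:R * (4 * M)^-1.
  have kt : k%:R * (4 * M)^-1 <= t by rewrite ler_pdivrMr ?mulr_gt0 // mulrC.
  have rM : r <= (4 * M)^-1.
    rewrite /r lerBlDr -{1}[(4 * M)^-1]mul1r -mulrDl addrC natr1 ler_pdivlMr ?mulr_gt0 //.
    by rewrite mulrC ltW.
  have tE : t = k%:R * (4 * M)^-1 + r by rewrite /r addrC subrK.
  have [e|r0] := eqVneq r 0; last first.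
    have rp : 0 < r by rewrite lt_neqAle eq_sym r0 subr_ge0.
    case: k @r kt k1 k2 rM tE r0 rp => [|k] r kt k1 k2 rM tE r0 rp.
      by rewrite tE mul0r add0r; exact: rem.
    rewrite {1 2}tE fD ?mulr_gt0 // fM // fd.
    have -> : k.+1%:R * ((4 * M)^-1 * f 1) + f r - (k.+1%:R * (4 * M)^-1 + r) * f 1 = f r - r * f 1 by ring.
    exact: rem.
  move: tE; rewrite e addr0; case: k {r e rM k1 k2 kt} => [|k] tE.
    by move: t0; rewrite tE mul0r ltxx.
  rewrite tE fM // fd mulrA subrr normr0; apply: divr_ge0; last exact: ltW.
  by apply: addr_ge0 => //; apply: mulr_ge0.
move=> t t0; apply/eqP; rewrite -subr_eq0 -normr_le0 leNgt; apply/negP => p.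
set C := 2 * N%:R + `|f 1|; have C0 : 0 <= C by rewrite addr_ge0 // mulr_ge0.
have /andP[_ h] := truncn_itv (divr_ge0 C0 (ltW p)).
have := bnd (Num.truncn (C / `|f t - t * f 1|)) t t0.
rewrite -/C ler_pdivlMr // leNgt; move: h; rewrite ltr_pdivrMr // mulrC => ->.
by [].
Unshelve. all: end_near. Qed.

(* The only consequence of Borel measurability that is used: measurability along
   polytopes with one vertex moving on a line. *)
Definition curve_measurable (R : realType) n (mu : set 'cV[R]_n -> 'cV[R]_n) := forall (s : seq 'cV[R]_n) p q j,
  (forall t : R, 1 <= t <= 2 -> Pno (hull [set` (p + t *: q) :: s])) ->
  measurable_fun `[1 : R, 2]%classic (fun t => mu (hull [set` (p + t *: q) :: s]) j 0).

Section Regular.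
Variables (R : realType) (n : nat) (s : seq 'cV[R]_n) (p q : 'cV[R]_n).
Let gam (t : R) := hull [set` (p + t *: q) :: s].

(** When one generator moves by [(t - t') *: q], a point of the hull moves by that vector times [w],
    the weight it gives to this generator. *)
Lemma gam_near t t' x : gam t x -> exists2 y, gam t' y & exists2 w : R, 0 <= w <= 1 & x = y + (w * (t - t')) *: q.
Proof.
apply: (@hull_min _ _ _ [set x | exists2 y, gam t' y & exists2 w : R, 0 <= w <= 1 & x = y + (w * (t - t')) *: q]).
  move=> x1 x2 a b [y1 h1 [w1 /andP[w10 w11] ->]] [y2 h2 [w2 /andP[w20 w21] ->]] a0 b0 ab.
  exists (a *: y1 + b *: y2); first exact: hull_convex.
  exists (a * w1 + b * w2); last by apply/matrixP => k l; rewrite !mxE; ring.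
  by rewrite addr_ge0 ?mulr_ge0 // -ab lerD // ler_piMr.
move=> z /=; rewrite inE => /orP[/eqP->|zs].
  exists (p + t' *: q); first by apply: sub_cv; rewrite /= inE eqxx.
  exists 1; first by rewrite ler01 lexx.
  by apply/matrixP => k l; rewrite !mxE; ring.
exists z; first by apply: sub_cv; rewrite /= inE zs orbT.
by exists 0; rewrite ?lexx ?ler01 // mul0r scale0r addr0.
Qed.

Lemma gam_hausdorff t t' (e : R) : `|t - t'| * enorm q < e -> hausdorff_lt (gam t) (gam t') e.
Proof.
move=> h; have nq : 0 <= enorm q by exact: sqrtr_ge0.
exists (`|t - t'| * enorm q); first by rewrite h mulr_ge0.
have le (w : R) u : 0 <= w <= 1 -> enorm ((w * u) *: q) <= `|u| * enorm q.
  move=> /andP[w0 w1]; rewrite enormZ ler_wpM2r // normrM ger0_norm //.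
  exact: ler_piMl.
split=> [x /(gam_near t')[y hy [w w01 ->]]|y /(gam_near t)[x hx [w w01 ->]]].
  by exists y => //; rewrite addrAC subrr add0r; exact: le.
exists x => //; rewrite opprD addrA subrr add0r -scaleNr -mulrN opprB; exact: le.
Qed.

Hypothesis gamP : forall t : R, 1 <= t <= 2 -> Pno (gam t).
Let D : set R := `[1 : R, 2]%classic.

Let DP t : D t -> Pno (gam t).
Proof. by rewrite /D /= in_itv /=; exact: gamP. Qed.

(** The sets with measurable preimage form a sigma-algebra, and preimages of open sets are
    relatively open because [gam] is Lipschitz for the Hausdorff distance ([gam_hausdorff]). *)
Lemma gam_borel A : borel_Pno A -> measurable (D `&` [set t | A (gam t)]).
Proof.
have mD : measurable D by exact: measurable_itv.
apply: (@smallest_sub _ _ _ [set A | measurable (D `&` [set t | A (gam t)])]).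
  split=> /=.
  - by rewrite (_ : _ `&` _ = set0) //; apply/seteqP; split=> // t [].
  - move=> B mB; rewrite (_ : _ `&` _ = D `\` (D `&` [set t | B (gam t)])); first exact: measurableD.
    apply/seteqP; split=> t; first by move=> [Dt [_ nB]]; split=> // -[].
    by move=> [Dt nB]; split=> //; split; [exact: DP|move=> Bt; apply: nB].
  - move=> F mF; rewrite (_ : _ `&` _ = \bigcup_k (D `&` [set t | F k (gam t)])).
      exact: bigcup_measurable.
    apply/seteqP; split=> t; first by move=> [Dt [k _ Fk]]; exists k.
    by move=> [k _ [Dt Fk]]; split=> //; exists k.
move=> U [UP hU] /=.
pose O : set R := [set t | exists2 e : R, 0 < e & forall t', D t' -> `|t - t'| < e -> U (gam t')].
rewrite (_ : _ `&` _ = D `&` O).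
  apply: measurableI => //; apply: open_measurable; rewrite openE => t [e e0 h].
  apply/nbhs_ballP; exists (e / 2); first by rewrite /= divr_gt0.
  move=> t1 /= tt; exists (e / 2); first by rewrite divr_gt0.
  move=> t' Dt' t1t; apply: h => //; move: tt; rewrite /ball /= => tt.
  have := ler_normD (t - t1) (t1 - t'); rewrite addrA subrK.
  by move: tt t1t; set a := `|t - t1|; set b := `|t1 - t'|; lra.
apply/seteqP; split=> t [Dt]; last first.
  by move=> [e e0 h]; split=> //; apply: h; rewrite // subrr normr0.
move=> Ut; split=> //; have [e e0 he] := hU _ Ut.
have nq : 0 <= enorm q by exact: sqrtr_ge0.
exists (e / (enorm q + 1)); first by rewrite divr_gt0 //; lra.
move=> t' Dt' tt'; apply: he; first exact: DP.
apply: gam_hausdorff; move: tt'; rewrite ltr_pdivlMr; last by lra.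
by apply: le_lt_trans; rewrite ler_wpM2l //; lra.
Qed.

End Regular.

Lemma measurable_curve (R : realType) n (mu : set 'cV[R]_n -> 'cV[R]_n) :
  measurable_on_Pno mu -> curve_measurable mu.
Proof.
move=> mm s p q j PP mD; apply: (measurability _ (RGenInftyO.measurableE R)) => //.
move=> _ [_ [c ->] <-].
have bB : borel_Rn [set v : 'cV[R]_n | v j 0 < c].
  apply: sub_gen_smallest => v /= vc; exists (c - v j 0); first by rewrite subr_gt0.
  move=> w; have := enorm_coord (w - v) j; rewrite !mxE => h1 h2 /=.
  have := ler_norm (w j 0 - v j 0); lra.
have := gam_borel PP (mm _ bB).
rewrite (_ : _ `&` _ = `[1 : R, 2]%classic `&` (fun t => mu (hull [set` (p + t *: q) :: s]) j 0) @^-1` `]-oo, c[%classic) //.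
apply/seteqP; split=> t /=; rewrite !in_itv /=; first by move=> [Dt [_ h]].
by move=> [Dt h]; split=> //; split=> //; exact: PP.
Qed.

(** * The functional equation *)

Section Solve.
Variable R : realType.
Variables (f : R -> R -> R -> R) (be : R -> R -> R).
Implicit Types (x y z p q t u v l : R).

Hypothesis fDD : forall x1 x2 x3 x4 y z, 0 < x1 -> 0 < x2 -> 0 < x3 -> 0 < x4 -> 0 < y -> 0 < z ->
  (f x1 x3 y - f x3 x1 z) + (f x2 x4 y - f x4 x2 z) =
  (f x1 x4 y - f x4 x1 z) + (f x2 x3 y - f x3 x2 z).
Hypothesis fZ : forall l x y z, 0 < l -> 0 < x -> 0 < y -> 0 < z ->
  f (l * x) (l * y) (z / l) = l * f x y z.
Hypothesis beZ : forall l x y, 0 < l -> 0 < x -> 0 < y -> be (l * x) (l * y) = l ^+ 3 * be x y.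
Hypothesis beC : forall x y, 0 < x -> 0 < y -> be x y = be y x.
Hypothesis eC : forall x y z, 0 < x -> 0 < y -> 0 < z ->
  - f y x z + f x y (x + y) + f (x + y) z y + be z (x + y) / 2 =
  f x (y + z) y - f (y + z) x z - be x (y + z).
Hypothesis eCR : forall x y z, 0 < x -> 0 < y -> 0 < z ->
  f x y z - f y x (x + y) - f z (x + y) y + be z (x + y) / 2 =
  - f (y + z) x y + f x (y + z) z - be x (y + z).
Hypothesis mf1 : measurable_fun `[1 : R, 2]%classic (fun t => f t^-1 1 1).
Hypothesis mf2 : measurable_fun `[1 : R, 2]%classic (fun t => f 1 t^-1 1).

Let s x y z := f x y z + f y x z.
Let a x y z := f x y z - f y x z.

(** [x * (x + y)], [y * (x + y)] and [x * y] are the arguments that homogeneity produces in the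
    equations below; dividing [u] and [v] by the square root of [u + v] makes the first two
    arbitrary. *)
Lemma half_split u v : 0 < u -> 0 < v ->
  exists x y, [/\ 0 < x, 0 < y, x * (x + y) = u, y * (x + y) = v & x * y = u * v / (u + v)].
Proof.
move=> u0 v0; have uv : 0 < u + v by rewrite addr_gt0.
pose S := Num.sqrt (u + v); have S0 : 0 < S by rewrite sqrtr_gt0.
have SS : S * S = u + v by rewrite -expr2 sqr_sqrtr // ltW.
exists (u / S), (v / S).
have e : u / S + v / S = S by rewrite -mulrDl -SS mulfK ?gt_eqF.
split; rewrite ?divr_gt0 ?e ?mulfVK ?gt_eqF //.
by rewrite -SS; field; rewrite gt_eqF.
Qed.

Let r x z := s x x z / 2.

(** [fDD] makes the symmetric part additive in [x] and [y] up to a term [e x y] free of [z]. The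
    difference of the triangle equations [eC], [eCR] writes [e (p + q) t] as a function of [p, q]
    plus one of [q, t]. So mixed differences of [e] vanish, and with symmetry and [e u u = 0] this
    gives [e = 0]. *)
Lemma s_split x y z : 0 < x -> 0 < y -> 0 < z -> s x y z = r x z + r y z.
Proof.
pose e p q := s p q 1 - r p 1 - r q 1.
have ez p q t : 0 < p -> 0 < q -> 0 < t -> s p q t = r p t + r q t + e p q.
  move=> p0 q0 t0; rewrite /e /r /s.
  have := fDD p0 q0 p0 q0 ltr01 t0; have := fDD p0 q0 p0 q0 t0 ltr01.
  have := fDD p0 q0 p0 q0 t0 t0; have := fDD p0 q0 p0 q0 ltr01 ltr01; lra.
have eqn p q t : 0 < p -> 0 < q -> 0 < t ->
    (r t q - r q t + r (q + t) t - r (q + t) q) +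
    (r p (p + q) + r q (p + q) + r (p + q) q - r p q) + e (p + q) t = 0.
  move=> p0 q0 t0; have pq := addr_gt0 p0 q0; have qt := addr_gt0 q0 t0.
  have := eC p0 q0 t0; have := eCR p0 q0 t0.
  have := ez q p t q0 p0 t0; have := ez p q (p + q) p0 q0 pq; have := ez (p + q) t q pq t0 q0.
  have := ez p (q + t) q p0 qt q0; have := ez (q + t) p t qt p0 t0.
  have ee : e q p = e p q by rewrite /e /s; ring.
  have ee' : e (q + t) p = e p (q + t) by rewrite /e /s; ring.
  rewrite ee ee' /s; lra.
have eC' p q : e p q = e q p by rewrite /e /s; ring.
have ezero p q : 0 < p -> 0 < q -> e p q = 0.
  move=> p0 q0; pose m := Num.min p q / 2.
  have m0 : 0 < m by rewrite divr_gt0 // lt_min p0.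
  have mp : 0 < p - m.
    have : Num.min p q <= p by rewrite ge_min lexx.
    by rewrite /m; lra.
  have mq : 0 < q - m.
    have : Num.min p q <= q by rewrite ge_min lexx orbT.
    by rewrite /m; lra.
  have := eqn (p - m) m p mp m0 p0; have := eqn (p - m) m q mp m0 q0.
  have := eqn (q - m) m p mq m0 p0; have := eqn (q - m) m q mq m0 q0.
  rewrite !subrK (eC' q p).
  have e0 u : e u u = 0 by rewrite /e /r; field.
  by rewrite !e0; lra.
by move=> x0 y0 z0; rewrite ez // ezero // addr0.
Qed.

Let h t := r 1 t.

Lemma r_hom x z : 0 < x -> 0 < z -> r x z = x * h (x * z).
Proof.
move=> x0 z0; have := fZ x0 ltr01 ltr01 (mulr_gt0 x0 z0).
by rewrite !mulr1 [x * z / x]mulrAC divff ?gt_eqF // mul1r /h /r /s => ->; ring.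
Qed.

(** The difference of the triangle equations reads [X q u + Y p q = 0] with [X] antisymmetric,
    whence [Y = 0]. Exchanging [x] and [y] there gives two equations in [h u] and [h v], and
    [half_split] makes the arguments arbitrary. *)
Lemma h_val t : 0 < t -> h t = h 1 / t ^+ 2.
Proof.
pose X y z := r z y - r y z + r (y + z) z - r (y + z) y.
pose Y x y := r x (x + y) + r y (x + y) + r (x + y) y - r x y.
have eqn p q u : 0 < p -> 0 < q -> 0 < u -> X q u + Y p q = 0.
  move=> p0 q0 u0; have pq := addr_gt0 p0 q0; have qu := addr_gt0 q0 u0.
  have := eC p0 q0 u0; have := eCR p0 q0 u0.
  have := s_split q0 p0 u0; have := s_split p0 q0 pq; have := s_split pq u0 q0.
  have := s_split p0 qu q0; have := s_split qu p0 u0; rewrite /s /X /Y; lra.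
have Xa q u : X q u = - X u q by rewrite /X [u + q]addrC; ring.
have Y0 p q : 0 < p -> 0 < q -> Y p q = 0.
  move=> p0 q0; have := eqn p q q p0 q0 q0; have := Xa q q; lra.
have hh u v : 0 < u -> 0 < v -> v ^+ 2 * h v = u ^+ 2 * h u.
  move=> u0 v0; have [x [y [x0 y0 eu ev _]]] := half_split u0 v0.
  have S0 := addr_gt0 x0 y0.
  have := Y0 x y x0 y0; have := Y0 y x y0 x0; rewrite /Y [y + x]addrC !r_hom //.
  rewrite [y * x]mulrC ![(x + y) * _]mulrC eu ev => h1 h2.
  have := congr1 (fun w => x * w) h1; have := congr1 (fun w => y * w) h2.
  rewrite !mulr0 => e1 e2; have h3 : y ^+ 2 * h v = x ^+ 2 * h u by move: e1 e2; lra.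
  rewrite -{1}ev -{1}eu !exprMn mulrAC h3; ring.
move=> t0; have := hh t 1 t0 ltr01; rewrite expr1n mul1r => ->.
by rewrite mulrAC divff ?mul1r // gt_eqF // exprn_gt0.
Qed.

Lemma s_val x y z : 0 < x -> 0 < y -> 0 < z -> s x y z = h 1 * (x^-1 + y^-1) / z ^+ 2.
Proof.
move=> x0 y0 z0; rewrite s_split // !r_hom // !(h_val (mulr_gt0 _ _)) //.
by field; rewrite !gt_eqF.
Qed.

(** The base point [z^-1] respects the scaling in [fZ], so that [P] is homogeneous ([P_hom]). *)
Let P x z := a x z^-1 z.
Let k t := P 1 t.

Lemma a_split x y z : 0 < x -> 0 < y -> 0 < z -> a x y z = P x z - P y z.
Proof.
move=> x0 y0 z0; have w0 : 0 < z^-1 by rewrite invr_gt0.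
have := fDD x0 w0 y0 w0 z0 z0; rewrite /P /a; lra.
Qed.

Lemma P_hom x z : 0 < x -> 0 < z -> P x z = x * k (x * z).
Proof.
move=> x0 z0; have xz := mulr_gt0 x0 z0; have w0 : 0 < (x * z)^-1 by rewrite invr_gt0.
have := fZ x0 ltr01 w0 xz; have := fZ x0 w0 ltr01 xz.
rewrite mulr1 [x * z / x]mulrAC divff ?gt_eqF // mul1r.
have -> : x * (x * z)^-1 = z^-1 by field; rewrite !gt_eqF.
by rewrite /k /P /a => -> ->; ring.
Qed.

Let X y z := - P y z - P z y + P (y + z) y + P (y + z) z.
Let Y x y := P x (x + y) - P y (x + y) + P (x + y) y - P x y.

(** Sum of the two triangle equations; their difference, in which [be] cancels, governed the
    symmetric part. *)
Lemma eqnA p q u : 0 < p -> 0 < q -> 0 < u ->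
  X q u + Y p q + be u (p + q) + 2 * be p (q + u) = 0.
Proof.
move=> p0 q0 u0; have pq := addr_gt0 p0 q0; have qu := addr_gt0 q0 u0.
have := eC p0 q0 u0; have := eCR p0 q0 u0.
have := a_split q0 p0 u0; have := a_split p0 q0 pq; have := a_split pq u0 q0.
have := a_split p0 qu q0; have := a_split qu p0 u0; rewrite /a /X /Y; lra.
Qed.

Let al := be 1 1 / 2.

(** Mixed differences of [eqnA] remove [X] and [Y]. Let [A] be the mixed difference of [be] with
    both arguments ranging over [p, q], and [B] the one with arguments shifted by [- m] and by [m]:
    then [A + 2 B = 0] and [B + 2 A = 0]. So [A = 0], which reduces [be] to its diagonal. *)
Lemma be_val p q : 0 < p -> 0 < q -> be p q = al * (p ^+ 3 + q ^+ 3).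
Proof.
move=> p0 q0; have diag u : 0 < u -> be u u = 2 * al * u ^+ 3.
  by move=> u0; have := beZ u0 ltr01 ltr01; rewrite !mulr1 => ->; rewrite /al; field.
suff : be p q = (be p p + be q q) / 2 by rewrite !diag // => ->; field.
pose m := Num.min p q / 2.
have m0 : 0 < m by rewrite divr_gt0 // lt_min p0.
have mp : 0 < p - m.
  have : Num.min p q <= p by rewrite ge_min lexx.
  by rewrite /m; lra.
have mq : 0 < q - m.
  have : Num.min p q <= q by rewrite ge_min lexx orbT.
  by rewrite /m; lra.
have mp' := addr_gt0 m0 p0; have mq' := addr_gt0 m0 q0.
have := eqnA mp m0 q0; have := eqnA mp m0 p0; have := eqnA mq m0 q0; have := eqnA mq m0 p0.
have := eqnA q0 m0 mp; have := eqnA q0 m0 mq; have := eqnA p0 m0 mp; have := eqnA p0 m0 mq.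
rewrite ![m + (_ - m)]addrC !subrK ![_ + m]addrC.
rewrite (beC mp mp') (beC mp mq') (beC mq mp') (beC mq mq') (beC q0 p0).
set X1 := X m _; set X2 := X m _; set X3 := X m _; set X4 := X m _.
set Y1 := Y _ m; set Y2 := Y _ m; set Y3 := Y _ m; set Y4 := Y _ m.
lra.
Qed.

(** The shift absorbs the terms coming from [be] and leaves an equation in [k1] alone. *)
Let k1 t := k t + 3 * al * t.

(** In terms of [k1 t^-1] this is Cauchy's equation. In [X1 q t + p * J p q = 0] both [X1] and [J]
    are symmetric; this forces [J 2 1 = 0], then [X1 q 1 = 0] for all [q], and finally [J = 0]. *)
Lemma k1_add u v : 0 < u -> 0 < v -> k1 u + k1 v = k1 (u * v / (u + v)).
Proof.
have kk t : k t = k1 t - 3 * al * t by rewrite /k1; ring.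
pose J x y := k1 (x * (x + y)) + k1 (y * (x + y)) - k1 (x * y).
pose X1 y z := - y * k1 (y * z) - z * k1 (z * y) + (y + z) * k1 ((y + z) * y) + (y + z) * k1 ((y + z) * z).
have eqn p q t : 0 < p -> 0 < q -> 0 < t -> X1 q t + p * J p q = 0.
  move=> p0 q0 t0; have := eqnA p0 q0 t0.
  have pq := addr_gt0 p0 q0; have qt := addr_gt0 q0 t0.
  rewrite /X /Y !P_hom // !be_val // !kk /X1 /J ![(p + q) * q]mulrC.
  set A1 := k1 _; set A2 := k1 _; set A3 := k1 _; set A4 := k1 _; set A5 := k1 _; set A6 := k1 _; set A7 := k1 _.
  move=> E; rewrite -[RHS]E; ring.
have XC q t : X1 q t = X1 t q.
  by rewrite /X1 [t + q]addrC; ring.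
have JC p q : J p q = J q p by rewrite /J [q + p]addrC [q * p]mulrC; ring.
have J21 : 2 * J 2 1 = 1 * J 1 2.
  have o2 : 0 < 2 :> R by [].
  have := eqn 2 1 2 o2 ltr01 o2; have := eqn 1 2 1 ltr01 o2 ltr01; have := XC 2 1; lra.
have X0 q : 0 < q -> X1 q 1 = 0.
  move=> q0; have o2 : 0 < 2 :> R by [].
  have h1 : X1 1 2 = 0.
    by have := eqn 2 1 2 o2 ltr01 o2; move: J21; rewrite (JC 1 2); lra.
  have h2 : X1 1 q = X1 1 2.
    by have := eqn 1 1 q ltr01 ltr01 q0; have := eqn 1 1 2 ltr01 ltr01 o2; lra.
  by rewrite XC h2.
move=> u0 v0; have [x [y [x0 y0 eu ev euv]]] := half_split u0 v0.
have := eqn x y 1 x0 y0 ltr01; rewrite X0 // add0r => /eqP.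
rewrite mulf_eq0 gt_eqF //= /J eu ev euv => /eqP; lra.
Qed.

Lemma k1_val t : 0 < t -> k1 t = k1 1 / t.
Proof.
pose K t := k1 t^-1.
have KD u v : 0 < u -> 0 < v -> K (u + v) = K u + K v.
  move=> u0 v0; rewrite /K k1_add ?invr_gt0 //; congr k1.
  by field; rewrite !gt_eqF // addr_gt0.
have mK : measurable_fun `[1 : R, 2]%classic K.
  apply: (@eq_measurable_fun _ _ _ _ _ (fun t => t * (f t^-1 1 1 - f 1 t^-1 1) + 3 * al * t^-1)).
    move=> x /set_mem /=; rewrite in_itv /= => /andP[x1 _].
    have x0 : 0 < x by rewrite (lt_le_trans _ x1).
    have w0 : 0 < x^-1 by rewrite invr_gt0.
    have := fZ x0 w0 ltr01 ltr01; have := fZ x0 ltr01 w0 ltr01.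
    rewrite mulr1 mul1r mulfV ?gt_eqF // /K /k1 /k /P /a invrK => -> ->; ring.
  have mi : measurable_fun `[1 : R, 2]%classic (fun t : R => t^-1).
    apply: (@eq_measurable_fun _ _ _ _ _ (fun t : R => (Num.max 1 t)^-1)).
      by move=> x /set_mem /=; rewrite in_itv /= => /andP[x1 _]; rewrite max_r.
    apply: nonincreasing_measurable => // u v uv.
    have m1 w : 0 < Num.max 1 w :> R by rewrite lt_max ltr01.
    by rewrite lef_pV2 ?posrE // ge_max !le_max lexx uv orbT.
  apply: measurable_funD; last by apply: measurable_funM.
  by apply: measurable_funM => //; apply: measurable_funB.
move=> t0; have w0 : 0 < t^-1 by rewrite invr_gt0.
by have := cauchy_pos KD mK w0; rewrite /K invrK invr1 mulrC.
Qed.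

Lemma a_val x y z : 0 < x -> 0 < y -> 0 < z -> a x y z = - 3 * al * (x ^+ 2 - y ^+ 2) * z.
Proof.
move=> x0 y0 z0; rewrite a_split // !P_hom //.
have kk t : k t = k1 t - 3 * al * t by rewrite /k1; ring.
rewrite !kk !(k1_val (mulr_gt0 _ _)) //; field; rewrite !gt_eqF //.
Qed.

Lemma functional_equation : exists k' k'' : R, forall x x' y z, 0 < x -> 0 < x' -> 0 < y -> 0 < z ->
  f x x' y - f x' x z = k' * (x ^+ 2 - x' ^+ 2) * (y + z) +
    k'' * (x^-1 + x'^-1) * ((y ^+ 2)^-1 - (z ^+ 2)^-1).
Proof.
exists (- 3 * al / 2), (h 1 / 2) => x x' y z x0 x'0 y0 z0.
have := s_val x0 x'0 y0; have := s_val x0 x'0 z0.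
have := a_val x0 x'0 y0; have := a_val x'0 x0 z0.
rewrite /s /a; lra.
Qed.

End Solve.

(** * Quadrilaterals *)

Section Four.
Variables (R : realType) (n : nat) (g : 'cV[R]_n) (nu : set 'cV[R]_n -> R) (Q : set 'cV[R]_n).
Hypothesis val : valuation nu.
Hypothesis bQ : equatorial g Q.

(** All four bipyramids are split at one common small pair [t *: u], [- (t *: u)]; each becomes a
    term in its upper apex plus a term in its lower apex, up to a common constant. *)
Lemma bipyr_four u u' v v' : dotv g v < 0 < dotv g u -> dotv g v' < 0 < dotv g u' ->
  Q (cross g u v) -> Q (cross g u' v') -> Q (cross g u v') -> Q (cross g u' v) ->
  nu (bipyr Q u v) + nu (bipyr Q u' v') = nu (bipyr Q u v') + nu (bipyr Q u' v).
Proof.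
move=> /andP[v0 u0] /andP[v0' u0'] q1 q2 q3 q4.
have S a b : dotv g b < 0 < dotv g a -> exists2 t : R, 0 < t & forall s, 0 <= s <= t ->
    bipyr Q a b (s *: u) /\ bipyr Q a b (- (s *: u)).
  move=> ab; have PX := bipyr_Pno bQ ab.
  have [t1 t10 h1] := Pno_small u PX; have [t2 t20 h2] := Pno_small (- u) PX.
  exists (Num.min t1 t2); first by rewrite lt_min t10.
  move=> s; rewrite le_min => /and3P[s0 s1 s2].
  by split; [apply: h1; rewrite s0|rewrite -scalerN; apply: h2; rewrite s0].
have uv : dotv g v < 0 < dotv g u by rewrite v0.
have uv' : dotv g v' < 0 < dotv g u by rewrite v0'.
have u'v : dotv g v < 0 < dotv g u' by rewrite v0.
have u'v' : dotv g v' < 0 < dotv g u' by rewrite v0'.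
have [t1 t10 h1] := S _ _ uv; have [t2 t20 h2] := S _ _ uv'.
have [t3 t30 h3] := S _ _ u'v; have [t4 t40 h4] := S _ _ u'v'.
pose t := Num.min (Num.min t1 t2) (Num.min t3 t4).
have t0 : 0 < t by rewrite !lt_min t10 t20 t30.
have ht : [/\ 0 <= t <= t1, 0 <= t <= t2, 0 <= t <= t3 & 0 <= t <= t4].
  by split; rewrite (ltW t0) /= !ge_min lexx ?orbT.
case: ht => /h1[a1 b1] /h2[a2 b2] /h3[a3 b3] /h4[a4 b4].
have pq : dotv g (- (t *: u)) < 0 < dotv g (t *: u).
  by rewrite dotvNr oppr_lt0 dotvZr mulr_gt0.
rewrite (bipyr_split val bQ uv q1 a1 b1 pq) (bipyr_split val bQ uv' q3 a2 b2 pq).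
rewrite (bipyr_split val bQ u'v q4 a3 b3 pq) (bipyr_split val bQ u'v' q2 a4 b4 pq).
ring.
Qed.

End Four.

Section PlanarPoints.
Variable R : realType.
Implicit Types (a b c d x y z h k l : R).

Definition pt a b : 'cV[R]_2 := \col_i (if i == o0 then a else b).

Lemma pt0 a b : pt a b o0 0 = a. Proof. by rewrite mxE. Qed.
Lemma pt1 a b : pt a b o1 0 = b. Proof. by rewrite mxE. Qed.

Lemma ptD a b c d : pt a b + pt c d = pt (a + c) (b + d).
Proof. by apply: vec2P; rewrite !mxE. Qed.
Lemma ptZ l a b : l *: pt a b = pt (l * a) (l * b).
Proof. by apply: vec2P; rewrite !mxE. Qed.
Lemma pt00 : pt 0 0 = 0.
Proof. by apply: vec2P; rewrite !mxE. Qed.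
Lemma dot_pt (v : 'cV[R]_2) a b : dotv v (pt a b) = v o0 0 * a + v o1 0 * b.
Proof. by rewrite /dotv sum2 pt0 pt1. Qed.

Definition mat2 a b c d : 'M[R]_2 := \matrix_(i, j)
  if i == o0 then (if j == o0 then a else b) else (if j == o0 then c else d).

Lemma mat2_pt a b c d x y : mat2 a b c d *m pt x y = pt (a * x + b * y) (c * x + d * y).
Proof. by apply: vec2P; rewrite [LHS]mxE sum2 pt0 pt1 !mxE. Qed.

Lemma det_mat2 a b c d : \det (mat2 a b c d) = a * d - b * c.
Proof. by rewrite det_mx22 !mxE. Qed.

Definition seg x x' : set 'cV[R]_2 := hull [set` [:: pt x^-1 0; pt (- x'^-1) 0]].

Lemma seg_in x x' a : 0 < x -> 0 < x' -> - x'^-1 <= a <= x^-1 -> seg x x' (pt a 0).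
Proof.
move=> x0 x'0 /andP[a1 a2].
have w : 0 < x^-1 + x'^-1 by rewrite addr_gt0 ?invr_gt0.
have -> : pt a 0 = ((a + x'^-1) / (x^-1 + x'^-1)) *: pt x^-1 0 +
    ((x^-1 - a) / (x^-1 + x'^-1)) *: pt (- x'^-1) 0.
  rewrite !ptZ ptD !mulr0 addr0; congr pt; field.
  by rewrite !gt_eqF // addr_gt0.
apply: hull_convex; try (by apply: sub_cv; rewrite /= !inE eqxx ?orbT).
- by apply: divr_ge0; [lra|exact: ltW].
- by apply: divr_ge0; [lra|exact: ltW].
- by rewrite -mulrDl; set s := x^-1 in w *; set s' := x'^-1 in w *; field; rewrite gt_eqF.
Qed.

Lemma seg_base x x' : 0 < x -> 0 < x' -> equatorial (pt 0 1) (seg x x').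
Proof.
move=> x0 x'0; split; first by exists [:: pt x^-1 0; pt (- x'^-1) 0].
- apply: hull_min.
    by move=> u v a b /= hu hv _ _ _; rewrite dotvDr !dotvZr hu hv !mulr0 addr0.
  by move=> u /=; rewrite !inE => /orP[] /eqP->; rewrite dot_pt pt0 pt1 mul0r mulr0 addr0.
move=> h h0; pose a := h o0 0; pose m := Num.min x^-1 x'^-1.
have m0 : 0 < m by rewrite lt_min !invr_gt0 x0.
have q0 : 0 < `|a| + 1 by apply: ltr_wpDl.
exists (m / (`|a| + 1)); first exact: divr_gt0.
have -> : h = pt a 0.
  apply: vec2P; rewrite ?pt0 ?pt1 //.
  by move: h0; rewrite dotvC dot_pt mulr0 add0r mulr1.
rewrite ptZ mulr0; apply: seg_in => //; apply/andP.
have le : `|m / (`|a| + 1) * a| <= m.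
  rewrite normrM ger0_norm; last by apply: divr_ge0; exact: ltW.
  by rewrite mulrAC ler_pdivrMr // ler_wpM2l ?lerDl // ltW.
move: le; rewrite ler_norml => /andP[e1 e2].
have m1 : m <= x^-1 by rewrite ge_min lexx.
have m2 : m <= x'^-1 by rewrite ge_min lexx orbT.
by split; lra.
Qed.

(* The parameters [y], [z] of the apexes, like [x], [x'] for [seg], are reciprocals
   of heights: with them the shear by [h] moves an apex to another [vup] or [vdn]
   and crossing conditions become linear. *)
Definition vup h y := pt (h / y) y^-1.
Definition vdn h z := pt (- (h / z)) (- z^-1).
Definition quadrilateral u v x x' : set 'cV[R]_2 := hull [set` [:: u; v; pt x^-1 0; pt (- x'^-1) 0]].

Lemma quadrilateral_bipyr u v x x' : quadrilateral u v x x' = bipyr (seg x x') u v.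
Proof.
rewrite /bipyr /seg hull_hullU; congr hull; apply/seteqP; split=> w /=; rewrite !inE.
  by move=> /or4P[] /eqP->; rewrite /= ?eqxx ?orbT; [right; left|right; right|left|left].
by move=> [/orP[] /eqP->|[->|->]]; rewrite eqxx ?orbT.
Qed.

Lemma vup_vdn_side h y k z : 0 < y -> 0 < z -> dotv (pt 0 1) (vdn k z) < 0 < dotv (pt 0 1) (vup h y).
Proof.
by move=> y0 z0; rewrite !dot_pt pt0 pt1 !mul0r !add0r !mul1r oppr_lt0 !invr_gt0 z0.
Qed.

Lemma quadrilateral_Pno h y k z x x' : 0 < y -> 0 < z -> 0 < x -> 0 < x' -> Pno (quadrilateral (vup h y) (vdn k z) x x').
Proof.
move=> y0 z0 x0 x'0; rewrite quadrilateral_bipyr; apply: bipyr_Pno (seg_base x0 x'0) _; exact: vup_vdn_side.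
Qed.

Lemma vup_vdn_cross h y k z : 0 < y -> 0 < z ->
  cross (pt 0 1) (vup h y) (vdn k z) = pt ((h - k) / (y + z)) 0.
Proof.
move=> y0 z0; apply: vec2P; rewrite /cross !mxE /= !dot_pt !pt0 !pt1 !mul0r !add0r !mul1r; field.
  by rewrite !gt_eqF // ?addr_gt0 // ?ltr0Sn // ; rewrite opprK addr_gt0.
by rewrite !gt_eqF // ?addr_gt0.
Qed.

(* The diagonal between the apexes with slopes differing by [k] meets [seg x x']. *)
Definition crosses x x' y z k := - (y + z) <= x' * k /\ x * k <= y + z.

Lemma crosses_seg x x' y z h k : 0 < x -> 0 < x' -> 0 < y -> 0 < z -> crosses x x' y z (h - k) ->
  seg x x' (cross (pt 0 1) (vup h y) (vdn k z)).
Proof.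
move=> x0 x'0 y0 z0 [h1 h2]; rewrite vup_vdn_cross //; apply: seg_in => //.
have yz := addr_gt0 y0 z0.
rewrite ler_pdivlMr // ler_pdivrMr //; apply/andP; split.
  by rewrite -(ler_pM2l x'0) mulrA mulrN mulfV ?gt_eqF // mulN1r.
by rewrite -(ler_pM2l x0) mulrA mulfV ?gt_eqF // mul1r.
Qed.

Lemma hull_seq_img (M : 'M[R]_2) s : mulmx M @` hull [set` s] = hull [set` map (mulmx M) s].
Proof.
rewrite -hull_img; congr hull; apply/seteqP; split=> x /=.
  by move=> [y ys <-]; exact: map_f.
by move=> /mapP[y ys ->]; exists y.
Qed.

Lemma quadrilateral_perm u v x x' s : perm_eq [:: u; v; pt x^-1 0; pt (- x'^-1) 0] s -> quadrilateral u v x x' = hull [set` s].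
Proof. by move=> p; congr hull; apply/seteqP; split=> w /=; rewrite (perm_mem p). Qed.

End PlanarPoints.

Section Planar.
Variables (R : realType) (mu : set 'cV[R]_2 -> 'cV[R]_2).
Hypothesis val : valuation mu.
Hypothesis contra : SL_contravariant mu.
Hypothesis reg : curve_measurable mu.
Implicit Types (a b c d x y z h k l t : R) (i : 'I_2).

Definition mu_quad i x x' h y k z : R := mu (quadrilateral (vup h y) (vdn k z) x x') i 0.

Lemma crosses0 x x' y z : 0 < y -> 0 < z -> crosses x x' y z 0.
Proof. by move=> y0 z0; have := addr_gt0 y0 z0; rewrite /crosses !mulr0; split; lra. Qed.

Lemma quad4 i x x' h1 y1 k1 z1 h2 y2 k2 z2 : 0 < x -> 0 < x' -> 0 < y1 -> 0 < z1 ->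
  0 < y2 -> 0 < z2 -> crosses x x' y1 z1 (h1 - k1) -> crosses x x' y2 z2 (h2 - k2) ->
  crosses x x' y1 z2 (h1 - k2) -> crosses x x' y2 z1 (h2 - k1) ->
  mu_quad i x x' h1 y1 k1 z1 + mu_quad i x x' h2 y2 k2 z2 =
  mu_quad i x x' h1 y1 k2 z2 + mu_quad i x x' h2 y2 k1 z1.
Proof.
move=> x0 x'0 y10 z10 y20 z20 p1 p2 p3 p4; rewrite /mu_quad !quadrilateral_bipyr.
have vi : valuation (fun P => mu P i 0).
  by move=> K L PK PL PU PI; have := val PK PL PU PI => /(congr1 (fun v : 'cV[R]_2 => v i 0)); rewrite !mxE.
apply: (bipyr_four vi (seg_base x0 x'0)); try exact: vup_vdn_side; exact: crosses_seg.
Qed.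

Lemma contra2 a b c d P : a * d - b * c = 1 -> Pno P ->
  mu (mulmx (mat2 a b c d) @` P) o0 0 * a + mu (mulmx (mat2 a b c d) @` P) o1 0 * c = mu P o0 0 /\
  mu (mulmx (mat2 a b c d) @` P) o0 0 * b + mu (mulmx (mat2 a b c d) @` P) o1 0 * d = mu P o1 0.
Proof.
move=> d1 PP; have dd : \det (mat2 a b c d) = 1 by rewrite det_mat2.
have := contra_dot contra (pt 1 0) dd PP; have := contra_dot contra (pt 0 1) dd PP.
by rewrite !mat2_pt !dot_pt !mulr0 !mulr1 ?addr0 ?add0r.
Qed.

Lemma hull_seq_eq (s s' : seq 'cV[R]_2) : s = s' -> hull [set` s] = hull [set` s'].
Proof. by move=> ->. Qed.

Lemma mu_quad_shear x x' h y k z l : 0 < x -> 0 < x' -> 0 < y -> 0 < z ->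
  mu_quad o0 x x' (h + l) y (k + l) z = mu_quad o0 x x' h y k z /\
  mu_quad o1 x x' (h + l) y (k + l) z = mu_quad o1 x x' h y k z - l * mu_quad o0 x x' h y k z.
Proof.
move=> x0 x'0 y0 z0; have d1 : 1 * 1 - l * 0 = 1 :> R by ring.
have [] := contra2 d1 (quadrilateral_Pno h k y0 z0 x0 x'0).
have -> : mulmx (mat2 1 l 0 1) @` quadrilateral (vup h y) (vdn k z) x x' = (quadrilateral (vup (h + l) y) (vdn (k + l) z) x x').
  by rewrite hull_seq_img /= /vup /vdn !mat2_pt /quadrilateral; apply: hull_seq_eq; congr [:: pt _ _; pt _ _; pt _ _; pt _ _]; ring.
by rewrite mulr1 mulr0 addr0 mulr1 /mu_quad => <- <-; split; [|ring].
Qed.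

Lemma mu_quad_opp i x x' h y k z : 0 < x -> 0 < x' -> 0 < y -> 0 < z ->
  mu_quad i x' x k z h y = - mu_quad i x x' h y k z.
Proof.
move=> x0 x'0 y0 z0; have d1 : - 1 * - 1 - 0 * 0 = 1 :> R by ring.
have [] := contra2 d1 (quadrilateral_Pno h k y0 z0 x0 x'0).
have -> : mulmx (mat2 (- 1) 0 0 (- 1)) @` quadrilateral (vup h y) (vdn k z) x x' = (quadrilateral (vup k z) (vdn h y) x' x).
  rewrite [RHS](@quadrilateral_perm _ _ _ _ _ [:: vdn h y; vup k z; pt (- x^-1) 0; pt x'^-1 0]).
    by rewrite hull_seq_img /= /vup /vdn !mat2_pt; apply: hull_seq_eq; congr [:: pt _ _; pt _ _; pt _ _; pt _ _]; ring.
  apply/seq.permP => q /=; ring.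
by rewrite /mu_quad => e1 e2; case: (ord2P i) => ->; lra.
Qed.

Lemma mu_quad_scale x x' h y k z l : 0 < x -> 0 < x' -> 0 < y -> 0 < z -> 0 < l ->
  mu_quad o0 (l * x) (l * x') (h / l ^+ 2) (y / l) (k / l ^+ 2) (z / l) = l * mu_quad o0 x x' h y k z /\
  mu_quad o1 (l * x) (l * x') (h / l ^+ 2) (y / l) (k / l ^+ 2) (z / l) = mu_quad o1 x x' h y k z / l.
Proof.
move=> x0 x'0 y0 z0 l0; have d1 : l^-1 * l - 0 * 0 = 1 :> R by rewrite mulVf ?gt_eqF // mulr0 subr0.
have [] := contra2 d1 (quadrilateral_Pno h k y0 z0 x0 x'0).
have -> : mulmx (mat2 l^-1 0 0 l) @` quadrilateral (vup h y) (vdn k z) x x' = (quadrilateral (vup (h / l ^+ 2) (y / l)) (vdn (k / l ^+ 2) (z / l)) (l * x) (l * x')).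
  rewrite hull_seq_img /= /vup /vdn !mat2_pt; apply: hull_seq_eq; congr [:: pt _ _; pt _ _; pt _ _; pt _ _]; by field; rewrite ?gt_eqF.
rewrite /mu_quad => <- <-.
by split; field; rewrite gt_eqF.
Qed.

Lemma mu_quad_rot x x' y z : 0 < x -> 0 < x' -> 0 < y -> 0 < z ->
  mu_quad o1 z y 0 x 0 x' = mu_quad o0 x x' 0 y 0 z /\
  mu_quad o0 z y 0 x 0 x' = - mu_quad o1 x x' 0 y 0 z.
Proof.
move=> x0 x'0 y0 z0; have d1 : 0 * 0 - (- 1) * 1 = 1 :> R by ring.
have [] := contra2 d1 (quadrilateral_Pno 0 0 y0 z0 x0 x'0).
have -> : mulmx (mat2 0 (- 1) 1 0) @` quadrilateral (vup 0 y) (vdn 0 z) x x' = (quadrilateral (vup 0 x) (vdn 0 x') z y).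
  rewrite [RHS](@quadrilateral_perm _ _ _ _ _ [:: pt (- y^-1) 0; pt z^-1 0; vup 0 x; vdn 0 x']).
    by rewrite hull_seq_img /= /vup /vdn !mat2_pt; apply: hull_seq_eq; congr [:: pt _ _; pt _ _; pt _ _; pt _ _]; ring.
  apply/seq.permP => q /=; ring.
by rewrite /mu_quad => e1 e2; split; lra.
Qed.

Lemma quadrilateral_tri u v w x x' : (exists p q : R, [/\ 0 <= p, 0 <= q, p + q = 1 & pt (- x'^-1) 0 = p *: u + q *: v]) ->
  w = pt x^-1 0 -> quadrilateral u v x x' = hull [set` [:: u; v; w]].
Proof.
move=> [p [q [p0 q0 pq e]]] ->; apply: hull_eq => y /=; rewrite !inE.
  move=> /or4P[] /eqP->; try (by apply: sub_cv; rewrite /= !inE eqxx ?orbT).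
  rewrite e; apply: hull_convex => //; by apply: sub_cv; rewrite /= !inE eqxx ?orbT.
by move=> h; apply: sub_cv; rewrite /= !inE; case/or3P: h => ->; rewrite ?orbT.
Qed.

Lemma triP y z : 0 < y -> 0 < z -> exists p q : R, [/\ 0 <= p, 0 <= q, p + q = 1 &
  pt (- (y + z)^-1) 0 = p *: vup 0 y + q *: vdn 1 z].
Proof.
move=> y0 z0; have yz := addr_gt0 y0 z0; exists (y / (y + z)), (z / (y + z)).
split; try (by apply: divr_ge0; exact: ltW).
  by rewrite -mulrDl divff ?gt_eqF.
by rewrite /vup /vdn !ptZ ptD; congr pt; field; rewrite ?gt_eqF.
Qed.

Lemma triP' y z : 0 < y -> 0 < z -> exists p q : R, [/\ 0 <= p, 0 <= q, p + q = 1 &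
  pt (- (y + z)^-1) 0 = p *: vup (- 1) z + q *: vdn 0 y].
Proof.
move=> y0 z0; have yz := addr_gt0 y0 z0; exists (z / (y + z)), (y / (y + z)).
split; try (by apply: divr_ge0; exact: ltW).
  by rewrite -mulrDl addrC divff ?gt_eqF // addrC gt_eqF.
by rewrite /vup /vdn !ptZ ptD; congr pt; field; rewrite ?gt_eqF.
Qed.

Lemma hull_seq_perm (s s' : seq 'cV[R]_2) : perm_eq s s' -> hull [set` s] = hull [set` s'].
Proof. by move=> p; congr hull; apply/seteqP; split=> w /=; rewrite (perm_mem p). Qed.

(** For [x' = y + z] the fourth vertex lies on a side ([triP]) and the quadrilateral is a triangle.
    The matrix has order 3 and permutes the three vertex directions cyclically, giving a degenerate
    quadrilateral of the same kind; [mu_quad_tri'] is the mirror image. *)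
Lemma mu_quad_tri x y z : 0 < x -> 0 < y -> 0 < z ->
  mu_quad o1 z (x + y) 0 x 1 y = mu_quad o0 x (y + z) 0 y 1 z.
Proof.
move=> x0 y0 z0; have d1 : 0 * (- 1) - (- 1) * 1 = 1 :> R by ring.
have yz := addr_gt0 y0 z0.
have [+ _] := contra2 d1 (quadrilateral_Pno 0 1 y0 z0 x0 yz).
have -> : mulmx (mat2 0 (- 1) 1 (- 1)) @` quadrilateral (vup 0 y) (vdn 1 z) x (y + z) = quadrilateral (vup 0 x) (vdn 1 y) z (x + y).
  rewrite (quadrilateral_tri (triP y0 z0) erefl) (quadrilateral_tri (triP x0 y0) erefl) hull_seq_img /= [RHS](@hull_seq_perm _ [:: vdn 1 y; pt z^-1 0; vup 0 x]).
    by rewrite /vup /vdn !mat2_pt; apply: hull_seq_eq; congr [:: pt _ _; pt _ _; pt _ _]; ring.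
  apply/seq.permP => q /=; ring.
by rewrite /mu_quad; lra.
Qed.

Lemma mu_quad_tri' x y z : 0 < x -> 0 < y -> 0 < z ->
  - mu_quad o1 z (x + y) (- 1) y 0 x = mu_quad o0 x (y + z) (- 1) z 0 y.
Proof.
move=> x0 y0 z0; have d1 : 0 * (- 1) - 1 * (- 1) = 1 :> R by ring.
have yz := addr_gt0 y0 z0.
have [+ _] := contra2 d1 (quadrilateral_Pno (- 1) 0 z0 y0 x0 yz).
have -> : mulmx (mat2 0 1 (- 1) (- 1)) @` quadrilateral (vup (- 1) z) (vdn 0 y) x (y + z) = quadrilateral (vup (- 1) y) (vdn 0 x) z (x + y).
  rewrite (quadrilateral_tri (triP' y0 z0) erefl) (quadrilateral_tri (triP' x0 y0) erefl) hull_seq_img /= [RHS](@hull_seq_perm _ [:: pt z^-1 0; vup (- 1) y; vdn 0 x]).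
    by rewrite /vup /vdn !mat2_pt; apply: hull_seq_eq; congr [:: pt _ _; pt _ _; pt _ _]; ring.
  apply/seq.permP => q /=; ring.
by rewrite /mu_quad; lra.
Qed.

(** A bound on a reciprocal parameter: beyond it the apex is so close to the origin that the
    diagonal certainly meets the segment ([crosses_big]). *)
Definition big_height x x' h := 1 + (x + x') * `|h|.

Lemma crosses_big x x' y z h : 0 < x -> 0 < x' -> 0 < y -> big_height x x' h <= z -> crosses x x' y z h.
Proof.
rewrite /big_height => x0 x'0 y0 hz; have := ler_norm h; have := ler_norm (- h); rewrite normrN => h1 h2.
have n0 := normr_ge0 h.
have := mulr_ge0 (ltW x0) n0; have := mulr_ge0 (ltW x'0) n0.
have := ler_wpM2l (ltW x0) h2; have := ler_wpM2l (ltW x'0) h1.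
by rewrite /crosses; split; lra.
Qed.

Lemma big_height_gt0 x x' h : 0 < x -> 0 < x' -> 0 < big_height x x' h.
Proof.
by move=> x0 x'0; rewrite /big_height; have := mulr_ge0 (ltW (addr_gt0 x0 x'0)) (normr_ge0 h); lra.
Qed.

Definition incr i x x' h y := mu_quad i x x' h y 0 (big_height x x' h) - mu_quad i x x' 0 y 0 (big_height x x' h).

(* [lra] and [ring] would otherwise compare the atoms [mu_quad ...] up to unfolding. *)
Ltac gen_quad := repeat match goal with
  | |- context [mu_quad ?i ?x ?x' ?h ?y ?k ?z] => generalize (mu_quad i x x' h y k z) end.
Ltac gen_incr := gen_quad; repeat match goal with
  | |- context [incr ?i ?x ?x' ?h ?y] => generalize (incr i x x' h y) end.

(** By [quad4] the effect of displacing the upper apex does not depend on the lower one, so any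
    admissible [z] may replace the large one of the definition. *)
Lemma incrE i x x' h y z : 0 < x -> 0 < x' -> 0 < y -> 0 < z -> crosses x x' y z h ->
  mu_quad i x x' h y 0 z - mu_quad i x x' 0 y 0 z = incr i x x' h y.
Proof.
move=> x0 x'0 y0 z0 o; have w0 := big_height_gt0 h x0 x'0.
have ob := crosses_big x0 x'0 y0 (lexx (big_height x x' h)).
have := @quad4 i x x' h y 0 z 0 y 0 (big_height x x' h) x0 x'0 y0 z0 y0 w0.
rewrite !subr0 => /(_ o (crosses0 _ _ y0 w0) ob (crosses0 _ _ y0 z0)); rewrite /incr; gen_quad; clear=> *; lra.
Qed.

Lemma decrE i x x' k y z : 0 < x -> 0 < x' -> 0 < y -> 0 < z -> crosses x x' y z (- k) ->
  mu_quad i x x' 0 y k z - mu_quad i x x' 0 y 0 z = - incr i x' x k z.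
Proof.
move=> x0 x'0 y0 z0 [p1 p2].
rewrite !(@mu_quad_opp i x' x _ z _ y) //= -(@incrE i x' x k z y) //; first by ring.
by split; lra.
Qed.

Lemma incr_diff i x x' h y z : 0 < x -> 0 < x' -> 0 < y -> 0 < z ->
  crosses x x' y z h -> crosses x x' y z (- h) ->
  mu_quad i x x' h y h z - mu_quad i x x' 0 y 0 z = incr i x x' h y - incr i x' x h z.
Proof.
move=> x0 x'0 y0 z0 p1 p2; have oz := crosses0 x x' y0 z0.
have := @quad4 i x x' h y h z 0 y 0 z x0 x'0 y0 z0 y0 z0.
rewrite subrr !subr0 sub0r => /(_ oz oz p1 p2).
have := incrE i x0 x'0 y0 z0 p1; have := decrE i x0 x'0 y0 z0 p2; gen_incr; clear=> *; lra.
Qed.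

Lemma shear0 x x' h y z : 0 < x -> 0 < x' -> 0 < y -> 0 < z ->
  mu_quad o0 x x' h y h z = mu_quad o0 x x' 0 y 0 z /\
  mu_quad o1 x x' h y h z = mu_quad o1 x x' 0 y 0 z - h * mu_quad o0 x x' 0 y 0 z.
Proof. by move=> x0 x'0 y0 z0; have := mu_quad_shear 0 0 h x0 x'0 y0 z0; rewrite !add0r. Qed.

Lemma big_heightN x x' h : big_height x x' (- h) = big_height x x' h.
Proof. by rewrite /big_height normrN. Qed.

Lemma incr0_big x x' h y z : 0 < x -> 0 < x' -> 0 < y -> big_height x x' h <= z ->
  incr o0 x x' h y = incr o0 x' x h z.
Proof.
move=> x0 x'0 y0 hz; have z0 := lt_le_trans (big_height_gt0 h x0 x'0) hz.
have p1 := crosses_big x0 x'0 y0 hz; have p2 : crosses x x' y z (- h) by apply: crosses_big; rewrite ?big_heightN.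
by have := incr_diff o0 x0 x'0 y0 z0 p1 p2; rewrite (shear0 h x0 x'0 y0 z0).1 subrr; lra.
Qed.

Lemma big_heightC x x' h : big_height x x' h = big_height x' x h.
Proof. by rewrite /big_height [x + x']addrC. Qed.

(** Shears preserve the first component, so displacing both apexes changes nothing, and the two
    increments agree when one parameter is large; two such comparisons link arbitrary [y] and
    [z]. *)
Lemma incr0_sym x x' h y z : 0 < x -> 0 < x' -> 0 < y -> 0 < z ->
  incr o0 x x' h y = incr o0 x' x h z.
Proof.
move=> x0 x'0 y0 z0; set Z := big_height x x' h; have Z0 : 0 < Z := big_height_gt0 h x0 x'0.
rewrite (incr0_big x0 x'0 y0 (lexx _)) -(incr0_big x0 x'0 Z0 (lexx _)).
by rewrite (@incr0_big x' x h z Z) // big_heightC.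
Qed.

Definition shear_coef x x' := incr o0 x x' 1 1.

Lemma incr_add x x' h k y : 0 < x -> 0 < x' -> 0 < y ->
  incr o0 x x' (h + k) y = incr o0 x x' h y + incr o0 x x' k y /\
  incr o1 x x' (h + k) y = incr o1 x x' h y + incr o1 x x' k y - k * incr o0 x x' h y.
Proof.
move=> x0 x'0 y0; pose z := 1 + (x + x') * (`|h| + `|k|).
have xx := ltW (addr_gt0 x0 x'0).
have le t : `|t| <= `|h| + `|k| -> crosses x x' y z t.
  by move=> ht; apply: crosses_big => //; rewrite /big_height /z lerD2l ler_wpM2l.
have z0 : 0 < z.
  by rewrite /z; have := mulr_ge0 xx (addr_ge0 (normr_ge0 h) (normr_ge0 k)); lra.
have oh : crosses x x' y z h by apply: le; rewrite lerDl.
have okk : crosses x x' y z k by apply: le; rewrite lerDr.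
have ohk : crosses x x' y z (h + k) by apply: le; exact: ler_normD.
have oz := crosses0 x x' y0 z0.
have Q i : mu_quad i x x' h y (- k) z + mu_quad i x x' 0 y 0 z = mu_quad i x x' h y 0 z + mu_quad i x x' 0 y (- k) z.
  by apply: quad4 => //; rewrite ?subr0 ?opprK ?add0r.
have [s1 s2] := mu_quad_shear h (- k) k x0 x'0 y0 z0.
have [s3 s4] := mu_quad_shear 0 (- k) k x0 x'0 y0 z0.
rewrite addNr ?add0r in s1 s2 s3 s4.
rewrite -!(incrE _ x0 x'0 y0 z0) // s1 s2 s3 s4.
move: (Q o0) (Q o1); gen_quad; clear=> a' b' c' d' a b c d E E'; split; first by lra.
have -> : d = b + a - c by lra.
have -> : d' = b' + a' - c' by lra.
ring.
Qed.

(** Linear without measurability: the second component is additive up to [k] times the first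
    increment for [h], and since [h + k = k + h] this defect is symmetric in [h] and [k]; take
    [k = 1]. *)
Lemma incr0_val x x' h y : 0 < x -> 0 < x' -> 0 < y -> incr o0 x x' h y = h * shear_coef x x'.
Proof.
move=> x0 x'0 y0; have e : incr o0 x x' h y = incr o0 x x' h 1.
  by rewrite (incr0_sym h x0 x'0 y0 ltr01) (incr0_sym h x'0 x0 ltr01 ltr01).
have [_ e1] := incr_add h 1 x0 x'0 ltr01; have [_ e2] := incr_add 1 h x0 x'0 ltr01.
by rewrite e /shear_coef; move: e1 e2; rewrite [1 + h]addrC mul1r => ->; rewrite [X in _ = X - _]addrC => /addrI /oppr_inj.
Qed.

Lemma shear_coefC x x' : 0 < x -> 0 < x' -> shear_coef x x' = shear_coef x' x.
Proof. by move=> x0 x'0; exact: incr0_sym. Qed.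

(** The linear coefficient in the displacement of minus the second increment, whose quadratic
    coefficient is half of [shear_coef] ([incr1_val]). First components on quadrilaterals are
    differences of this function ([quad0_val]). *)
Definition half_quad x x' y := - incr o1 x x' 1 y - shear_coef x x' / 2.

Ltac gen_fun := repeat match goal with
  | |- context [half_quad ?x ?x' ?y] => generalize (half_quad x x' y)
  | |- context [shear_coef ?x ?x'] => generalize (shear_coef x x') end.

Lemma mu_quad_measurable x x' y z : 0 < x -> 0 < x' -> 0 < y -> 0 < z ->
  measurable_fun `[1 : R, 2]%classic (fun t => mu_quad o1 x x' t y 0 z).
Proof.
move=> x0 x'0 y0 z0.
have e t : quadrilateral (vup t y) (vdn 0 z) x x' =
    hull [set` (pt 0 y^-1 + t *: pt y^-1 0) :: [:: vdn 0 z; pt x^-1 0; pt (- x'^-1) 0]].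
  by rewrite /quadrilateral /vup ptZ ptD mulr0 addr0 add0r.
rewrite (_ : (fun t => _) = fun t => mu (hull [set` (pt 0 y^-1 + t *: pt y^-1 0) ::
    [:: vdn 0 z; pt x^-1 0; pt (- x'^-1) 0]]) o1 0); last first.
  by apply/funext => t; rewrite /mu_quad e.
by apply: reg => t _; rewrite -e; exact: quadrilateral_Pno.
Qed.

(** The quadratic term cancels the defect in [incr_add]; what remains is additive, and measurable
    because a single vertex moves. *)
Lemma incr1_val x x' h y : 0 < x -> 0 < x' -> 0 < y -> 0 < h ->
  incr o1 x x' h y = - shear_coef x x' * h ^+ 2 / 2 - h * half_quad x x' y.
Proof.
move=> x0 x'0 y0 h0; pose G t := incr o1 x x' t y + shear_coef x x' * t ^+ 2 / 2.
have GD s t : 0 < s -> 0 < t -> G (s + t) = G s + G t.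
  move=> _ _; rewrite /G (incr_add s t x0 x'0 y0).2 (incr0_val s x0 x'0 y0); lra.
have mG : measurable_fun `[1 : R, 2]%classic G.
  pose z := big_height x x' 2; have z0 : 0 < z := big_height_gt0 2 x0 x'0.
  apply: (@eq_measurable_fun _ _ _ _ _
    (fun t => mu_quad o1 x x' t y 0 z - mu_quad o1 x x' 0 y 0 z + (shear_coef x x' / 2) * t ^+ 2)).
    move=> w /set_mem /=; rewrite in_itv /= => /andP[t1 t2].
    rewrite /G (incrE o1 x0 x'0 y0 z0); first by field.
    apply: crosses_big => //; rewrite /z /big_height lerD2l; apply: ler_wpM2l.
      by apply: ltW; exact: addr_gt0.
    by rewrite !ger0_norm //; lra.
  apply: measurable_funD; first by apply: measurable_funB => //; exact: mu_quad_measurable.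
  by apply: measurable_funM => //; apply: measurable_funX.
have := cauchy_pos GD mG h0; rewrite /G /half_quad expr1n; lra.
Qed.

Lemma incr1_opp x x' y : 0 < x -> 0 < x' -> 0 < y ->
  incr o1 x x' (- 1) y = half_quad x x' y - shear_coef x x' / 2.
Proof.
move=> x0 x'0 y0; have [_] := incr_add 1 (- 1) x0 x'0 y0.
have -> : incr o1 x x' (1 - 1) y = 0 by rewrite subrr /incr subrr.
by rewrite (incr0_val 1 x0 x'0 y0) /half_quad; lra.
Qed.

Lemma incr1_1 x x' y : incr o1 x x' 1 y = - shear_coef x x' / 2 - half_quad x x' y.
Proof. by rewrite /half_quad; lra. Qed.

(** Displacing both apexes by 1 is a shear, which changes the second component by the first;
    comparison with [incr_diff] expresses the first component through increments. This requires one
    large parameter, a restriction that [quad4] removes. *)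
Lemma quad0_val x x' y z : 0 < x -> 0 < x' -> 0 < y -> 0 < z ->
  mu_quad o0 x x' 0 y 0 z = half_quad x x' y - half_quad x' x z.
Proof.
move=> x0 x'0 y0 z0.
have big y' z' : 0 < y' -> big_height x x' 1 <= z' -> mu_quad o0 x x' 0 y' 0 z' = half_quad x x' y' - half_quad x' x z'.
  move=> y'0 hz; have z'0 := lt_le_trans (big_height_gt0 1 x0 x'0) hz.
  have p1 := crosses_big x0 x'0 y'0 hz; have p2 : crosses x x' y' z' (- 1) by apply: crosses_big; rewrite ?big_heightN.
  have := incr_diff o1 x0 x'0 y'0 z'0 p1 p2; rewrite (shear0 1 x0 x'0 y'0 z'0).2.
  by rewrite !incr1_1 (shear_coefC x0 x'0); lra.
have big' y' z' : 0 < z' -> big_height x x' 1 <= y' -> mu_quad o0 x x' 0 y' 0 z' = half_quad x x' y' - half_quad x' x z'.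
  move=> z'0 hy; have y'0 := lt_le_trans (big_height_gt0 1 x0 x'0) hy.
  have [a1 a2] := crosses_big x0 x'0 z'0 hy.
  have [b1 b2] : crosses x x' z' y' (- 1) by apply: crosses_big; rewrite ?big_heightN.
  have p1 : crosses x x' y' z' 1 by split; lra.
  have p2 : crosses x x' y' z' (- 1) by split; lra.
  have := incr_diff o1 x0 x'0 y'0 z'0 p1 p2; rewrite (shear0 1 x0 x'0 y'0 z'0).2.
  by rewrite !incr1_1 (shear_coefC x0 x'0); lra.
pose Z := big_height x x' 1; have Z0 : 0 < Z := big_height_gt0 1 x0 x'0.
have := @quad4 o0 x x' 0 y 0 z 0 Z 0 Z x0 x'0 y0 z0 Z0 Z0.
rewrite subrr => /(_ (crosses0 _ _ y0 z0) (crosses0 _ _ Z0 Z0) (crosses0 _ _ y0 Z0) (crosses0 _ _ Z0 z0)).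
rewrite (big Z Z) // (big y Z) // (big' Z z) //; gen_quad; clear=> *; lra.
Qed.

Lemma quad1_val x x' y z : 0 < x -> 0 < x' -> 0 < y -> 0 < z ->
  mu_quad o1 x x' 0 y 0 z = - (half_quad z y x - half_quad y z x').
Proof.
move=> x0 x'0 y0 z0; have [_ e] := mu_quad_rot x0 x'0 y0 z0.
by rewrite -(quad0_val z0 y0 x0 x'0) e opprK.
Qed.

Lemma crosses_tri x y z : 0 < x -> 0 < y -> 0 < z -> crosses x (y + z) y z (- 1).
Proof. by move=> x0 y0 z0; split; lra. Qed.

Lemma tri0 x y z : 0 < x -> 0 < y -> 0 < z ->
  mu_quad o0 x (y + z) 0 y 1 z = half_quad x (y + z) y - half_quad (y + z) x z - shear_coef x (y + z).
Proof.
move=> x0 y0 z0; have yz := addr_gt0 y0 z0.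
have := decrE o0 x0 yz y0 z0 (crosses_tri x0 y0 z0).
by rewrite (incr0_val 1 yz x0 z0) (quad0_val x0 yz y0 z0) (shear_coefC yz x0); lra.
Qed.

Lemma tri1 x y z : 0 < x -> 0 < y -> 0 < z ->
  mu_quad o1 x (y + z) 0 y 1 z =
  - half_quad z y x + half_quad y z (y + z) + half_quad (y + z) x z + shear_coef x (y + z) / 2.
Proof.
move=> x0 y0 z0; have yz := addr_gt0 y0 z0.
have := decrE o1 x0 yz y0 z0 (crosses_tri x0 y0 z0).
by rewrite incr1_1 (quad1_val x0 yz y0 z0) (shear_coefC yz x0); lra.
Qed.

Lemma crosses_tri' x y z : 0 < x -> 0 < y -> 0 < z -> crosses x (y + z) z y (- 1).
Proof. by move=> x0 y0 z0; split; lra. Qed.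

Lemma tri0' x y z : 0 < x -> 0 < y -> 0 < z ->
  mu_quad o0 x (y + z) (- 1) z 0 y = half_quad x (y + z) z - half_quad (y + z) x y - shear_coef x (y + z).
Proof.
move=> x0 y0 z0; have yz := addr_gt0 y0 z0.
have := incrE o0 x0 yz z0 y0 (crosses_tri' x0 y0 z0).
by rewrite (incr0_val (- 1) x0 yz z0) (quad0_val x0 yz z0 y0); lra.
Qed.

Lemma tri1' x y z : 0 < x -> 0 < y -> 0 < z ->
  mu_quad o1 x (y + z) (- 1) z 0 y =
  - half_quad y z x + half_quad z y (y + z) + half_quad x (y + z) z - shear_coef x (y + z) / 2.
Proof.
move=> x0 y0 z0; have yz := addr_gt0 y0 z0.
have := incrE o1 x0 yz z0 y0 (crosses_tri' x0 y0 z0).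
by rewrite (incr1_opp x0 yz z0) (quad1_val x0 yz z0 y0); lra.
Qed.

Lemma scale_incr x x' y l : 0 < x -> 0 < x' -> 0 < y -> 0 < l ->
  incr o0 (l * x) (l * x') (1 / l ^+ 2) (y / l) = l * incr o0 x x' 1 y /\
  incr o1 (l * x) (l * x') (1 / l ^+ 2) (y / l) = incr o1 x x' 1 y / l.
Proof.
move=> x0 x'0 y0 l0; have l2 : 0 < l ^+ 2 by exact: exprn_gt0.
pose z := big_height x x' 1; have z0 : 0 < z := big_height_gt0 1 x0 x'0.
have lx := mulr_gt0 l0 x0; have lx' := mulr_gt0 l0 x'0.
have yl := divr_gt0 y0 l0; have zl := divr_gt0 z0 l0.
have [p1 p2] := crosses_big x0 x'0 y0 (lexx z).
have o : crosses (l * x) (l * x') (y / l) (z / l) (1 / l ^+ 2).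
  have e w : l * w * (1 / l ^+ 2) = w * 1 / l by field; rewrite gt_eqF.
  rewrite /crosses !e -mulrDl -mulNr !ler_pM2r ?invr_gt0 //.
rewrite -!(incrE _ lx lx' yl zl o) -!(incrE _ x0 x'0 y0 z0 (crosses_big x0 x'0 y0 (lexx z))).
have [] := mu_quad_scale 1 0 x0 x'0 y0 z0 l0; have [] := mu_quad_scale 0 0 x0 x'0 y0 z0 l0.
rewrite !mul0r => -> -> -> ->; split; ring.
Qed.

Lemma shear_coefZ l x x' : 0 < l -> 0 < x -> 0 < x' -> shear_coef (l * x) (l * x') = l ^+ 3 * shear_coef x x'.
Proof.
move=> l0 x0 x'0; have lx := mulr_gt0 l0 x0; have lx' := mulr_gt0 l0 x'0.
have [] := scale_incr x0 x'0 ltr01 l0.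
rewrite (incr0_val _ lx lx' (divr_gt0 ltr01 l0)) -/(shear_coef x x') => e _.
apply: (@mulfI _ (1 / l ^+ 2)); first by rewrite gt_eqF // divr_gt0 // exprn_gt0.
by rewrite e; field; rewrite gt_eqF.
Qed.

Lemma half_quadZ l x x' y : 0 < l -> 0 < x -> 0 < x' -> 0 < y ->
  half_quad (l * x) (l * x') (y / l) = l * half_quad x x' y.
Proof.
move=> l0 x0 x'0 y0; have lx := mulr_gt0 l0 x0; have lx' := mulr_gt0 l0 x'0.
have l2 : 0 < 1 / l ^+ 2 by rewrite divr_gt0 // exprn_gt0.
have [_] := scale_incr x0 x'0 y0 l0.
rewrite (incr1_val lx lx' (divr_gt0 y0 l0) l2) (shear_coefZ l0 x0 x'0) incr1_1 => e.
apply: (@mulfI _ (1 / l ^+ 2)); first by rewrite gt_eqF.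
have -> : 1 / l ^+ 2 * half_quad (l * x) (l * x') (y / l) =
   - (l ^+ 3 * shear_coef x x') * (1 / l ^+ 2) ^+ 2 / 2 - (- shear_coef x x' / 2 - half_quad x x' y) / l.
  by rewrite -e; ring.
by field; rewrite gt_eqF.
Qed.

Lemma half_quadE x x' : 0 < x -> 0 < x' -> x <= 1 ->
  half_quad x x' 1 = - (mu_quad o1 x x' 1 1 0 1 - mu_quad o1 x x' 0 1 0 1)
    - (mu_quad o0 x x' 1 1 0 1 - mu_quad o0 x x' 0 1 0 1) / 2.
Proof.
move=> x0 x'0 x1; have o : crosses x x' 1 1 1 by split; lra.
by rewrite !(incrE _ x0 x'0 ltr01 ltr01 o) /half_quad /shear_coef.
Qed.

Lemma mu_quad_measurable_base i h : 
  measurable_fun `[1 : R, 2]%classic (fun t => mu_quad i t^-1 1 h 1 0 1) /\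
  measurable_fun `[1 : R, 2]%classic (fun t => mu_quad i 1 t^-1 h 1 0 1).
Proof.
split.
  have e t : quadrilateral (vup h 1) (vdn 0 1) t^-1 1 =
    hull [set` (0 + t *: pt 1 0) :: [:: vup h 1; vdn 0 1; pt (- 1^-1) 0]].
    rewrite (@quadrilateral_perm _ _ _ _ _ [:: pt t^-1^-1 0; vup h 1; vdn 0 1; pt (- 1^-1) 0]).
      by rewrite invrK add0r ptZ mulr1 mulr0.
    by apply/seq.permP => q /=; ring.
  rewrite (_ : (fun t => _) = fun t => mu (hull [set` (0 + t *: pt 1 0) ::
    [:: vup h 1; vdn 0 1; pt (- 1^-1) 0]]) i 0); last first.
    by apply/funext => t; rewrite /mu_quad e.
  apply: reg => t /andP[t1 _]; rewrite -e; apply: quadrilateral_Pno => //.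
  by rewrite invr_gt0; lra.
have e t : quadrilateral (vup h 1) (vdn 0 1) 1 t^-1 =
  hull [set` (0 + t *: pt (- 1) 0) :: [:: vup h 1; vdn 0 1; pt 1^-1 0]].
  rewrite (@quadrilateral_perm _ _ _ _ _ [:: pt (- t^-1^-1) 0; vup h 1; vdn 0 1; pt 1^-1 0]).
    by rewrite invrK add0r ptZ mulrN1 mulr0.
  by apply/seq.permP => q /=; ring.
rewrite (_ : (fun t => _) = fun t => mu (hull [set` (0 + t *: pt (- 1) 0) ::
  [:: vup h 1; vdn 0 1; pt 1^-1 0]]) i 0); last first.
  by apply/funext => t; rewrite /mu_quad e.
apply: reg => t /andP[t1 _]; rewrite -e; apply: quadrilateral_Pno => //.
by rewrite invr_gt0; lra.
Qed.

Lemma planar : exists k' k'' : R, forall x x' y z, 0 < x -> 0 < x' -> 0 < y -> 0 < z ->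
  mu (quadrilateral (vup 0 y) (vdn 0 z) x x') o0 0 = k' * (x ^+ 2 - x' ^+ 2) * (y + z) +
    k'' * (x^-1 + x'^-1) * ((y ^+ 2)^-1 - (z ^+ 2)^-1) /\
  mu (quadrilateral (vup 0 y) (vdn 0 z) x x') o1 0 = - (k' * (z ^+ 2 - y ^+ 2) * (x + x') +
    k'' * (z^-1 + y^-1) * ((x ^+ 2)^-1 - (x' ^+ 2)^-1)).
Proof.
have [||||||||k' [k'' hk]] := @functional_equation R half_quad shear_coef; last first.
  exists k', k'' => x x' y z x0 x'0 y0 z0; rewrite -!hk // -quad0_val // -quad1_val //.
- apply: (@eq_measurable_fun _ _ _ _ _ (fun t => - (mu_quad o1 1 t^-1 1 1 0 1 - mu_quad o1 1 t^-1 0 1 0 1)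
    + (- (1 / 2)) * (mu_quad o0 1 t^-1 1 1 0 1 - mu_quad o0 1 t^-1 0 1 0 1))).
    move=> w /set_mem /=; rewrite in_itv /= => /andP[t1 _]; rewrite half_quadE ?invr_gt0 ?lexx //; first by field.
    lra.
  have m i h := (mu_quad_measurable_base i h).2.
  apply: measurable_funD; first by apply: measurable_funN; apply: measurable_funB; exact: m.
  by apply: measurable_funM => //; apply: measurable_funB; exact: m.
- apply: (@eq_measurable_fun _ _ _ _ _ (fun t => - (mu_quad o1 t^-1 1 1 1 0 1 - mu_quad o1 t^-1 1 0 1 0 1)
    + (- (1 / 2)) * (mu_quad o0 t^-1 1 1 1 0 1 - mu_quad o0 t^-1 1 0 1 0 1))).
    move=> w /set_mem /=; rewrite in_itv /= => /andP[t1 _]; rewrite half_quadE ?invr_gt0 //; first by field.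
      lra.
    by rewrite invf_le1 //; lra.
  have m i h := (mu_quad_measurable_base i h).1.
  apply: measurable_funD; first by apply: measurable_funN; apply: measurable_funB; exact: m.
  by apply: measurable_funM => //; apply: measurable_funB; exact: m.
- move=> x y z x0 y0 z0; have := mu_quad_tri' x0 y0 z0.
  have := tri0' x0 y0 z0; have := tri1' z0 x0 y0.
  by move=> -> ->; gen_fun; clear=> *; lra.
- move=> x y z x0 y0 z0; have := mu_quad_tri x0 y0 z0.
  by rewrite (tri0 x0 y0 z0) (tri1 z0 x0 y0); gen_fun; clear=> *; lra.
- exact: shear_coefC.
- by move=> l x y l0 x0 y0; exact: shear_coefZ.
- by move=> l x y z l0 x0 y0 z0; exact: half_quadZ.
- move=> x1 x2 x3 x4 y z x10 x20 x30 x40 y0 z0; rewrite -!quad0_val //.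
  (* A quarter turn makes [x1], [x2], [x3], [x4] parameters of apexes, which [quad4] can
     exchange. *)
  have e p q : 0 < p -> 0 < q -> mu_quad o0 p q 0 y 0 z = mu_quad o1 z y 0 p 0 q.
    by move=> p0 q0; have [->] := mu_quad_rot p0 q0 y0 z0.
  by rewrite !e //; apply: quad4 => //; rewrite subrr; exact: crosses0.
Qed.

End Planar.

(** * Reduction to coordinate planes *)

Section Standard.
Variables (R : realType) (m : nat).
Notation n := m.+1.
Implicit Types (b d : 'I_n -> 'cV[R]_n) (c : 'I_n -> R) (s : nat -> R).

Lemma joinset_inj b kap c s : injective kap -> joinset b kap c s = hull ([set 0] `|`
  [set x | exists i, x = c i *: b i] `|` [set x | exists i : 'I_n, x = - (s (kap i) *: b i)]).
Proof.
move=> inj; rewrite /joinset; congr (hull (_ `|` _)); apply/seteqP.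
by split=> x /= [i ->]; exists i; rewrite (big_pred1 i) // => j; rewrite (inj_eq inj).
Qed.

(** The basis is brought to determinant 1 by dividing one vector by [del]; the lengths on that axis
    are multiplied by the absolute value of [del], and for negative [del] its two vertices exchange
    roles. *)
Lemma vanish_cross (nu : set 'cV[R]_n -> 'cV[R]_n) : SL_contravariant nu ->
  (forall c s, (forall i, 0 < c i) -> (forall k, 0 < s k) -> nu (cpoly c s) = 0) ->
  forall b d kap c s, dualb b d -> injective kap -> (forall i, 0 < c i) ->
    (forall k, 0 < s k) -> nu (joinset b kap c s) = 0.
Proof.
move=> contra H b d kap c s bd inj c0 s0.
pose B : 'M[R]_n := \matrix_(k, i) b i k 0.
pose D : 'M[R]_n := \matrix_(i, k) d i k 0.
have DB : D *m B = 1%:M.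
  apply/matrixP => i j; rewrite !mxE -bd; apply: eq_bigr => k _; by rewrite !mxE.
have uB : B \in unitmx by case: (mulmx1_unit DB).
pose del := \det B; have d0 : del != 0 by rewrite -unitfE -unitmxE.
pose i0 : 'I_n := ord0.
pose S : 'M[R]_n := diag_mx (\row_i (if i == i0 then del^-1 else 1)).
pose phi := B *m S.
have dphi : \det phi = 1.
  rewrite det_mulmx det_diag (bigD1 i0) //= mxE eqxx big1 ?mulr1 ?mulfV // => i ii.
  by rewrite mxE (negbTE ii).
have phiE i : phi *m delta_mx i 0 = (if i == i0 then del^-1 else 1) *: b i.
  rewrite /phi -mulmxA -colE; apply/matrixP => k l; rewrite ord1 !mxE (bigD1 i) //= !mxE eqxx mulr1n.
  rewrite big1 ?addr0; last by move=> q qi; rewrite !mxE (negbTE qi) mulr0n mulr0.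
  by rewrite mulrC.
pose c' i := if i == i0 then (if 0 < del then del * c i else - del * s (kap i)) else c i.
pose s' (k : nat) := let i : 'I_n := inord k in
  if i == i0 then (if 0 < del then del * s (kap i) else - del * c i) else s (kap i).
have dn : ~~ (0 < del) -> 0 < - del by rewrite -leNgt oppr_gt0 lt_neqAle d0.
have c'0 i : 0 < c' i.
  by rewrite /c'; case: ifP => // _; case: ifPn => [p|/dn p]; rewrite mulr_gt0.
have s'0 k : 0 < s' k.
  by rewrite /s'; case: ifP => // _; case: ifPn => [p|/dn p]; rewrite mulr_gt0.
have s'i (i : 'I_n) : s' i = if i == i0 then (if 0 < del then del * s (kap i) else - del * c i) else s (kap i).
  by rewrite /s' inord_val.
have -> : joinset b kap c s = mulmx phi @` cpoly c' s'.
  rewrite joinset_inj // cpolyE -hull_img !image_setU image_set1 mulmx0.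
  have E1 i : phi *m (c' i *: delta_mx i 0) =
      if i == i0 then (if 0 < del then c i *: b i else - (s (kap i) *: b i)) else c i *: b i.
    rewrite -scalemxAr phiE scalerA /c'; case: ifP => _; last by rewrite mulr1.
    by case: ifP => _; rewrite -?scaleNr; congr (_ *: _); field.
  have E2 (i : 'I_n) : phi *m (- (s' i *: delta_mx i 0)) =
      if i == i0 then (if 0 < del then - (s (kap i) *: b i) else c i *: b i) else - (s (kap i) *: b i).
    rewrite mulmxN -scalemxAr phiE scalerA s'i; case: ifP => _; last by rewrite mulr1.
    case: ifP => _; first by congr (- (_ *: _)); field.
    by rewrite -[LHS]scaleNr; congr (_ *: _); field.
  congr hull; apply/seteqP; split=> x.
    move=> [[->|[i ->]]|[i ->]]; first by left; left.
      have := E1 i; have := E2 i; case: (i == i0) => [|_ e].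
        case: (0 < del) => [_ e|e _].
          by left; right; rewrite -e; exists (c' i *: delta_mx i 0) => //; exists i.
        by right; rewrite -e; exists (- (s' i *: delta_mx i 0)) => //; exists i.
      by left; right; rewrite -e; exists (c' i *: delta_mx i 0) => //; exists i.
    have := E1 i; have := E2 i; case: (i == i0) => [|e _].
      case: (0 < del) => [e _|_ e].
        by right; rewrite -e; exists (- (s' i *: delta_mx i 0)) => //; exists i.
      by left; right; rewrite -e; exists (c' i *: delta_mx i 0) => //; exists i.
    by right; rewrite -e; exists (- (s' i *: delta_mx i 0)) => //; exists i.
  move=> [[->|[_ [i ->] <-]]|[_ [i ->] <-]]; first by left; left.
    rewrite E1; case: ifP => _; last by left; right; exists i.
    by case: ifP => _; [left; right; exists i|right; exists i].
  rewrite E2; case: ifP => _; last by right; exists i.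
  by case: ifP => _; [right; exists i|left; right; exists i].
by rewrite contra // ?H ?mulmx0 //; exact: cpoly_Pno.
Qed.

End Standard.

Section Plane.
Variables (R : realType) (n : nat) (j q : 'I_n) (c : 'I_n -> R) (s : nat -> R).
Hypothesis jq : j != q.
Hypothesis c0 : forall i, 0 < c i.
Hypothesis s0 : forall k, 0 < s k.
Notation vec := 'cV[R]_n.
Implicit Types (P K L : set 'cV[R]_2) (x y z : vec) (u v w : 'cV[R]_2).

Definition plane_emb : 'M[R]_(n, 2) := \matrix_(k, i) (k == if i == o0 then j else q)%:R.

Lemma emb_pt (a b : R) : plane_emb *m pt a b = a *: delta_mx j 0 + b *: delta_mx q 0.
Proof.
apply/matrixP => k l; rewrite ord1 [LHS]mxE sum2 pt0 pt1 !mxE /= !andbT; ring.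
Qed.

Lemma embT x : plane_emb^T *m x = pt (x j 0) (x q 0).
Proof.
have e i : (plane_emb^T *m x) i 0 = x (if i == o0 then j else q) 0.
  rewrite mxE (bigD1 (if i == o0 then j else q)) //= !mxE eqxx mul1r big1 ?addr0 // => k ki.
  by rewrite !mxE (negbTE ki) mul0r.
by apply: vec2P; rewrite e ?pt0 ?pt1.
Qed.

Lemma embTK v : plane_emb^T *m (plane_emb *m v) = v.
Proof.
rewrite embT; have -> : v = pt (v o0 0) (v o1 0) by apply: vec2P; rewrite ?pt0 ?pt1.
rewrite emb_pt; congr pt; rewrite !mxE !eqxx ?(negbTE jq) ?[q == j]eq_sym ?(negbTE jq) /=; ring.
Qed.

Definition rest : seq vec := 0 :: flatten [seq [:: c l *: delta_mx l 0; - (s l *: delta_mx l 0)] |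
  l <- enum 'I_n & (l != j) && (l != q)].

Lemma restP x : x \in rest <-> x = 0 \/ exists l, [/\ l != j, l != q &
  x = c l *: delta_mx l 0 \/ x = - (s l *: delta_mx l 0)].
Proof.
rewrite inE; split.
  move=> /orP[/eqP->|/flattenP[t /mapP[l]]]; first by left.
  rewrite mem_filter => /andP[/andP[lj lq] _] -> ; rewrite !inE => h; right; exists l; split=> //.
  by case/orP: h => /eqP ->; [left|right].
move=> [->|[l [lj lq h]]]; first by rewrite eqxx.
apply/orP; right; apply/flattenP; exists [:: c l *: delta_mx l 0; - (s l *: delta_mx l 0)].
  by apply/mapP; exists l => //; rewrite mem_filter lj lq mem_enum.
by rewrite !inE; case: h => ->; rewrite eqxx ?orbT.
Qed.

(** Completes [P], placed in the plane of coordinates [j] and [q], by fixed segments on the other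
    axes; thus [mu] induces a planar map [planar_part] with the same properties. *)
Definition joinp P : set vec := hull ((mulmx plane_emb @` P) `|` [set` rest]).

Let Z : set vec := hull [set` rest].

Let Z0 : Z 0.
Proof. by apply: sub_cv; rewrite /= inE eqxx. Qed.

Let ZT z : Z z -> plane_emb^T *m z = 0.
Proof.
apply: (@hull_min _ _ _ [set z | plane_emb^T *m z = 0]).
  move=> x y a b /= hx hy _ _ _; by rewrite mulmxDr -!scalemxAr hx hy !scaler0 addr0.
move=> x /= /restP[->|[l [lj lq h]]]; first by rewrite mulmx0.
have e : plane_emb^T *m (delta_mx l 0 : vec) = 0.
  by rewrite embT !mxE eq_sym (negbTE lj) eq_sym (negbTE lq) pt00.
by case: h => ->; rewrite ?mulmxN -scalemxAr e scaler0 ?oppr0.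
Qed.

Lemma convex_comb k (C : set 'cV[R]_k) (x y : 'cV[R]_k) (a b : R) : is_convex C -> C x -> C y ->
  0 <= a -> 0 <= b -> exists2 z, C z & a *: x + b *: y = (a + b) *: z.
Proof.
move=> cC Cx Cy a0 b0; have [e|ne] := eqVneq (a + b) 0.
  have ea : a = 0 by lra.
  have eb : b = 0 by lra.
  by exists x => //; rewrite ea eb addr0 !scale0r addr0.
have p : 0 < a + b by rewrite lt_neqAle eq_sym ne addr_ge0.
exists ((a / (a + b)) *: x + (b / (a + b)) *: y).
  apply: cC => //; try (by apply: divr_ge0 => //; exact: ltW).
  by rewrite -mulrDl divff.
by rewrite scalerDr !scalerA ![(a + b) * _]mulrC !divfK.
Qed.

Lemma joinpP P x : is_convex P -> P 0 -> joinp P x <->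
  exists t p z, [/\ 0 <= t <= 1, P p, Z z & x = t *: (plane_emb *m p) + (1 - t) *: z].
Proof.
move=> cP P0; split; last first.
  move=> [t [p [z [/andP[t0 t1] Pp Zz ->]]]]; apply: hull_convex => //; last by lra.
  - by apply: sub_cv; left; exists p.
  - by apply: hull_mono Zz => y; right.
  - lra.
apply: (@hull_min _ _ _ [set x | exists t p z, [/\ 0 <= t <= 1, P p, Z z & x = t *: (plane_emb *m p) + (1 - t) *: z]]).
  move=> _ _ a b [t [p [z [/andP[t0 t1] Pp Zz ->]]]] [t' [p' [z' [/andP[t0' t1'] Pp' Zz' ->]]]] a0 b0 ab.
  have [p'' Pp'' e1] := convex_comb cP Pp Pp' (mulr_ge0 a0 t0) (mulr_ge0 b0 t0').
  have r0 : 0 <= 1 - t by lra. have r0' : 0 <= 1 - t' by lra.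
  have [z'' Zz'' e2] := convex_comb (@hull_convex _ _ [set` rest]) Zz Zz' (mulr_ge0 a0 r0) (mulr_ge0 b0 r0').
  exists (a * t + b * t'), p'', z''; split=> //.
    have := mulr_ge0 a0 t0; have := mulr_ge0 b0 t0'; have := mulr_ge0 a0 r0; have := mulr_ge0 b0 r0'.
    by move=> *; apply/andP; split; lra.
  have -> : 1 - (a * t + b * t') = a * (1 - t) + b * (1 - t') by rewrite -{1}ab; ring.
  rewrite -e2 [(a * t + b * t') *: _]scalemxAr -e1 mulmxDr -!scalemxAr !scalerDr !scalerA.
  by rewrite addrACA.
move=> y [[p Pp <-]|yr].
  by exists 1, p, 0; split; rewrite ?ler01 ?lexx // scale1r scaler0 addr0.
by exists 0, 0, y; split; rewrite ?ler01 ?lexx //; [exact: sub_cv|rewrite scale0r add0r subr0 scale1r].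
Qed.

Lemma joinpU K L : is_convex K -> is_convex L -> is_convex (K `|` L) -> K 0 -> L 0 ->
  joinp (K `|` L) = joinp K `|` joinp L.
Proof.
move=> cK cL cU K0 L0; apply/seteqP; split=> x.
  move=> /(joinpP _ cU)[|t [p [z [t01 [Kp|Lp] Zz ->]]]]; first by left.
    by left; apply/joinpP => //; exists t, p, z.
  by right; apply/joinpP => //; exists t, p, z.
by move=> [|]; apply: hull_mono => y [[p Pp <-]|yr]; [left; exists p => //; left|right|left; exists p => //; right|right].
Qed.

(** The projection to the plane determines [t *: p]; so, of two representations of a point, the one
    with the larger nonzero parameter has its planar point between 0 and the other one, hence in
    both sets. *)
Lemma joinpI K L : is_convex K -> is_convex L -> K 0 -> L 0 ->
  joinp (K `&` L) = joinp K `&` joinp L.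
Proof.
move=> cK cL K0 L0.
have cI : is_convex (K `&` L).
  by move=> x y a b [Kx Lx] [Ky Ly] a0 b0 ab; split; [exact: cK|exact: cL].
apply/seteqP; split=> x.
  by move=> h; split; apply: hull_mono h => y [[p [Kp Lp] <-]|yr]; [left; exists p|right|left; exists p|right].
have key K' L' t t' p p' z z' : is_convex K' -> K' 0 -> 0 <= t -> t <= t' -> t' <= 1 -> K' p -> L' p' -> Z z -> Z z' ->
    t *: (plane_emb *m p) + (1 - t) *: z = t' *: (plane_emb *m p') + (1 - t') *: z' ->
    (K' p' /\ L' p') \/ t' = 0.
  move=> cK' K'0 t0 tt t1 Kp Lp Zz Zz' e.
  have [->|tn] := eqVneq t' 0; [by right|left; split=> //].
  have tp : 0 < t' by rewrite lt_neqAle eq_sym tn (le_trans t0).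
  have e' : t *: p = t' *: p'.
    have := congr1 (mulmx plane_emb^T) e; rewrite !mulmxDr -!scalemxAr !embTK (ZT Zz) (ZT Zz').
    by rewrite !scaler0 !addr0.
  have -> : p' = (t / t') *: p by rewrite -[LHS](scalerK tn) -e' scalerA mulrC.
  apply: convex_scale => //; rewrite ler_pdivrMr // mul1r tt andbT.
  by apply: divr_ge0 => //; exact: ltW.
move=> [/(joinpP _ cK K0)[t [p [z [/andP[t0 t1] Kp Zz e]]]] /(joinpP _ cL L0)[t' [p' [z' [/andP[t0' t1'] Lp' Zz' e']]]]].
have I0 : (K `&` L) 0 by split.
have [tt|tt] := leP t t'.
  have := key K L t t' p p' z z' cK K0 t0 tt t1' Kp Lp' Zz Zz'.
  rewrite -e -e' => /(_ erefl)[[h1 h2]|h].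
    by apply/joinpP => //; exists t', p', z'; split=> //; rewrite t0'.
  by apply/joinpP => //; exists 0, 0, z'; split; rewrite ?ler01 ?lexx // e' h !scale0r.
have := key L K t' t p' p z' z cL L0 t0' (ltW tt) t1 Lp' Kp Zz' Zz.
rewrite -e -e' => /(_ erefl)[[h1 h2]|h].
  by apply/joinpP => //; exists t, p, z; split=> //; rewrite t0.
by apply/joinpP => //; exists 0, 0, z; split; rewrite ?ler01 ?lexx // e h !scale0r.
Qed.

Lemma joinp_cvs (t : seq 'cV[R]_2) : joinp (hull [set` t]) = hull [set` map (mulmx plane_emb) t ++ rest].
Proof.
rewrite /joinp -hull_img hull_hullU; congr hull; apply/seteqP; split=> x /=; rewrite mem_cat.
  by move=> [[y yt <-]|->]; rewrite ?orbT // map_f.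
by move=> /orP[/mapP[y yt ->]|]; [left; exists y|right].
Qed.

Lemma joinp_Pno P : Pno P -> Pno (joinp P).
Proof.
move=> PP; have [[t et] _] := iffLR (PnoE P) PP; apply/PnoE; split.
  by rewrite et joinp_cvs; eexists.
apply: (absorb_basis (@delta_dual R n)); first exact: hull_convex.
- by apply: sub_cv; right; rewrite /= inE eqxx.
- move=> i; have [e|ij] := eqVneq i j.
    have [r r0 hr] := Pno_small (pt 1 0) PP; exists r => //; apply: sub_cv; left.
    exists (r *: pt 1 0); first by apply: hr; rewrite lexx ltW.
    by rewrite -scalemxAr emb_pt scale1r scale0r addr0 e.
  have [e|iq] := eqVneq i q.
    have [r r0 hr] := Pno_small (pt 0 1) PP; exists r => //; apply: sub_cv; left.
    exists (r *: pt 0 1); first by apply: hr; rewrite lexx ltW.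
    by rewrite -scalemxAr emb_pt scale1r scale0r add0r e.
  exists (c i) => //; apply: sub_cv; right; apply/restP; right; exists i; split=> //; by left.
- move=> i; have [e|ij] := eqVneq i j.
    have [r r0 hr] := Pno_small (pt (- 1) 0) PP; exists r => //; apply: sub_cv; left.
    exists (r *: pt (- 1) 0); first by apply: hr; rewrite lexx ltW.
    by rewrite -scalemxAr emb_pt scaleN1r scale0r addr0 e scalerN.
  have [e|iq] := eqVneq i q.
    have [r r0 hr] := Pno_small (pt 0 (- 1)) PP; exists r => //; apply: sub_cv; left.
    exists (r *: pt 0 (- 1)); first by apply: hr; rewrite lexx ltW.
    by rewrite -scalemxAr emb_pt scaleN1r scale0r add0r e scalerN.
  exists (s i) => //; apply: sub_cv; right; apply/restP; right; exists i; split=> //; by right.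
Qed.

Variable mu : set vec -> vec.
Hypothesis val : valuation mu.
Hypothesis contra : SL_contravariant mu.
Hypothesis reg : curve_measurable mu.

Definition planar_part P := plane_emb^T *m mu (joinp P).

Lemma planar_val : valuation planar_part.
Proof.
move=> K L PK PL PU PI; rewrite /planar_part.
have [cK cL cU] := And3 (Pno_convex PK) (Pno_convex PL) (Pno_convex PU).
have [K0 L0] := conj (Pno0 PK) (Pno0 PL).
have JU := joinp_Pno PU; have JI := joinp_Pno PI.
rewrite joinpU // joinpI // in JU JI *.
by rewrite -!mulmxDr val //; exact: joinp_Pno.
Qed.

Lemma planar_contra : SL_contravariant planar_part.
Proof.
move=> phi P d1 PP; rewrite /planar_part.
have u : phi \in unitmx by rewrite unitmxE d1 unitr1.
(* Acts as [phi] on the coordinate plane and as the identity on the other axes. *)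
pose phi' : 'M[R]_n := 1%:M + plane_emb *m ((phi - 1%:M) *m plane_emb^T).
have EE : plane_emb^T *m plane_emb = 1%:M.
  apply/matrixP => a b; have := congr1 (fun v : 'cV[R]_2 => v a 0) (embTK (delta_mx b 0)).
  by rewrite mulmxA -colE [LHS]mxE => ->; rewrite !mxE eqxx andbT.
have d1' : \det phi' = 1.
  by rewrite /phi' det_sylvester -mulmxA EE mulmx1 addrC subrK.
have u' : phi' \in unitmx by rewrite unitmxE d1' unitr1.
have pE : phi' *m plane_emb = plane_emb *m phi.
  by rewrite /phi' mulmxDl mul1mx -!mulmxA EE mulmx1 mulmxBr mulmx1 addrC subrK.
have pZ z : plane_emb^T *m z = 0 -> phi' *m z = z.
  by move=> h; rewrite /phi' mulmxDl mul1mx -!mulmxA h !mulmx0 addr0.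
have -> : joinp (mulmx phi @` P) = mulmx phi' @` joinp P.
  rewrite /joinp -hull_img image_setU; congr hull; congr (_ `|` _); apply/seteqP; split=> x.
  - by move=> [_ [p Pp <-] <-]; exists (plane_emb *m p); [exists p|rewrite !mulmxA pE].
  - by move=> [_ [p Pp <-] <-]; exists (phi *m p); [exists p|rewrite !mulmxA pE].
  - by move=> xr; exists x => //; apply: pZ; apply: ZT; exact: sub_cv.
  - by move=> [y yr <-]; rewrite pZ //; apply: ZT; exact: sub_cv.
rewrite contra //; last exact: joinp_Pno.
rewrite !mulmxA; congr (_ *m _); apply: trmx_inj; rewrite !trmx_mul !trmxK.
apply: (can_inj (mulKmx u')); rewrite mulKVmx // mulmxA pE -mulmxA mulmxV // mulmx1.
by [].
Qed.

Lemma planar_reg : curve_measurable planar_part.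
Proof.
move=> t p w i PP.
have e r : joinp (hull [set` (p + r *: w) :: t]) =
    hull [set` (plane_emb *m p + r *: (plane_emb *m w)) :: (map (mulmx plane_emb) t ++ rest)].
  by rewrite joinp_cvs /= mulmxDr scalemxAr.
rewrite (_ : (fun r => _) = fun r => mu (hull [set` (plane_emb *m p + r *: (plane_emb *m w)) ::
    (map (mulmx plane_emb) t ++ rest)]) (if i == o0 then j else q) 0).
  by apply: reg => r hr; rewrite -e; apply: joinp_Pno; exact: PP.
apply/funext => r; rewrite /planar_part e embT.
by case: (ord2P i) => ->; rewrite ?pt0 ?pt1.
Qed.

Lemma joinp_cpoly (x x' y z : R) :
  joinp (quadrilateral (vup 0 y) (vdn 0 z) x x') =
  cpoly (upd (upd c j x^-1) q y^-1) (upd (upd s j x'^-1) q z^-1).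
Proof.
have nq (i : 'I_n) : i != q -> (i : nat) != q by [].
have e1 : plane_emb *m vup 0 y = y^-1 *: delta_mx q 0 by rewrite /vup emb_pt mul0r scale0r add0r.
have e2 : plane_emb *m vdn 0 z = - (z^-1 *: delta_mx q 0) by rewrite /vdn emb_pt mul0r oppr0 scale0r add0r scaleNr.
have e3 a : plane_emb *m pt a 0 = a *: delta_mx j 0 by rewrite emb_pt scale0r addr0.
rewrite joinp_cvs cpolyE /= e1 e2 !e3 scaleNr; congr hull; apply/seteqP; split=> w /=.
  rewrite !inE => /or4P[/eqP->|/eqP->|/eqP->|].
  - by left; right; exists q; rewrite upd_eq.
  - by right; exists q; rewrite upd_eq.
  - by left; right; exists j; rewrite upd_ne // upd_eq.
  move=> /orP[/eqP->|]; first by right; exists j; rewrite upd_ne // upd_eq.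
  move=> /restP[->|[l [lj lq [->|->]]]]; first by left; left.
    by left; right; exists l; rewrite !upd_ne.
  by right; exists l; rewrite !upd_ne.
have R0 (v : vec) : v \in rest -> v \in [:: y^-1 *: delta_mx q 0, - (z^-1 *: delta_mx q 0), x^-1 *: delta_mx j 0,
    - (x'^-1 *: delta_mx j 0) & rest] by rewrite !inE => ->; rewrite ?orbT.
move=> [[->|[i ->]]|[i ->]]; first by apply: R0; apply/restP; left.
  have [->|iq] := eqVneq i q; first by rewrite upd_eq inE eqxx.
  have [->|ij] := eqVneq i j; first by rewrite upd_ne // upd_eq !inE eqxx ?orbT.
  by rewrite !upd_ne //; apply: R0; apply/restP; right; exists i; split=> //; left.
have [->|iq] := eqVneq i q; first by rewrite upd_eq !inE eqxx ?orbT.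
have [->|ij] := eqVneq i j; first by rewrite upd_ne // upd_eq !inE eqxx ?orbT.
by rewrite !upd_ne //; apply: R0; apply/restP; right; exists i; split=> //; right.
Qed.

Lemma pair_formula : exists k' k'' : R, forall x x' y z : R, 0 < x -> 0 < x' -> 0 < y -> 0 < z ->
  let P := cpoly (upd (upd c j x^-1) q y^-1) (upd (upd s j x'^-1) q z^-1) in
  mu P j 0 = k' * (x ^+ 2 - x' ^+ 2) * (y + z) +
    k'' * (x^-1 + x'^-1) * ((y ^+ 2)^-1 - (z ^+ 2)^-1) /\
  mu P q 0 = - (k' * (z ^+ 2 - y ^+ 2) * (x + x') +
    k'' * (z^-1 + y^-1) * ((x ^+ 2)^-1 - (x' ^+ 2)^-1)).
Proof.
have [k' [k'' hk]] := planar planar_val planar_contra planar_reg.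
exists k', k'' => x x' y z x0 x'0 y0 z0 P; have := hk x x' y z x0 x'0 y0 z0.
by rewrite /planar_part joinp_cpoly -/P embT pt0 pt1.
Qed.

End Plane.

(** * Assembly of the classification *)

Section Combination.
Variables (R : realType) (n : nat) (mu nu : set 'cV[R]_n -> 'cV[R]_n) (k : R).

Lemma valuation_sub : valuation mu -> valuation nu -> valuation (fun P => mu P - k *: nu P).
Proof.
move=> vm vn K L PK PL PU PI.
by rewrite addrACA vm // -opprD -scalerDr vn // scalerDr opprD addrACA.
Qed.

Lemma contra_sub : SL_contravariant mu -> SL_contravariant nu ->
  SL_contravariant (fun P => mu P - k *: nu P).
Proof. by move=> cm cn phi P d1 PP; rewrite cm // cn // mulmxBr -scalemxAr. Qed.

End Combination.

Lemma cpoly2_hq (R : realType) (c : 'I_2 -> R) s : (forall i, 0 < c i) -> (forall k, 0 < s k) ->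
  cpoly c s = quadrilateral (vup 0 (c o1)^-1) (vdn 0 (s 1%N)^-1) (c o0)^-1 (s 0%N)^-1.
Proof.
move=> c0 s0; have i0 k : 0 < (s k)^-1 by rewrite invr_gt0.
have j0 k : 0 < (c k)^-1 by rewrite invr_gt0.
rewrite cpolyE /quadrilateral /vup /vdn !mul0r oppr0 !invrK; apply: hull_eq => x /=.
  move=> [[->|[i ->]]|[i ->]].
  - have := Pno0 (quadrilateral_Pno 0 0 (j0 o1) (i0 1%N) (j0 o0) (i0 0%N)).
    by rewrite /quadrilateral /vup /vdn !mul0r oppr0 !invrK.
  - apply: sub_cv; rewrite /= !inE; case: (ord2P i) => ->; apply/or4P.
      by apply: Or43; apply/eqP; apply: vec2P; rewrite ?pt0 ?pt1 !mxE /= ?mulr1 ?mulr0.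
    by apply: Or41; apply/eqP; apply: vec2P; rewrite ?pt0 ?pt1 !mxE /= ?mulr1 ?mulr0.
  - apply: sub_cv; rewrite /= !inE; case: (ord2P i) => ->; apply/or4P.
      by apply: Or44; apply/eqP; apply: vec2P; rewrite ?pt0 ?pt1 !mxE /= ?mulr1 ?mulr0 ?oppr0.
    by apply: Or42; apply/eqP; apply: vec2P; rewrite ?pt0 ?pt1 !mxE /= ?mulr1 ?mulr0 ?oppr0.
rewrite !inE => /or4P[] /eqP->; apply: sub_cv.
- by left; right; exists o1; apply: vec2P; rewrite ?pt0 ?pt1 !mxE /= ?mulr1 ?mulr0.
- by right; exists o1; apply: vec2P; rewrite ?pt0 ?pt1 !mxE /= ?mulr1 ?mulr0 ?oppr0.
- by left; right; exists o0; apply: vec2P; rewrite ?pt0 ?pt1 !mxE /= ?mulr1 ?mulr0.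
- by right; exists o0; apply: vec2P; rewrite ?pt0 ?pt1 !mxE /= ?mulr1 ?mulr0 ?oppr0.
Qed.

Lemma classification2 (R : realType) (mu : set 'cV[R]_2 -> 'cV[R]_2) :
  valuation mu -> SL_contravariant mu -> curve_measurable mu ->
  exists k1 k2 : R, forall P, Pno P -> mu P = k1 *: moment (polar P) + k2 *: rot90 (moment P).
Proof.
move=> val contra reg; have [k' [k'' hk]] := planar val contra reg.
(* These compensate the factors 1/2 in [moment_polar_cpoly] and 1/6 in [moment_cpoly2]; the sign
   comes from [rot90]. *)
exists (2 * k'), (- 6 * k'').
pose nu1 P := mu P - (2 * k') *: moment (polar P).
pose nu P := nu1 P - (- 6 * k'') *: rot90 (moment P).
have v1 : valuation nu1 := valuation_sub (2 * k') val (@moment_polar_valn R 2).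
have v2 : valuation nu := valuation_sub (- 6 * k'') v1 (@rot_moment_valn R).
have c1 : SL_contravariant nu1 := contra_sub (2 * k') contra (@moment_polar_contra R 1).
have c2 : SL_contravariant nu := contra_sub (- 6 * k'') c1 (@rot_moment_contra R).
suff Z c s : (forall i, 0 < c i) -> (forall k, 0 < s k) -> nu (cpoly c s) = 0.
  move=> P PP; have := crosspolytopes_determine v2 c2 (vanish_cross c2 Z) PP.
  by rewrite /nu /nu1 => /eqP; rewrite subr_eq0 subr_eq => /eqP ->; rewrite addrC.
have Z0 c' s' : (forall i, 0 < c' i) -> (forall k, 0 < s' k) -> nu (cpoly c' s') o0 0 = 0.
  move=> c0 s0; have i0 k : 0 < (s' k)^-1 by rewrite invr_gt0.
  have j0 k : 0 < (c' k)^-1 by rewrite invr_gt0.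
  have [e _] := hk _ _ _ _ (j0 o0) (i0 0%N) (j0 o1) (i0 1%N).
  rewrite -cpoly2_hq // in e.
  have m2 := moment_cpoly2 c0 s0.
  have m1 := moment_polar_cpoly o0 c0 s0.
  have p1 : \prod_(i | i != o0) ((c' i)^-1 + (s' i)^-1) = (c' o1)^-1 + (s' 1%N)^-1.
    by rewrite (big_pred1 o1) // => i; case: (ord2P i) => ->.
  have [r0 _] := rot90E (moment (cpoly c' s')).
  have mB (v w : 'cV[R]_2) : (v - w) o0 0 = v o0 0 - w o0 0 by rewrite !mxE.
  have mZ k (v : 'cV[R]_2) : (k *: v) o0 0 = k * v o0 0 by rewrite !mxE.
  rewrite /nu /nu1 !mB !mZ e r0 m1 m2 p1 !invrK !exprVn !invrK; field.
  by rewrite !gt_eqF.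
move=> c0 s0; have i0 k : 0 < (s k)^-1 by rewrite invr_gt0.
have j0 k : 0 < (c k)^-1 by rewrite invr_gt0.
apply: vec2P; rewrite [RHS]mxE; first exact: Z0.
(* A quarter turn makes the second component the first one on another crosspolytope, which [Z0]
   settles. *)
have [_] := mu_quad_rot c2 (j0 o0) (i0 0%N) (j0 o1) (i0 1%N).
rewrite /mu_quad -(cpoly2_hq c0 s0) => E; apply: oppr_inj; rewrite -E oppr0.
pose c' (i : 'I_2) := if i == o0 then s 1%N else c o0.
pose s' (k : nat) := if k == 0%N then c o1 else s 0%N.
have := @cpoly2_hq R c' s'; rewrite /c' /s' /= => <-.
- by apply: Z0 => k; case: ifP.
- by move=> i; case: ifP.
- by move=> k; case: ifP.
Qed.

Section HighDim.
Variables (R : realType) (n : nat) (mu : set 'cV[R]_n -> 'cV[R]_n).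
Hypothesis n3 : (3 <= n)%N.
Hypothesis val : valuation mu.
Hypothesis contra : SL_contravariant mu.
Hypothesis reg : curve_measurable mu.
Implicit Types (c : 'I_n -> R) (s : nat -> R) (i j q m : 'I_n).

Lemma ex_third j q : exists m, m != j /\ m != q.
Proof.
apply: contrapT => /forallNP h.
have : (size (enum 'I_n) <= size [:: j; q])%N.
  apply: uniq_leq_size; first exact: enum_uniq.
  move=> m _; rewrite !inE; apply: contrapT => /negP; rewrite negb_or => /andP[mj mq].
  by apply: (h m).
by rewrite size_enum_ord /= leqNgt n3.
Qed.

Lemma bsum_val (b : 'I_n -> 'cV[R]_n) i : bsum (@nat_of_ord n) i b = b i.
Proof. by rewrite /bsum (big_pred1 i). Qed.

Lemma mu_quarter_turn j q m c s : q != m -> j != q -> j != m -> (forall i, 0 < c i) -> (forall k, 0 < s k) ->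
  mu (cpoly c s) j 0 =
  mu (cpoly (upd (upd c q (s m)) m (c q)) (upd (upd s q (c m)) m (s q))) j 0.
Proof.
move=> qm jq jm c0 s0; pose e i : 'cV[R]_n := delta_mx i 0.
have ee i k : dotv (e i) (e k) = (i == k)%:R by exact: delta_dual.
have mq : m != q by rewrite eq_sym.
pose phi : 'M[R]_n := 1%:M + (e m - e q) *m (e q)^T + (- e q - e m) *m (e m)^T.
have dphi : \det phi = 1.
  rewrite det_rank2 !dotvDr !dotvNr !ee !eqxx (negbTE qm) (negbTE mq) ?mulr0n ?mulr1n; ring.
have phiE x : phi *m x = x + dotv (e q) x *: (e m - e q) + dotv (e m) x *: (- e q - e m).
  exact: rank2_mul.
have pq : phi *m e q = e m.
  rewrite phiE !ee eqxx (negbTE mq) scale1r scale0r addr0; by rewrite addrC subrK.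
have pm : phi *m e m = - e q.
  by rewrite phiE !ee eqxx (negbTE qm) scale1r scale0r addr0 [- e q - e m]addrC addrA subrr add0r.
have po i : i != q -> i != m -> phi *m e i = e i.
  by move=> iq im; rewrite phiE !ee eq_sym (negbTE iq) eq_sym (negbTE im) !scale0r !addr0.
have := contra_dot contra (e j) dphi (cpoly_Pno c0 s0).
rewrite po // ![dotv _ (e j)]dotvC !dotv_delta => <-; congr (mu _ j 0).
rewrite /cpoly joinset_img; set c2 := upd _ _ _; set s2 := upd _ _ _.
have c2q : c2 q = s m by rewrite /c2 upd_ne // upd_eq.
have c2m : c2 m = c q by rewrite /c2 upd_eq.
have c2o i : i != q -> i != m -> c2 i = c i by move=> *; rewrite /c2 !upd_ne.
have s2q : s2 q = c m by rewrite /s2 upd_ne // upd_eq.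
have s2m : s2 m = s q by rewrite /s2 upd_eq.
have s2o i : i != q -> i != m -> s2 i = s i by move=> *; rewrite /s2 !upd_ne.
pose J := joinset e (@nat_of_ord n) c2 s2.
pose J' := joinset (fun i => phi *m e i) (@nat_of_ord n) c s.
have Ji i : J (c2 i *: e i) by exact: join_inc.
have Js i : J (- (s2 i *: e i)) by have := join_ins e (@nat_of_ord n) c2 s2 i; rewrite bsum_val.
have Ji' i : J' (c i *: (phi *m e i)) by exact: (join_inc (fun i => phi *m e i)).
have Js' i : J' (- (s i *: (phi *m e i))).
  by have := join_ins (fun i => phi *m e i) (@nat_of_ord n) c s i; rewrite bsum_val.
apply: join_eq => i; rewrite ?bsum_val -/(e i) -/J -/J'.
- have [->|iq] := eqVneq i q; first by rewrite pq -c2m.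
  have [->|im] := eqVneq i m; first by rewrite pm scalerN -s2q.
  by rewrite po // -c2o.
- have [->|iq] := eqVneq i q; first by rewrite pq -s2m.
  have [->|im] := eqVneq i m; first by rewrite pm scalerN opprK -c2q.
  by rewrite po // -s2o.
- have [->|iq] := eqVneq i q; first by rewrite c2q -[e q]opprK -pm scalerN.
  have [->|im] := eqVneq i m; first by rewrite c2m -pq.
  by rewrite c2o // -[e i]po.
- have [->|iq] := eqVneq i q; first by rewrite s2q -scalerN -pm.
  have [->|im] := eqVneq i m; first by rewrite s2m -pq.
  by rewrite s2o // -[e i]po.
Qed.

Lemma upd_id (T : eqType) (V : Type) (f : T -> V) a : upd f a (f a) = f.
Proof. by apply/funext => x; rewrite /upd; case: eqP => [->|]. Qed.

Lemma updC (T : eqType) (V : Type) (f : T -> V) a b u v : a != b ->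
  upd (upd f a u) b v = upd (upd f b v) a u.
Proof.
move=> ab; apply/funext => x; rewrite /upd.
by case: eqP => // ->; case: eqP => // e; rewrite e eqxx in ab.
Qed.

(** In [(a, b)] the component is [al * (a + b) + be * D a b], and its odd part [O] must vanish. The
    quarter turn gives [O a b u v = O v u a b], so [O u v u v] is its own opposite. This kills [be]
    if [u] and [v] differ; if [u = v], then [O 2 1 u u = O u u 2 1 = 0] does. *)
Lemma mu_reflect j q c s (a b : R) : j != q -> (forall i, 0 < c i) -> (forall k, 0 < s k) ->
  0 < a -> 0 < b ->
  mu (cpoly (upd c q a^-1) (upd s q b^-1)) j 0 = mu (cpoly (upd c q b^-1) (upd s q a^-1)) j 0.
Proof.
move=> jq c0 s0; have [m [mj mq]] := ex_third j q.
have qm : q != m by rewrite eq_sym.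
have jm : j != m by rewrite eq_sym.
have [qj] : q != j by rewrite eq_sym.
pose Gf a b u v := mu (cpoly (upd (upd c q a^-1) m u^-1) (upd (upd s q b^-1) m v^-1)) j 0.
pose D (a b : R) := (a ^+ 2)^-1 - (b ^+ 2)^-1.
have inv (r : R) : 0 < r -> 0 < r^-1 by move=> r0; rewrite invr_gt0.
have H1 u v : 0 < u -> 0 < v -> exists al be, forall a b, 0 < a -> 0 < b ->
    Gf a b u v = al * (a + b) + be * D a b.
  move=> u0 v0; have c0' := upd_gt0 m c0 (inv _ u0); have s0' := upd_gt0 (m : nat) s0 (inv _ v0).
  have [k' [k'' h]] := pair_formula jq c0' s0' val contra reg.
  exists (k' * ((c j)^-1 ^+ 2 - (s j)^-1 ^+ 2)), (k'' * (c j + s j)) => a1 b1 a10 b10.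
  have := h _ _ a1 b1 (inv _ (c0 j)) (inv _ (s0 j)) a10 b10; rewrite /= !invrK => -[+ _].
  have e1 : upd (upd (upd c m u^-1) j (c j)) q a1^-1 = upd (upd c q a1^-1) m u^-1.
    by rewrite [RHS]updC //; congr (upd _ q _); rewrite updC // upd_id.
  have e2 : upd (upd (upd s m v^-1) j (s j)) q b1^-1 = upd (upd s q b1^-1) m v^-1.
    by rewrite [RHS]updC //; congr (upd _ (q : nat) _); rewrite updC // upd_id.
  by rewrite e1 e2 /Gf => ->; rewrite /D !exprVn; ring.
have H3 a1 b1 u v : 0 < a1 -> 0 < b1 -> 0 < u -> 0 < v -> Gf a1 b1 u v = Gf v u a1 b1.
  move=> a10 b10 u0 v0; rewrite /Gf (@mu_quarter_turn j q m) //; last 2 first.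
  - by do 2!(apply: upd_gt0; last exact: inv).
  - by do 2!(apply: upd_gt0; last exact: inv).
  rewrite !upd_eq !(upd_ne _ _ qm) !upd_eq (upd_ne (upd s q _) _ (_ : (q : nat) != m)) //.
  rewrite upd_eq; congr (mu (cpoly _ _) j 0); apply/funext => x; rewrite /upd.
    by case: (x == m); case: (x == q).
  by case: (x == m :> nat); case: (x == q :> nat).
move=> a0 b0; pose u := (c m)^-1; pose v := (s m)^-1.
have u0 : 0 < u := inv _ (c0 m); have v0 : 0 < v := inv _ (s0 m).
suff : Gf a b u v = Gf b a u v.
  have e (r : R) : upd (upd c q r) m u^-1 = upd c q r by rewrite /u invrK updC // upd_id.
  have e' (r : R) : upd (upd s q r) m v^-1 = upd s q r by rewrite /v invrK updC // upd_id.
  by rewrite /Gf !e !e'.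
pose O a b u v := Gf a b u v - Gf b a u v.
have OO a1 b1 u1 v1 : 0 < a1 -> 0 < b1 -> 0 < u1 -> 0 < v1 -> O a1 b1 u1 v1 = O v1 u1 a1 b1.
  move=> a10 b10 u10 v10; rewrite /O H3 //; congr (_ - _).
  by rewrite H3 // H3 // H3.
have [al [be h]] := H1 u v u0 v0.
suff be0 : be = 0 by rewrite (h a b) // (h b a) // be0 !mul0r [b + a]addrC.
have Dn x y : 0 < x -> 0 < y -> x != y -> D x y != 0.
  move=> x0 y0; apply: contra_neq => /eqP; rewrite subr_eq0 => /eqP /invr_inj /eqP.
  by rewrite eqrXn2 ?ltW // => /eqP.
have [e|uv] := eqVneq u v.
  have o2 : 0 < 2 :> R by [].
  have E : Gf 2 1 u v = Gf 1 2 u v.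
    by apply/eqP; rewrite -subr_eq0 -/(O 2 1 u v) OO // /O e subrr.
  have d : D 2 1 != 0 by apply: Dn => //; rewrite pnatr_eq1.
  have dN : D 1 2 = - D 2 1 by rewrite /D opprB.
  move: E; rewrite (h 2 1) // (h 1 2) // => E; have : be * D 2 1 = 0 by move: E; rewrite dN; lra.
  by move=> /eqP; rewrite mulf_eq0 (negbTE d) orbF => /eqP.
have dN : D v u = - D u v by rewrite /D opprB.
have E : be * D u v = 0.
  have := OO u v u v u0 v0 u0 v0; rewrite /O.
  rewrite (h u v) // (h v u) // dN; set x := Gf v u v u; lra.
move: E.
by move=> /eqP; rewrite mulf_eq0 (negbTE (Dn _ _ u0 v0 uv)) orbF => /eqP.
Qed.

Lemma pair_formula3 j q c s : j != q -> (forall i, 0 < c i) -> (forall k, 0 < s k) ->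
  exists k : R, forall x x' y z : R, 0 < x -> 0 < x' -> 0 < y -> 0 < z ->
  let P := cpoly (upd (upd c j x^-1) q y^-1) (upd (upd s j x'^-1) q z^-1) in
  mu P j 0 = k * (x ^+ 2 - x' ^+ 2) * (y + z) /\ mu P q 0 = k * (y ^+ 2 - z ^+ 2) * (x + x').
Proof.
move=> jq c0 s0; have [k' [k'' h]] := pair_formula jq c0 s0 val contra reg.
have o2 : 0 < 2 :> R by [].
have i1 : 0 < 1^-1 :> R by rewrite invr1.
have k0 : k'' = 0.
  (* With [x = x'] only the term of [k''] remains; it is odd under exchange of [y] and [z], whereas
     [mu_reflect] makes it even. *)
  have [e1 _] := h 1 1 2 1 ltr01 ltr01 o2 ltr01; have [e2 _] := h 1 1 1 2 ltr01 ltr01 ltr01 o2.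
  have := mu_reflect jq (upd_gt0 j c0 i1) (upd_gt0 (j : nat) s0 i1) o2 ltr01.
  rewrite e1 e2 expr1n subrr invr1 mulr0 !mul0r !add0r => E.
  have n2 : (2 ^+ 2)^-1 = 1 / 4 :> R by field.
  by move: E; rewrite n2; lra.
exists k' => x x' y z x0 x'0 y0 z0 P; have [-> ->] := h x x' y z x0 x'0 y0 z0.
by rewrite k0; split; ring.
Qed.

(** The constant in [pair_formula3] may depend on all the other lengths. A reference crosspolytope
    fixes [k], and its lengths are then replaced by the given ones, one axis at a time. *)
Lemma cross_formula : exists k : R, forall c s, (forall i, 0 < c i) -> (forall k, 0 < s k) -> forall j,
  mu (cpoly c s) j 0 = k * ((c j)^-2 - (s j)^-2) * \prod_(i | i != j) ((c i)^-1 + (s i)^-1).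
Proof.
have inv (r : R) : 0 < r -> 0 < r^-1 by move=> r0; rewrite invr_gt0.
have i0 : 'I_n by exact: (Ordinal (leq_trans (ltn0Sn 2) n3)).
(* The reciprocals 2 and 1 differ, so on an axis not yet replaced the difference of squares 3 is
   nonzero and constants can be compared by division. The sums of reciprocals are 3 as well, whence
   the denominator of [k]. *)
pose bc (i : 'I_n) : R := 2^-1; pose bs (k : nat) : R := 1^-1.
have bc0 i : 0 < bc i by rewrite /bc invr_gt0.
have bs0 k : 0 < bs k by rewrite /bs invr1.
pose k : R := mu (cpoly bc bs) i0 0 / (3 * 3 ^+ n.-1); exists k.
pose good c s := forall j, mu (cpoly c s) j 0 =
  k * ((c j)^-2 - (s j)^-2) * \prod_(i | i != j) ((c i)^-1 + (s i)^-1).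
have base : good bc bs.
  have pr j : \prod_(i | i != j) ((bc i)^-1 + (bs i)^-1) = 3 ^+ n.-1.
    transitivity (\prod_(i in predC1 j) (3 : R)).
      by apply: eq_bigr => i _; rewrite /bc /bs !invrK; ring.
    by rewrite prodr_const cardC1 card_ord.
  have ej j : (bc j)^-2 - (bs j)^-2 = 3.
    by rewrite /bc /bs !exprVn !invrK expr1n; ring.
  have p3 : 0 < 3 * 3 ^+ n.-1 :> R by rewrite mulr_gt0 // exprn_gt0.
  move=> j; rewrite pr ej /k -mulrA mulfVK ?gt_eqF //.
  have [->//|ji] := eqVneq j i0.
  have [k' h] := pair_formula3 ji bc0 bs0; have o2 : 0 < 2 :> R by [].
  have [] := h 2 1 2 1 o2 ltr01 o2 ltr01.
  rewrite !(upd_id bc) (upd_id bs (j : nat)) (upd_id bs (i0 : nat)) => -> ->.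
  by [].
have step q c s (y z : R) : (forall i, 0 < c i) -> (forall k, 0 < s k) -> good c s ->
    (c q)^-2 - (s q)^-2 != 0 -> 0 < y -> 0 < z -> good (upd c q y^-1) (upd s q z^-1).
  move=> c0 s0 g ne y0 z0.
  have rest j : j != q -> exists2 T, \prod_(i | i != j) ((c i)^-1 + (s i)^-1) = ((c q)^-1 + (s q)^-1) * T &
      \prod_(i | i != j) ((upd c q y^-1 i)^-1 + (upd s q z^-1 i)^-1) = (y + z) * T /\
      \prod_(i | i != q) ((c i)^-1 + (s i)^-1) = ((c j)^-1 + (s j)^-1) * T /\
      \prod_(i | i != q) ((upd c q y^-1 i)^-1 + (upd s q z^-1 i)^-1) = ((c j)^-1 + (s j)^-1) * T.
    move=> jq; have qj : q != j by rewrite eq_sym.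
    exists (\prod_(i | (i != j) && (i != q)) ((c i)^-1 + (s i)^-1)); first by rewrite (bigD1 q).
    split.
      rewrite (bigD1 q) //= !upd_eq !invrK; congr (_ * _).
      by apply: eq_bigr => i /andP[_ iq]; rewrite !upd_ne.
    split; rewrite (bigD1 j) //=; first by congr (_ * _); apply: eq_bigl => i; rewrite andbC.
    rewrite !upd_ne //; congr (_ * _); apply: eq_big => i; first by rewrite andbC.
    by move=> /andP[iq _]; rewrite !upd_ne.
  have PF j : j != q -> exists k' : R, forall y z : R, 0 < y -> 0 < z ->
      mu (cpoly (upd c q y^-1) (upd s q z^-1)) j 0 = k' * ((c j)^-2 - (s j)^-2) * (y + z) /\
      mu (cpoly (upd c q y^-1) (upd s q z^-1)) q 0 = k' * (y ^+ 2 - z ^+ 2) * ((c j)^-1 + (s j)^-1).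
    move=> jq; have [k' h] := pair_formula3 jq c0 s0; exists k' => y1 z1 y10 z10.
    have := h _ _ y1 z1 (inv _ (c0 j)) (inv _ (s0 j)) y10 z10.
    by rewrite /= !invrK !upd_id !exprVn.
  have cq := inv _ (c0 q); have sq := inv _ (s0 q).
  move=> j; have [jq|jq] := eqVneq j q.
    have [m [mq _]] := ex_third q q.
    have [T _ [_ [T2 T3]]] := rest m mq; have [k' h] := PF m mq.
    have [_] := h _ _ cq sq; rewrite !invrK !upd_id g T2 => E.
    have [_ E'] := h y z y0 z0.
    rewrite jq E' T3 !upd_eq !exprVn !invrK.
    have b0 : 0 < (c m)^-1 + (s m)^-1 by apply: addr_gt0; exact: inv.
    have -> : k' = k * T.
      apply: (mulIf (_ : ((c m)^-1 + (s m)^-1) * ((c q)^-2 - (s q)^-2) != 0)).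
        by rewrite mulf_neq0 // gt_eqF.
      by move: E; rewrite !exprVn => E; rewrite mulrC -mulrA [RHS]mulrC; lra.
    ring.
  have [T T1 [T2 _]] := rest j jq; have [k' h] := PF j jq.
  have [E _] := h _ _ cq sq; rewrite !invrK !upd_id g T1 in E.
  have [E' _] := h y z y0 z0; rewrite E' T2 !upd_ne //.
  have b0 : 0 < (c q)^-1 + (s q)^-1 by apply: addr_gt0.
  have -> : k' * ((c j)^-2 - (s j)^-2) = k * ((c j)^-2 - (s j)^-2) * T.
    apply: (mulIf (_ : (c q)^-1 + (s q)^-1 != 0)); first by rewrite gt_eqF.
    by rewrite -E; ring.
  ring.
move=> c s c0 s0.
(* Interpolates between the reference lengths and the given ones: the first [p] axes have been
   replaced. *)
pose hc (p : nat) (i : 'I_n) := if (i < p)%N then c i else bc i.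
pose hs (p k : nat) := if (k < p)%N || (n <= k)%N then s k else bs k.
have hc0 p i : 0 < hc p i by rewrite /hc; case: ifP.
have hs0 p (l : nat) : 0 < hs p l by rewrite /hs; case: ifP.
have eqc (c1 c2 : 'I_n -> R) (s1 s2 : nat -> R) : (forall i, c1 i = c2 i) -> (forall i : 'I_n, s1 i = s2 i) ->
    good c1 s1 -> good c2 s2.
  move=> ec es g j; have -> : cpoly c2 s2 = cpoly c1 s1.
    rewrite !cpolyE; congr hull; apply/seteqP; split=> x [[->|[i ->]]|[i ->]].
    - by left; left.
    - by left; right; exists i; rewrite ec.
    - by right; exists i; rewrite es.
    - by left; left.
    - by left; right; exists i; rewrite ec.
    - by right; exists i; rewrite es.
  rewrite g ec es; congr (_ * _); apply: eq_bigr => i _; by rewrite ec es.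
have H p : (p <= n)%N -> good (hc p) (hs p).
  elim: p => [|p IH] pn.
    apply: (eqc bc _ bs _ _ _ base) => i; first by rewrite /hc.
    by rewrite /hs ltn0 leqNgt ltn_ord.
  pose q := Ordinal pn.
  have := step q _ _ (c q)^-1 (s q)^-1 (hc0 p) (hs0 p) (IH (ltnW pn)).
  rewrite !invrK => st; apply: (eqc _ _ _ _ _ _ (st _ (inv _ (c0 q)) (inv _ (s0 q)))).
  - move=> i; rewrite /upd /hc -val_eqE /= ltnS.
    by case: (ltngtP i p) => // e; congr c; apply: val_inj.
  - move=> i; rewrite /upd /hs [(n <= i)%N]leqNgt ltn_ord /= !orbF ltnS.
    by case: (ltngtP i p) => // ->.
  - rewrite /hc /hs /= ltnn leqNgt pn /= /bc /bs !exprVn !invrK expr1n.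
    by have -> : 2 ^+ 2 - 1 = 3 :> R; [ring|].
apply: (eqc _ _ _ _ _ _ (H n (leqnn n))) => i; first by rewrite /hc ltn_ord.
by rewrite /hs ltn_ord.
Qed.

End HighDim.

Lemma classification3 (R : realType) n (mu : set 'cV[R]_n -> 'cV[R]_n) : (3 <= n)%N ->
  valuation mu -> SL_contravariant mu -> curve_measurable mu ->
  exists k : R, forall P, Pno P -> mu P = k *: moment (polar P).
Proof.
case: n mu => // n mu n3 val contra reg; have [k hk] := cross_formula n3 val contra reg.
exists (2 * k); pose nu P := mu P - (2 * k) *: moment (polar P).
have v1 : valuation nu := valuation_sub (2 * k) val (@moment_polar_valn R n.+1).
have c1 : SL_contravariant nu := contra_sub (2 * k) contra (@moment_polar_contra R n).
have Z c s : (forall i, 0 < c i) -> (forall k, 0 < s k) -> nu (cpoly c s) = 0.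
  move=> c0 s0; apply/matrixP => j l; rewrite ord1 /nu mxE [X in _ + X]mxE [X in - X]mxE.
  by rewrite hk // moment_polar_cpoly // mxE; field; rewrite !gt_eqF.
move=> P PP; have := crosspolytopes_determine v1 c1 (vanish_cross c1 Z) PP.
by rewrite /nu => /eqP; rewrite subr_eq0 => /eqP.
Qed.

Theorem theorem3p16 (R : realType) :
  (forall mu : set 'cV[R]_2 -> 'cV[R]_2,
     measurable_on_Pno mu -> valuation_on_Pno mu -> SL_contravariant mu ->
     exists k1 k2 : R, forall P, Pno P ->
       mu P = k1 *: moment (polar P) + k2 *: rot90 (moment P)) /\
  (forall (n : nat) (mu : set 'cV[R]_n -> 'cV[R]_n), (3 <= n)%N ->
     measurable_on_Pno mu -> valuation_on_Pno mu -> SL_contravariant mu ->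
     exists k : R, forall P, Pno P -> mu P = k *: moment (polar P)).
Proof.
split=> [mu mm val contra|n mu n3 mm val contra].
  exact: classification2 val contra (measurable_curve mm).
exact: classification3 n3 val contra (measurable_curve mm).
Qed.
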